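(* Let $(w(t))_{t\ge0}$ be a Brownian motion on $\mathbb{H}P^n$ started at $0$ and let $\mathfrak a(t)$ be its quaternionic stochastic area process. For $t>0$, the density of $\mathfrak a(t)$ with respect to Lebesgue measure on $\mathbb{R}^3$ is given by the following absolutely convergent series, $x\in\mathbb{R}^3$: $$\frac1{2\pi^2}\sum_{j\ge0}(-1)^j\frac{(2n)_j}{j!}e^{-2j(j+2n+1)t}\Bigg\{2^{2n}(2j+2n)t\,e^{(2j+2n)t}\,\frac{K_2\left(\sqrt{|x|^2+(2j+2n)^2t^2}\right)}{|x|^2+(2j+2n)^2t^2}$$ $$\qquad+\sum_{k=0}^{2n+1}a_{k,n}(j)\int_0^\infty e^{-2(j+k)u}\,[u+(2j+2n)t]\,e^{[u+(2j+2n)t]}\,\frac{K_2\left(\sqrt{|x|^2+[u+(2j+2n)t]^2}\right)}{|x|^2+[u+(2j+2n)t]^2}\,du\Bigg\},$$ where the real coefficients $a_{k,n}(j)$ are defined by the partial fraction decompositions in $\mu$: for $j\ge1$, $$\frac{(2j+2n+\mu+1)\,\mu(\mu+2)\,(j+\mu+2n)\cdots(j+\mu+2)}{4\,(j+\mu/2+2n+1)\cdots(j+\mu/2)}=2^{2n}+\sum_{k=0}^{2n+1}\frac{a_{k,n}(j)}{\mu+2j+2k},$$ and for $j=0$, $$\frac{\Gamma(\mu/2+2)\,\Gamma(2n+\mu+2)}{\Gamma(\mu/2+2n+2)\,\Gamma(\mu+2)}=2^{2n}+\sum_{k=1}^{2n+1}\frac{a_{k,n}(0)}{\mu+2k},\qquad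 a_{0,n}(0)=0 .$$
   Context: $n\ge1$. $\mathbb{H}$ is the field of quaternions with units $I,J,K$; imaginary quaternions $xI+yJ+zK$ are identified with $(x,y,z)\in\mathbb{R}^3$. The quaternionic projective space $\mathbb{H}P^n$ is described by inhomogeneous coordinates $w=(w_1,\dots,w_n)\in\mathbb{H}^n$ (valid off a set which Brownian motion started at $0$ almost surely never hits), in which its Riemannian metric is $\frac{\sum_j|dw_j|^2}{1+|w|^2}-\frac{|\sum_j dw_j\overline{w_j}|^2}{(1+|w|^2)^2}$; $0$ is the point $w=0$. Brownian motion has generator $\frac12\Delta_{\mathbb{H}P^n}$ (half the Laplace–Beltrami operator). Its quaternionic stochastic area process is $$\mathfrak a(t)=\frac12\sum_{j=1}^n\int_0^t\frac{dw_j(s)\overline{w_j}(s)-w_j(s)d\overline{w_j}(s)}{1+|w(s)|^2}\in\mathbb{R}^3$$ (Stratonovich, equivalently Itô, integrals). $(a)_j=a(a+1)\cdots(a+j-1)$, $(a)_0=1$, is the Pochhammer symbol, and $K_2$ is the modified Bessel function of the second kind of order $2$. In the decomposition for $j\ge1$, the product $(j+\mu+2n)\cdots(j+\mu+2)$ has $2n-1$ factors decreasing by $1$, and $(j+\mu/2+2n+1)\cdots(j+\mu/2)$ has $2n+2$ factors decreasing by $1$. *)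

(* Defs.v *)
From HB Require Import structures.
From mathcomp Require Import all_boot all_order all_algebra.
From mathcomp Require Import all_classical all_reals all_analysis.
Import Order.TTheory GRing.Theory Num.Theory.
Import numFieldNormedType.Exports.

Set Implicit Arguments.
Unset Strict Implicit.
Unset Printing Implicit Defensive.

Local Open Scope classical_set_scope.
Local Open Scope ring_scope.

(* The quaternion a + b I + c J + d K is the row (a, b, c, d), and a point of
   H^n is an n x 4 matrix whose j-th row is its j-th quaternionic coordinate. *)
Section Quaternions.
Context {R : realType}.
Implicit Types p q : 'rV[R]_4.

Definition quat (a b c d : R) : 'rV[R]_4 := \row_i nth 0 [:: a; b; c; d] i.

Definition qmul p q : 'rV[R]_4 :=
  quat (p 0 0 * q 0 0 - p 0 1 * q 0 1 - p 0 2 * q 0 2 - p 0 3 * q 0 3)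
       (p 0 0 * q 0 1 + p 0 1 * q 0 0 + p 0 2 * q 0 3 - p 0 3 * q 0 2)
       (p 0 0 * q 0 2 - p 0 1 * q 0 3 + p 0 2 * q 0 0 + p 0 3 * q 0 1)
       (p 0 0 * q 0 3 + p 0 1 * q 0 2 - p 0 2 * q 0 1 + p 0 3 * q 0 0).

Definition qconj q : 'rV[R]_4 := quat (q 0 0) (- q 0 1) (- q 0 2) (- q 0 3).

Definition qre q : R := q 0 0.

Definition imquat (x : R * R * R) : 'rV[R]_4 := quat 0 x.1.1 x.1.2 x.2.

End Quaternions.

Section ProjectiveSpace.
Context {R : realType} {n : nat}.
Implicit Types (w u v : 'M[R]_(n, 4)) (f : 'M[R]_(n, 4) -> R).

Definition sqnormH w : R := \sum_j \sum_k w j k ^+ 2.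

(* sum_j u_j conj(v_j) *)
Definition hdot u v : 'rV[R]_4 := \sum_j qmul (row j u) (qconj (row j v)).

(* Polarization of |dw|^2/(1+|w|^2) - |sum_j dw_j conj(w_j)|^2/(1+|w|^2)^2. *)
Definition HPmetric w u v : R :=
  qre (hdot u v) / (1 + sqnormH w)
  - qre (qmul (hdot u w) (qconj (hdot v w))) / (1 + sqnormH w) ^+ 2.

(* The 4n real coordinate directions of H^n. *)
Definition basisH (i : 'I_(n * 4)) : 'M[R]_(n, 4) := vec_mx (delta_mx 0 i).

Definition HPgram w : 'M[R]_(n * 4) :=
  \matrix_(i, k) HPmetric w (basisH i) (basisH k).

Definition HPlaplacian f w : R :=
  (Num.sqrt (\det (HPgram w)))^-1 *
  \sum_i 'D_(basisH i)
    (fun v => Num.sqrt (\det (HPgram v)) *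
              \sum_k invmx (HPgram v) i k * 'D_(basisH k) f v) w.

Definition smooth f : Prop :=
  forall (s : seq 'M[R]_(n, 4)) w,
    differentiable (foldr (fun v g => 'D_v g) f s) w.

Definition compactly_supported f : Prop :=
  exists M : R, forall w, M < `|w| -> f w = 0.

End ProjectiveSpace.

Section Processes.
Context {R : realType} {d : measure_display} {T : measurableType d}.
Variable P : probability T R.
Implicit Types (F : R -> set (set T)) (M X : R -> T -> R).

(* Time is [0, +oo[; values at negative times are irrelevant throughout. *)
Definition filtration F : Prop :=
  (forall s, 0 <= s -> sigma_algebra setT (F s) /\ F s `<=` measurable) /\
  (forall s t, 0 <= s -> s <= t -> F s `<=` F t).

Definition adapted F X : Prop :=
  forall s, 0 <= s -> forall B : set R, measurable B -> F s (X s @^-1` B).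

Definition martingale F M : Prop :=
  [/\ adapted F M,
      forall s, 0 <= s -> P.-integrable setT (EFin \o M s)
    & forall s t, 0 <= s -> s <= t -> forall A, F s A ->
        (\int[P]_(x in A) (M t x)%:E = \int[P]_(x in A) (M s x)%:E)%E].

(* Brownian motion on HP^n started at 0, read in the chart H^n: a continuous
   adapted process solving the martingale problem for half the Laplacian.  The
   complement of the chart is polar, so the process stays in H^n for all times
   and smooth functions compactly supported in the chart suffice as tests. *)
Definition HPbrownian (n : nat) F (w : R -> T -> 'M[R]_(n, 4)) : Prop :=
  [/\ forall i k, adapted F (fun s x => w s x i k),
      {ae P, forall x, {within `[0, +oo[, continuous (fun s => w s x)}},
      {ae P, forall x, w 0 x = 0}
    & forall f : 'M[R]_(n, 4) -> R, smooth f -> compactly_supported f ->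
        martingale F (fun t x => f (w t x) - f (w 0 x)
          - 2^-1 * \int[lebesgue_measure]_(s in `[0, t])
                     HPlaplacian f (w s x))].

(* Stratonovich sum along p_0 <= ... <= p_m, for the product b of an integrand
   value and an increment of the integrator. *)
Definition stratonovich_sum (b : 'rV[R]_4 -> 'rV[R]_4 -> 'rV[R]_4)
    (X Y : R -> 'rV[R]_4) (m : nat) (p : nat -> R) : 'rV[R]_4 :=
  \sum_(i < m) b (2^-1 *: (X (p i) + X (p i.+1))) (Y (p i.+1) - Y (p i)).

Definition area_sum (n : nat) (c : R -> 'M[R]_(n, 4)) (m : nat)
    (p : nat -> R) : 'rV[R]_4 :=
  2^-1 *: \sum_(j < n)
    (stratonovich_sum (fun y dz => qmul dz y)
       (fun s => (1 + sqnormH (c s))^-1 *: qconj (row j (c s)))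
       (fun s => row j (c s)) m p
     - stratonovich_sum qmul
       (fun s => (1 + sqnormH (c s))^-1 *: row j (c s))
       (fun s => qconj (row j (c s))) m p).

Definition subdivision (t : R) (m : nat) (p : nat -> R) : Prop :=
  [/\ p 0%N = 0, p m = t & forall i, (i < m)%N -> p i <= p i.+1].

(* The Stratonovich integral of a continuous semimartingale is the limit in
   probability of the Stratonovich sums as the mesh tends to 0. *)
Definition stochastic_area (n : nat) (w : R -> T -> 'M[R]_(n, 4))
    (a : R -> T -> R * R * R) : Prop :=
  forall t, 0 <= t ->
    measurable_fun setT (a t) /\
    forall eps : R, 0 < eps -> exists2 delta : R, 0 < delta &
      forall (m : nat) (p : nat -> R), subdivision t m p ->
        (forall i, (i < m)%N -> p i.+1 - p i < delta) ->
        (P [set x | (eps <= `|area_sum (w ^~ x) m p - imquat (a t x)|)%R]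
         <= eps%:E)%E.

Definition lebesgue3 : set (R * R * R) -> \bar R :=
  ((lebesgue_measure \x lebesgue_measure) \x lebesgue_measure)%E.

Definition has_density3 (X : T -> R * R * R) (f : R * R * R -> R) : Prop :=
  [/\ measurable_fun setT f, forall x, 0 <= f x
    & forall A, measurable A ->
        (P (X @^-1` A) = \int[lebesgue3]_(x in A) (f x)%:E)%E].

End Processes.

Section SpecialFunctions.
Context {R : realType}.

Definition cosh (u : R) : R := (expR u + expR (- u)) / 2.

(* Only meaningful for z > 0. *)
Definition besselK (nu z : R) : R :=
  \int[lebesgue_measure]_(u in `[0, +oo[) (expR (- (z * cosh u)) * cosh (nu * u)).

(* Euler's integral; only meaningful for s > 0. *)
Definition Gamma (s : R) : R :=
  \int[lebesgue_measure]_(x in `]0, +oo[) (x `^ (s - 1) * expR (- x)).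

Definition pochhammer (x : R) (j : nat) : R := \prod_(i < j) (x + i%:R).

(* a k j stands for a_{k,n}(j).  For j = 0 the identity is required on
   mu > -2, where all Gamma values are given by Euler's integral. *)
Definition area_coefficients (n : nat) (a : nat -> nat -> R) : Prop :=
  [/\ forall (j : nat) (mu : R), (1 <= j)%N ->
        (forall k, (k <= 2 * n + 1)%N -> mu + 2 * j%:R + 2 * k%:R != 0) ->
        (2 * j%:R + 2 * n%:R + mu + 1) * (mu * (mu + 2))
          * \prod_(2 <= i < (2 * n).+1) (j%:R + mu + i%:R)
          / (4 * \prod_(0 <= i < (2 * n + 1).+1) (j%:R + mu / 2 + i%:R))
        = 2 ^+ (2 * n)
          + \sum_(0 <= k < (2 * n + 1).+1) a k j / (mu + 2 * j%:R + 2 * k%:R),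
      forall mu : R, -2 < mu ->
        Gamma (mu / 2 + 2) * Gamma (2 * n%:R + mu + 2)
          / (Gamma (mu / 2 + 2 * n%:R + 2) * Gamma (mu + 2))
        = 2 ^+ (2 * n)
          + \sum_(1 <= k < (2 * n + 1).+1) a k 0%N / (mu + 2 * k%:R)
    & a 0%N 0%N = 0].

Definition sqnorm3 (x : R * R * R) : R := x.1.1 ^+ 2 + x.1.2 ^+ 2 + x.2 ^+ 2.

Definition area_kernel (x : R * R * R) (s : R) : R :=
  s * expR s * (besselK 2 (Num.sqrt (sqnorm3 x + s ^+ 2))
                / (sqnorm3 x + s ^+ 2)).

Definition area_term (n : nat) (a : nat -> nat -> R) (t : R)
    (x : R * R * R) (j : nat) : R :=
  let s := (2 * j%:R + 2 * n%:R) * t in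
  (-1) ^+ j * (pochhammer (2 * n%:R) j / j`!%:R)
  * expR (- (2 * j%:R * (j%:R + 2 * n%:R + 1) * t))
  * (2 ^+ (2 * n) * area_kernel x s
     + \sum_(0 <= k < (2 * n + 1).+1)
         a k j * \int[lebesgue_measure]_(u in `[0, +oo[)
                   (expR (- (2 * (j%:R + k%:R) * u)) * area_kernel x (u + s))).

End SpecialFunctions.

(* Main.v *)
(* Write v = 1 + |w|^2.  For lambda in R^3 put mu = sqrt(1 + |lambda|^2) - 1 and nu = mu / 2.  If
   H(v) = v^(-nu) P_j(1 - 1/v) with P_j the Jacobi polynomial 2F1(-j, j + 2n + mu + 1; 2n; .), then
   1/2 Delta H - 1/2 |lambda|^2 (v - 1) H = - kappa_j H for kappa_j = 2 n mu + 2 j (j + 2n + mu + 1),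
   and hence E[cos(theta + lambda . a_t) H(v_t)] = e^(- kappa_j t) cos(theta) H(1).  This is proved
   directly from the martingale problem: along the subdivision of step t/N the product of cos(lambda . a)
   and of a test function of w changes in mean, over one step, by the drift up to O(N^(-3/2)).
   Expanding 1 = v^(-nu) (1 - z)^(-nu), z = 1 - 1/v, in the P_j (inversion of the Jacobi matrix and
   Gauss's summation) gives the characteristic function as a series in j whose coefficients are the
   rational functions of mu of the statement.  Their partial fractions are Laplace transforms in mu,
   and e^(- s sqrt(1 + |lambda|^2)) is, by Gaussian subordination, the Fourier transform of the K_2
   kernel; this yields the summable terms of the density.  Finally, an integrable characteristic
   function determines a density: smoothing by Gaussian kernels and integrating over boxes squeezes
   the law between open and closed boxes. *)
Require Import Defs.
From HB Require Import structures.
From mathcomp Require Import all_boot all_order all_algebra.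
From mathcomp Require Import all_classical all_reals all_analysis.
From mathcomp Require Import measurable_realfun.
From mathcomp Require Import zify ring lra.
Import Order.TTheory GRing.Theory Num.Theory.
Import numFieldNormedType.Exports.
Set Implicit Arguments.
Unset Strict Implicit.
Unset Printing Implicit Defensive.
Local Open Scope classical_set_scope.
Local Open Scope ring_scope.

(** * Smooth functions and the Laplacian of HP^n *)

Section Smooth.
Context {R : realType} {n : nat}.
Notation V := 'M[R]_(n, 4).
Implicit Types (f g : V -> R) (u v w : V).

Fixpoint Ck (k : nat) f : Prop :=
  (forall w, differentiable f w) /\
  match k with 0%N => True | k'.+1 => forall v, Ck k' ('D_v f) end.

Lemma Ck_diff k f : Ck k f -> forall w, differentiable f w.
Proof. by case: k => [|k] []. Qed.

Lemma Ck_derive k f v : Ck k.+1 f -> Ck k ('D_v f).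
Proof. by case=> _; apply. Qed.

Lemma smooth_derive f v : smooth f -> smooth ('D_v f).
Proof. by move=> sf s w; have := sf (rcons s v) w; rewrite foldr_rcons. Qed.

Lemma smooth_diff f w : smooth f -> differentiable f w.
Proof. by move=> /(_ [::] w). Qed.

Lemma smoothP f : smooth f <-> forall k, Ck k f.
Proof.
split=> [sf k|Cf s w].
  elim: k f sf => [|k IH] f sf; split=> //; try (by move=> w; exact: smooth_diff).
  by move=> v; apply: IH; exact: smooth_derive.
elim/last_ind: s f {Cf}(Cf (size s)) w => [|s v IH] f /=; first by case.
by rewrite size_rcons foldr_rcons => Cf; apply: IH; exact: Ck_derive.
Qed.

Lemma CkW k f : Ck k.+1 f -> Ck k f.
Proof.
elim: k f => [|k IH] f [df Df]; split=> // v.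
exact/IH/Df.
Qed.

Lemma smooth_derivable f w v : smooth f -> derivable f w v.
Proof. by move=> sf; apply: diff_derivable; exact: smooth_diff. Qed.

Lemma derive_fD f g v w : smooth f -> smooth g ->
  'D_v (fun w => f w + g w) w = 'D_v f w + 'D_v g w.
Proof. by move=> sf sg; apply: deriveD; exact: smooth_derivable. Qed.

Lemma derive_fM f g v w : smooth f -> smooth g ->
  'D_v (fun w => f w * g w) w = f w * 'D_v g w + 'D_v f w * g w.
Proof.
move=> sf sg; rewrite [LHS]deriveM; [|exact: smooth_derivable..].
by rewrite /GRing.scale /= [g w * _]mulrC.
Qed.

Lemma derive_fZ c f v w : smooth f -> 'D_v (fun w => c * f w) w = c * 'D_v f w.
Proof. by move=> sf; rewrite [LHS]deriveZ//; exact: smooth_derivable. Qed.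

Lemma derive_funD f g v : (forall w, differentiable f w) ->
  (forall w, differentiable g w) ->
  'D_v (fun w => f w + g w) = (fun w => 'D_v f w + 'D_v g w).
Proof.
by move=> df dg; apply/funext => w; apply: deriveD; exact: diff_derivable.
Qed.

Lemma derive_funM f g v : (forall w, differentiable f w) ->
  (forall w, differentiable g w) ->
  'D_v (fun w => f w * g w) = (fun w => f w * 'D_v g w + 'D_v f w * g w).
Proof.
move=> df dg; apply/funext => w.
have -> : (fun w => f w * g w) = f * g by [].
rewrite deriveM; [|exact: diff_derivable..].
by rewrite /GRing.scale /= [g w * _]mulrC.
Qed.

Lemma CkD k f g : Ck k f -> Ck k g -> Ck k (fun w => f w + g w).
Proof.
elim: k f g => [|k IH] f g [df Df] [dg Dg]; split=> //;
  try (by move=> w; exact: differentiableD).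
by move=> v; rewrite derive_funD//; apply: IH; [exact: Df|exact: Dg].
Qed.

Lemma CkM k f g : Ck k f -> Ck k g -> Ck k (fun w => f w * g w).
Proof.
elim: k f g => [|k IH] f g Cf Cg.
  by split=> // w; apply: differentiableM; [exact: Ck_diff Cf w|exact: Ck_diff Cg w].
split=> [w|v].
  by apply: differentiableM; [exact: Ck_diff Cf w|exact: Ck_diff Cg w].
rewrite derive_funM; [|exact: Ck_diff Cf|exact: Ck_diff Cg].
apply: CkD; apply: IH; try exact: CkW; exact: Ck_derive.
Qed.

Lemma Ck_cst k (c : R) : Ck k (fun=> c).
Proof.
elim: k c => [|k IH] c; split=> //.
move=> v.
have -> : 'D_v (fun=> c) = (fun=> 0) :> (V -> R).
  by apply/funext => w; exact: derive_cst.
exact: IH.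
Qed.

Lemma derive_comp (G G1 : R -> R) f v w :
  is_derive (f w) 1 G (G1 (f w)) -> differentiable f w ->
  differentiable (fun x => G (f x)) w /\
  'D_v (fun x => G (f x)) w = G1 (f w) * 'D_v f w.
Proof.
move=> dG df.
have dG' : differentiable G (f w) by apply/derivable1_diffP; exact: ex_derive.
have dc : differentiable (G \o f) w by exact: differentiable_comp.
split=> //.
rewrite (deriveE v dc) diff_comp//= deriveE// diff1E// derive1E derive_val.
by rewrite mulrC.
Qed.

Lemma Ck_comp k (G : nat -> R -> R) f :
  (forall i w, is_derive (f w) 1 (G i) (G i.+1 (f w))) -> Ck k f ->
  forall i, Ck k (fun x => G i (f x)).
Proof.
move=> dG; elim: k => [|k IH] Cf i.
  by split=> // w; have [] := derive_comp 0 (dG i w) (Ck_diff Cf w).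
split=> [w|v]; first by have [] := derive_comp 0 (dG i w) (Ck_diff Cf w).
have -> : 'D_v (fun x => G i (f x)) = fun x => G i.+1 (f x) * 'D_v f x.
  by apply/funext => w; have [] := derive_comp v (dG i w) (Ck_diff Cf w).
by apply: CkM; [apply: IH; exact: CkW|exact: Ck_derive].
Qed.

Lemma smooth_cst (c : R) : smooth (fun _ : V => c).
Proof. by apply/smoothP => k; exact: Ck_cst. Qed.

Lemma smoothD f g : smooth f -> smooth g -> smooth (fun w => f w + g w).
Proof. by move=> /smoothP sf /smoothP sg; apply/smoothP => k; exact: CkD. Qed.

Lemma smoothM f g : smooth f -> smooth g -> smooth (fun w => f w * g w).
Proof. by move=> /smoothP sf /smoothP sg; apply/smoothP => k; exact: CkM. Qed.

Lemma smoothZ (c : R) f : smooth f -> smooth (fun w => c * f w).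
Proof. by move=> sf; apply: smoothM => //; exact: smooth_cst. Qed.

Lemma smoothB f g : smooth f -> smooth g -> smooth (fun w => f w - g w).
Proof.
move=> sf sg; apply: smoothD => //.
have -> : (fun w => - g w) = fun w => (-1) * g w by apply/funext => w; rewrite mulN1r.
exact: smoothZ.
Qed.

Lemma smoothX f m : smooth f -> smooth (fun w => f w ^+ m).
Proof.
move=> sf; elim: m => [|m IH]; first exact: (smooth_cst 1).
under eq_fun do rewrite exprS.
exact: smoothM.
Qed.

Lemma smooth_sum (I : Type) (r : seq I) (P : pred I) (F : I -> V -> R) :
  (forall i, smooth (F i)) -> smooth (fun w => \sum_(i <- r | P i) F i w).
Proof.
move=> sF; elim: r => [|i r IH].
  by under eq_fun do rewrite big_nil; exact: smooth_cst.
under eq_fun do rewrite big_cons.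
by case: (P i) => //; exact: smoothD.
Qed.

Lemma smooth_comp (G : nat -> R -> R) f :
  (forall i w, is_derive (f w) 1 (G i) (G i.+1 (f w))) -> smooth f ->
  smooth (fun x => G 0%N (f x)).
Proof.
by move=> dG /smoothP sf; apply/smoothP => k; exact: (Ck_comp dG (sf k)).
Qed.

Lemma derive_coord i j v w : 'D_v (fun x : V => x i j) w = v i j.
Proof.
apply: lim_near_cst => //.
near=> h; rewrite /= !mxE addrK /GRing.scale /= mulrA mulVf ?mul1r//.
near: h; exact: nbhs_dnbhs_neq.
Unshelve. all: by end_near.
Qed.

Lemma smooth_coord i j : smooth (fun x : V => x i j).
Proof.
apply/smoothP => -[|k]; split => //; try (by move=> w; exact: differentiable_coord).
move=> v.
have -> : 'D_v (fun x : V => x i j) = (fun=> v i j).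
  by apply/funext => w; rewrite derive_coord.
exact: Ck_cst.
Qed.

Lemma derive_sum_fun (I : Type) (r : seq I) (P : pred I) (F : I -> V -> R) v w :
  (forall i, smooth (F i)) ->
  'D_v (fun x => \sum_(i <- r | P i) F i x) w = \sum_(i <- r | P i) 'D_v (F i) w.
Proof.
move=> sF; elim: r w => [|i r IH] w.
  rewrite big_nil; under eq_fun do rewrite big_nil; exact: derive_cst.
rewrite big_cons.
case Pi: (P i); under eq_fun do rewrite big_cons Pi; last exact: IH.
by rewrite derive_fD ?IH//; exact: smooth_sum.
Qed.

Lemma smooth_inv f : smooth f -> (forall w, f w != 0) -> smooth (fun w => (f w)^-1).
Proof.
move=> sf f0.
pose G (i : nat) (x : R) := (-1) ^+ i * i`!%:R * x^-1 ^+ i.+1.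
have -> : (fun w => (f w)^-1) = (fun w => G 0%N (f w)).
  by apply/funext => w; rewrite /G expr0 fact0 !mul1r expr1.
apply: smooth_comp sf => i w; rewrite /G.
have dV : is_derive (f w) 1 (fun x : R => x^-1) (- (f w)^-1 ^+ 2).
  apply: DeriveDef; first by apply: derivableV => //; exact: (f0 w).
  rewrite [LHS](@deriveV _ _ id (f w) 1 (f0 w)); last exact: derivable_id.
  by rewrite derive_id /GRing.scale /= mulr1 exprVn.
have dX := @is_deriveX _ _ (fun x : R => x^-1) i.+1 (f w) 1 _ dV.
rewrite exprfctE in dX.
have := @is_deriveZ _ _ _ _ ((-1) ^+ i * i`!%:R) _ _ _ dX.
rewrite /GRing.scale /= => dZ; apply: is_derive_eq dZ _.
rewrite factS natrM !exprS mulrnAl -mulr_natl; ring.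
Qed.

Lemma derive_fV f v w : smooth f -> f w != 0 ->
  'D_v (fun w => (f w)^-1) w = - (f w)^-1 ^+ 2 * 'D_v f w.
Proof.
move=> sf f0; rewrite [LHS]deriveV//; last exact: smooth_derivable.
by rewrite /GRing.scale /= exprVn.
Qed.

Lemma derive_fX f v w m : smooth f ->
  'D_v (fun w => f w ^+ m) w = m%:R * f w ^+ m.-1 * 'D_v f w.
Proof.
move=> sf; elim: m => [|m IH]; first by rewrite !mul0r; exact: (derive_cst (1 : R)).
under eq_fun do rewrite exprS.
rewrite derive_fM//; last exact: smoothX.
by rewrite IH -natr1; case: m {IH} => [|m]; rewrite ?exprS /=; ring.
Qed.

Lemma derive_linear_dir (I : Type) (r : seq I) (c : I -> R) (u : I -> V) f w :
  smooth f -> 'D_(\sum_(i <- r) c i *: u i) f w = \sum_(i <- r) c i * 'D_(u i) f w.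
Proof.
move=> sf; have df := smooth_diff w sf.
rewrite deriveE// linear_sum; apply: eq_bigr => i _.
by rewrite linearZ -deriveE.
Qed.

End Smooth.

Lemma sylvester_det {R : comNzRingType} m p (A : 'M[R]_(m, p)) (B : 'M[R]_(p, m)) :
  \det (1%:M - A *m B) = \det (1%:M - B *m A).
Proof.
have e1 : block_mx 1%:M A B 1%:M =
    block_mx 1%:M 0 B 1%:M *m block_mx 1%:M A 0 (1%:M - B *m A).
  by rewrite mulmx_block !mul1mx !mulmx1 !mul0mx !addr0 addrC subrK.
have e2 : block_mx 1%:M A B 1%:M =
    block_mx 1%:M A 0 1%:M *m block_mx (1%:M - A *m B) 0 B 1%:M.
  by rewrite mulmx_block !mul1mx !mulmx1 !mul0mx !add0r subrK.
have := congr1 determinant e1; rewrite {1}e2 !det_mulmx.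
by rewrite !det_lblock !det_ublock !det1 !mul1r !mulr1.
Qed.

Section Quat.
Context {R : realType} {n : nat}.
Notation V := 'M[R]_(n, 4).
Implicit Types (f g : V -> R) (u v w : V).

Definition ip u v : R := \sum_j \sum_k u j k * v j k.

(* Left multiplication of every coordinate by 1, I, J, K. *)
Definition lq (c : 'I_4) w : V := \matrix_(j, k)
  nth 0 (nth [::] [:: [:: w j 0; w j 1; w j 2; w j 3];
                      [:: - w j 1; w j 0; - w j 3; w j 2];
                      [:: - w j 2; w j 3; w j 0; - w j 1];
                      [:: - w j 3; - w j 2; w j 1; w j 0]] c) k.

Lemma big4 (T : nmodType) (F : 'I_4 -> T) : \sum_i F i = F 0 + F 1 + F 2 + F 3.
Proof.
rewrite !big_ord_recl big_ord0 addr0 !addrA.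
by congr (_ + F _ + F _ + F _); apply: val_inj.
Qed.

Lemma ord4P (P : 'I_4 -> Prop) : P 0 -> P 1 -> P 2 -> P 3 -> forall i, P i.
Proof.
move=> p0 p1 p2 p3 [[|[|[|[|i]]]] Hi] //.
- by have -> : Ordinal Hi = 0 by exact: val_inj.
- by have -> : Ordinal Hi = 1 by exact: val_inj.
- by have -> : Ordinal Hi = 2 by exact: val_inj.
- by have -> : Ordinal Hi = 3 by exact: val_inj.
Qed.

Lemma ip_lq_lq c c' w : ip (lq c w) (lq c' w) = (c == c')%:R * sqnormH w.
Proof.
rewrite /ip /sqnormH mulr_sumr; apply: eq_bigr => j _; rewrite !big4 !mxE.
by move: c c'; apply: ord4P; apply: ord4P => /=; rewrite ?mul1r ?mul0r; ring.
Qed.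

Lemma lq0 w : lq 0 w = w.
Proof. by apply/matrixP => j; apply: ord4P; rewrite mxE. Qed.

Lemma ip_lq c u : ip u (lq c u) = (c == 0)%:R * sqnormH u.
Proof. by rewrite -{1}[u]lq0 ip_lq_lq eq_sym. Qed.

Lemma lq_lq c w : lq c (lq c w) = (if c == 0 then 1 else -1) *: w.
Proof.
apply/matrixP => j; move: c; apply: ord4P; apply: ord4P; rewrite !mxE /=; ring.
Qed.

Fact lq_linear c : linear (lq c).
Proof.
move=> a u v; apply/matrixP => j; move: c; apply: ord4P; apply: ord4P.
all: by rewrite !mxE /=; ring.
Qed.
HB.instance Definition _ c :=
  GRing.isLinear.Build R V V _ (lq c) (lq_linear c).

Lemma hdotE u w c : hdot u w 0 c = ip u (lq c w).
Proof.
rewrite /hdot /ip summxE; apply: eq_bigr => j _; rewrite !big4 !mxE.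
by move: c; apply: ord4P => /=; rewrite ?mxE /=; ring.
Qed.

Lemma qre_mulconj (p q : 'rV[R]_4) : qre (qmul p (qconj q)) = \sum_c p 0 c * q 0 c.
Proof. by rewrite big4 /qre /qmul /qconj !mxE /=; ring. Qed.

Lemma HPmetricE w u v : HPmetric w u v =
  ip u v / (1 + sqnormH w) -
  (\sum_c ip u (lq c w) * ip v (lq c w)) / (1 + sqnormH w) ^+ 2.
Proof.
rewrite /HPmetric; congr (_ / _ - _ / _); first by rewrite /qre hdotE lq0.
by rewrite qre_mulconj; apply: eq_bigr => c _; rewrite !hdotE.
Qed.

Lemma sum_mxvec (T : nmodType) (F : 'I_(n * 4) -> T) :
  \sum_i F i = \sum_j \sum_k F (mxvec_index j k).
Proof.
rewrite pair_big /= (reindex (uncurry (@mxvec_index n 4))) /=; last first.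
  have [g gK Kg] := curry_mxvec_bij n 4; exists g => x _; [exact: gK|exact: Kg].
by apply: eq_bigr => -[].
Qed.

Lemma ip_basis i u : ip (basisH i) u = mxvec u 0 i.
Proof.
case/mxvec_indexP: i => j k; rewrite mxvecE /basisH vec_mx_delta /ip.
rewrite (bigD1 j)//= (bigD1 k)//= !mxE !eqxx mul1r.
rewrite big1 ?addr0 => [|k' /negbTE nk]; last by rewrite mxE eqxx nk mul0r.
rewrite big1 ?addr0// => j' /negbTE nj; rewrite big1// => k' _.
by rewrite mxE nj mul0r.
Qed.

Lemma ip_mxvec u v : ip u v = \sum_i mxvec u 0 i * mxvec v 0 i.
Proof.
by rewrite sum_mxvec; apply: eq_bigr => j _; apply: eq_bigr => k _; rewrite !mxvecE.
Qed.

Lemma ipC u v : ip u v = ip v u.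
Proof. by apply: eq_bigr => j _; apply: eq_bigr => k _; rewrite mulrC. Qed.

Lemma ip_sqnorm u : ip u u = sqnormH u.
Proof. by apply: eq_bigr => j _; apply: eq_bigr => k _; rewrite expr2. Qed.

Lemma mxvec_basis i k : mxvec (basisH i : V) 0 k = (i == k)%:R.
Proof. by rewrite /basisH vec_mxK mxE eqxx eq_sym. Qed.

Lemma sum_basis u : u = \sum_i mxvec u 0 i *: basisH i.
Proof.
apply: (can_inj mxvecK); apply/rowP => k; rewrite linear_sum summxE.
rewrite (bigD1 k)//= linearZ !mxE mxvec_basis eqxx mulr1 big1 ?addr0// => i ik.
by rewrite linearZ mxE mxvec_basis (negbTE ik) mulr0.
Qed.

Lemma derive_basis f u w : smooth f ->
  'D_u f w = \sum_i mxvec u 0 i * 'D_(basisH i) f w.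
Proof. by move=> sf; rewrite {1}(sum_basis u) derive_linear_dir. Qed.

Lemma sqnormH_ge0 w : 0 <= sqnormH w.
Proof. by apply: sumr_ge0 => j _; apply: sumr_ge0 => k _; exact: sqr_ge0. Qed.

Definition vv w : R := 1 + sqnormH w.
Lemma vv_ge1 w : 1 <= vv w. Proof. by rewrite lerDl sqnormH_ge0. Qed.
Lemma vv_gt0 w : 0 < vv w. Proof. exact: lt_le_trans ltr01 (vv_ge1 w). Qed.
Lemma vv_neq0 w : vv w != 0. Proof. by rewrite gt_eqF ?vv_gt0. Qed.

Lemma smooth_vv : smooth vv.
Proof.
apply: smoothD; first exact: smooth_cst.
by do 2!apply: smooth_sum => ?; exact/smoothX/smooth_coord.
Qed.

Lemma derive_vv u w : 'D_u vv w = 2 * ip w u.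
Proof.
have sq j k : smooth (fun w : V => w j k ^+ 2) by exact/smoothX/smooth_coord.
have sj j : smooth (fun w : V => \sum_k w j k ^+ 2) by exact: smooth_sum.
rewrite derive_fD; [|exact: smooth_cst|exact: smooth_sum].
rewrite derive_cst add0r derive_sum_fun// /ip mulr_sumr; apply: eq_bigr => j _.
rewrite derive_sum_fun// mulr_sumr; apply: eq_bigr => k _.
by rewrite derive_fX ?derive_coord ?expr1 ?mulrA//; exact: smooth_coord.
Qed.

End Quat.
Section Laplacian.
Context {R : realType} {n : nat}.
Notation V := 'M[R]_(n, 4).
Implicit Types (f g : V -> R) (u v w : V).

Definition Wmx w : 'M[R]_(n * 4, 4) := \matrix_(i, c) mxvec (lq c w) 0 i.

Lemma tr_Wmx_Wmx w : (Wmx w)^T *m Wmx w = (sqnormH w)%:M.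
Proof.
apply/matrixP => c c'; rewrite !mxE.
under eq_bigr do rewrite !mxE.
by rewrite -ip_mxvec ip_lq_lq mulr_natl.
Qed.

Lemma HPgramE w :
  HPgram w = (vv w)^-1 *: (1%:M - (vv w)^-1 *: (Wmx w *m (Wmx w)^T)).
Proof.
apply/matrixP => i k; rewrite !mxE HPmetricE ip_basis mxvec_basis eq_sym.
rewrite -/(vv w) mulrBr; congr (_ - _); first by rewrite mulrC.
rewrite [RHS]mulrA -invfM -expr2 mulrC; congr (_ * _).
by apply: eq_bigr => c _; rewrite !mxE !ip_basis.
Qed.

Lemma det_HPgram w : \det (HPgram w) = (vv w)^-1 ^+ (n * 4 + 4).
Proof.
rewrite HPgramE detZ.
have -> : (vv w)^-1 *: (Wmx w *m (Wmx w)^T) = ((vv w)^-1 *: Wmx w) *m (Wmx w)^T.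
  by rewrite scalemxAl.
rewrite sylvester_det -scalemxAr tr_Wmx_Wmx.
have -> : 1%:M - (vv w)^-1 *: (sqnormH w)%:M = ((vv w)^-1)%:M :> 'M[R]_4.
  rewrite scale_scalar_mx -raddfB/=; congr (_%:M).
  by have := vv_neq0 w; rewrite /vv => h; field.
by rewrite det_scalar exprD.
Qed.

Lemma sqrt_det_HPgram w : Num.sqrt (\det (HPgram w)) = (vv w)^-1 ^+ (2 * n + 2).
Proof.
rewrite det_HPgram.
have -> : (n * 4 + 4 = (2 * n + 2) * 2)%N by ring.
by rewrite exprM sqrtr_sqr ger0_norm// exprn_ge0// invr_ge0 ltW ?vv_gt0.
Qed.

Lemma invmx_HPgram w :
  invmx (HPgram w) = vv w *: (1%:M + Wmx w *m (Wmx w)^T).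
Proof.
have v0 := vv_neq0 w.
have e : HPgram w *m (vv w *: (1%:M + Wmx w *m (Wmx w)^T)) = 1%:M.
  rewrite HPgramE -scalemxAl -scalemxAr scalerA mulVf// scale1r.
  rewrite mulmxDr mulmx1 mulmxBl mul1mx -scalemxAl.
  have -> : Wmx w *m (Wmx w)^T *m (Wmx w *m (Wmx w)^T) =
      sqnormH w *: (Wmx w *m (Wmx w)^T).
    rewrite -mulmxA [X in _ *m X]mulmxA tr_Wmx_Wmx mul_scalar_mx.
    by rewrite -scalemxAr.
  set X := Wmx w *m _; rewrite scalerA.
  have -> : 1%:M - (vv w)^-1 *: X + (X - ((vv w)^-1 * sqnormH w) *: X) =
     1%:M + (1 - (vv w)^-1 - (vv w)^-1 * sqnormH w) *: X.
    by rewrite !scalerBl scale1r -!addrA; congr (_ + _); rewrite addrCA.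
  suff -> : 1 - (vv w)^-1 - (vv w)^-1 * sqnormH w = 0 by rewrite scale0r addr0.
  by move: v0; rewrite /vv => v0; field.
have [u _] := mulmx1_unit e.
by apply: (can_inj (mulKmx u)); rewrite mulmxV// e.
Qed.

Lemma derive_mxvec_lq c i u w :
  'D_u (fun w => mxvec (lq c w) 0 i) w = mxvec (lq c u) 0 i.
Proof.
apply: lim_near_cst => //.
near=> h; rewrite /= !linearP /= !mxE addrK /GRing.scale /= mulrA mulVf ?mul1r//.
near: h; exact: nbhs_dnbhs_neq.
Unshelve. all: by end_near.
Qed.

Lemma smooth_mxvec_lq c i : smooth (fun w : V => mxvec (lq c w) 0 i).
Proof.
have -> : (fun w : V => mxvec (lq c w) 0 i) =
    fun w => \sum_j \sum_k mxvec (lq c (delta_mx j k)) 0 i * w j k.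
  apply/funext => w; rewrite {1}[w]matrix_sum_delta !linear_sum summxE.
  apply: eq_bigr => j _; rewrite !linear_sum summxE; apply: eq_bigr => k _.
  by rewrite !linearZ mxE mulrC.
by do 2!(apply: smooth_sum => ?); apply: smoothZ; exact: smooth_coord.
Qed.

Definition HPop f w : R :=
  vv w * (\sum_i 'D_(basisH i) ('D_(basisH i) f) w +
          \sum_c 'D_(lq c w) ('D_(lq c w) f) w - 4 * 'D_w f w).

Lemma sum_lq_derive c w f : smooth f ->
  \sum_k mxvec (lq c w) 0 k * 'D_(basisH k) f w = 'D_(lq c w) f w.
Proof. by move=> sf; rewrite -derive_basis. Qed.

Definition iv w : R := (vv w)^-1.

Lemma smooth_iv : smooth iv.
Proof. by apply: smooth_inv; [exact: smooth_vv|exact: vv_neq0]. Qed.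

Lemma derive_iv u w : 'D_u iv w = - iv w ^+ 2 * (2 * ip w u).
Proof. by rewrite derive_fV ?derive_vv//; [exact: smooth_vv|exact: vv_neq0]. Qed.

Definition Qd c f w := \sum_k mxvec (lq c w) 0 k * 'D_(basisH k) f w.

Lemma smooth_Qd c f : smooth f -> smooth (Qd c f).
Proof.
move=> sf; apply: smooth_sum => k; apply: smoothM; first exact: smooth_mxvec_lq.
exact: smooth_derive.
Qed.

Lemma derive_Qd c f u w : smooth f -> 'D_u (Qd c f) w =
  'D_(lq c u) f w + \sum_k mxvec (lq c w) 0 k * 'D_u ('D_(basisH k) f) w.
Proof.
move=> sf; rewrite derive_sum_fun => [|k]; last first.
  by apply: smoothM; [exact: smooth_mxvec_lq|exact: smooth_derive].
under eq_bigr => k _.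
  rewrite derive_fM; [|exact: smooth_mxvec_lq|exact: smooth_derive].
  rewrite derive_mxvec_lq; over.
by rewrite big_split /= addrC -derive_basis.
Qed.

Definition HPflux f i w := iv w ^+ (2 * n + 1) *
  ('D_(basisH i) f w + \sum_c mxvec (lq c w) 0 i * Qd c f w).

Lemma HPlaplacianE_flux f w : smooth f ->
  HPlaplacian f w = vv w ^+ (2 * n + 2) * \sum_i 'D_(basisH i) (HPflux f i) w.
Proof.
move=> sf; rewrite /HPlaplacian sqrt_det_HPgram exprVn invrK; congr (_ * _).
apply: eq_bigr => i _; congr ('D_(basisH i) _ w); apply/funext => v.
rewrite sqrt_det_HPgram invmx_HPgram /HPflux -/(iv v).
under eq_bigr => k _ do rewrite !mxE.
have -> : (2 * n + 2 = (2 * n + 1).+1)%N by rewrite addnS.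
rewrite exprSr -mulrA; congr (_ * _).
under eq_bigr => k _ do rewrite -mulrA.
rewrite -mulr_sumr mulrA mulVf ?vv_neq0// mul1r.
under eq_bigr => k _ do rewrite mulrDl.
rewrite big_split /=; congr (_ + _).
  rewrite (bigD1 i)//= eqxx mul1r big1 ?addr0// => k ki.
  by rewrite eq_sym (negbTE ki) mul0r.
under eq_bigr => k _ do rewrite mulr_suml.
rewrite exchange_big /=; apply: eq_bigr => c _; rewrite /Qd mulr_sumr.
by apply: eq_bigr => k _; rewrite !mxE mulrA.
Qed.

Lemma smooth_flux_in f i : smooth f ->
  smooth (fun w => 'D_(basisH i) f w + \sum_c mxvec (lq c w) 0 i * Qd c f w).
Proof.
move=> sf; apply: smoothD; first exact: smooth_derive.
by apply: smooth_sum => c; apply: smoothM; [exact: smooth_mxvec_lq|exact: smooth_Qd].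
Qed.

Lemma HPlaplacianE f w : smooth f -> HPlaplacian f w = HPop f w.
Proof.
move=> sf; rewrite HPlaplacianE_flux//.
have dflux i : 'D_(basisH i) (HPflux f i) w =
   iv w ^+ (2 * n + 1) * ('D_(basisH i) ('D_(basisH i) f) w +
     \sum_c (mxvec (lq c (basisH i)) 0 i * Qd c f w +
       mxvec (lq c w) 0 i * ('D_(lq c (basisH i)) f w +
          \sum_k mxvec (lq c w) 0 k * 'D_(basisH i) ('D_(basisH k) f) w)))
   - (2 * n + 1)%:R * iv w ^+ (2 * n + 2) * 2 * mxvec w 0 i *
     ('D_(basisH i) f w + \sum_c mxvec (lq c w) 0 i * Qd c f w).
  rewrite /HPflux derive_fM; [|exact/smoothX/smooth_iv|exact: smooth_flux_in].
  rewrite derive_fX; last exact: smooth_iv.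
  rewrite derive_iv ipC ip_basis derive_fD; first last.
  - apply: smooth_sum => c; apply: smoothM; first exact: smooth_mxvec_lq.
    exact: smooth_Qd.
  - exact: smooth_derive.
  rewrite derive_sum_fun; last first.
    by move=> c; apply: smoothM; [exact: smooth_mxvec_lq|exact: smooth_Qd].
  congr (_ * (_ + _) + _).
    apply: eq_bigr => c _; rewrite derive_fM; first last.
    - exact: smooth_Qd.
    - exact: smooth_mxvec_lq.
    by rewrite derive_mxvec_lq derive_Qd// addrC.
  by set X := (_ + \sum_c _); rewrite !addnS addn0 /= !exprS; ring.
under eq_bigr do rewrite dflux.
rewrite sumrB -mulr_sumr big_split /=.
have e1 : \sum_i \sum_c (mxvec (lq c (basisH i)) 0 i * Qd c f w +
       mxvec (lq c w) 0 i * ('D_(lq c (basisH i)) f w +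
          \sum_k mxvec (lq c w) 0 k * 'D_(basisH i) ('D_(basisH k) f) w)) =
   (4 * n%:R - 2) * 'D_w f w + \sum_c 'D_(lq c w) ('D_(lq c w) f) w.
  rewrite exchange_big /=.
  have tr c : \sum_i mxvec (lq c (basisH i : V)) 0 i = (c == 0)%:R * (4 * n%:R) :> R.
    under eq_bigr do rewrite -ip_basis ip_lq.
    rewrite -mulr_sumr; congr (_ * _).
    under eq_bigr do rewrite -ip_sqnorm ip_basis mxvec_basis eqxx.
    by rewrite sumr_const card_ord mulnC natrM.
  have sq c : \sum_i mxvec (lq c w) 0 i * 'D_(lq c (basisH i)) f w =
      (if c == 0 then 1 else -1) * 'D_w f w.
    rewrite -(derive_linear_dir _ _ _ _ sf).
    have -> : \sum_i mxvec (lq c w) 0 i *: lq c (basisH i) = lq c (lq c w).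
      rewrite [in RHS](sum_basis (lq c w)) linear_sum.
      by apply: eq_bigr => i _; rewrite linearZ.
    by rewrite lq_lq !(deriveE _ (smooth_diff w sf)) linearZ.
  have dd c : \sum_i mxvec (lq c w) 0 i *
      \sum_k mxvec (lq c w) 0 k * 'D_(basisH i) ('D_(basisH k) f) w =
      'D_(lq c w) ('D_(lq c w) f) w.
    rewrite [RHS]derive_basis; last exact: smooth_derive.
    apply: eq_bigr => i _; congr (_ * _).
    have -> : 'D_(lq c w) f = fun v => \sum_k mxvec (lq c w) 0 k * 'D_(basisH k) f v.
      by apply/funext => v; rewrite derive_basis.
    rewrite derive_sum_fun; last by move=> k; exact/smoothZ/smooth_derive.
    by apply: eq_bigr => k _; rewrite derive_fZ//; exact: smooth_derive.
  have key : forall c, true -> \sum_i (mxvec (lq c (basisH i)) 0 i * Qd c f w +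
       mxvec (lq c w) 0 i * ('D_(lq c (basisH i)) f w +
          \sum_k mxvec (lq c w) 0 k * 'D_(basisH i) ('D_(basisH k) f) w)) =
     (c == 0)%:R * (4 * n%:R) * Qd c f w + (if c == 0 then 1 else -1) * 'D_w f w
     + 'D_(lq c w) ('D_(lq c w) f) w.
    move=> c _; rewrite big_split /= -mulr_suml tr -addrA; congr (_ + _).
    by under eq_bigr do rewrite mulrDr; rewrite big_split /= sq dd.
  rewrite (eq_bigr _ key) big_split /=; congr (_ + _).
  rewrite big4 /= !mul0r /Qd sum_lq_derive// lq0; ring.
rewrite e1.
have e2 : \sum_i (2 * n + 1)%:R * iv w ^+ (2 * n + 2) * 2 * mxvec w 0 i *
     ('D_(basisH i) f w + \sum_c mxvec (lq c w) 0 i * Qd c f w) =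
   (2 * n + 1)%:R * iv w ^+ (2 * n + 2) * 2 * (vv w * 'D_w f w).
  under eq_bigr do rewrite -mulrA.
  rewrite -mulr_sumr; congr (_ * _).
  under eq_bigr do rewrite mulrDr.
  rewrite big_split /= -derive_basis// /vv mulrDl mul1r; congr (_ + _).
  under eq_bigr do rewrite mulr_sumr.
  rewrite exchange_big /=.
  under eq_bigr => c _.
    under eq_bigr => i _ do rewrite mulrA.
    rewrite -mulr_suml -ip_mxvec ip_lq /Qd sum_lq_derive//; over.
  by rewrite big4 /= !mul0r !addr0 mul1r lq0.
rewrite e2 /HPop natrD natrM.
have -> : iv w ^+ (2 * n + 2) = iv w ^+ (2 * n + 1) * iv w by rewrite addnS exprSr.
have -> : vv w ^+ (2 * n + 2) = vv w ^+ (2 * n + 1) * vv w by rewrite addnS exprSr.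
have e3 : iv w * vv w = 1 by rewrite mulVf ?vv_neq0.
have e4 : vv w ^+ (2 * n + 1) * iv w ^+ (2 * n + 1) = 1.
  by rewrite -exprMn mulrC e3 expr1n.
set D := 'D_w f w; set S1 := \sum_i _; set S2 := \sum_c _.
transitivity (vv w ^+ (2 * n + 1) * iv w ^+ (2 * n + 1) * vv w *
  (S1 + ((4 * n%:R - 2) * D + S2) - (2 * n%:R + 1) * 2 * (iv w * vv w) * D)).
  ring.
rewrite e3 e4; ring.
Qed.

End Laplacian.

Local Opaque derive.

Section Carre.
Context {R : realType} {n : nat}.
Notation V := 'M[R]_(n, 4).
Implicit Types (f g : V -> R) (u v w a : V) (l : R * R * R).

Lemma derive2_dir f u w : smooth f -> 'D_u ('D_u f) w =
  \sum_i mxvec u 0 i * \sum_k mxvec u 0 k * 'D_(basisH i) ('D_(basisH k) f) w.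
Proof.
move=> sf; rewrite [LHS]derive_basis; last exact: smooth_derive.
apply: eq_bigr => i _; congr (_ * _).
have -> : 'D_u f = fun v => \sum_k mxvec u 0 k * 'D_(basisH k) f v.
  by apply/funext => v; rewrite derive_basis.
rewrite derive_sum_fun; last by move=> k; exact/smoothZ/smooth_derive.
by apply: eq_bigr => k _; rewrite derive_fZ//; exact: smooth_derive.
Qed.

Lemma smooth_HPop f : smooth f -> smooth (HPop f).
Proof.
move=> sf; have sm i : smooth (fun w : V => mxvec w 0 i).
  have -> : (fun w : V => mxvec w 0 i) = fun w => mxvec (lq 0 w) 0 i.
    by apply/funext => w; rewrite lq0.
  exact: smooth_mxvec_lq.
apply: smoothM; first exact: smooth_vv.
apply: smoothB; first apply: smoothD.
- by apply: smooth_sum => i; do 2!apply: smooth_derive.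
- apply: smooth_sum => c.
  under eq_fun do rewrite derive2_dir//.
  apply: smooth_sum => i; apply: smoothM; first exact: smooth_mxvec_lq.
  apply: smooth_sum => k; apply: smoothM; first exact: smooth_mxvec_lq.
  by do 2!apply: smooth_derive.
- apply: smoothZ; under eq_fun do rewrite derive_basis//.
  apply: smooth_sum => i; apply: smoothM; first exact: sm.
  exact: smooth_derive.
Qed.

Definition HPgamma f g w : R := vv w *
  (\sum_i 'D_(basisH i) f w * 'D_(basisH i) g w +
   \sum_c 'D_(lq c w) f w * 'D_(lq c w) g w).

Lemma derive2_fM f g u w : smooth f -> smooth g ->
  'D_u ('D_u (fun w => f w * g w)) w =
  f w * 'D_u ('D_u g) w + g w * 'D_u ('D_u f) w + 2 * ('D_u f w * 'D_u g w).
Proof.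
move=> sf sg; rewrite derive_funM; [|by move=> ?; exact: smooth_diff..].
have sdf := smooth_derive u sf; have sdg := smooth_derive u sg.
rewrite (derive_fD u w (smoothM sf sdg) (smoothM sdf sg)).
transitivity ((f w * 'D_u ('D_u g) w + 'D_u f w * 'D_u g w) +
  ('D_u f w * 'D_u g w + 'D_u ('D_u f) w * g w)).
  by congr (_ + _); exact: derive_fM.
move: ('D_u ('D_u g) w) ('D_u ('D_u f) w) ('D_u f w) ('D_u g w) => a b c d; ring.
Qed.

Lemma HPopM f g w : smooth f -> smooth g ->
  HPop (fun w => f w * g w) w =
  f w * HPop g w + g w * HPop f w + 2 * HPgamma f g w.
Proof.
move=> sf sg; rewrite /HPop /HPgamma derive_fM//.
have e (m : nat) (u : 'I_m -> V) :
    \sum_i 'D_(u i) ('D_(u i) (fun w => f w * g w)) w =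
    f w * (\sum_i 'D_(u i) ('D_(u i) g) w) +
    g w * (\sum_i 'D_(u i) ('D_(u i) f) w) +
    2 * (\sum_i 'D_(u i) f w * 'D_(u i) g w).
  rewrite !mulr_sumr -!big_split; apply: eq_bigr => i _; exact: derive2_fM.
transitivity (vv w * (
  (f w * (\sum_i 'D_(basisH i) ('D_(basisH i) g) w) +
    g w * (\sum_i 'D_(basisH i) ('D_(basisH i) f) w) +
    2 * (\sum_i 'D_(basisH i) f w * 'D_(basisH i) g w)) +
  (f w * (\sum_c 'D_(lq c w) ('D_(lq c w) g) w) +
    g w * (\sum_c 'D_(lq c w) ('D_(lq c w) f) w) +
    2 * (\sum_c 'D_(lq c w) f w * 'D_(lq c w) g w)) -
  4 * (f w * 'D_w g w + 'D_w f w * g w))).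
  by congr (_ * (_ + _ - _)); exact: e.
have alg (V x y s1 s2 s3 s4 s5 s6 a b : R) :
    V * ((x * s1 + y * s2 + 2 * s3) + (x * s4 + y * s5 + 2 * s6) - 4 * (x * b + a * y)) =
    x * (V * (s1 + s4 - 4 * b)) + y * (V * (s2 + s5 - 4 * a)) + 2 * (V * (s3 + s6)).
  ring.
exact: alg.
Qed.

Lemma HPopD f g w : smooth f -> smooth g ->
  HPop (fun w => f w + g w) w = HPop f w + HPop g w.
Proof.
move=> sf sg; rewrite /HPop derive_fD//.
have e u : 'D_u ('D_u (fun w => f w + g w)) w = 'D_u ('D_u f) w + 'D_u ('D_u g) w.
  rewrite derive_funD; [|by move=> ?; exact: smooth_diff..].
  by rewrite (derive_fD u w (smooth_derive u sf) (smooth_derive u sg)).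
have e' (m : nat) (u : 'I_m -> V) :
    \sum_i 'D_(u i) ('D_(u i) (fun w => f w + g w)) w =
    \sum_i 'D_(u i) ('D_(u i) f) w + \sum_i 'D_(u i) ('D_(u i) g) w.
  by rewrite -big_split; apply: eq_bigr => i _; exact: e.
transitivity (vv w * (
  (\sum_i 'D_(basisH i) ('D_(basisH i) f) w +
   \sum_i 'D_(basisH i) ('D_(basisH i) g) w) +
  (\sum_c 'D_(lq c w) ('D_(lq c w) f) w + \sum_c 'D_(lq c w) ('D_(lq c w) g) w) -
  4 * ('D_w f w + 'D_w g w))).
  by congr (_ * (_ + _ - _)); exact: e'.
have alg (V s1 s2 s3 s4 a b : R) : V * ((s1 + s2) + (s3 + s4) - 4 * (a + b)) =
    V * (s1 + s3 - 4 * a) + V * (s2 + s4 - 4 * b).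
  ring.
exact: alg.
Qed.

Lemma HPop_cst (c : R) w : HPop (fun=> c) w = 0.
Proof.
have e' (k : R) u x : 'D_u (fun _ : V => k) x = 0 by exact: derive_cst.
have e u : 'D_u ('D_u (fun _ : V => c)) w = 0.
  have -> : 'D_u (fun _ : V => c) = fun=> 0 by apply/funext => x; exact: e'.
  exact: e'.
rewrite /HPop (e' c w w) (eq_bigr _ (fun i _ => e (basisH i))).
rewrite (eq_bigr _ (fun i _ => e (lq i w))) !sumr_const !mul0rn; ring.
Qed.

Lemma HPgamma0l f g w : smooth f -> (forall u, 'D_u f w = 0) -> HPgamma f g w = 0.
Proof.
move=> sf D0; rewrite /HPgamma; under eq_bigr do rewrite D0 mul0r.
under [X in _ + X]eq_bigr do rewrite D0 mul0r.
by rewrite !sumr_const !mul0rn addr0 mulr0.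
Qed.

Lemma HPopZ (c : R) f w : smooth f -> HPop (fun w => c * f w) w = c * HPop f w.
Proof.
move=> sf; rewrite (HPopM _ (smooth_cst c) sf) HPop_cst HPgamma0l.
- by rewrite !mulr0 !addr0.
- exact: smooth_cst.
- by move=> u; exact: derive_cst.
Qed.

Lemma near_derive0 f u w : (\forall x \near w, f x = 0) ->
  \forall x \near w, 'D_u f x = 0.
Proof.
move=> /near_join; apply: filterS => x nf.
by rewrite (near_eq_derive u nf) derive_cst.
Qed.

Lemma compactly_supported_near f M w : (forall w, M < `|w| -> f w = 0) ->
  M < `|w| -> \forall x \near w, f x = 0.
Proof.
move=> f0 Mw; near=> x; apply: f0; near: x.
have : `|x| @[x --> w] --> `|w| by exact: norm_continuous.
by move/cvgr_gt; apply.
Unshelve. all: by end_near.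
Qed.

Lemma compactly_supported_HPop f : compactly_supported f ->
  compactly_supported (HPop f).
Proof.
move=> [M f0]; exists M => w Mw.
have nf := compactly_supported_near f0 Mw.
have D1 u := near_derive0 u nf; have D2 u := near_derive0 u (D1 u).
rewrite /HPop (nbhs_singleton (D1 w)) mulr0 subr0.
under eq_bigr do rewrite (nbhs_singleton (D2 _)).
under [X in _ + X]eq_bigr do rewrite (nbhs_singleton (D2 _)).
by rewrite !sumr_const !mul0rn addr0 mulr0.
Qed.

Lemma compactly_supportedMl f g : compactly_supported f ->
  compactly_supported (fun w => f w * g w).
Proof. by move=> [M f0]; exists M => w /f0 ->; rewrite mul0r. Qed.

Lemma compactly_supportedMr f g : compactly_supported g ->
  compactly_supported (fun w => f w * g w).
Proof. by move=> [M f0]; exists M => w /f0 ->; rewrite mulr0. Qed.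

(* G is the sequence of successive derivatives of G 0 on the positive axis. *)
Definition dseq (G : nat -> R -> R) : Prop :=
  forall i (x : R), 0 < x -> is_derive (x : R) 1 (G i) (G i.+1 x).

Lemma smooth_radial G : dseq G -> smooth (fun w : V => G 0%N (vv w)).
Proof.
by move=> dG; apply: smooth_comp; [move=> i w; exact/dG/vv_gt0|exact: smooth_vv].
Qed.

Lemma derive_radial G u w : dseq G ->
  'D_u (fun w : V => G 0%N (vv w)) w = G 1%N (vv w) * (2 * ip w u).
Proof.
move=> dG; have [_ ->] := derive_comp u (dG 0%N _ (vv_gt0 w)) (smooth_diff w smooth_vv).
by rewrite derive_vv.
Qed.

Lemma dseqS G : dseq G -> dseq (fun i => G i.+1).
Proof. by move=> dG i x; exact: dG. Qed.

Lemma smooth_ip a : smooth (fun w : V => ip w a).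
Proof.
do 2!(apply: smooth_sum => ?); under eq_fun do rewrite mulrC.
exact/smoothZ/smooth_coord.
Qed.

Lemma derive_ip a u w : 'D_u (fun w : V => ip w a) w = ip u a.
Proof.
have s i j : smooth (fun w : V => w i j * a i j).
  by under eq_fun do rewrite mulrC; exact/smoothZ/smooth_coord.
rewrite derive_sum_fun; last by move=> i; exact: smooth_sum.
apply: eq_bigr => i _; rewrite derive_sum_fun//; apply: eq_bigr => j _.
by under eq_fun do rewrite mulrC; rewrite derive_fZ ?derive_coord 1?mulrC//; exact: smooth_coord.
Qed.

Lemma derive2_radial G u w : dseq G ->
  'D_u ('D_u (fun w : V => G 0%N (vv w))) w =
  4 * G 2%N (vv w) * ip w u ^+ 2 + 2 * G 1%N (vv w) * sqnormH u.
Proof.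
move=> dG.
have -> : 'D_u (fun w : V => G 0%N (vv w)) = fun w => G 1%N (vv w) * (2 * ip w u).
  by apply/funext => x; exact: derive_radial.
rewrite derive_fM; first last.
- exact/smoothZ/smooth_ip.
- exact: (smooth_radial (dseqS dG)).
rewrite derive_fZ ?derive_ip; last exact: smooth_ip.
rewrite (derive_radial _ _ (dseqS dG)) ip_sqnorm; ring.
Qed.

Lemma sqnorm_lq c w : sqnormH (lq c w) = sqnormH w.
Proof. by rewrite -ip_sqnorm ip_lq_lq eqxx mul1r. Qed.

Lemma HPop_radial G w : dseq G -> HPop (fun w : V => G 0%N (vv w)) w =
  4 * vv w ^+ 2 * (vv w - 1) * G 2%N (vv w) + 8 * n%:R * vv w * G 1%N (vv w).
Proof.
move=> dG; rewrite /HPop (derive_radial _ _ dG).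
rewrite (eq_bigr _ (fun i _ => derive2_radial (basisH i) w dG)).
rewrite (eq_bigr _ (fun i _ => derive2_radial (lq i w) w dG)).
rewrite !big_split /= -!mulr_sumr.
have -> : \sum_i sqnormH (basisH i : V) = 4 * n%:R :> R.
  under eq_bigr do rewrite -ip_sqnorm ip_basis mxvec_basis eqxx.
  by rewrite sumr_const card_ord mulnC natrM.
have -> : \sum_i ip w (basisH i) ^+ 2 = sqnormH w.
  by rewrite -ip_sqnorm ip_mxvec; apply: eq_bigr => i _; rewrite ipC ip_basis expr2.
rewrite !big4 !sqnorm_lq !ip_lq /= ip_sqnorm /vv; ring.
Qed.

Definition lam l w : V := l.1.1 *: lq 1 w + l.1.2 *: lq 2 w + l.2 *: lq 3 w.

Lemma ipDr u v w : ip u (v + w) = ip u v + ip u w.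
Proof.
rewrite /ip -big_split /=; apply: eq_bigr => i _.
by rewrite -big_split /=; apply: eq_bigr => j _; rewrite mxE mulrDr.
Qed.

Lemma ipZr u (c : R) v : ip u (c *: v) = c * ip u v.
Proof.
rewrite /ip mulr_sumr; apply: eq_bigr => i _.
by rewrite mulr_sumr; apply: eq_bigr => j _; rewrite mxE mulrCA.
Qed.

Lemma ip_lam l w : ip w (lam l w) = 0.
Proof. by rewrite /lam !ipDr !ipZr !ip_lq /= !mul0r !mulr0 !addr0. Qed.

Lemma ip_lq_lam l c w : ip (lq c w) (lam l w) =
  nth 0 [:: 0; l.1.1; l.1.2; l.2] c * sqnormH w.
Proof.
rewrite /lam !ipDr !ipZr !ip_lq_lq.
by move: c; apply: ord4P => /=; ring.
Qed.

Lemma sqnorm_lam l w : sqnormH (lam l w) = sqnorm3 l * sqnormH w.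
Proof.
by rewrite -ip_sqnorm {2}/lam !ipDr !ipZr ![ip (lam _ _) _]ipC !ip_lq_lam /sqnorm3 /=; ring.
Qed.

Definition area_step l w w' : R := 2^-1 * (iv w + iv w') * ip w' (lam l w).

Lemma smooth_area_step l a : smooth (area_step l a).
Proof.
apply: smoothM; last exact: smooth_ip.
by apply/smoothZ/smoothD; [exact: smooth_cst|exact: smooth_iv].
Qed.

Lemma area_step_diag l a : area_step l a a = 0.
Proof. by rewrite /area_step ip_lam mulr0. Qed.

Lemma derive_area_step l a u :
  'D_u (area_step l a) a = iv a * ip u (lam l a).
Proof.
rewrite derive_fM; first last.
- exact: smooth_ip.
- by apply/smoothZ/smoothD; [exact: smooth_cst|exact: smooth_iv].
by rewrite ip_lam mulr0 addr0 derive_ip; field.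
Qed.

Lemma HPgamma_area_step l a :
  HPgamma (area_step l a) (area_step l a) a = sqnorm3 l * sqnormH a.
Proof.
rewrite /HPgamma; under eq_bigr do rewrite derive_area_step.
under [X in _ + X]eq_bigr do rewrite derive_area_step ip_lq_lam.
have -> : \sum_i iv a * ip (basisH i) (lam l a) * (iv a * ip (basisH i) (lam l a)) =
    iv a ^+ 2 * (sqnorm3 l * sqnormH a).
  rewrite -sqnorm_lam -ip_sqnorm ip_mxvec mulr_sumr; apply: eq_bigr => i _.
  by rewrite !ip_basis; ring.
rewrite big4 /= /iv /sqnorm3.
have := vv_neq0 a; rewrite /vv => v0; field.
exact: v0.
Qed.

Lemma HPgamma_area_step_radial l a G : dseq G ->
  HPgamma (area_step l a) (fun w => G 0%N (vv w)) a = 0.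
Proof.
move=> dG; rewrite /HPgamma.
under eq_bigr do rewrite derive_area_step derive_radial//.
under [X in _ + X]eq_bigr do rewrite derive_area_step derive_radial// ip_lq_lam ip_lq.
have -> : \sum_i iv a * ip (basisH i) (lam l a) * (G 1%N (vv a) * (2 * ip a (basisH i)))
   = iv a * G 1%N (vv a) * 2 * ip a (lam l a).
  rewrite ip_mxvec mulr_sumr; apply: eq_bigr => i _.
  by rewrite ip_basis ipC ip_basis; ring.
by rewrite ip_lam big4 /=; ring.
Qed.

Lemma HPop_area_step l a : HPop (area_step l a) a = 0.
Proof.
pose G (i : nat) (x : R) := (-1) ^+ i * i`!%:R * x^-1 ^+ i.+1.
have dG : dseq G.
  move=> i x x0; rewrite /G.
  have dV : is_derive x 1 (fun x : R => x^-1) (- x^-1 ^+ 2).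
    have x0' : x != 0 by rewrite gt_eqF.
    apply: DeriveDef; first by apply: derivableV.
    rewrite [LHS](@deriveV _ _ id x 1 x0'); last exact: derivable_id.
    by rewrite derive_id /GRing.scale /= mulr1 exprVn.
  have dX := @is_deriveX _ _ (fun x : R => x^-1) i.+1 x 1 _ dV.
  rewrite exprfctE in dX.
  have := @is_deriveZ _ _ _ _ ((-1) ^+ i * i`!%:R) _ _ _ dX.
  rewrite /GRing.scale /= => dZ; apply: is_derive_eq dZ _.
  rewrite factS natrM !exprS mulrnAl -mulr_natl; ring.
pose H (i : nat) (x : R) := 2^-1 * ((if i == 0%N then iv a else 0) + G i x).
have dH : dseq H.
  move=> i x x0; apply: is_deriveZ; have dg := dG i x x0.
  have := is_deriveD (is_derive_cst (if i == 0%N then iv a else 0) x 1) dg.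
  by rewrite /= add0r.
have -> : area_step l a = fun w => H 0%N (vv w) * ip w (lam l a).
  by apply/funext => w; rewrite /H /G /= expr0 fact0 !mul1r expr1.
rewrite HPopM; [|exact: smooth_radial|exact: smooth_ip].
rewrite ip_lam mul0r addr0.
have -> : HPop (fun w => ip w (lam l a)) a = 0.
  rewrite /HPop derive_ip ip_lam mulr0 subr0.
  have e u : 'D_u ('D_u (fun w : V => ip w (lam l a))) a = 0.
    have -> : 'D_u (fun w : V => ip w (lam l a)) = fun=> ip u (lam l a).
      by apply/funext => x; exact: derive_ip.
    exact: derive_cst.
  rewrite (eq_bigr _ (fun i _ => e (basisH i))) (eq_bigr _ (fun i _ => e (lq i a))).
  by rewrite !sumr_const !mul0rn addr0 mulr0.
rewrite mulr0 add0r /HPgamma.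
under eq_bigr do rewrite derive_radial// derive_ip.
under [X in _ + X]eq_bigr do rewrite derive_radial// derive_ip ip_lq_lam ip_lq.
have -> : \sum_i H 1%N (vv a) * (2 * ip a (basisH i)) * ip (basisH i) (lam l a)
   = H 1%N (vv a) * 2 * ip a (lam l a).
  rewrite ip_mxvec mulr_sumr; apply: eq_bigr => i _.
  by rewrite ip_basis ipC ip_basis; ring.
by rewrite ip_lam big4 /=; ring.
Qed.

Lemma HPop_area_step1 l a G : dseq G ->
  HPop (fun w => area_step l a w * G 0%N (vv w)) a = 0.
Proof.
move=> dG; rewrite HPopM; [|exact: smooth_area_step|exact: smooth_radial].
by rewrite area_step_diag HPop_area_step HPgamma_area_step_radial// !mulr0 mul0r !addr0.
Qed.

Lemma derive_sqr0 f w u : smooth f -> f w = 0 -> 'D_u (fun w => f w ^+ 2) w = 0.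
Proof. by move=> sf f0; rewrite derive_fX//= expr1 f0 mulr0 mul0r. Qed.

Lemma HPop_area_step2 l a g : smooth g ->
  HPop (fun w => area_step l a w ^+ 2 * g w) a = 2 * sqnorm3 l * sqnormH a * g a.
Proof.
move=> sg; have sa := smooth_area_step l a.
rewrite HPopM//; last exact: smoothX.
rewrite area_step_diag expr2 mul0r mul0r add0r HPgamma0l; first last.
- by move=> u; rewrite derive_sqr0 ?area_step_diag.
- exact: smoothX.
have -> : (fun w => area_step l a w ^+ 2) = fun w => area_step l a w * area_step l a w.
  by apply/funext => w; rewrite expr2.
rewrite HPopM// HPop_area_step HPgamma_area_step; ring.
Qed.

Lemma HPop_area_step4 l a g : smooth g ->
  HPop (fun w => area_step l a w ^+ 4 * g w) a = 0.
Proof.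
move=> sg; have sa := smooth_area_step l a.
have -> : (fun w => area_step l a w ^+ 4 * g w) =
   fun w => area_step l a w ^+ 2 * (area_step l a w ^+ 2 * g w).
  by apply/funext => w; rewrite mulrA -exprD.
rewrite HPop_area_step2; last by apply: smoothM => //; exact: smoothX.
by rewrite area_step_diag expr2 !mul0r mulr0.
Qed.

End Carre.

Local Transparent derive.

(** * The martingale problem and the stochastic area *)

Section BoundedRV.
Context {R : realType} {d : measure_display} {T : measurableType d}.
Variable P : probability T R.
Implicit Types (f g : T -> R).

Definition bm f := measurable_fun setT f /\ exists M, forall x, `|f x| <= M.

Lemma prob_integrable_cst (c : R) : P.-integrable setT (EFin \o cst c).
Proof. exact: finite_measure_integrable_cst. Qed.

Lemma bm_integrable f : bm f -> P.-integrable setT (EFin \o f).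
Proof.
move=> [mf [M fM]]; apply: (@le_integrable _ _ _ _ _ _ _ (EFin \o cst `|M|)).
- exact: measurableT.
- exact/measurable_EFinP.
- move=> x _ /=; rewrite lee_fin; apply: le_trans (fM x) _.
  by rewrite (ger0_norm (normr_ge0 M)) ler_norm.
- exact: prob_integrable_cst.
Qed.

Lemma bm_cst (c : R) : bm (fun=> c).
Proof. by split; [exact: measurable_cst|exists `|c|]. Qed.

Lemma bmD f g : bm f -> bm g -> bm (fun x => f x + g x).
Proof.
move=> [mf [M fM]] [mg [N gN]]; split; first exact: measurable_funD.
exists (M + N) => x; apply: le_trans (ler_normD _ _) _; exact: lerD.
Qed.

Lemma bmM f g : bm f -> bm g -> bm (fun x => f x * g x).
Proof.
move=> [mf [M fM]] [mg [N gN]]; split; first exact: measurable_funM.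
by exists (M * N) => x; rewrite normrM ler_pM.
Qed.

Lemma bmZ c f : bm f -> bm (fun x => c * f x).
Proof. by apply: bmM; exact: bm_cst. Qed.

Lemma bmB f g : bm f -> bm g -> bm (fun x => f x - g x).
Proof.
move=> bf /(bmZ (-1)) bg; apply: bmD => //.
by under eq_fun do rewrite -mulN1r.
Qed.

Lemma bm_norm f : bm f -> bm (fun x => `|f x|).
Proof.
move=> [mf [M fM]]; split; first exact: measurableT_comp.
by exists M => x; rewrite normr_id.
Qed.

Lemma bm_sum (I : Type) (r : seq I) (F : I -> T -> R) :
  (forall i, bm (F i)) -> bm (fun x => \sum_(i <- r) F i x).
Proof.
move=> bF; elim: r => [|i r IH].
  by under eq_fun do rewrite big_nil; exact: bm_cst.
by under eq_fun do rewrite big_cons; exact: bmD.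
Qed.

Definition EE f : R := \int[P]_x f x.

Lemma EED f g : bm f -> bm g -> EE (fun x => f x + g x) = EE f + EE g.
Proof. by move=> /bm_integrable ? /bm_integrable ?; exact: RintegralD. Qed.

Lemma EEB f g : bm f -> bm g -> EE (fun x => f x - g x) = EE f - EE g.
Proof. by move=> /bm_integrable ? /bm_integrable ?; exact: RintegralB. Qed.

Lemma EEZ c f : bm f -> EE (fun x => c * f x) = c * EE f.
Proof. by move=> /bm_integrable ?; exact: RintegralZl. Qed.

Lemma EE_cst (c : R) : EE (fun=> c) = c.
Proof.
rewrite /EE Rintegral_cst//.
have /(congr1 fine) /= -> : P setT = 1%:E by exact: probability_setT.
by rewrite mulr1.
Qed.

Lemma EE_le f g : bm f -> bm g -> (forall x, f x <= g x) -> EE f <= EE g.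
Proof. by move=> /bm_integrable ? /bm_integrable ? fg; apply: le_Rintegral. Qed.

Lemma EE_ge0 f : (forall x, 0 <= f x) -> 0 <= EE f.
Proof. by move=> f0; apply: Rintegral_ge0. Qed.

Lemma EE_norm f : bm f -> `|EE f| <= EE (fun x => `|f x|).
Proof. by move=> /bm_integrable ?; exact: le_normr_Rintegral. Qed.

Lemma EE_bound f M : bm f -> (forall x, `|f x| <= M) -> `|EE f| <= M.
Proof.
move=> bf fM; apply: le_trans (EE_norm bf) _.
by rewrite -[leRHS]EE_cst; apply: EE_le => //; [exact: bm_norm|exact: bm_cst].
Qed.

Lemma EE_sum (I : Type) (r : seq I) (F : I -> T -> R) :
  (forall i, bm (F i)) -> EE (fun x => \sum_(i <- r) F i x) = \sum_(i <- r) EE (F i).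
Proof.
move=> bF; elim: r => [|i r IH].
  by rewrite big_nil; under eq_fun do rewrite big_nil; exact: EE_cst.
rewrite big_cons -IH -EED//; last exact: bm_sum.
by congr EE; apply/funext => x; rewrite big_cons.
Qed.

Lemma EE_ae_eq f g : measurable_fun setT f -> measurable_fun setT g ->
  {ae P, forall x, f x = g x} -> EE f = EE g.
Proof.
move=> mf mg fg; rewrite /EE /Rintegral; congr fine.
apply: ae_eq_integral => //; [exact/measurable_EFinP..|].
by apply: filterS fg => x -> _.
Qed.

Lemma EE_dominated (F : nat -> T -> R) f M :
  (forall m, measurable_fun setT (F m)) -> measurable_fun setT f ->
  (forall m x, `|F m x| <= M) ->
  {ae P, forall x, F m x @[m --> \oo] --> f x} ->
  EE (F m) @[m --> \oo] --> EE f.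
Proof.
move=> mF mf FM cF.
have cF' : {ae P, forall x, setT x -> (F m x)%:E @[m --> \oo] --> (EFin \o f) x}.
  by apply: filterS cF => x Fx _; apply: cvg_EFin => //; exact: nearW.
have bF : {ae P, forall x m, setT x -> (`|(F m x)%:E| <= (EFin \o cst M) x)%E}.
  by apply: aeW => x m _ /=; rewrite lee_fin.
have [i1 _ h] := @dominated_convergence _ T R P setT measurableT
  (fun m x => (F m x)%:E) (EFin \o f) (EFin \o cst M)
  (fun m => proj2 (measurable_EFinP _ _) (mF m)) (proj2 (measurable_EFinP _ _) mf)
  cF' (prob_integrable_cst M) bF.
apply: fine_cvg; rewrite fineK; first apply: h.
exact: (integrable_fin_num _ i1).
Qed.

End BoundedRV.

Section Freeze.
Context {R : realType} {d : measure_display} {T : measurableType d}.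
Variable P : probability T R.

Lemma count_le_natural (m : nat) (y : R) : 0 <= y -> y <= m%:R ->
  `|\sum_(i < m) (i.+1%:R <= y :> R)%:R - y| <= 1.
Proof.
elim: m y => [|m IH] y y0 ym.
  rewrite big_ord0 sub0r normrN ger0_norm//; exact: le_trans ym _.
rewrite big_ord_recr /=; have [ym'|my] := leP y m%:R.
  have [h|h] := boolP (m.+1%:R <= y); last by rewrite addr0; exact: IH.
  by have := le_trans h ym'; rewrite ler_nat ltnn.
have -> : \sum_(i < m) (i.+1%:R <= y :> R)%:R = m%:R :> R.
  rewrite (eq_bigr (fun=> 1)) ?sumr_const ?card_ord// => i _.
  by rewrite (le_trans _ (ltW my))// ler_nat.
have [h|h] := boolP (m.+1%:R <= y).
  have -> : y = m.+1%:R by apply/eqP; rewrite eq_le ym h.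
  by rewrite -natr1 /= subrr normr0 ler01.
rewrite addr0 ler_norml; move: ym my; rewrite -natr1 => ym my.
by apply/andP; split; lra.
Qed.

Lemma integral_set_mul0 (G : set (set T)) (Z D : T -> R) :
  G `<=` measurable -> (forall r, G (Z @^-1` `[r, +oo[)) ->
  measurable_fun setT Z ->
  P.-integrable setT (EFin \o D) ->
  (forall A, G A -> (\int[P]_(x in A) (D x)%:E = 0)%E) ->
  (forall x, 0 <= Z x <= 1) -> \int[P]_x (Z x * D x) = 0.
Proof.
move=> Gm GZ mZ iD D0 Z01.
have mD : measurable_fun setT D by apply/measurable_EFinP; exact: (measurable_int _ iD).
pose K := \int[P]_x `|D x|.
have iZD (Y : T -> R) M : measurable_fun setT Y -> (forall x, `|Y x| <= M) ->
    P.-integrable setT (EFin \o (fun x => Y x * D x)).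
  move=> mY YM; apply: (@le_integrable _ _ _ _ _ _ _ (EFin \o (fun x => M * D x))) => //.
  - exact/measurable_EFinP/measurable_funM.
  - move=> x _ /=; rewrite lee_fin !normrM ler_wpM2r//.
    by apply: le_trans (YM x) _; exact: ler_norm.
  - rewrite (_ : _ \o _ = (fun x => M%:E * (D x)%:E)%E)//; exact: integrableZl.
have bound m : `|\int[P]_x (Z x * D x)| <= m.+1%:R^-1 * K.
  pose A i := Z @^-1` `[i.+1%:R / m.+1%:R, +oo[.
  pose S x : R := m.+1%:R^-1 * \sum_(i < m.+1) \1_(A i) x.
  have mA i : measurable (A i) by exact/Gm/GZ.
  have mS : measurable_fun setT S.
    apply: measurable_funM => //; apply: measurable_sum => i.
    exact: measurable_indic.
  have ZS x : `|Z x - S x| <= m.+1%:R^-1.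
    have /andP[z0 z1] := Z01 x.
    have -> : Z x - S x = - (m.+1%:R^-1 * (\sum_(i < m.+1) \1_(A i) x - m.+1%:R * Z x)).
      by rewrite mulrBr mulKf// opprB.
    rewrite normrN normrM ger0_norm// ler_piMr//.
    have -> : \sum_(i < m.+1) \1_(A i) x = \sum_(i < m.+1) (i.+1%:R <= m.+1%:R * Z x :> R)%:R :> R.
      apply: eq_bigr => i _; rewrite indicE; congr (nat_of_bool _)%:R.
      rewrite /A; apply/idP/idP; rewrite ?inE /= in_itv /= andbT ler_pdivrMr// mulrC//.
    apply: count_le_natural; first by rewrite mulr_ge0.
    by rewrite ler_piMr.
  have iS : P.-integrable setT (EFin \o (fun x => S x * D x)).
    apply: (iZD _ 2) => // x.
    have -> : S x = Z x - (Z x - S x) by rewrite opprB addrCA subrr addr0.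
    apply: le_trans (ler_normB _ _) _; apply: lerD.
      by have /andP[z0 z1] := Z01 x; rewrite ger0_norm.
    by apply: le_trans (ZS x) _; rewrite invf_le1 ?ler1n.
  have iZ : P.-integrable setT (EFin \o (fun x => Z x * D x)).
    by apply: (iZD _ 1) => // x; have /andP[z0 z1] := Z01 x; rewrite ger0_norm.
  have SD0 : \int[P]_x (S x * D x) = 0.
    have i1 i : P.-integrable setT (EFin \o (fun x => \1_(A i) x * D x)).
      apply: (iZD _ 1) => // x; rewrite indicE.
      by case: (_ \in _); rewrite ?normr1 ?normr0.
    have sum0 k : P.-integrable setT (EFin \o (fun x => \sum_(i < k) (\1_(A i) x * D x))) /\
       \int[P]_x (\sum_(i < k) (\1_(A i) x * D x)) = 0.
      elim: k => [|k [IH1 IH2]].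
        split; under eq_fun do rewrite big_ord0.
          exact: prob_integrable_cst.
        by rewrite Rintegral_cst// mul0r.
      have e : (fun x => \sum_(i < k.+1) (\1_(A i) x * D x)) =
          fun x => \sum_(i < k) (\1_(A i) x * D x) + \1_(A k) x * D x.
        by apply/funext => x; rewrite big_ord_recr.
      split.
        rewrite e; have := integrableD measurableT IH1 (i1 k).
        by congr (integrable _ _ _).
      rewrite e RintegralD// IH2 add0r /Rintegral.
      rewrite (_ : (fun x => _) = (EFin \o D) \_ (A k)) -?integral_mkcond ?D0//; first exact: GZ.
      by apply/funext => x; rewrite patchE indicE; case: ifP => _; rewrite ?mul1r ?mul0r.
    rewrite (_ : (fun x => S x * D x) = fun x => m.+1%:R^-1 * \sum_(i < m.+1) (\1_(A i) x * D x)).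
      by rewrite RintegralZl ?(sum0 m.+1).2 ?mulr0//; exact: (sum0 m.+1).1.
    by apply/funext => x; rewrite /S -mulrA mulr_suml.
  have -> : \int[P]_x (Z x * D x) = \int[P]_x (Z x * D x - S x * D x).
    by rewrite RintegralB// SD0 subr0.
  have iB : P.-integrable setT (EFin \o (fun x => Z x * D x - S x * D x)).
    rewrite (_ : _ \o _ = (fun x => (Z x * D x)%:E - (S x * D x)%:E)%E)//.
    exact: integrableB.
  apply: le_trans (le_normr_Rintegral _ iB) _ => //.
  rewrite /K -RintegralZl//; last exact: (integrable_norm iD).
  apply: le_Rintegral => //.
  - exact: (integrable_norm iB).
  - rewrite (_ : _ \o _ = (fun x => m.+1%:R^-1%:E * (`|D x|)%:E)%E)//.
    apply: integrableZl => //; exact: (integrable_norm iD).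
  - by move=> x _; rewrite -mulrBl normrM ler_wpM2r.
apply/eqP; rewrite -normr_le0; apply/ler_addgt0Pr => e e0; rewrite add0r.
have K0 : 0 <= K by apply: Rintegral_ge0.
have [m hm] : exists m : nat, K / e < m.+1%:R.
  exists (Num.truncn (K / e)); exact: truncnS_gt.
apply: le_trans (bound m) _.
by rewrite mulrC ler_pdivrMr// mulrC -ler_pdivrMr// ltW.
Qed.

End Freeze.

Section MeasMx.
Context {R : realType} {d : measure_display} {T : measurableType d} {n k : nat}.

Lemma measurable_continuous_mx (phi : 'M[R]_(n, k) -> R) (W : T -> 'M[R]_(n, k)) :
  continuous phi -> (forall i j, measurable_fun setT (fun x => W x i j)) ->
  measurable_fun setT (fun x => phi (W x)).
Proof.
move=> cphi mW.
pose rd (m : nat) x : 'M[int]_(n, k) := \matrix_(i, j) Num.floor (m.+1%:R * W x i j).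
pose sc (m : nat) (z : 'M[int]_(n, k)) : 'M[R]_(n, k) := \matrix_(i, j) (m.+1%:R^-1 * (z i j)%:~R).
have mrd m z : measurable [set x | rd m x = z].
  have -> : [set x | rd m x = z] =
      \bigcap_(i in [set: 'I_n]) \bigcap_(j in [set: 'I_k])
        ((fun x => m.+1%:R * W x i j) @^-1` `[(z i j)%:~R, (z i j + 1)%:~R[).
    apply/seteqP; split=> x /=.
      move=> rz i _ j _ /=; rewrite in_itv/=.
      by rewrite -rz mxE floor_itv.
    move=> h; apply/matrixP => i j; rewrite mxE.
    have := h i I j I; rewrite /= in_itv /= => /floor_def; exact.
  apply: fin_bigcap_measurable => // i _; apply: fin_bigcap_measurable => // j _.
  rewrite -[X in measurable X]setTI; apply: measurable_funM => //.
have mm m : measurable_fun setT (fun x => phi (sc m (rd m x))).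
  move=> _ B mB; rewrite setTI.
  have -> : (fun x => phi (sc m (rd m x))) @^-1` B =
     \bigcup_(z : 'M[int]_(n, k)) (if pselect (B (phi (sc m z))) then [set x | rd m x = z] else set0).
    apply/seteqP; split=> x /=.
      by move=> Bx; exists (rd m x) => //; case: pselect.
    by move=> [z _]; case: pselect => //= Bz ->.
  apply: countable_bigcupT_measurable => // z.
  by case: pselect => ? /=; [exact: mrd|exact: measurable0].
apply: (measurable_fun_cvg mm) => x _.
apply: cvg_comp; last exact: cphi.
apply/cvgrPdist_le => e e0.
near=> m.
rewrite [`|_|]mx_normrE; apply: bigmax_le => [|[i j] _ /=]; first exact: ltW.
rewrite !mxE.
have m0 : (0 : R) < m.+1%:R by rewrite ltr0n.
have /andP[f1 f2] := floor_itv (m.+1%:R * W x i j).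
rewrite intrD in f2.
rewrite -(ler_pM2l m0) -[X in X * `|_|]gtr0_norm// -normrM mulrBr mulVKf ?gt_eqF//.
rewrite ger0_norm ?subr_ge0//.
apply: (@le_trans _ _ 1).
  by rewrite lerBlDr addrC ltW.
rewrite -ler_pdivrMr// div1r ltW//.
apply: lt_le_trans (truncnS_gt _) _.
rewrite ler_nat ltnS; near: m; exact: nbhs_infty_ge.
Unshelve. all: by end_near.
Qed.

End MeasMx.

Local Opaque derive.

Section OneStep.
Context {R : realType} {d : measure_display} {T : measurableType d}.
Context (P : probability T R) {n : nat} (F : R -> set (set T)).
Context (w : R -> T -> 'M[R]_(n, 4)).
Notation V := 'M[R]_(n, 4).
Hypothesis filt : filtration F.
Hypothesis bw : HPbrownian P F w.
Notation E := (EE P).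

Definition Fm (s : R) (Z : T -> R) : Prop :=
  measurable_fun setT (Z : g_sigma_algebraType (F s) -> R).

Lemma Fm_pre s Z B : 0 <= s -> Fm s Z -> measurable B -> F s (Z @^-1` B).
Proof.
move=> s0 mZ mB; have := mZ measurableT B mB; rewrite setTI.
have [sF _] := filt.1 s s0.
by rewrite /measurable /= (sigma_algebra_id sF).
Qed.

Lemma FmP s Z : 0 <= s -> (forall B, measurable B -> F s (Z @^-1` B)) -> Fm s Z.
Proof.
move=> s0 h _ B mB; rewrite setTI; have [sF _] := filt.1 s s0.
by rewrite /measurable /= (sigma_algebra_id sF); exact: h.
Qed.

Lemma Fm_measurable s Z : 0 <= s -> Fm s Z -> measurable_fun setT Z.
Proof.
move=> s0 mZ _ B mB; rewrite setTI; have [_ sF] := filt.1 s s0.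
by apply: sF; exact: Fm_pre.
Qed.

Lemma Fm_mono s t Z : 0 <= s -> s <= t -> Fm s Z -> Fm t Z.
Proof.
move=> s0 st mZ; have t0 := le_trans s0 st.
by apply: FmP => // B mB; apply: (filt.2 s t) => //; exact: Fm_pre.
Qed.

Lemma Fm_cont s (phi : V -> R) : 0 <= s -> continuous phi -> Fm s (fun x => phi (w s x)).
Proof.
move=> s0 cphi; apply: (@measurable_continuous_mx _ _ (g_sigma_algebraType (F s))) => //.
move=> i j; apply: FmP => // B mB; have [+ _ _ _] := bw.
by move=> /(_ i j s s0 B mB).
Qed.

Lemma w_measurable s (phi : V -> R) : 0 <= s -> continuous phi ->
  measurable_fun setT (fun x => phi (w s x)).
Proof. by move=> s0 cphi; exact: (Fm_measurable s0 (Fm_cont s0 cphi)). Qed.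

Lemma smooth_continuous (f : V -> R) : smooth f -> continuous f.
Proof. by move=> sf x; exact: differentiable_continuous (smooth_diff x sf). Qed.

Lemma continuous_vec_mx : continuous (fun u : 'rV[R]_(n * 4) => vec_mx u : V).
Proof.
move=> u; have /= FF := @nbhs_filter _ u; apply/cvgrPdist_le => e e0.
have := @cvg_id _ (nbhs u); move/cvgrPdist_le => /(_ e e0); apply: filterS => v.
move=> uv; rewrite [`|_|]mx_normrE; apply: bigmax_le => [|[i j] _ /=]; first exact: ltW.
rewrite !mxE; move: uv.
rewrite [`|_|]mx_normrE => /bigmax_leP[_ /(_ (0, mxvec_index i j) isT)] /=.
by rewrite !mxE.
Qed.

Lemma continuous_cs_bounded (f : V -> R) : continuous f -> compactly_supported f ->
  exists M, forall x, `|f x| <= M.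
Proof.
move=> cf [M f0].
pose A : set 'rV[R]_(n * 4) := [set u | `|u| <= `|M|].
have cA : compact A.
  apply: bounded_closed_compact.
    by exists `|M|; split; [exact: num_real|move=> x Mx u Au; exact: le_trans Au (ltW Mx)].
  apply: (@closed_comp _ _ (fun u : 'rV[R]_(n * 4) => `|u|) [set r | r <= `|M|]).
    by move=> u _; exact: norm_continuous.
  exact: closed_le.
have cv : continuous (fun u : 'rV[R]_(n * 4) => f (vec_mx u)).
  by move=> u; apply: continuous_comp; [exact: continuous_vec_mx|exact: cf].
have A0 : A !=set0 by exists 0; rewrite /A /= normr0.
have cn : {within A, continuous (fun u => `|f (vec_mx u)|)}.
  apply: continuous_subspaceT => u; apply: continuous_comp; first exact: cv.
  exact: norm_continuous.
have [c _ cmax] := compact_EVT_max A0 cA cn.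
exists `|f (vec_mx c)| => x.
have [xM|Mx] := leP `|x| `|M|; last first.
  by rewrite f0 ?normr0//; apply: le_lt_trans Mx; exact: ler_norm.
rewrite -[x]mxvecK; apply: cmax; rewrite inE /A /=.
rewrite [`|_|]mx_normrE; apply: bigmax_le => // -[i j] _ /=.
rewrite ord1; case/mxvec_indexP: j => i' j'; rewrite mxvecE.
apply: le_trans xM; rewrite [leRHS]mx_normrE.
exact: (@le_bigmax _ _ _ _ (fun k : 'I_n * 'I_4 => `|x k.1 k.2|) (i', j')).
Qed.

Lemma good_paths : exists N, [/\ measurable N, P N = 0%E &
  forall x, ~ N x -> {within `[0, +oo[, continuous (fun s => w s x)} /\ w 0 x = 0].
Proof.
have [_ [N1 [mN1 N10 s1]] [N2 [mN2 N20 s2]] _] := bw.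
exists (N1 `|` N2); split; first exact: measurableU.
  by apply/eqP; rewrite -measure_le0 -[leRHS]adde0 -{1}N10 -N20 measureU2.
move=> x; rewrite not_orP => -[n1 n2]; split.
  by apply: contrapT => h; apply/n1/s1.
by apply: contrapT => h; apply/n2/s2.
Qed.

Lemma path_cont (k : V -> R) x : continuous k ->
  {within `[0, +oo[, continuous (fun s => w s x)} ->
  {within `[0, +oo[, continuous (fun s => k (w s x))}.
Proof.
move=> ck cw s; apply: continuous_comp; first exact: cw.
exact: ck.
Qed.

Lemma path_integrable (k : V -> R) x s t : continuous k -> 0 <= s ->
  {within `[0, +oo[, continuous (fun s => w s x)} ->
  lebesgue_measure.-integrable `[s, t] (EFin \o (fun u => k (w u x))).
Proof.
move=> ck s0 cw; apply: continuous_compact_integrable; first exact: segment_compact.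
apply: continuous_subspaceW (path_cont ck cw) => u /=.
by rewrite !in_itv /= andbT => /andP[su _]; exact: le_trans su.
Qed.

Lemma path_cont_pt (k : V -> R) x s : continuous k -> 0 < s ->
  {within `[0, +oo[, continuous (fun s => w s x)} ->
  {for s, continuous (fun s => k (w s x))}.
Proof.
move=> ck s0 cw.
have : {within `]0, +oo[, continuous (fun s => k (w s x))}.
  apply: continuous_subspaceW (path_cont ck cw) => u /=.
  by rewrite !in_itv /= !andbT => /ltW.
rewrite continuous_open_subspace; last exact: interval_open.
by apply; rewrite inE /= in_itv /= andbT.
Qed.

Lemma path_integral_bound (k : V -> R) C x s t : continuous k -> 0 <= s -> s <= t ->
  (forall v, `|k v| <= C) ->
  {within `[0, +oo[, continuous (fun s => w s x)} ->
  `|\int[lebesgue_measure]_(u in `[s, t]) k (w u x)| <= C * (t - s).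
Proof.
move=> ck s0 st kC cw.
have ik := path_integrable t ck s0 cw.
apply: le_trans (le_normr_Rintegral _ ik) _ => //.
have -> : C * (t - s) = \int[lebesgue_measure]_(u in `[s, t]) C.
  by rewrite Rintegral_cst//= lebesgue_measure_itv /= lte_fin; move: st; rewrite le_eqVlt => /predU1P[->|->] //; rewrite ltxx subrr.
apply: le_Rintegral => //.
- exact: integrable_norm ik.
- exact: (path_integrable (k := fun=> C) t (@cst_continuous _ _ C) s0 cw).
Qed.

Lemma martingale_increment (f : V -> R) s t Z (N : set T) K :
  smooth f -> compactly_supported f -> 0 <= s -> s <= t ->
  Fm s Z -> (forall x, `|Z x| <= K) -> measurable N -> P N = 0%E ->
  (forall x, ~ N x -> {within `[0, +oo[, continuous (fun s => w s x)} /\ w 0 x = 0) ->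
  exists D : T -> R, [/\ bm D,
    forall x, ~ N x -> D x = f (w t x) - f (w s x)
      - 2^-1 * \int[lebesgue_measure]_(u in `[s, t]) HPop f (w u x),
    forall x, N x -> D x = 0 & E (fun x => Z x * D x) = 0].
Proof.
move=> sf cf s0 st mZ ZK mN N0 good; have t0 := le_trans s0 st.
have ck := smooth_continuous (smooth_HPop sf).
have [C kC] := continuous_cs_bounded ck (compactly_supported_HPop cf).
have [B fB] := continuous_cs_bounded (smooth_continuous sf) cf.
have [_ _ _ /(_ f sf cf) [aM iM mart]] := bw.
set M := (fun t x => _ : R) in aM iM mart.
pose D0 x := M t x - M s x.
have mMr r : 0 <= r -> measurable_fun setT (M r).
  move=> r0; apply: (@Fm_measurable r) => //; apply: FmP => //; exact: aM.
have iD0 : P.-integrable setT (EFin \o D0).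
  have := integrableB measurableT (iM t t0) (iM s s0).
  by congr (integrable _ _ _).
pose Nc := ~` N.
have D0E x : ~ N x -> D0 x = f (w t x) - f (w s x)
      - 2^-1 * \int[lebesgue_measure]_(u in `[s, t]) HPop f (w u x).
  move=> nN; have [cw _] := good x nN.
  rewrite /D0 /M.
  have e r : \int[lebesgue_measure]_(u in `[0, r]) HPlaplacian f (w u x) =
     \int[lebesgue_measure]_(u in `[0, r]) HPop f (w u x).
    by apply: eq_Rintegral => u _; exact: HPlaplacianE.
  rewrite !e.
  have -> : \int[lebesgue_measure]_(u in `[s, t]) HPop f (w u x) =
    \int[lebesgue_measure]_(u in `[0, t]) HPop f (w u x) -
    \int[lebesgue_measure]_(u in `[0, s]) HPop f (w u x).
    rewrite Rintegral_itvB ?bnd_simp//; last exact: path_integrable.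
    rewrite -Rintegral_itv_obnd_cbnd//.
    apply: integrableS (path_integrable t ck s0 cw) => // u /=.
    by rewrite !in_itv /= => /andP[/ltW -> ->].
  ring.
pose D x := \1_Nc x * D0 x.
have mNc : measurable Nc by exact: measurableC.
have mD : measurable_fun setT D.
  apply: measurable_funM; first exact: measurable_indic.
  by apply: measurable_funB; exact: mMr.
exists D; split.
- split=> //; exists (B + B + 2^-1 * (C * (t - s))) => x.
  have C0 : 0 <= C by exact: le_trans (kC 0).
  have B0 : 0 <= B by exact: le_trans (fB 0).
  rewrite /D indicE; have [xN|xN] := boolP (x \in Nc); last first.
    rewrite mul0r normr0 addr_ge0 ?addr_ge0// mulr_ge0// mulr_ge0// subr_ge0//.
  rewrite mul1r D0E; last by move: xN; rewrite inE.
  have [cw _] := good x (ltac:(by move: xN; rewrite inE)).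
  apply: le_trans (ler_normB _ _) _; apply: lerD.
    by apply: le_trans (ler_normB _ _) _; apply: lerD.
  by rewrite normrM gtr0_norm// ler_wpM2l// path_integral_bound.
- by move=> x nN; rewrite /D indicE mem_set// mul1r D0E.
- by move=> x xN; rewrite /D indicE memNset ?mul0r// /Nc /=; apply.
have mZ' := Fm_measurable s0 mZ.
have ZD0 : \int[P]_x (Z x * D0 x) = 0.
  have K0 : 0 <= `|K| + 1 by rewrite addr_ge0.
  have K1 : 0 < `|K| + 1 by rewrite ltr_wpDl.
  pose Y x := 2^-1 * (Z x / (`|K| + 1) + 1).
  have Z1 x : `|Z x / (`|K| + 1)| <= 1.
    rewrite normf_div (gtr0_norm K1) ler_pdivrMr// mul1r.
    apply: le_trans (ZK x) _; apply: le_trans (ler_norm _) _; by rewrite lerDl.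
  have FZ : Fm s Y.
    apply: measurable_funM => //; apply: measurable_funD => //.
    exact: measurable_funM.
  have mY := Fm_measurable s0 FZ.
  have Y0 : \int[P]_x (Y x * D0 x) = 0.
    apply: (@integral_set_mul0 _ _ _ P (F s)) => //.
    - exact: (filt.1 s s0).2.
    - by move=> r; apply: Fm_pre => //; exact: measurable_itv.
    - move=> A FA.
      have mA : measurable A by exact: (filt.1 s s0).2.
      have -> : (\int[P]_(x in A) (D0 x)%:E = \int[P]_(x in A) (M t x)%:E - \int[P]_(x in A) (M s x)%:E)%E.
        rewrite -integralB_EFin//.
          by apply: integrableS (iM t t0).
        by apply: integrableS (iM s s0).
      rewrite (mart s t s0 st A FA) subee//.
      by apply: integrable_fin_num => //; apply: integrableS (iM s s0).
    - move=> x; have := Z1 x; rewrite ler_norml => /andP[a b].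
      rewrite /Y; apply/andP; split.
        by rewrite mulr_ge0// -lerBlDr sub0r.
      by rewrite mulrC ler_pdivrMr// mul1r -[2]/(1 + 1) lerD2r.
  have D00 : \int[P]_x D0 x = 0.
    rewrite /Rintegral -[X in fine X]/((\int[P]_(x in setT) (D0 x)%:E)%E).
    have FT : F s setT.
      have [[s1 s2 _] _] := filt.1 s s0; have := s2 _ s1; by rewrite setTD setC0.
    have -> : (\int[P]_(x in setT) (D0 x)%:E = \int[P]_(x in setT) (M t x)%:E - \int[P]_(x in setT) (M s x)%:E)%E.
      by rewrite -integralB_EFin//; [exact: iM|exact: iM].
    rewrite (mart s t s0 st _ FT) subee//.
    by apply: integrable_fin_num => //; exact: iM.
  have mD0 : measurable_fun setT D0 by apply: measurable_funB; exact: mMr.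
  have iYD : P.-integrable setT (EFin \o (fun x => Y x * D0 x)).
    apply: le_integrable iD0 => //; first exact/measurable_EFinP/measurable_funM.
    move=> x _ /=; rewrite lee_fin normrM ler_piMl//.
    have := Z1 x; rewrite !ler_norml => /andP[a b]; apply/andP; split.
      by apply: (@le_trans _ _ 0); rewrite ?lerN10// mulr_ge0// -lerBlDr sub0r.
    by rewrite /Y mulrC ler_pdivrMr// mul1r -[2]/(1 + 1) lerD2r.
  have -> : (fun x => Z x * D0 x) = fun x => (`|K| + 1) * (2 * (Y x * D0 x) - D0 x).
    apply/funext => x; rewrite /Y; field.
    by rewrite gt_eqF.
  have i2 : P.-integrable setT (EFin \o (fun x => 2 * (Y x * D0 x))).
    have := integrableZl measurableT (2 : R) iYD.
    by congr (integrable _ _ _).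
  have i3 : P.-integrable setT (EFin \o (fun x => 2 * (Y x * D0 x) - D0 x)).
    have := integrableB measurableT i2 iD0.
    by congr (integrable _ _ _).
  by rewrite RintegralZl// RintegralB// RintegralZl// Y0 D00 mulr0 subr0 mulr0.
rewrite -ZD0; apply: EE_ae_eq.
- exact: measurable_funM.
- by apply: measurable_funM => //; apply: measurable_funB; exact: mMr.
- exists N; split=> // x /= h; apply: contrapT => nN; apply: h.
  by rewrite /D indicE mem_set ?mul1r.
Qed.

Definition drift (f : V -> R) : V -> R := fun v => 2^-1 * HPop f v.

Lemma smooth_drift f : smooth f -> smooth (drift f).
Proof. by move=> sf; apply: smoothZ; exact: smooth_HPop. Qed.

Lemma compactly_supported_drift f : compactly_supported f -> compactly_supported (drift f).
Proof. by move=> cf; apply: compactly_supportedMr; exact: compactly_supported_HPop. Qed.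

Lemma bm_path (k : V -> R) s : 0 <= s -> continuous k -> compactly_supported k ->
  bm (fun x => k (w s x)).
Proof.
move=> s0 ck csk; split; first exact: w_measurable.
by have [M kM] := continuous_cs_bounded ck csk; exists M.
Qed.

Lemma bm_Fm s Z K : 0 <= s -> Fm s Z -> (forall x, `|Z x| <= K) -> bm Z.
Proof. by move=> s0 mZ ZK; split; [exact: Fm_measurable mZ|exists K]. Qed.

Lemma lipschitz_step f C : smooth f -> compactly_supported f ->
  (forall v, `|drift f v| <= C) ->
  forall s t Z, 0 <= s -> s <= t -> Fm s Z -> (forall x, `|Z x| <= 1) ->
  `|E (fun x => Z x * f (w t x)) - E (fun x => Z x * f (w s x))| <= C * (t - s).
Proof.
move=> sf cf fC s t Z s0 st mZ Z1; have t0 := le_trans s0 st.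
have [N [mN N0 good]] := good_paths.
have [D [bD DE DN ZD]] := martingale_increment sf cf s0 st mZ Z1 mN N0 good.
have bZ := bm_Fm s0 mZ Z1.
have bt := bm_path t0 (smooth_continuous sf) cf.
have bs := bm_path s0 (smooth_continuous sf) cf.
have -> : E (fun x => Z x * f (w t x)) - E (fun x => Z x * f (w s x)) =
    E (fun x => Z x * (f (w t x) - f (w s x) - D x)).
  rewrite -EEB; [|exact: bmM..].
  rewrite -[LHS]subr0 -[X in _ - X]ZD -EEB; [|apply: bmB; exact: bmM|exact: bmM].
  by congr EE; apply/funext => x; ring.
pose D' x := \1_(~` N) x * (f (w t x) - f (w s x) - D x).
have bD' : bm D'.
  apply: bmM; last by apply: bmB => //; exact: bmB.
  split; first by apply: measurable_indic; exact: measurableC.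
  by exists 1 => x; rewrite indicE; case: (_ \in _); rewrite ?normr1 ?normr0.
have -> : E (fun x => Z x * (f (w t x) - f (w s x) - D x)) = E (fun x => Z x * D' x).
  apply: EE_ae_eq.
  - by apply: (bmM bZ (bmB (bmB bt bs) bD)).1.
  - exact: (bmM bZ bD').1.
  - exists N; split=> // x /= h; apply: contrapT => nN; apply: h.
    by rewrite /D' indicE mem_set ?mul1r.
apply: EE_bound; first exact: bmM.
move=> x; rewrite normrM; apply: (@le_trans _ _ `|D' x|).
  by rewrite ler_piMl.
have C0 : 0 <= C by exact: le_trans (fC 0).
have [xN|xN] := pselect (N x).
  rewrite /D' indicE memNset; last by apply.
  by rewrite mul0r normr0 mulr_ge0// subr_ge0.
rewrite /D' indicE mem_set// mul1r DE// opprB addrC subrK normrM ger0_norm//.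
have [cw _] := good x xN.
have C2 v : `|HPop f v| <= 2 * C.
  have -> : HPop f v = 2 * drift f v by rewrite /drift mulrA divff ?mul1r.
  by rewrite normrM ger0_norm// ler_wpM2l.
have := path_integral_bound (smooth_continuous (smooth_HPop sf)) s0 st C2 cw.
by rewrite -(ler_pM2l (x := 2^-1))// !mulrA mulVf// mul1r.
Qed.

Lemma derive_expectation f s u Z : smooth f -> compactly_supported f ->
  0 <= s -> s < u -> Fm s Z -> (forall x, `|Z x| <= 1) ->
  is_derive u 1 (fun v => E (fun x => Z x * f (w v x)))
    (E (fun x => Z x * drift f (w u x))).
Proof.
move=> sf cf s0 su mZ Z1; have u0 := le_lt_trans s0 su.
have [N [mN N0 good]] := good_paths.
have bZ := bm_Fm s0 mZ Z1.
have ck := smooth_continuous (smooth_HPop sf).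
have csk := compactly_supported_HPop cf.
have [C kC] := continuous_cs_bounded ck csk.
pose k := HPop f.
pose I v x := \int[lebesgue_measure]_(r in `[s, v]) k (w r x).
pose g v x := \1_(~` N) x * (Z x * (2^-1 * I v x)).
have mNc : measurable (~` N) by exact: measurableC.
have bNc : bm (\1_(~` N) : T -> R).
  split; first exact: measurable_indic.
  by exists 1 => x; rewrite indicE; case: (_ \in _); rewrite ?normr1 ?normr0.
have bf v : 0 <= v -> bm (fun x => f (w v x)).
  by move=> v0; apply: bm_path => //; exact: smooth_continuous.
have repr v : s <= v -> bm (g v) /\
    E (fun x => Z x * f (w v x)) = E (fun x => Z x * f (w s x)) + E (g v).
  move=> sv; have v0 := le_trans s0 sv.
  have [D [bD DE DN ZD]] := martingale_increment sf cf s0 sv mZ Z1 mN N0 good.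
  have e : g v = fun x => \1_(~` N) x * (Z x * (f (w v x) - f (w s x) - D x)).
    apply/funext => x; rewrite /g indicE.
    have [xN|xN] := boolP (x \in ~` N); last by rewrite !mul0r.
    rewrite DE; last by move: xN; rewrite inE.
    by rewrite opprB addrC subrK.
  have bg : bm (g v).
    by rewrite e; apply: bmM => //; apply: bmM => //; apply: bmB => //; apply: bmB; exact: bf.
  split=> //.
  have -> : E (g v) = E (fun x => Z x * (f (w v x) - f (w s x) - D x)).
    apply: EE_ae_eq => //; first exact: bg.1.
      by apply: (bmM bZ (bmB (bmB (bf _ _) (bf _ _)) bD)).1.
    exists N; split=> // x /= h; apply: contrapT => nN; apply: h.
    by rewrite e indicE mem_set ?mul1r.
  have bfv := bf _ v0; have bfs := bf _ s0.
  have -> : E (fun x => Z x * (f (w v x) - f (w s x) - D x)) =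
      E (fun x => Z x * f (w v x)) - E (fun x => Z x * f (w s x)) - E (fun x => Z x * D x).
    rewrite -!EEB; [|by do ?[apply: bmB|apply: bmM]..].
    by congr EE; apply/funext => x; ring.
  by rewrite ZD subr0 addrC subrK.
have mg v : `]s, u + 1[%classic v -> P.-integrable (~` N) (EFin \o g v).
  rewrite /= in_itv /= => /andP[sv _].
  by apply: integrableS (bm_integrable P (repr v (ltW sv)).1).
have dI v x : `]s, u + 1[%classic v -> (~` N) x -> derivable (I ^~ x) v 1 /\ (I ^~ x)^`()%classic v = k (w v x).
  rewrite /= in_itv /= => /andP[sv vu] nN; have [cw _] := good x nN.
  apply: (@continuous_FTC1_closed _ _ _ _ (v + 1)) => //.
  - by rewrite ltrDl.
  - exact: path_integrable.
  - by apply: path_cont_pt => //; exact: le_lt_trans sv.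
have gE x : g ^~ x = fun v => (\1_(~` N) x * Z x * 2^-1) * I v x.
  by apply/funext => v; rewrite /g; ring.
have dg v x : `]s, u + 1[%classic v -> (~` N) x -> derivable (g ^~ x) v 1.
  by move=> sv nN; rewrite gE; apply: derivableZ; exact: (dI _ _ sv nN).1.
have dg' v x : `]s, u + 1[%classic v -> (~` N) x -> partial1of2 g v x = \1_(~` N) x * (Z x * drift f (w v x)).
  move=> sv nN; have [d1 d2] := dI _ _ sv nN.
  rewrite partial1of2E gE [LHS]deriveZ//.
  by rewrite -derive1E d2 /drift /k /GRing.scale /=; ring.
have Iu : `]s, u + 1[%classic u by rewrite /= in_itv /= su ltrDl ltr01.
have iG : P.-integrable (~` N) (EFin \o cst (2^-1 * C)) by exact: finite_measure_integrable_cst.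
have C0 : 0 <= C by exact: le_trans (kC 0).
have G0 (y : T) : 0 <= cst (2^-1 * C) y by rewrite /= mulr_ge0.
have := @cvg_differentiation_under_integral _ _ _ P g (~` N) mNc u s (u + 1) Iu mg dg
  (cst (2^-1 * C)) G0 iG.
have bnd v x : `]s, u + 1[%classic v -> (~` N) x -> `|partial1of2 g v x| <= cst (2^-1 * C) x.
  move=> sv nN; rewrite dg'// indicE mem_set// mul1r normrM /=.
  apply: (@le_trans _ _ `|drift f (w v x)|); first by rewrite ler_piMl.
  by rewrite /drift normrM ger0_norm// ler_wpM2l.
move=> /(_ bnd).
have -> : \int[P]_(y in ~` N) partial1of2 g u y = E (fun x => Z x * drift f (w u x)).
  have -> : \int[P]_(y in ~` N) partial1of2 g u y =
      \int[P]_(y in ~` N) (\1_(~` N) y * (Z y * drift f (w u y))).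
    by apply: eq_Rintegral => x; rewrite inE => nN; exact: dg'.
  rewrite Rintegral_mkcond; apply: EE_ae_eq.
  - rewrite (_ : _ \_ _ = fun y => \1_(~` N) y * (Z y * drift f (w u y))).
      apply: (bmM bNc (bmM bZ (bm_path (ltW u0) _ (compactly_supported_drift cf)))).1.
      exact/smooth_continuous/smooth_drift.
    apply/funext => y; rewrite patchE /= indicE; case: (y \in ~` N) => //; by rewrite mul0r.
  - apply: (bmM bZ (bm_path (ltW u0) _ (compactly_supported_drift cf))).1.
    exact/smooth_continuous/smooth_drift.
  - exists N; split=> // x /= h; apply: contrapT => nN; apply: h.
    by rewrite patchE mem_set// indicE mem_set// mul1r.
move=> cvgd.
pose Phi v := E (fun x => Z x * f (w v x)).
have eqn : \forall h \near 0^', h^-1 *: ((fun x' => \int[P]_(y in ~` N) g x' y) (h + u) -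
   (fun x' => \int[P]_(y in ~` N) g x' y) u) = h^-1 *: ((Phi \o shift u) (h *: 1) - Phi u).
  near=> h.
  have hs : s <= h + u.
    have : `|h| <= u - s.
      near: h; apply: nbhs_dnbhs; apply/nbhs_normP; exists (u - s); first by rewrite /= subr_gt0.
      by move=> y /=; rewrite sub0r normrN => /ltW.
    by rewrite ler_norml => /andP[+ _]; rewrite opprB lerBlDr.
  have gi v : s <= v -> \int[P]_(y in ~` N) g v y = E (g v).
    move=> sv; rewrite Rintegral_mkcond /EE; congr Rintegral; apply/funext => y.
    rewrite patchE /g /= indicE; case: (y \in ~` N) => //; by rewrite mul0r.
  rewrite /= !gi ?(ltW su)//; congr (_ *: _).
  have e1 : h *: 1 + u = h + u by rewrite /GRing.scale /= mulr1.
  rewrite /Phi e1 (repr _ hs).2 (repr _ (ltW su)).2.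
  have alg (a b c : R) : b - c = a + b - (a + c) by ring.
  exact: alg.
have cP : h^-1 *: ((Phi \o shift u) (h *: 1) - Phi u) @[h --> 0^'] --> E (fun x => Z x * drift f (w u x)).
  by apply: cvg_trans cvgd; apply: near_eq_cvg.
apply: DeriveDef; last exact: cvg_lim cP.
by apply/cvg_ex; eexists; exact: cP.
Unshelve. all: by end_near.
Qed.

Lemma onestep f : smooth f -> compactly_supported f -> exists2 C, 0 <= C &
  forall s t Z, 0 <= s -> s <= t -> Fm s Z -> (forall x, `|Z x| <= 1) ->
  `|E (fun x => Z x * f (w t x)) -
    E (fun x => Z x * (f (w s x) + (t - s) * drift f (w s x)))| <= C * (t - s) ^+ 2.
Proof.
move=> sf cf.
have sd := smooth_drift sf; have cd := compactly_supported_drift cf.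
have sdd := smooth_drift sd; have cdd := compactly_supported_drift cd.
have [C dC] := continuous_cs_bounded (smooth_continuous sd) cd.
have [C' ddC] := continuous_cs_bounded (smooth_continuous sdd) cdd.
have C'0 : 0 <= C' by exact: le_trans (ddC 0).
exists C' => // s t Z s0 st mZ Z1.
have bZ := bm_Fm s0 mZ Z1.
have [->|neq] := eqVneq s t.
  rewrite subrr; under [X in _ - E X]eq_fun do rewrite mul0r addr0.
  by rewrite subrr normr0 expr2 !mulr0.
have slt : s < t by rewrite lt_neqAle neq.
pose Phi v := E (fun x => Z x * f (w v x)).
pose dPhi v := E (fun x => Z x * drift f (w v x)).
have dP v : v \in `]s, t[ -> is_derive v 1 Phi (dPhi v).
  rewrite in_itv /= => /andP[sv _]; exact: (derive_expectation sf cf s0 sv mZ Z1).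
have lip u v : s <= u -> u <= v -> `|Phi v - Phi u| <= C * (v - u).
  move=> su uv; apply: lipschitz_step => //; first exact: le_trans su.
  exact: Fm_mono mZ.
have C0 : 0 <= C by exact: le_trans (dC 0).
have cP : {within `[s, t], continuous Phi}.
  apply/(continuous_within_itvP _ slt); split.
  - move=> v vst; apply: differentiable_continuous; apply/derivable1_diffP.
    by have [] := dP v vst.
  - apply/cvgrPdist_le => e e0; near=> v.
    rewrite distrC; apply: le_trans (lip s v _ _) _ => //; try by near: v; apply: nbhs_right_ge.
    apply: (le_trans (y := (C + 1) * (v - s))).
      by rewrite ler_wpM2r ?lerDl// subr_ge0; near: v; apply: nbhs_right_ge.
    rewrite mulrC -ler_pdivlMr ?ltr_wpDl// lerBlDl.
    near: v; apply: nbhs_right_le; by rewrite ltrDl divr_gt0 ?ltr_wpDl.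
  - apply/cvgrPdist_le => e e0; near=> v.
    have vt : v <= t by near: v; apply: nbhs_left_le.
    have sv : s <= v by near: v; apply: nbhs_left_ge.
    apply: le_trans (lip v t _ _) _ => //.
    apply: (le_trans (y := (C + 1) * (t - v))).
      by rewrite ler_wpM2r ?lerDl// subr_ge0.
    rewrite mulrC -ler_pdivlMr ?ltr_wpDl// lerBlDr -lerBlDl.
    near: v; apply: nbhs_left_ge; by rewrite ltrBlDr ltrDl divr_gt0 ?ltr_wpDl.
have [c cst] := MVT_segment st dP cP.
rewrite -/(Phi t) => PE.
have bf := bm_path s0 (smooth_continuous sf) cf.
have bdr := bm_path s0 (smooth_continuous sd) cd.
have -> : E (fun x => Z x * (f (w s x) + (t - s) * drift f (w s x))) = Phi s + (t - s) * dPhi s.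
  rewrite -EEZ; last exact: bmM.
  rewrite -EED; [|exact: bmM|by apply: bmZ; exact: bmM].
  by congr EE; apply/funext => x; ring.
have -> : Phi t - (Phi s + (t - s) * dPhi s) = (dPhi c - dPhi s) * (t - s).
  have alg (a b e c' d' : R) : a - b = c' * e -> a - (b + e * d') = (c' - d') * e.
    by move=> h; rewrite opprD addrA h; ring.
  exact: alg PE.
move: cst; rewrite in_itv /= => /andP[sc ct].
rewrite normrM [`|t - s|]ger0_norm ?subr_ge0// expr2 mulrA.
apply: ler_wpM2r; first by rewrite subr_ge0.
apply: le_trans (lipschitz_step sd cd ddC s0 sc mZ Z1) _.
by rewrite ler_wpM2l// lerD2r.
Unshelve. all: by end_near.
Qed.

End OneStep.

Local Transparent derive.

Section SmoothHalfLine.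
Context {R : realType}.
Implicit Types (f g : R -> R).

Fixpoint Dk (k : nat) f : Prop :=
  (forall x, 0 < x -> derivable f x 1) /\
  match k with 0%N => True | k'.+1 => Dk k' f^`()%classic end.

Lemma Dk_derivable k f x : Dk k f -> 0 < x -> derivable f x 1.
Proof. by case: k => [|k] [+ _] x0; apply. Qed.

Lemma DkW k f : Dk k.+1 f -> Dk k f.
Proof. elim: k f => [|k IH] f [df Df]; split=> //; exact/IH/Df. Qed.

Lemma near_pos (x : R) : 0 < x -> \forall y \near x, 0 < y.
Proof. by move=> x0; apply: open_nbhs_nbhs; split => //; exact: open_gt. Qed.

Lemma Dk_ext k f g : (forall x, 0 < x -> f x = g x) -> Dk k f -> Dk k g.
Proof.
elim: k f g => [|k IH] f g fg [df Df]; split.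
- move=> x x0; apply: near_eq_derivable (df x x0).
  by apply: filterS (near_pos x0) => y /fg.
- by [].
- move=> x x0; apply: near_eq_derivable (df x x0).
  by apply: filterS (near_pos x0) => y /fg.
- apply: IH Df => x x0; rewrite !derive1E; apply: near_eq_derive.
  by apply: filterS (near_pos x0) => y /fg.
Qed.

Lemma Dk_is_derive k f g : (forall x : R, 0 < x -> is_derive x 1 f (g x)) ->
  Dk k g -> Dk k.+1 f.
Proof.
move=> fg Dg; split; first by move=> x /fg [].
by apply: Dk_ext Dg => x /fg h; rewrite derive1E; rewrite derive_val.
Qed.

Lemma Dk_is_derive' k f g : (forall x : R, 0 < x -> is_derive x 1 f (g x)) ->
  Dk k.+1 f -> Dk k g.
Proof.
move=> fg [_]; apply: Dk_ext => x /fg h; by rewrite derive1E derive_val.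
Qed.

Lemma is_derive_Dk k f x : Dk k f -> 0 < x -> is_derive (x : R) 1 f (f^`()%classic x).
Proof.
by move=> Df x0; apply: DeriveDef; [exact: Dk_derivable Df x0|rewrite derive1E].
Qed.

Lemma Dk_cst k (c : R) : Dk k (fun=> c).
Proof.
elim: k c => [|k IH] c.
  by split=> // x _; exact: derivable_cst.
by apply: Dk_is_derive (IH 0) => x _; exact: is_derive_cst.
Qed.

Lemma Dk_id k : Dk k (fun x => x).
Proof.
case: k => [|k]; first by split=> // x _; exact: derivable_id.
by apply: Dk_is_derive (Dk_cst k 1) => x _; exact: is_derive_id.
Qed.

Lemma DkD k f g : Dk k f -> Dk k g -> Dk k (fun x => f x + g x).
Proof.
elim: k f g => [|k IH] f g Df Dg.
  by split=> // x x0; apply: derivableD; [exact: (Dk_derivable Df)|exact: (Dk_derivable Dg)].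
apply: (@Dk_is_derive _ _ (fun x => f^`()%classic x + g^`()%classic x)).
  by move=> x x0; apply: is_deriveD; [exact: (is_derive_Dk Df)|exact: (is_derive_Dk Dg)].
by apply: IH; [case: Df|case: Dg].
Qed.

Lemma DkM k f g : Dk k f -> Dk k g -> Dk k (fun x => f x * g x).
Proof.
elim: k f g => [|k IH] f g Df Dg.
  by split=> // x x0; apply: derivableM; [exact: (Dk_derivable Df)|exact: (Dk_derivable Dg)].
apply: (@Dk_is_derive _ _ (fun x => f x * g^`()%classic x + g x * f^`()%classic x)).
  by move=> x x0; apply: is_deriveM; [exact: (is_derive_Dk Df)|exact: (is_derive_Dk Dg)].
by apply: DkD; apply: IH; try exact: DkW; [case: Dg|case: Df].
Qed.

Lemma is_derive_comp1 f g x (df dg : R) : is_derive (x : R) 1 f df ->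
  is_derive (f x : R) 1 g dg -> is_derive x 1 (fun x => g (f x)) (dg * df).
Proof. by move=> hf hg; have := is_derive1_comp hg hf; rewrite mulrC. Qed.

Lemma Dk_comp k (G : nat -> R -> R) f :
  (forall i x, 0 < x -> is_derive (f x) 1 (G i) (G i.+1 (f x))) -> Dk k f ->
  forall i, Dk k (fun x => G i (f x)).
Proof.
move=> dG; elim: k => [|k IH] Df i.
  split=> // x x0.
  by have [] := is_derive_comp1 (is_derive_Dk Df x0) (dG i x x0).
apply: (@Dk_is_derive _ _ (fun x => G i.+1 (f x) * f^`()%classic x)).
  by move=> x x0; apply: is_derive_comp1 (dG i x x0); exact: is_derive_Dk Df x0.
by apply: DkM; [apply: IH; exact: DkW|case: Df].
Qed.

Lemma is_deriveV1 (x : R) : x != 0 -> is_derive x 1 (fun x : R => x^-1) (- x^-1 ^+ 2).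
Proof.
move=> x0; apply: DeriveDef; first by apply: derivableV.
rewrite [LHS](@deriveV _ _ id x 1 x0); last exact: derivable_id.
by rewrite derive_id /GRing.scale /= mulr1 exprVn.
Qed.

Definition invseq (i : nat) (x : R) := (-1) ^+ i * i`!%:R * x^-1 ^+ i.+1.

Lemma is_derive_invseq i (x : R) : x != 0 -> is_derive x 1 (invseq i) (invseq i.+1 x).
Proof.
move=> x0; have dX := @is_deriveX _ _ (fun x : R => x^-1) i.+1 x 1 _ (is_deriveV1 x0).
rewrite exprfctE in dX.
have := @is_deriveZ _ _ _ _ ((-1) ^+ i * i`!%:R) _ _ _ dX.
rewrite /GRing.scale /= => dZ; apply: is_derive_eq dZ _.
rewrite /invseq factS natrM !exprS mulrnAl -mulr_natl; ring.
Qed.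

Lemma DkV k f : (forall x, 0 < x -> f x != 0) -> Dk k f -> Dk k (fun x => (f x)^-1).
Proof.
move=> f0 Df; have := Dk_comp (G := invseq) _ Df 0.
under eq_fun do rewrite /invseq expr0 fact0 !mul1r expr1.
by apply=> i x x0; apply: is_derive_invseq; exact: f0.
Qed.

Lemma DkX k f m : Dk k f -> Dk k (fun x => f x ^+ m).
Proof.
move=> Df; elim: m => [|m IH]; first exact: (Dk_cst k 1).
by under eq_fun do rewrite exprS; exact: DkM.
Qed.

Lemma Dk_sum k (I : Type) (r : seq I) (F : I -> R -> R) :
  (forall i, Dk k (F i)) -> Dk k (fun x => \sum_(i <- r) F i x).
Proof.
move=> DF; elim: r => [|i r IH].
  by under eq_fun do rewrite big_nil; exact: Dk_cst.
by under eq_fun do rewrite big_cons; exact: DkD.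
Qed.

Definition Dinf f := forall k, Dk k f.

Lemma dseq_Dinf f : Dinf f -> dseq (fun i => f^`(i)%classic).
Proof.
move=> Df i x x0; rewrite derive1nS.
suff : Dinf f^`(i)%classic by move=> /(_ 0%N) h; exact: is_derive_Dk h x0.
elim: i => [|i IH]; first by rewrite derive1n0.
by move=> k; rewrite derive1nS; have [] := IH k.+1.
Qed.

Lemma dseq_Dinf2 f f1 f2 : Dinf f ->
  (forall x : R, 0 < x -> is_derive x 1 f (f1 x)) ->
  (forall x : R, 0 < x -> is_derive x 1 f1 (f2 x)) ->
  exists G, [/\ dseq G, G 0%N = f, G 1%N = f1 & G 2%N = f2].
Proof.
move=> Df d1 d2.
have D1 : Dinf f1 by move=> k; exact: Dk_is_derive' d1 (Df k.+1).
have D2 : Dinf f2 by move=> k; exact: Dk_is_derive' d2 (D1 k.+1).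
exists (fun i => match i with 0 => f | 1 => f1 | i.+2 => f2^`(i)%classic end).
split=> // -[|[|i]] x x0; [exact: d1|exact: d2|].
exact: (dseq_Dinf D2 i x0).
Qed.

End SmoothHalfLine.

Section Flat.
Context {R : realType}.

Lemma pow_le_expR k (u : R) : 0 <= u -> u ^+ k <= k`!%:R * expR u.
Proof.
move=> u0; case: k => [|k].
  by rewrite expr0 fact0 mul1r -expR0 ler_expR.
have := expR_ge1Dxn k u0 => h.
rewrite mulrC -ler_pdivrMr ?ltr0n ?fact_gt0//; apply: le_trans h.
by rewrite lerDr.
Qed.

Lemma poly_expR_bound (p : {poly R}) :
  exists C, forall u : R, 0 <= u -> `|p.[u]| * expR (- u) <= C.
Proof.
exists (\sum_(i < size p) `|p`_i| * i`!%:R) => u u0.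
rewrite horner_coef; apply: (@le_trans _ _ (\sum_(i < size p) `|p`_i * u ^+ i| * expR (- u))).
  by rewrite -mulr_suml ler_wpM2r ?expR_ge0// ler_norm_sum.
apply: ler_sum => i _; rewrite normrM [`|u ^+ i|]ger0_norm ?exprn_ge0// -mulrA.
rewrite ler_wpM2l// expRN ler_pdivrMr ?expR_gt0//; exact: pow_le_expR.
Qed.

Definition flat (p : {poly R}) (x : R) : R :=
  if 0 < x then p.[x^-1] * expR (- x^-1) else 0.

Definition dflat (p : {poly R}) : {poly R} := 'X ^+ 2 * (p - p^`()).

Lemma is_derive_flat p (x : R) : is_derive x 1 (flat p) (flat (dflat p) x).
Proof.
have [x0|x0|x0] := ltgtP 0 x.
- have e : \forall y \near x, p.[y^-1] * expR (- y^-1) = flat p y.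
    by apply: filterS (near_pos x0) => y y0; rewrite /flat y0.
  apply: (near_eq_is_derive e).
  have dV := is_deriveV1 (lt0r_neq0 x0).
  have dp := is_derive_comp1 dV (is_derive_poly p x^-1).
  have dN : is_derive x 1 (fun y : R => - y^-1) (- - x^-1 ^+ 2) by exact: is_deriveN.
  have dE := is_derive_comp1 dN (is_derive_expR _).
  have := is_deriveM dp dE => h; apply: is_derive_eq h _.
  rewrite /flat x0 /dflat /GRing.scale /= hornerM hornerXn !hornerE.
  rewrite -[X in X + _]/(p.[x^-1] * expR (- x^-1) * (- - x^-1 ^+ 2)).
  rewrite -[X in _ + X]/(expR (- x^-1) * p^`().[x^-1] * (- x^-1 ^+ 2)).
  ring.
- have e : \forall y \near x, (fun=> 0) y = flat p y.
    have : \forall y \near x, y < 0 by apply: open_nbhs_nbhs; split => //; exact: open_lt.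
    by apply: filterS => y y0; rewrite /flat ltNge (ltW y0).
  apply: (near_eq_is_derive e).
  by rewrite /flat ltNge (ltW x0) /=; exact: is_derive_cst.
- rewrite -x0.
  have [C hC] := poly_expR_bound ('X ^+ 2 * p).
  have C0 : 0 <= C by apply: le_trans (hC 0 (lexx _)); rewrite mulr_ge0 ?expR_ge0.
  have lim0 : h^-1 *: ((flat p \o shift 0) (h *: 1) - flat p 0) @[h --> 0^'] --> flat (dflat p) 0.
    have f0 q : flat q 0 = 0 by rewrite /flat ltxx.
    rewrite !f0.
    have bnd (h : R) : h != 0 -> `|h^-1 *: ((flat p \o shift 0) (h *: 1) - 0)| <= C * `|h|.
      move=> h0; rewrite subr0 /= addr0 /GRing.scale /= mulr1 /flat.
      case: ifP => h1; last by rewrite mulr0 normr0 mulr_ge0.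
      rewrite !normrM (ger0_norm (expR_ge0 _)).
      have hi : 0 <= h^-1 by rewrite invr_ge0 ltW.
      have := hC _ hi; rewrite hornerM hornerXn normrM => b.
      have := ler_wpM2r (normr_ge0 h) b.
      rewrite normrX; apply: le_trans; rewrite le_eqVlt; apply/orP; left; apply/eqP.
      rewrite normfV; field; by rewrite normr_eq0.
    apply: norm_cvg0; apply: (@squeeze_cvgr _ _ _ _ (fun=> 0) (fun h => C * `|h|)).
    - near=> h; rewrite normr_ge0 /= bnd//; near: h; exact: nbhs_dnbhs_neq.
    - exact: cvg_cst.
    - rewrite -[X in _ --> X](mulr0 C); apply: cvgMr.
      apply: cvg_within_filter.
      by have := @norm_continuous R R 0; rewrite /continuous_at normr0.
  apply: DeriveDef; last exact: cvg_lim lim0.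
  by apply/cvg_ex; eexists; exact: lim0.
Unshelve. all: by end_near.
Qed.

Definition fseq (i : nat) := flat (iter i dflat 1).

Lemma is_derive_fseq i (x : R) : is_derive x 1 (fseq i) (fseq i.+1 x).
Proof. exact: is_derive_flat. Qed.

Definition rho := fseq 0.

Lemma rho_gt0 x : 0 < x -> 0 < rho x.
Proof. by move=> x0; rewrite /rho /fseq /flat x0 /= hornerC mul1r expR_gt0. Qed.

Lemma rho_le0 x : x <= 0 -> rho x = 0.
Proof. by move=> x0; rewrite /rho /fseq /flat ltNge x0. Qed.

Lemma rho_ge0 x : 0 <= rho x.
Proof. by have [/rho_le0 ->//|/rho_gt0/ltW] := leP x 0. Qed.

Lemma Dinf_comp_affine (G : nat -> R -> R) (a b : R) :
  (forall i (x : R), is_derive x 1 (G i) (G i.+1 x)) -> Dinf (fun x => G 0%N (a * x + b)).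
Proof.
move=> dG k; apply: (Dk_comp (G := G) (f := fun x => a * x + b)) => //.
apply: DkD; last exact: Dk_cst.
by apply: DkM; [exact: Dk_cst|exact: Dk_id].
Qed.

(* A smooth plateau: 1 for x <= r and 0 for x >= 2 r. *)
Definition plateau (r x : R) : R :=
  rho (- r^-1 * x + 2) / (rho (- r^-1 * x + 2) + rho (r^-1 * x - 1)).

Lemma plateau_den_gt0 r x : 0 < rho (- r^-1 * x + 2) + rho (r^-1 * x - 1).
Proof.
have [h|h] := ltP 0 (- r^-1 * x + 2).
  by rewrite ltr_pwDl ?rho_gt0 ?rho_ge0.
rewrite ltr_wpDl ?rho_ge0// rho_gt0//.
by move: h; rewrite mulNr => h; lra.
Qed.

Lemma plateau_ge0 r x : 0 <= plateau r x.
Proof. by rewrite divr_ge0 ?rho_ge0// ltW ?plateau_den_gt0. Qed.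

Lemma plateau_le1 r x : plateau r x <= 1.
Proof. by rewrite ler_pdivrMr ?plateau_den_gt0// mul1r lerDl rho_ge0. Qed.

Lemma plateau1 r x : 0 < r -> x <= r -> plateau r x = 1.
Proof.
move=> r0 xr; rewrite /plateau [rho (r^-1 * x - 1)]rho_le0 ?addr0.
  rewrite divff// gt_eqF// rho_gt0// mulNr.
  have : r^-1 * x <= 1 by rewrite mulrC ler_pdivrMr// mul1r.
  by move=> h; lra.
by rewrite subr_le0 mulrC ler_pdivrMr// mul1r.
Qed.

Lemma plateau0 r x : 0 < r -> 2 * r <= x -> plateau r x = 0.
Proof.
move=> r0 xr; rewrite /plateau rho_le0 ?mul0r// mulNr addrC subr_le0.
by rewrite mulrC ler_pdivlMr.
Qed.

Lemma Dinf_plateau r : Dinf (plateau r).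
Proof.
have d1 := Dinf_comp_affine (- r^-1) 2 is_derive_fseq.
have d2 := Dinf_comp_affine (r^-1) (-1) is_derive_fseq.
move=> k; apply: DkM; first exact: d1.
apply: DkV; last by apply: DkD; [exact: d1|exact: d2].
by move=> x _; rewrite gt_eqF// plateau_den_gt0.
Qed.

Lemma plateau_scale r : plateau r = fun x => plateau 1 (r^-1 * x).
Proof. by apply/funext => x; rewrite /plateau invr1 !mulN1r mul1r mulNr. Qed.

Lemma fseq1_ge0 (x : R) : 0 <= fseq 1 x.
Proof.
rewrite /fseq /flat; case: ifP => // x0; rewrite mulr_ge0 ?expR_ge0//= /dflat.
have -> : (1 : {poly R})^`() = 0 by rewrite -[1]/(1%:P) derivC.
by rewrite subr0 mulr1 hornerXn exprn_ge0// invr_ge0 ltW.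
Qed.

Lemma fseq1_le2 (x : R) : fseq 1 x <= 2.
Proof.
rewrite /fseq /flat; case: ifP => // x0; rewrite /= /dflat.
have -> : (1 : {poly R})^`() = 0 by rewrite -[1]/(1%:P) derivC.
rewrite subr0 mulr1 hornerXn expRN ler_pdivrMr ?expR_gt0//.
have xi : 0 <= x^-1 by rewrite invr_ge0 ltW.
by have := pow_le_expR 2 xi.
Qed.

Lemma fseq2_ge0 (x : R) : x <= 2^-1 -> 0 <= fseq 2 x.
Proof.
move=> x2; rewrite /fseq /flat; case: ifP => // x0.
rewrite mulr_ge0 ?expR_ge0//= /dflat.
have c32 : 2 <= x^-1.
  by rewrite -[2]invrK lef_pV2 ?posrE ?invr_gt0.
have -> : (1 : {poly R})^`() = 0 by rewrite -[1]/(1%:P) derivC.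
rewrite !subr0 !mulr1 derivXn /= expr1 !hornerE.
rewrite mulr_ge0 ?exprn_ge0//; first by rewrite (le_trans _ c32).
by rewrite -mulr2n -mulr_natl expr2 -mulrBl mulr_ge0 ?subr_ge0// (le_trans _ c32).
Qed.

Lemma continuous_fseq i : continuous (fseq i).
Proof.
move=> y; apply: differentiable_continuous; apply/derivable1_diffP.
by have [] := is_derive_fseq i y.
Qed.

(* The convexity of exp(-1/x) on ]-oo, 1/2] in tangent-line form. *)
Lemma rho_tangent (x : R) : x <= 2^-1 -> fseq 1 x * (2^-1 - x) <= rho 2^-1 - rho x.
Proof.
move=> x2.
have [c1 + ->] := MVT_segment x2 (fun y _ => is_derive_fseq 0 y) (continuous_subspaceT (@continuous_fseq 0)).
rewrite in_itv /= => /andP[xc c2].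
rewrite ler_wpM2r ?subr_ge0//.
have [c3 + h] := MVT_segment xc (fun y _ => is_derive_fseq 1 y) (continuous_subspaceT (@continuous_fseq 1)).
rewrite in_itv /= => /andP[_ c3c].
by rewrite -subr_ge0 h mulr_ge0 ?subr_ge0// fseq2_ge0// (le_trans c3c).
Qed.

Lemma rho_increment (x : R) : x <= 2^-1 -> 0 <= rho 2^-1 - rho x <= 2 * (2^-1 - x).
Proof.
move=> x2.
have [c1 + ->] := MVT_segment x2 (fun y _ => is_derive_fseq 0 y) (continuous_subspaceT (@continuous_fseq 0)).
rewrite in_itv /= => /andP[xc c2].
by rewrite mulr_ge0 ?fseq1_ge0 ?subr_ge0//= ler_wpM2r ?fseq1_le2 ?subr_ge0.
Qed.

End Flat.

Local Opaque derive.

Local Opaque EE.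

Section RealAux.
Context {R : realType}.

Lemma sin_bound (x : R) : 0 <= x -> 0 <= x - sin x <= x ^+ 3 / 2.
Proof.
move=> x0.
have c1 : continuous (@sin R) by exact: continuous_sin.
have sx (y : R) : 0 <= y -> `|sin y| <= y.
  move=> y0.
  have [c + ] := MVT_segment y0 (fun z _ => is_derive_sin z) (continuous_subspaceT c1).
  move=> _; rewrite sin0 !subr0 => ->; rewrite normrM (ger0_norm y0) ler_piMl//.
  by rewrite ler_norml cos_geN1 cos_le1.
have cb (y : R) : 0 <= y -> 0 <= 1 - cos y <= y ^+ 2.
  move=> y0; rewrite subr_ge0 cos_le1 /=.
  have [c + h] := MVT_segment y0 (fun z _ => is_derive_cos z) (continuous_subspaceT (@continuous_cos R)).
  rewrite in_itv /= => /andP[c0 cy].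
  have -> : 1 - cos y = sin c * y by rewrite -cos0 -opprB h subr0 mulNr opprK.
  apply: le_trans (ler_norm _) _; rewrite normrM (ger0_norm y0) expr2 ler_wpM2r//.
  exact: le_trans (sx c c0) cy.
have dh (k : R) (z : R) : is_derive z 1 (fun y : R => k * y ^+ 3 - (y - sin y)) (k * (3%:R * z ^+ 2) - (1 - cos z)).
  have dX := @is_deriveX _ _ (fun x : R => x) 3 z 1 _ (is_derive_id _ _).
  rewrite exprfctE in dX.
  have := is_deriveB (is_deriveZ k dX) (is_deriveB (is_derive_id z 1) (is_derive_sin z)).
  move=> h; apply: is_derive_eq h _; rewrite /GRing.scale /=; ring.
have cont (k : R) : continuous (fun y : R => k * y ^+ 3 - (y - sin y)).
  by move=> z; apply: differentiable_continuous; apply/derivable1_diffP; have [] := dh k z.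
apply/andP; split.
  have [c + h] := MVT_segment x0 (fun z _ => dh 0 z) (continuous_subspaceT (cont 0)).
  rewrite in_itv /= => /andP[c0 cx]; move: h.
  rewrite sin0 !mul0r !subr0 !sub0r => /eqP; rewrite eqr_oppLR => /eqP ->.
  by rewrite mulNr opprK mulr_ge0//; have /andP[] := cb c c0.
have [c + h] := MVT_segment x0 (fun z _ => dh 2^-1 z) (continuous_subspaceT (cont 2^-1)).
rewrite in_itv /= => /andP[c0 cx]; move: h.
rewrite expr0n /= mulr0 sin0 subrr !subr0 => h.
rewrite -subr_ge0 mulrC h mulr_ge0//.
have /andP[_ b] := cb c c0.
have := sqr_ge0 c; lra.
Qed.

Lemma cos_bound (x : R) : 0 <= x -> 0 <= cos x - 1 + x ^+ 2 / 2 <= x ^+ 4 / 2.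
Proof.
move=> x0.
have dh (k : R) (z : R) : is_derive z 1 (fun y : R => cos y - 1 + y ^+ 2 / 2 - k * y ^+ 4)
    ((z - sin z) - k * (4%:R * z ^+ 3)).
  have dX4 := @is_deriveX _ _ (fun x : R => x) 4 z 1 _ (is_derive_id _ _).
  have dX2 := @is_deriveX _ _ (fun x : R => x) 2 z 1 _ (is_derive_id _ _).
  rewrite exprfctE in dX4; rewrite exprfctE in dX2.
  have := is_deriveB (is_deriveD (is_deriveB (is_derive_cos z) (is_derive_cst (1 : R) z 1))
    (is_deriveZ 2^-1 dX2)) (is_deriveZ k dX4).
  have -> : (fun y : R => cos y - 1 + y ^+ 2 / 2 - k * y ^+ 4) =
    ((cos \- cst 1) \+ 2^-1 \*: (fun x : R => x ^+ 2)) \- k \*: (fun x : R => x ^+ 4).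
    by apply/funext => y /=; rewrite /GRing.scale /= [_ / 2]mulrC.
  move=> h; apply: is_derive_eq h _; rewrite /GRing.scale /=.
  by field.
have cont (k : R) : continuous (fun y : R => cos y - 1 + y ^+ 2 / 2 - k * y ^+ 4).
  by move=> z; apply: differentiable_continuous; apply/derivable1_diffP; have [] := dh k z.
apply/andP; split.
  have [c + h] := MVT_segment x0 (fun z _ => dh 0 z) (continuous_subspaceT (cont 0)).
  rewrite in_itv /= => /andP[c0 cx]; move: h.
  rewrite !mul0r !subr0 cos0 subrr expr0n /= mul0r addr0 subr0 => ->.
  by rewrite mulr_ge0//; have /andP[] := sin_bound c0.
have [c + h] := MVT_segment x0 (fun z _ => dh 2^-1 z) (continuous_subspaceT (cont 2^-1)).
rewrite in_itv /= => /andP[c0 cx]; move: h.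
rewrite !expr0n /= mulr0 mul0r cos0 subrr addr0 !subr0 => h.
rewrite -subr_le0 [_ ^+ 4 / 2]mulrC h.
have /andP[_ b] := sin_bound c0.
have c3 : 0 <= c ^+ 3 by rewrite exprn_ge0.
by apply: mulr_le0_ge0 => //; lra.
Qed.

Lemma cos_taylor (S D r : R) : 0 < r ->
  `|cos (S + D) - (cos S - cos S * D ^+ 2 / 2 - sin S * D)| <=
  r * D ^+ 2 + (r^-1 + 1) * D ^+ 4.
Proof.
move=> r0.
have -> : cos (S + D) - (cos S - cos S * D ^+ 2 / 2 - sin S * D) =
   cos S * (cos D - 1 + D ^+ 2 / 2) + sin S * (D - sin D).
  by rewrite cosD; ring.
have cs (y : R) : `|cos y| <= 1 by rewrite ler_norml cos_geN1 cos_le1.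
have ss (y : R) : `|sin y| <= 1 by rewrite ler_norml sin_geN1 sin_le1.
have b1 : `|cos D - 1 + D ^+ 2 / 2| <= D ^+ 4 / 2.
  have /andP[b1 b2] := cos_bound (normr_ge0 D).
  have cN : cos `|D| = cos D by case: (ger0P D) => // _; rewrite cosN.
  have e2 : `|D| ^+ 2 = D ^+ 2 by rewrite real_normK ?num_real.
  have e4 : `|D| ^+ 4 = D ^+ 4 by rewrite (exprM _ 2 2) e2 -exprM.
  move: b1 b2; rewrite cN e2 e4 => b1 b2; by rewrite ger0_norm.
have b2 : `|D - sin D| <= `|D| ^+ 3 / 2.
  have /andP[c1 c2] := sin_bound (normr_ge0 D).
  have -> : `|D - sin D| = `| `|D| - sin `|D| |.
    by case: (ger0P D) => // _; rewrite sinN opprK -[LHS]normrN opprB addrC.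
  by rewrite ger0_norm.
apply: le_trans (ler_normD _ _) _; rewrite !normrM.
have am : `|D| ^+ 3 <= r * D ^+ 2 + r^-1 * D ^+ 4.
  have -> : r * D ^+ 2 + r^-1 * D ^+ 4 = r * (`|D| - r^-1 * `|D| ^+ 2) ^+ 2 + 2 * `|D| ^+ 3.
    have e2 : D ^+ 2 = `|D| ^+ 2 by rewrite real_normK ?num_real.
    have -> : D ^+ 4 = `|D| ^+ 4 by rewrite (exprM _ 2 2) e2 -exprM.
    rewrite e2; field; exact: lt0r_neq0.
  have p1 : 0 <= r * (`|D| - r^-1 * `|D| ^+ 2) ^+ 2 by rewrite mulr_ge0 ?sqr_ge0// ltW.
  have p2 : 0 <= `|D| ^+ 3 by rewrite exprn_ge0.
  lra.
have h1 : `|cos S| * `|cos D - 1 + D ^+ 2 / 2| <= D ^+ 4 / 2.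
  by rewrite -[leRHS]mul1r ler_pM.
have h2 : `|sin S| * `|D - sin D| <= `|D| ^+ 3 / 2 by rewrite -[leRHS]mul1r ler_pM.
have p4 : 0 <= D ^+ 4 by rewrite (exprM _ 2 2) sqr_ge0.
have p3 : 0 <= `|D| ^+ 3 by rewrite exprn_ge0.
move: h1 h2 am; rewrite mulrDl mul1r; lra.
Qed.

End RealAux.

Section Radial.
Context {R : realType} {n : nat}.
Notation V := 'M[R]_(n, 4).
Implicit Types (f : R -> R) (w : V).

Lemma smooth_rad f : Dinf f -> smooth (fun w : V => f (vv w)).
Proof. by move=> Df; have := smooth_radial (dseq_Dinf Df); exact. Qed.

Lemma HPop_rad f f1 f2 w : Dinf f ->
  (forall x : R, 0 < x -> is_derive x 1 f (f1 x)) ->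
  (forall x : R, 0 < x -> is_derive x 1 f1 (f2 x)) ->
  HPop (fun w : V => f (vv w)) w =
  4 * vv w ^+ 2 * (vv w - 1) * f2 (vv w) + 8 * n%:R * vv w * f1 (vv w).
Proof.
move=> Df d1 d2; have [G [dG <- <- <-]] := dseq_Dinf2 Df d1 d2.
exact: HPop_radial.
Qed.

Lemma norm_le_vv w : `|w| <= vv w.
Proof.
rewrite [`|_|]mx_normrE; apply: bigmax_le => [|i _]; first exact: ltW (vv_gt0 w).
have h : w i.1 i.2 ^+ 2 <= sqnormH w.
  rewrite /sqnormH (bigD1 i.1)//= (bigD1 i.2)//= -addrA lerDl addr_ge0//.
    by apply: sumr_ge0 => k _; exact: sqr_ge0.
  by do 2!apply: sumr_ge0 => ? _; exact: sqr_ge0.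
rewrite /vv; apply: le_trans (lerD (lexx 1) h).
rewrite -[w i.1 i.2 ^+ 2]real_normK ?num_real//; set a : R := `|_|.
rewrite -subr_ge0 (_ : 1 + a ^+ 2 - a = ((a - 1) ^+ 2 + a ^+ 2 + 1) / 2); last by field.
by rewrite divr_ge0// addr_ge0// addr_ge0 ?sqr_ge0.
Qed.

Lemma compactly_supported_rad f r : (forall x, r <= x -> f x = 0) ->
  compactly_supported (fun w : V => f (vv w)).
Proof.
move=> f0; exists r => w rw; apply: f0; apply: le_trans (ltW rw) _; exact: norm_le_vv.
Qed.

Lemma near_vv_gt r w : r < vv w -> \forall x \near w, r < vv x.
Proof.
move=> rw; have cv : continuous (vv : V -> R) by exact: smooth_continuous smooth_vv.
have := cv w; move/cvgr_gt; exact.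
Qed.

Lemma HPop_near0 (f : V -> R) w : (\forall x \near w, f x = 0) -> HPop f w = 0.
Proof.
move=> nf; have D1 u := near_derive0 u nf; have D2 u := near_derive0 u (D1 u).
rewrite /HPop (nbhs_singleton (D1 w)) mulr0 subr0.
under eq_bigr do rewrite (nbhs_singleton (D2 _)).
under [X in _ + X]eq_bigr do rewrite (nbhs_singleton (D2 _)).
by rewrite !sumr_const !mul0rn addr0 mulr0.
Qed.

End Radial.

Section Process.
Context {R : realType} {d : measure_display} {T : measurableType d}.
Context (P : probability T R) {n : nat} (F : R -> set (set T)).
Context (w : R -> T -> 'M[R]_(n, 4)).
Notation V := 'M[R]_(n, 4).
Hypothesis filt : filtration F.
Hypothesis bw : HPbrownian P F w.
Notation E := (EE P).
Notation Fm := (Fm F).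

Lemma bm_continuous (k : V -> R) K s : 0 <= s -> continuous k -> (forall v, `|k v| <= K) ->
  bm (fun x => k (w s x)).
Proof. by move=> s0 ck kK; split; [exact: (w_measurable filt bw)|exists K]. Qed.

Lemma discrete_gronwall (u : R -> R) (kap C t : R) : 0 <= kap -> 0 <= C -> 0 <= t ->
  (forall s, 0 <= s -> 0 <= u s) ->
  (forall s del, 0 <= s -> 0 <= del -> u (s + del) <= (1 + kap * del) * u s + C * del ^+ 2) ->
  u t <= expR (kap * t) * u 0.
Proof.
move=> k0 C0 t0 u0 step.
have bound N : u t <= expR (kap * t) * (u 0 + C * t ^+ 2 / N.+1%:R).
  pose del := t / N.+1%:R.
  have del0 : 0 <= del by rewrite divr_ge0.
  have ind i : u (i%:R * del) <= expR (kap * (i%:R * del)) * (u 0 + i%:R * (C * del ^+ 2)).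
    elim: i => [|i IH]; first by rewrite !mul0r mulr0 expR0 mul1r addr0.
    have -> : i.+1%:R * del = i%:R * del + del by rewrite -natr1 mulrDl mul1r.
    apply: le_trans (step _ _ _ del0) _; first by rewrite mulr_ge0.
    have e1 : 1 + kap * del <= expR (kap * del) by exact: expR_ge1Dx.
    have ui : 0 <= u (i%:R * del) by apply: u0; rewrite mulr_ge0.
    rewrite [kap * (_ + _)]mulrDr expRD.
    have h1 := le_trans (ler_wpM2r ui e1) (ler_wpM2l (expR_ge0 _) IH).
    apply: le_trans (lerD h1 (lexx _)) _.
    have YZ1 : 1 <= expR (kap * (i%:R * del)) * expR (kap * del).
      rewrite -expRD -expR0 ler_expR addr_ge0// mulr_ge0// mulr_ge0//.
    have Cd : 0 <= C * del ^+ 2 by rewrite mulr_ge0 ?exprn_ge0.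
    have alg (Y Z U D : R) : 1 <= Y * Z -> 0 <= D ->
        Z * (Y * (U + i%:R * D)) + D <= Y * Z * (U + i.+1%:R * D).
      move=> YZ D0; rewrite -natr1.
      have -> : Y * Z * (U + (i%:R + 1) * D) = Z * (Y * (U + i%:R * D)) + Y * Z * D by ring.
      by rewrite lerD2l ler_peMl.
    exact: alg.
  have := ind N.+1; have -> : N.+1%:R * del = t by rewrite /del mulrC divfK.
  by have -> : N.+1%:R * (C * del ^+ 2) = C * t ^+ 2 / N.+1%:R by rewrite /del; field.
apply/ler_addgt0Pr => e e0.
pose K := expR (kap * t) * (C * t ^+ 2).
have K0 : 0 <= K by rewrite mulr_ge0 ?expR_ge0// mulr_ge0 ?exprn_ge0.
have [m hm] : exists m : nat, K / e < m.+1%:R.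
  exists (Num.truncn (K / e)); exact: truncnS_gt.
apply: le_trans (bound m) _; rewrite mulrDr lerD2l mulrA -/K.
by rewrite ler_pdivrMr// mulrC -ler_pdivrMr// ltW.
Qed.

(* 1 + |w|^2 is an eigenfunction of the Laplacian; the concave truncations
   rho(1/2) - rho((1 - v/r)/2) of v turn this into a bound without stopping times. *)
Lemma tail_bound (t : R) : 0 <= t -> exists2 C, 0 <= C &
  forall r s : R, 0 < r -> 0 <= s -> s <= t -> E (fun x => (r <= vv (w s x) :> R)%:R) <= C / r.
Proof.
move=> t0; exists (expR (4 * n%:R * t) / rho 2^-1).
  by rewrite divr_ge0 ?expR_ge0 ?rho_ge0.
move=> r s r0 s0 st.
pose a := - (2 * r)^-1; pose h i (v : R) := a ^+ i * fseq i (a * v + 2^-1).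
have dh i (x : R) : is_derive x 1 (h i) (h i.+1 x).
  have d1 : is_derive x 1 (fun v : R => a * v + 2^-1) (a * 1 + 0).
    by apply: is_deriveD; apply: is_deriveZ.
  have := is_deriveZ (a ^+ i) (is_derive_comp1 d1 (is_derive_fseq i (a * x + 2^-1))).
  move=> hh; apply: is_derive_eq hh _; rewrite /h /GRing.scale /= exprS; ring.
have Dh : Dinf (h 0%N).
  by have := Dinf_comp_affine a 2^-1 is_derive_fseq; rewrite /h; under [X in _ -> Dinf X]eq_fun do rewrite expr0 mul1r.
have h0E v : h 0%N v = rho (a * v + 2^-1) by rewrite /h expr0 mul1r.
have half v : 0 <= v -> a * v + 2^-1 <= 2^-1.
  by move=> v0; rewrite gerDr mulNr oppr_le0 mulr_ge0// invr_ge0 mulr_ge0// ltW.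
have hr v : r <= v -> h 0%N v = 0.
  move=> rv; rewrite h0E rho_le0// /a mulNr addrC subr_le0 invfM -mulrA ler_pMr//.
  by rewrite mulrC ler_pdivlMr// mul1r.
have sg := smooth_rad (n := n) Dh.
have cg : compactly_supported (fun w : V => h 0%N (vv w)) by exact: compactly_supported_rad hr.
have [C C0 one] := onestep filt bw sg cg.
have b1 s' : 0 <= s' -> bm (fun x => h 0%N (vv (w s' x))).
  by move=> h'; have := bm_path filt bw h' (smooth_continuous sg) cg.
have b2 s' : 0 <= s' -> bm (fun x => drift (fun w : V => h 0%N (vv w)) (w s' x)).
  move=> h'; apply: (bm_path filt bw h'); first exact/smooth_continuous/smooth_drift.
  exact: compactly_supported_drift.
pose u s' := rho 2^-1 - E (fun x => h 0%N (vv (w s' x))).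
have uE s' : 0 <= s' -> u s' = E (fun x => rho 2^-1 - h 0%N (vv (w s' x))).
  by move=> h'; rewrite EEB ?EE_cst//; [exact: bm_cst|exact: b1].
have inc v : 0 <= v -> 0 <= rho 2^-1 - h 0%N v <= 2 * (2^-1 - (a * v + 2^-1)).
  by move=> v0; rewrite h0E; apply: rho_increment; exact: half.
have u0 s' : 0 <= s' -> 0 <= u s'.
  by move=> h'; rewrite uE//; apply: EE_ge0 => x; have /andP[] := inc _ (ltW (vv_gt0 (w s' x))).
have dr v : - (4 * n%:R) * (rho 2^-1 - h 0%N (vv v)) <= drift (fun w : V => h 0%N (vv w)) v.
  rewrite /drift (HPop_rad _ Dh (fun x _ => dh 0%N x) (fun x _ => dh 1%N x)).
  have v1 := vv_ge1 v; set y := vv v in v1 *.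
  have y0 : 0 <= y by exact: le_trans v1.
  have h2 : 0 <= h 2%N y by rewrite /h mulr_ge0 ?sqr_ge0// fseq2_ge0// half.
  have h1 : - (rho 2^-1 - h 0%N y) <= y * h 1%N y.
    have -> : y * h 1%N y = - (fseq 1 (a * y + 2^-1) * (2^-1 - (a * y + 2^-1))).
      by rewrite /h expr1; ring.
    by rewrite lerN2 h0E; apply: rho_tangent; exact: half.
  have n0 : 0 <= n%:R :> R by [].
  have p1 : 0 <= y ^+ 2 * (y - 1) * h 2%N y.
    by rewrite mulr_ge0// mulr_ge0 ?sqr_ge0// subr_ge0.
  have p2 := ler_wpM2l n0 h1.
  move: p1 p2; rewrite mulrN; lra.
have step s' del : 0 <= s' -> 0 <= del ->
    u (s' + del) <= (1 + 4 * n%:R * del) * u s' + C * del ^+ 2.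
  move=> h' d0; have h'' : s' <= s' + del by rewrite lerDl.
  have F1 : Fm s' (fun=> 1) by exact: measurable_cst.
  have := one s' (s' + del) (fun=> 1) h' h'' F1 (fun=> (ltac:(by rewrite normr1))).
  rewrite addrAC subrr add0r.
  under eq_fun do rewrite mul1r.
  under [X in _ - E X]eq_fun do rewrite mul1r.
  rewrite EED; [|exact: b1|by apply: bmZ; exact: b2].
  rewrite (EEZ P del (b2 _ h')).
  rewrite ler_norml => /andP[+ _].
  have : - (4 * n%:R) * u s' <= E (fun x => drift (fun w : V => h 0%N (vv w)) (w s' x)).
    rewrite uE// -EEZ; last by apply: bmB; [exact: bm_cst|exact: b1].
    apply: EE_le => [||x]; last exact: dr.
    - by apply: bmZ; apply: bmB; [exact: bm_cst|exact: b1].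
    - exact: b2.
  rewrite /u; set e1 := E _; set e2 := E _; set e3 := E _ => q1 q2.
  have := ler_wpM2l d0 q1; move: q2; lra.
have n4 : 0 <= 4 * n%:R :> R by rewrite mulr_ge0.
have gr := discrete_gronwall n4 C0 s0 u0 step.
have ui : u 0 <= r^-1.
  have [N [mN N0 good]] := good_paths bw.
  rewrite uE//.
  rewrite (EE_ae_eq (g := fun=> rho 2^-1 - h 0%N 1)).
  - rewrite EE_cst; have /andP[_] := inc 1 ler01; move/le_trans; apply.
    by rewrite /a mulr1 opprD addrCA subrr addr0 opprK invfM mulrA divff// mul1r.
  - apply: measurable_funB => //; exact: (b1 0 (lexx _)).1.
  - exact: measurable_cst.
  - exists N; split=> // x /= hx; apply: contrapT => nN; apply: hx.
    by have [_ ->] := good x nN; rewrite /vv /sqnormH big1 ?addr0// => j _; rewrite big1// => k _; rewrite mxE expr0n.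
have key : rho 2^-1 * E (fun x => (r <= vv (w s x) :> R)%:R) <= u s.
  have bi : bm (fun x => (r <= vv (w s x) :> R)%:R : R).
    have -> : (fun x => (r <= vv (w s x) :> R)%:R : R) = \1_((fun x => vv (w s x)) @^-1` `[r, +oo[).
      apply/funext => x; rewrite indicE; congr (nat_of_bool _)%:R.
      by apply/idP/idP; rewrite ?inE /= in_itv /= andbT.
    split; first apply: measurable_indic.
      rewrite -[X in measurable X]setTI; apply: (w_measurable filt bw) => //.
      exact: smooth_continuous smooth_vv.
    by exists 1 => x; rewrite indicE; case: (_ \in _); rewrite ?normr1 ?normr0.
  rewrite -EEZ// uE//; apply: EE_le.
  - exact: bmZ.
  - by apply: bmB; [exact: bm_cst|exact: b1].
  - move=> x; have [/hr ->|_] := leP r (vv (w s x)); first by rewrite mulr1 subr0.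
    by rewrite mulr0; have /andP[] := inc _ (ltW (vv_gt0 (w s x))).
have rho0 : 0 < rho (2^-1 : R) by rewrite rho_gt0.
rewrite -(ler_pM2l rho0); apply: le_trans key _; apply: le_trans gr _.
have -> : rho 2^-1 * (expR (4 * n%:R * t) / rho 2^-1 / r) = expR (4 * n%:R * t) * r^-1.
  by field; rewrite !gt_eqF.
by apply: ler_pM; rewrite ?expR_ge0 ?u0// ler_expR ler_wpM2l.
Qed.

End Process.

Section Separable.
Context {R : realType} {n : nat}.
Notation V := 'M[R]_(n, 4).

Inductive sep : (V -> V -> R) -> Prop :=
| sep_prod (phi psi : V -> R) : continuous phi -> smooth psi -> sep (fun a b => phi a * psi b)
| sepD (Phi Psi : V -> V -> R) : sep Phi -> sep Psi -> sep (fun a b => Phi a b + Psi a b).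

Lemma sep_l phi : continuous phi -> sep (fun a _ => phi a).
Proof.
move=> cphi; have := sep_prod cphi (smooth_cst 1).
by congr sep; apply/funext => a; apply/funext => b; rewrite mulr1.
Qed.

Lemma sep_r psi : smooth psi -> sep (fun _ b => psi b).
Proof.
move=> spsi; have := sep_prod (@cst_continuous _ _ (1 : R)) spsi.
by congr sep; apply/funext => a; apply/funext => b; rewrite mul1r.
Qed.

Lemma sepM Phi Psi : sep Phi -> sep Psi -> sep (fun a b => Phi a b * Psi a b).
Proof.
move=> sPhi; elim: sPhi Psi => [phi psi cphi spsi|P1 P2 _ IH1 _ IH2] Psi sPsi.
  elim: sPsi => [phi' psi' cphi' spsi'|Q1 Q2 _ IH1 _ IH2].
    have := @sep_prod (fun a => phi a * phi' a) (fun b => psi b * psi' b).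
    move=> /(_ (fun a => continuousM (cphi a) (cphi' a)) (smoothM spsi spsi')).
    by congr sep; apply/funext => a; apply/funext => b; rewrite mulrACA.
  have := sepD IH1 IH2; congr sep.
  by apply/funext => a; apply/funext => b; rewrite -mulrDr.
have := sepD (IH1 _ sPsi) (IH2 _ sPsi); congr sep.
by apply/funext => a; apply/funext => b; rewrite -mulrDl.
Qed.

Lemma sep_sum (I : Type) (r : seq I) (Phi : I -> V -> V -> R) :
  (forall i, sep (Phi i)) -> sep (fun a b => \sum_(i <- r) Phi i a b).
Proof.
move=> sPhi; elim: r => [|i r IH].
  have -> : (fun a b : V => \sum_(i <- [::]) Phi i a b) = fun _ _ => 0.
    by apply/funext => a; apply/funext => b; rewrite big_nil.
  exact/sep_l/cst_continuous.
have -> : (fun a b => \sum_(j <- i :: r) Phi j a b) = fun a b => Phi i a b + \sum_(j <- r) Phi j a b.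
  by apply/funext => a; apply/funext => b; rewrite big_cons.
exact: sepD.
Qed.

Lemma sepX Phi m : sep Phi -> sep (fun a b => Phi a b ^+ m).
Proof.
move=> sPhi; elim: m => [|m IH]; first exact/sep_l/cst_continuous.
have -> : (fun a b => Phi a b ^+ m.+1) = fun a b => Phi a b * Phi a b ^+ m.
  by apply/funext => a; apply/funext => b; rewrite exprS.
exact: sepM.
Qed.

Lemma sep_smooth Phi a : sep Phi -> smooth (Phi a).
Proof.
elim=> [phi psi _ spsi|P1 P2 _ IH1 _ IH2]; first exact: smoothZ.
exact: smoothD.
Qed.

Lemma smooth_lam_coord l j k : smooth (fun w : V => lam l w j k).
Proof.
have sl c : smooth (fun w : V => lq c w j k).
  have -> : (fun w : V => lq c w j k) = fun w => mxvec (lq c w) 0 (mxvec_index j k).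
    by apply/funext => w; rewrite mxvecE.
  exact: smooth_mxvec_lq.
have -> : (fun w : V => lam l w j k) =
    fun w => l.1.1 * lq 1 w j k + l.1.2 * lq 2 w j k + l.2 * lq 3 w j k.
  apply/funext => w; rewrite /lam 2!mxE; congr (_ + _ + _);
    by set q := lq _ w; rewrite mxE.
by apply: smoothD; [apply: smoothD|]; exact: smoothZ.
Qed.

Lemma sep_area_step l : sep (@area_step R n l).
Proof.
have cv : continuous (@iv R n) by exact: smooth_continuous smooth_iv.
apply: sepM; first apply: sepM.
- exact/sep_l/cst_continuous.
- by apply: sepD; [exact: sep_l|apply: sep_r; exact: smooth_iv].
apply: sep_sum => j; apply: sep_sum => k; apply: sepM.
  by apply: sep_r; exact: smooth_coord.
by apply: sep_l; apply: smooth_continuous; exact: smooth_lam_coord.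
Qed.

End Separable.

Section CosStep.
Context {R : realType} {d : measure_display} {T : measurableType d}.
Context (P : probability T R) {n : nat} (F : R -> set (set T)).
Context (w : R -> T -> 'M[R]_(n, 4)).
Notation V := 'M[R]_(n, 4).
Hypothesis filt : filtration F.
Hypothesis bw : HPbrownian P F w.
Notation E := (EE P).
Notation Fm := (Fm F).
Implicit Types (Phi : V -> V -> R) (L : V -> R).

Lemma Fm_sep Phi s t : 0 <= s -> s <= t -> sep Phi -> Fm t (fun x => Phi (w s x) (w t x)).
Proof.
move=> s0 st; have t0 := le_trans s0 st.
elim=> [phi psi cphi spsi|P1 P2 _ IH1 _ IH2]; last exact: measurable_funD.
apply: measurable_funM; last exact: (Fm_cont filt bw t0 (smooth_continuous spsi)).
exact: (Fm_mono filt s0 st (Fm_cont filt bw s0 cphi)).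
Qed.

Definition expands Phi L : Prop :=
  [/\ forall s t, 0 <= s -> s <= t -> bm (fun x => Phi (w s x) (w t x)),
      forall s, 0 <= s -> bm (fun x => L (w s x)) &
      exists2 C, 0 <= C & forall s t Z, 0 <= s -> s <= t -> Fm s Z ->
        (forall x, `|Z x| <= 1) ->
      `|E (fun x => Z x * Phi (w s x) (w t x)) -
        E (fun x => Z x * (Phi (w s x) (w s x) + (t - s) * L (w s x)))|
        <= C * (t - s) ^+ 2].

Lemma expandsD Phi L Psi M : expands Phi L -> expands Psi M ->
  expands (fun a b => Phi a b + Psi a b) (fun a => L a + M a).
Proof.
move=> [b1 l1 [C1 C10 h1]] [b2 l2 [C2 C20 h2]]; split.
- by move=> s t s0 st; apply: bmD; [exact: b1|exact: b2].
- by move=> s s0; apply: bmD; [exact: l1|exact: l2].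
exists (C1 + C2); first by rewrite addr_ge0.
move=> s t Z s0 st mZ Z1.
have bZ := bm_Fm filt s0 mZ Z1.
have q1 := bmM bZ (b1 s t s0 st); have q2 := bmM bZ (b2 s t s0 st).
have q3 := bmM bZ (bmD (b1 s s s0 (lexx s)) (bmZ (t - s) (l1 s s0))).
have q4 := bmM bZ (bmD (b2 s s s0 (lexx s)) (bmZ (t - s) (l2 s s0))).
have -> : E (fun x => Z x * (Phi (w s x) (w t x) + Psi (w s x) (w t x))) =
   E (fun x => Z x * Phi (w s x) (w t x)) + E (fun x => Z x * Psi (w s x) (w t x)).
  by rewrite -EED//; congr EE; apply/funext => x; rewrite mulrDr.
have -> : E (fun x => Z x * (Phi (w s x) (w s x) + Psi (w s x) (w s x) +
     (t - s) * (L (w s x) + M (w s x)))) =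
   E (fun x => Z x * (Phi (w s x) (w s x) + (t - s) * L (w s x))) +
   E (fun x => Z x * (Psi (w s x) (w s x) + (t - s) * M (w s x))).
  by rewrite -EED//; congr EE; apply/funext => x; ring.
rewrite opprD addrACA mulrDl; apply: le_trans (ler_normD _ _) _.
by apply: lerD; [exact: h1|exact: h2].
Qed.

Lemma expands_prod (phi psi : V -> R) : continuous phi ->
  (exists K, forall v, `|phi v| <= K) -> smooth psi -> compactly_supported psi ->
  expands (fun a b => phi a * psi b) (fun a => phi a * drift psi a).
Proof.
move=> cphi [K phiK] spsi cpsi.
have bphi s : 0 <= s -> bm (fun x => phi (w s x)) by move=> s0; exact: (bm_continuous filt bw s0 cphi phiK).
have bpsi s : 0 <= s -> bm (fun x => psi (w s x)).
  by move=> s0; apply: (bm_path filt bw) => //; exact: smooth_continuous.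
have bd s : 0 <= s -> bm (fun x => drift psi (w s x)).
  move=> s0; apply: (bm_path filt bw) => //; first exact/smooth_continuous/smooth_drift.
  exact: compactly_supported_drift.
split.
- by move=> s t s0 st; apply: bmM; [exact: bphi|apply: bpsi; exact: le_trans st].
- by move=> s s0; apply: bmM; [exact: bphi|exact: bd].
have [C C0 h] := onestep filt bw spsi cpsi.
have K1 : 0 < `|K| + 1 by rewrite ltr_wpDl.
exists ((`|K| + 1) * C); first by rewrite mulr_ge0// ltW.
move=> s t Z s0 st mZ Z1.
pose Z' x := Z x * phi (w s x) / (`|K| + 1).
have mZ' : Fm s Z'.
  apply: measurable_funM => //; apply: measurable_funM => //.
  exact: (Fm_cont filt bw s0 cphi).
have Z'1 x : `|Z' x| <= 1.
  rewrite /Z' normf_div (gtr0_norm K1) ler_pdivrMr// mul1r normrM.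
  apply: (@le_trans _ _ `|phi (w s x)|); first by rewrite ler_piMl.
  apply: le_trans (phiK _) _; apply: le_trans (ler_norm _) _; by rewrite lerDl.
have bZ' := bm_Fm filt s0 mZ' Z'1.
have t0 := le_trans s0 st.
have := h s t Z' s0 st mZ' Z'1.
have -> : (fun x => Z x * (phi (w s x) * psi (w t x))) = fun x => (`|K| + 1) * (Z' x * psi (w t x)).
  by apply/funext => x; rewrite /Z'; field; rewrite gt_eqF.
have -> : (fun x => Z x * (phi (w s x) * psi (w s x) + (t - s) * (phi (w s x) * drift psi (w s x)))) =
    fun x => (`|K| + 1) * (Z' x * (psi (w s x) + (t - s) * drift psi (w s x))).
  by apply/funext => x; rewrite /Z'; field; rewrite gt_eqF.
have bp := bpsi _ s0; have bt := bpsi _ t0; have bd' := bd _ s0.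
rewrite (EEZ P _ (bmM bZ' bt)) (EEZ P _ (bmM bZ' (bmD bp (bmZ (t - s) bd')))).
move=> hh; rewrite -mulrBr normrM (gtr0_norm K1) -mulrA.
by rewrite ler_wpM2l// ltW.
Qed.

Lemma expands_sep Phi (X g : V -> R) : sep Phi -> continuous X -> compactly_supported X ->
  smooth g -> compactly_supported g ->
  expands (fun a b => X a * Phi a b * g b) (fun a => X a * drift (fun b => Phi a b * g b) a).
Proof.
move=> sPhi cX csX sg cg.
elim: sPhi => [phi psi cphi spsi|P1 P2 sP1 IH1 sP2 IH2].
  have cXp : continuous (fun a => X a * phi a) by move=> a; exact: continuousM (cX a) (cphi a).
  have := @expands_prod (fun a => X a * phi a) (fun b => psi b * g b) cXp
    (continuous_cs_bounded cXp (compactly_supportedMl _ csX)) (smoothM spsi sg)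
    (compactly_supportedMr _ cg).
  congr expands; first by apply/funext => a; apply/funext => b; rewrite !mulrA.
  apply/funext => a; rewrite -mulrA; congr (_ * _); rewrite /drift.
  rewrite mulrCA -HPopZ; last exact: smoothM.
  by congr (_ * HPop _ _); apply/funext => b; rewrite mulrA.
have := expandsD IH1 IH2; congr expands.
  by apply/funext => a; apply/funext => b; rewrite mulrDr mulrDl.
apply/funext => a; rewrite -mulrDr; congr (_ * _); rewrite /drift -mulrDr; congr (_ * _).
rewrite -HPopD; [|apply: smoothM => //; exact: sep_smooth..].
by congr HPop; apply/funext => b; rewrite mulrDl.
Qed.

Definition area_gen l (g : V -> R) (a : V) : R :=
  drift g a - 2^-1 * (sqnorm3 l * sqnormH a * g a).

Lemma cos_step l (G : R -> R) (r : R) : Dinf G -> 1 <= r -> (forall v, r <= v -> G v = 0) ->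
  exists2 C, 0 <= C & forall s t S, 0 <= s -> s <= t -> t - s <= 1 -> Fm s S ->
  `|E (fun x => cos (S x + area_step l (w s x) (w t x)) * G (vv (w t x))) -
    E (fun x => cos (S x) * (G (vv (w s x)) +
         (t - s) * area_gen l (fun v => G (vv v)) (w s x)))| <= C * ((t - s) * Num.sqrt (t - s)).
Proof.
move=> DG r1 G0; have r0 : 0 < r by exact: lt_le_trans ltr01 r1.
pose g (v : V) := G (vv v).
have sg : smooth g by exact: smooth_rad.
have cg : compactly_supported g by exact: compactly_supported_rad G0.
pose k (v : V) := plateau r (vv v).
have sk : smooth k by apply: smooth_rad; exact: Dinf_plateau.
have k0 v : 2 * r <= vv v -> k v = 0 by exact: plateau0.
have ck : compactly_supported k.
  by apply: (@compactly_supported_rad _ _ _ (2 * r)) => x; exact: plateau0.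
pose X (v : V) := plateau (2 * r) (vv v).
have r20 : 0 < 2 * r by rewrite mulr_gt0.
have sX : smooth X by apply: smooth_rad; exact: Dinf_plateau.
have cX := smooth_continuous sX.
have csX : compactly_supported X.
  by apply: (@compactly_supported_rad _ _ _ (2 * (2 * r))) => x; exact: plateau0.
have [B gB] := continuous_cs_bounded (smooth_continuous sg) cg.
have B0 : 0 <= B by exact: le_trans (gB 0).
have gBk v : `|g v| <= B * k v.
  have [vr|rv] := leP (vv v) r; first by rewrite /k plateau1// mulr1.
  by rewrite /g (G0 _ (ltW rv)) normr0 mulr_ge0// plateau_ge0.
have sA := @sep_area_step R n l.
have s1 : sep (fun _ _ : V => 1 : R) by exact/sep_l/cst_continuous.
have [b1 _ [C1 C10 h1]] := expands_sep s1 cX csX sg cg.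
have [b2 _ [C2 C20 h2]] := expands_sep (sepX 2 sA) cX csX sg cg.
have [b3 _ [C3 C30 h3]] := expands_sep sA cX csX sg cg.
have [b4 l4 [C4 C40 h4]] := expands_sep (sepX 2 sA) cX csX sk ck.
have [b5 _ [C5 C50 h5]] := expands_sep (sepX 4 sA) cX csX sk ck.
have cX1 : continuous (fun a => 1 - X a).
  by apply: smooth_continuous; apply: smoothB => //; exact: smooth_cst.
have bX1 : exists K, forall v, `|1 - X v| <= K.
  exists 1 => v; rewrite ger0_norm ?subr_ge0 ?plateau_le1//.
  by rewrite gerBl plateau_ge0.
have [b6 _ [C6 C60 h6]] := expands_prod cX1 bX1 sk ck.
have Xout v : X v != 1 -> 2 * r < vv v.
  by rewrite ltNge; apply: contra => h; rewrite /X plateau1.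
have Xout1 v : X v != 1 -> r <= vv v.
  by move=> /Xout /ltW; apply: le_trans; rewrite ler_peMl ?ler1n// ltW.
have Xg v : X v * g v = g v.
  have [->|h] := eqVneq (X v) 1; first by rewrite mul1r.
  by rewrite /g G0 ?mulr0// Xout1.
have Xk v : (1 - X v) * k v = 0.
  have [->|h] := eqVneq (X v) 1; first by rewrite subrr mul0r.
  by rewrite k0 ?mulr0// ltW// Xout.
have Xdg v : X v * drift g v = drift g v.
  have [->|h] := eqVneq (X v) 1; first by rewrite mul1r.
  rewrite /drift HPop_near0 ?mulr0//.
  have := near_vv_gt (Xout _ h); apply: filterS => y /ltW h'.
  by rewrite /g G0// (le_trans _ h')// ler_peMl ?ler1n// ltW.
have Xdk v : (1 - X v) * drift k v = 0.
  have [->|h] := eqVneq (X v) 1; first by rewrite subrr mul0r.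
  rewrite /drift HPop_near0 ?mulr0//.
  by have := near_vv_gt (Xout _ h); apply: filterS => y /ltW; exact: k0.
have d2 (f : V -> R) a : smooth f ->
    drift (fun b => area_step l a b ^+ 2 * f b) a = sqnorm3 l * sqnormH a * f a.
  by move=> sf; rewrite /drift HPop_area_step2// !mulrA mulVf// mul1r.
have [M4 hM4] : exists M, forall v, `|X v * (sqnorm3 l * sqnormH v * k v)| <= M.
  apply: continuous_cs_bounded; last exact: compactly_supportedMl.
  apply: smooth_continuous; apply: smoothM => //; apply: smoothM => //.
  apply: smoothZ; by do 2!(apply: smooth_sum => ?); exact/smoothX/smooth_coord.
have M40 : 0 <= M4 by exact: le_trans (hM4 0).
have dG0 := dseq_Dinf DG.
exists (C1 + C2 + C3 + B * (C6 + M4 + C4 + 2 * C5)).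
  by rewrite !addr_ge0// mulr_ge0// !addr_ge0// mulr_ge0.
move=> s t S s0 st st1 mS; have t0 := le_trans s0 st.
set h := t - s.
have h0 : 0 <= h by rewrite subr_ge0.
pose Zc x := cos (S x); pose Zs x := sin (S x).
have mZc : Fm s Zc by apply: measurableT_comp => //; apply: continuous_measurable_fun; exact: continuous_cos.
have mZs : Fm s Zs by apply: measurableT_comp => //; apply: continuous_measurable_fun; exact: continuous_sin.
have m1 : Fm s (fun=> 1) by exact: measurable_cst.
have Zc1 x : `|Zc x| <= 1 by rewrite ler_norml cos_geN1 cos_le1.
have Zs1 x : `|Zs x| <= 1 by rewrite ler_norml sin_geN1 sin_le1.
have m11 (x : T) : `|(fun=> 1 : R) x| <= 1 by rewrite normr1.
have bc := bm_Fm filt s0 mZc Zc1; have bs := bm_Fm filt s0 mZs Zs1.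
pose A x := area_step l (w s x) (w t x).
have bgs : bm (fun x => g (w s x)) by exact: (bm_path filt bw s0 (smooth_continuous sg) cg).
have bgt : bm (fun x => g (w t x)) by exact: (bm_path filt bw t0 (smooth_continuous sg) cg).
have z1 (a b c : R) : 1 * (a * 0 * b + c * (a * (2^-1 * 0))) = 0 by ring.
have z2 (a b c e : R) : 1 * (a * 0 * b + c * (a * e)) = c * (a * e) by ring.
have z3 (z a b c : R) : z * (a * 0 * b + c * (a * (2^-1 * 0))) = 0 by ring.
have z4 (z a b c e : R) : z * (a * 0 * b + c * (a * (e * b))) = c * (z * (e * (a * b))) by ring.
have := h1 s t Zc s0 st mZc Zc1; have := h2 s t Zc s0 st mZc Zc1.
have := h3 s t Zs s0 st mZs Zs1; have := h4 s t _ s0 st m1 m11.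
have := h5 s t _ s0 st m1 m11; have := h6 s t _ s0 st m1 m11.
rewrite -/h.
have -> : (fun x => 1 * ((1 - X (w s x)) * k (w s x) + h * ((1 - X (w s x)) * drift k (w s x)))) = fun=> 0.
  by apply/funext => x; rewrite Xk Xdk mulr0 addr0 mulr0.
have -> : (fun x => 1 * (X (w s x) * area_step l (w s x) (w s x) ^+ 4 * k (w s x) +
    h * (X (w s x) * drift (fun b => area_step l (w s x) b ^+ 4 * k b) (w s x)))) = fun=> 0.
  apply/funext => x; rewrite area_step_diag /drift HPop_area_step4// expr0n.
  exact: z1.
have -> : (fun x => 1 * (X (w s x) * area_step l (w s x) (w s x) ^+ 2 * k (w s x) +
    h * (X (w s x) * drift (fun b => area_step l (w s x) b ^+ 2 * k b) (w s x)))) =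
    fun x => h * (X (w s x) * (sqnorm3 l * sqnormH (w s x) * k (w s x))).
  apply/funext => x; rewrite area_step_diag d2// expr0n.
  exact: z2.
have -> : (fun x => Zs x * (X (w s x) * area_step l (w s x) (w s x) * g (w s x) +
    h * (X (w s x) * drift (fun b => area_step l (w s x) b * g b) (w s x)))) = fun=> 0.
  apply/funext => x; rewrite area_step_diag /drift (HPop_area_step1 _ _ dG0).
  exact: z3.
have -> : (fun x => Zc x * (X (w s x) * area_step l (w s x) (w s x) ^+ 2 * g (w s x) +
    h * (X (w s x) * drift (fun b => area_step l (w s x) b ^+ 2 * g b) (w s x)))) =
    fun x => h * (Zc x * (sqnorm3 l * sqnormH (w s x) * g (w s x))).
  apply/funext => x; rewrite area_step_diag d2// expr0n.
  rewrite -[in RHS](Xg (w s x)); exact: z4.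
have -> : (fun x => Zc x * (X (w s x) * 1 * g (w s x) +
    h * (X (w s x) * drift (fun b => 1 * g b) (w s x)))) =
    fun x => Zc x * (g (w s x) + h * drift g (w s x)).
  apply/funext => x; rewrite mulr1 Xg.
  have -> : (fun b => 1 * g b) = g by apply/funext => b; rewrite mul1r.
  by rewrite Xdg.
rewrite EE_cst.
have bq : bm (fun x => Zc x * (sqnorm3 l * sqnormH (w s x) * g (w s x))).
  apply: bmM => //; apply: (bm_path filt bw s0 (k := fun v => sqnorm3 l * sqnormH v * g v)).
    apply: smooth_continuous; apply: smoothM => //.
    apply: smoothZ; by do 2!(apply: smooth_sum => ?); exact/smoothX/smooth_coord.
  exact: compactly_supportedMr.
have bq4 : bm (fun x => X (w s x) * (sqnorm3 l * sqnormH (w s x) * k (w s x))).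
  have := l4 s s0; congr bm; apply/funext => x; by rewrite d2.
have hM4' x : `|X (w s x) * (sqnorm3 l * sqnormH (w s x) * k (w s x))| <= M4 by exact: hM4.
have bdg : bm (fun x => Zc x * (g (w s x) + h * drift g (w s x))).
  apply: bmM => //; apply: bmD => //; apply: bmZ.
  apply: (bm_path filt bw s0); first exact/smooth_continuous/smooth_drift.
  exact: compactly_supported_drift.
rewrite (EEZ P h bq) (EEZ P h bq4) !subr0.
set e6 := E _; set e5 := E _; set e4 := E _; set e4' := E _; set e3 := E _; set e2 := E _; set e2' := E _; set e1 := E _; set e1' := E _.
move=> q6 q5 q4 q3 q2 q1.
have q4' : `|e4'| <= M4 by exact: (EE_bound P bq4 hM4').
have -> : E (fun x => cos (S x) * (G (vv (w s x)) + h * area_gen l (fun v => G (vv v)) (w s x))) =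
    e1' - h / 2 * e2'.
  rewrite /e1' /e2' -(EEZ P _ bq) -EEB//; last exact: bmZ.
  by congr EE; apply/funext => x; rewrite /area_gen -/(g (w s x)) /Zc -/g; field.
have [h00|hn0] := eqVneq h 0.
  have ts : t = s by apply/eqP; rewrite -subr_eq0 -/h h00.
  have -> : E (fun x => cos (S x + area_step l (w s x) (w t x)) * G (vv (w t x))) = e1'.
    rewrite /e1'; congr EE; apply/funext => x.
    by rewrite ts area_step_diag addr0 h00 mul0r addr0.
  by rewrite h00 !mul0r subr0 subrr normr0 mulr0.
have hp : 0 < h by rewrite lt_neqAle eq_sym hn0.
pose rt := Num.sqrt h.
have rt0 : 0 < rt by rewrite sqrtr_gt0.
have rth : rt ^+ 2 = h by rewrite sqr_sqrtr.
have rt1 : rt <= 1 by rewrite -sqrtr1 ler_wsqrtr.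
have b1' := bmM bc (b1 s t s0 st); have b2' := bmM bc (b2 s t s0 st).
have b3' := bmM bs (b3 s t s0 st).
have b4' := b4 s t s0 st; have b5' := b5 s t s0 st; have b6' := b6 s t s0 st.
have bcos : bm (fun x => cos (S x + A x) * g (w t x)).
  apply: bmM => //; split; last by exists 1 => x; rewrite ler_norml cos_geN1 cos_le1.
  apply: measurableT_comp; first by apply: continuous_measurable_fun; exact: continuous_cos.
  apply: measurable_funD; first exact: (Fm_measurable filt s0 mS).
  exact: (Fm_measurable filt t0 (Fm_sep s0 st (sep_area_step l))).
set e0 := E (fun x => cos (S x + area_step l (w s x) (w t x)) * G (vv (w t x))).
have main : `|e0 - (e1 - 2^-1 * e2 - e3)| <= B * (e6 + (rt * e4 + (rt^-1 + 1) * e5)).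
  pose U x := (1 - X (w s x)) * k (w t x) +
     (rt * (X (w s x) * A x ^+ 2 * k (w t x)) + (rt^-1 + 1) * (X (w s x) * A x ^+ 4 * k (w t x))).
  have bU : bm U by apply: bmD => //; apply: bmD; apply: bmZ.
  pose D x := cos (S x + A x) * g (w t x) -
    (Zc x * (X (w s x) * 1 * g (w t x)) - 2^-1 * (Zc x * (X (w s x) * A x ^+ 2 * g (w t x)))
      - Zs x * (X (w s x) * A x * g (w t x))).
  have bD : bm D.
    by apply: bmB => //; apply: bmB => //; apply: bmB => //; exact: bmZ.
  have -> : e0 - (e1 - 2^-1 * e2 - e3) = E D.
    rewrite /D EEB//; last by apply: bmB => //; apply: bmB => //; exact: bmZ.
    rewrite EEB//; last by apply: bmB => //; exact: bmZ.
    rewrite EEB//; last exact: bmZ.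
    by rewrite (EEZ P _ b2').
  have -> : B * (e6 + (rt * e4 + (rt^-1 + 1) * e5)) = E (fun x => B * U x).
    rewrite (EEZ P _ bU) /U EED//; last by apply: bmD; apply: bmZ.
    rewrite EED; [|exact: bmZ..].
    rewrite (EEZ P _ b4') (EEZ P _ b5').
    congr (_ * (_ + (_ * _ + _ * _)));
      by congr EE; apply/funext => x; rewrite mul1r.
  apply: le_trans (EE_norm P bD) _; apply: EE_le; [exact: bm_norm|exact: bmZ|].
  move=> x; set a := A x; set X' := X (w s x); set g' := g (w t x); set k' := k (w t x).
  have X0 : 0 <= X' by exact: plateau_ge0.
  have X1 : X' <= 1 by exact: plateau_le1.
  have -> : D x = (1 - X') * (cos (S x + a) * g') +
     X' * g' * (cos (S x + a) - (cos (S x) - cos (S x) * a ^+ 2 / 2 - sin (S x) * a)).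
    by rewrite /D /Zc /Zs -/a -/X' -/g'; field.
  have gk : `|g'| <= B * k' by exact: gBk.
  have gk0 : 0 <= `|g'| by [].
  have -> : B * U x = (1 - X') * (B * k') + X' * (B * k') * (rt * a ^+ 2 + (rt^-1 + 1) * a ^+ 4).
    by rewrite /U -/a -/X' -/k'; ring.
  apply: le_trans (ler_normD _ _) _; apply: lerD.
    rewrite normrM ger0_norm ?subr_ge0// ler_wpM2l ?subr_ge0//.
    rewrite normrM; apply: le_trans gk; rewrite ler_piMl// ler_norml cos_geN1 cos_le1//.
  rewrite normrM [`|X' * g'|]normrM (ger0_norm X0).
  have ct := cos_taylor (S x) a rt0.
  have T0 : 0 <= rt * a ^+ 2 + (rt^-1 + 1) * a ^+ 4.
    by rewrite addr_ge0// mulr_ge0 ?sqr_ge0 ?addr_ge0 ?invr_ge0 ?(exprM _ 2 2) ?sqr_ge0// ltW.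
  apply: ler_pM => //; first by rewrite mulr_ge0.
  by rewrite ler_wpM2l.
have hrt : h * rt = rt ^+ 3 by rewrite -rth -exprSr.
have h2' : h ^+ 2 = rt ^+ 4 by rewrite -rth -exprM.
have r43 : rt ^+ 4 <= rt ^+ 3 by rewrite exprSr ler_piMr// exprn_ge0// ltW.
have r53 : rt * rt ^+ 4 <= rt ^+ 3.
  by apply: le_trans r43; rewrite ler_piMl// exprn_ge0// ltW.
rewrite -/rt hrt.
have p3 : 0 <= rt ^+ 3 by rewrite exprn_ge0// ltW.
rewrite h2' in q1 q2 q3 q4 q5 q6.
have w1 : `|e1 - e1'| <= C1 * rt ^+ 3 by apply: le_trans q1 _; rewrite ler_wpM2l.
have w2 : `|e2 - h * e2'| <= C2 * rt ^+ 3 by apply: le_trans q2 _; rewrite ler_wpM2l.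
have w3 : `|e3| <= C3 * rt ^+ 3 by apply: le_trans q3 _; rewrite ler_wpM2l.
have w6 : e6 <= C6 * rt ^+ 3.
  by apply: le_trans (ler_norm _) _; apply: le_trans q6 _; rewrite ler_wpM2l.
have w4 : rt * e4 <= (M4 + C4) * rt ^+ 3.
  have i1 : e4 <= h * M4 + C4 * rt ^+ 4.
    have -> : e4 = h * e4' + (e4 - h * e4') by rewrite addrCA subrr addr0.
    apply: lerD; first by rewrite ler_wpM2l// (le_trans (ler_norm _)).
    exact: le_trans (ler_norm _) q4.
  apply: le_trans (ler_wpM2l (ltW rt0) i1) _.
  have z5 (a b c : R) : rt * (a * b + c * rt ^+ 4) = b * (a * rt) + c * (rt * rt ^+ 4) by ring.
  by rewrite z5 hrt [leRHS]mulrDl lerD2l ler_wpM2l.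
have w5 : (rt^-1 + 1) * e5 <= 2 * C5 * rt ^+ 3.
  have i1 : e5 <= C5 * rt ^+ 4 by exact: le_trans (ler_norm _) q5.
  apply: le_trans (ler_wpM2l _ i1) _; first by rewrite addr_ge0// invr_ge0 ltW.
  have -> : (rt^-1 + 1) * (C5 * rt ^+ 4) = C5 * rt ^+ 3 + C5 * rt ^+ 4.
    by field; rewrite gt_eqF.
  by rewrite -mulrA [leRHS]mulr_natl mulr2n lerD2l ler_wpM2l.
have wB : B * (e6 + (rt * e4 + (rt^-1 + 1) * e5)) <= B * ((C6 + M4 + C4 + 2 * C5) * rt ^+ 3).
  have z6 (p : R) : (C6 + M4 + C4 + 2 * C5) * p = C6 * p + ((M4 + C4) * p + 2 * C5 * p) by ring.
  by rewrite ler_wpM2l// z6; apply: lerD => //; exact: lerD.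
have tri (a0 a1 a1' a2 a2' a3 b : R) : a0 - (a1' - b / 2 * a2') =
   (a0 - (a1 - 2^-1 * a2 - a3)) + (a1 - a1') - 2^-1 * (a2 - b * a2') - a3 by field.
rewrite (tri e0 e1 e1' e2 e2' e3 h).
have w2' : `|2^-1 * (e2 - h * e2')| <= C2 * rt ^+ 3.
  rewrite normrM ger0_norm//; apply: le_trans w2; rewrite ler_piMl//.
  by rewrite invf_le1 ?ler1n.
have alg (p : R) : (C1 + C2 + C3 + B * (C6 + M4 + C4 + 2 * C5)) * p =
  B * ((C6 + M4 + C4 + 2 * C5) * p) + C1 * p + C2 * p + C3 * p by ring.
rewrite alg.
apply: le_trans (ler_normB _ _) _; apply: lerD => //.
apply: le_trans (ler_normB _ _) _; apply: lerD => //.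
apply: le_trans (ler_normD _ _) _; apply: lerD => //.
exact: le_trans main wB.
Qed.

End CosStep.

Section AreaSum.
Context {R : realType} {n : nat}.
Notation V := 'M[R]_(n, 4).

Lemma area_sum_coord (c : R -> V) m p (k : 'I_4) : area_sum c m p 0 k =
  \sum_(i < m) (k != 0)%:R * (2^-1 * (iv (c (p i)) + iv (c (p i.+1))) * ip (c (p i.+1)) (lq k (c (p i)))).
Proof.
have step (a b : 'rV[R]_4) (al be : R) :
    2^-1 * (qmul (b - a) (2^-1 *: (al *: qconj a + be *: qconj b)) 0 k
     - qmul (2^-1 *: (al *: a + be *: b)) (qconj b - qconj a) 0 k) =
    (k != 0)%:R * (2^-1 * (al + be) * \sum_k' b 0 k' *
      nth 0 (nth [::] [:: [:: a 0 0; a 0 1; a 0 2; a 0 3];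
                      [:: - a 0 1; a 0 0; - a 0 3; a 0 2];
                      [:: - a 0 2; a 0 3; a 0 0; - a 0 1];
                      [:: - a 0 3; - a 0 2; a 0 1; a 0 0]] k) k').
  by rewrite !big4 !mxE /=; move: k; apply: ord4P => /=; rewrite ?mxE /=; field.
have subk (X Y : 'rV[R]_4) : (X - Y) 0 k = X 0 k - Y 0 k by rewrite !mxE.
rewrite /area_sum /stratonovich_sum mxE summxE mulr_sumr.
under eq_bigr => j _.
  rewrite subk !summxE -sumrB mulr_sumr.
  under eq_bigr do rewrite step.
  over.
rewrite exchange_big /=; apply: eq_bigr => i _.
rewrite -mulr_sumr -mulr_sumr; congr (_ * (_ * _)).
apply: eq_bigr => j _; apply: eq_bigr => k' _; rewrite !mxE; congr (_ * _).
Qed.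

Lemma ip_lamE l (u v : V) : ip u (lam l v) =
  l.1.1 * ip u (lq 1 v) + l.1.2 * ip u (lq 2 v) + l.2 * ip u (lq 3 v).
Proof. by rewrite /lam !ipDr !ipZr. Qed.

Lemma area_sum_step l (c : R -> V) m p :
  l.1.1 * area_sum c m p 0 1 + l.1.2 * area_sum c m p 0 2 + l.2 * area_sum c m p 0 3 =
  \sum_(i < m) area_step l (c (p i)) (c (p i.+1)).
Proof.
rewrite !area_sum_coord !mulr_sumr -!big_split /=; apply: eq_bigr => i _.
rewrite /area_step ip_lamE !mul1r.
move: (ip _ _) (ip _ _) (ip _ _) => x y z; ring.
Qed.

Lemma cos_lipschitz (a b : R) : `|cos a - cos b| <= `|a - b|.
Proof.
wlog ab : a b / a <= b.
  by move=> h; have [/h//|/ltW/h] := leP a b; rewrite distrC [leRHS]distrC.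
have [c + ] := MVT_segment ab (fun z _ => is_derive_cos z) (continuous_subspaceT (@continuous_cos R)).
move=> _ h; rewrite distrC [leRHS]distrC h normrM normrN ler_piMl//.
by rewrite ler_norml sin_geN1 sin_le1.
Qed.

Lemma plateau_derivatives : exists p1 p2 : R -> R, exists2 K, 0 <= K &
  [/\ forall x : R, 0 < x -> is_derive x 1 (plateau 1) (p1 x),
      forall x : R, 0 < x -> is_derive x 1 p1 (p2 x),
      forall x, 0 < x -> x < 1 \/ 2 < x -> p1 x = 0 /\ p2 x = 0 &
      forall x, 0 < x -> `|p1 x| <= K /\ `|p2 x| <= K].
Proof.
have D := @Dinf_plateau R 1.
pose p1 : R -> R := (plateau 1)^`()%classic; pose p2 : R -> R := p1^`()%classic.
have d1 (x : R) : 0 < x -> is_derive x 1 (plateau 1) (p1 x) by move=> x0; exact: is_derive_Dk (D 0%N) x0.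
have d2 (x : R) : 0 < x -> is_derive x 1 p1 (p2 x).
  by move=> x0; exact: (@is_derive_Dk R 0 p1 x (proj2 (D 1%N)) x0).
have d3 (x : R) : 0 < x -> is_derive x 1 p2 (p2^`()%classic x).
  by move=> x0; exact: (@is_derive_Dk R 0 p2 x (proj2 (proj2 (D 2%N))) x0).
have cont (f g : R -> R) : (forall x : R, 0 < x -> is_derive x 1 f (g x)) ->
    {within `[2^-1 : R, 3], continuous f}.
  move=> df; apply: derivable_within_continuous => x; rewrite in_itv /= => /andP[x2 _].
  by have [] := df x (lt_le_trans _ x2).
have bnd (f g : R -> R) : (forall x : R, 0 < x -> is_derive x 1 f (g x)) ->
    exists K, forall x, 2^-1 <= x -> x <= 3 -> `|f x| <= K.
  move=> /cont cf.
  have h23 : (2^-1 : R) <= 3 by lra.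
  have [c _ hc] := EVT_max h23 cf; have [c' _ hc'] := EVT_min h23 cf.
  exists (`|f c| + `|f c'|) => x x2 x3.
  have xi : x \in `[2^-1 : R, 3] by rewrite in_itv /= x2.
  have := hc x xi; have := hc' x xi.
  have := ler_norm (f c); have := ler_norm (- f c'); rewrite normrN.
  have := normr_ge0 (f c); have := normr_ge0 (f c') => *.
  by rewrite ler_norml; apply/andP; split; lra.
have zero (x : R) : 0 < x -> x < 1 \/ 2 < x -> p1 x = 0.
  move=> x0 [x1|x2]; rewrite /p1 derive1E.
    have nx : \forall y \near x, plateau 1 y = 1.
      apply: filterS (open_nbhs_nbhs (conj (@open_lt R 1) x1)) => y /= /ltW; exact: plateau1.
    by have -> : 'D_1 (plateau 1) x = 'D_1 (fun=> 1 : R) x; [exact: near_eq_derive|exact: derive_cst].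
  have nx : \forall y \near x, plateau 1 y = 0.
    by apply: filterS (open_nbhs_nbhs (conj (@open_gt R 2) x2)) => y /= /ltW h; apply: plateau0; rewrite ?mulr1.
  by have -> : 'D_1 (plateau 1) x = 'D_1 (fun=> 0 : R) x; [exact: near_eq_derive|exact: derive_cst].
have zero2 (x : R) : 0 < x -> x < 1 \/ 2 < x -> p2 x = 0.
  move=> x0 h; rewrite /p2 derive1E.
  have nx : \forall y \near x, p1 y = 0.
    case: h => h.
      near=> y; apply: zero; first by near: y; exact: near_pos.
      by left; near: y; exact: (open_nbhs_nbhs (conj (@open_lt R 1) h)).
    near=> y; apply: zero; first by near: y; exact: near_pos.
    by right; near: y; exact: (open_nbhs_nbhs (conj (@open_gt R 2) h)).
  by have -> : 'D_1 p1 x = 'D_1 (fun=> 0 : R) x; [exact: near_eq_derive|exact: derive_cst].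
have [K1 h1] := bnd _ _ d2; have [K2 h2] := bnd _ _ d3.
exists p1, p2, (`|K1| + `|K2|); first exact: addr_ge0.
split=> // x x0; first by move=> h; split; [exact: zero|exact: zero2].
have [xl|xl] := ltP x 1; first by rewrite zero ?zero2 ?normr0 ?addr_ge0//; left.
have [xr|xr] := ltP 2 x; first by rewrite zero ?zero2 ?normr0 ?addr_ge0//; right.
have := h1 x; have := h2 x; have := ler_norm K1; have := ler_norm K2.
have : 2^-1 <= x by lra.
have : x <= 3 by lra.
move=> x3 x2 n2 n1 /(_ x2 x3) b2 /(_ x2 x3) b1.
by have := normr_ge0 K1; have := normr_ge0 K2; split; lra.
Unshelve. all: by end_near.
Qed.

End AreaSum.

Section RadialMartingale.
Context {R : realType} {d : measure_display} {T : measurableType d}.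
Context (P : probability T R) {n : nat} (F : R -> set (set T)).
Context (w : R -> T -> 'M[R]_(n, 4)) (area : R -> T -> R * R * R).
Notation V := 'M[R]_(n, 4).
Hypothesis filt : filtration F.
Hypothesis bw : HPbrownian P F w.
Hypothesis sa : stochastic_area P w area.
Notation E := (EE P).
Notation Fm := (Fm F).

Definition ip3 (l x : R * R * R) : R := l.1.1 * x.1.1 + l.1.2 * x.1.2 + l.2 * x.2.

Lemma cos_sum_approx l (th t eps : R) (G : R -> R) (r kap : R) : 0 <= t -> Dinf G -> 1 <= r ->
  (forall v, r <= v -> G v = 0) -> 0 <= kap -> 0 <= eps ->
  (forall s, 0 <= s -> s <= t ->
     E (fun x => `|area_gen l (fun v => G (vv v)) (w s x) + kap * G (vv (w s x))|) <= eps) ->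
  exists2 C, 0 <= C & forall N : nat, t / N.+1%:R <= 1 ->
   `|E (fun x => cos (th + \sum_(i < N.+1) area_step l (w (i%:R * (t / N.+1%:R)) x)
        (w (i.+1%:R * (t / N.+1%:R)) x)) * G (vv (w t x))) - expR (- (kap * t)) * (cos th * G 1)|
   <= t * eps + C * Num.sqrt (t / N.+1%:R).
Proof.
move=> t0 DG r1 G0 k0 e0 he.
have [C C0 step] := cos_step filt bw l DG r1 G0.
pose g (v : V) := G (vv v).
have sg : smooth g by exact: smooth_rad.
have cg : compactly_supported g by exact: compactly_supported_rad G0.
have [B gB] := continuous_cs_bounded (smooth_continuous sg) cg.
have B0 : 0 <= B by exact: le_trans (gB 0).
exists (t * (C + kap ^+ 2 * B)); first by rewrite mulr_ge0// addr_ge0// mulr_ge0// sqr_ge0.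
move=> N; set h := t / N.+1%:R => h1.
have h0 : 0 <= h by rewrite divr_ge0.
pose p (i : nat) := i%:R * h.
have p0 i : 0 <= p i by rewrite mulr_ge0.
have pS i : p i.+1 = p i + h by rewrite /p -natr1 mulrDl mul1r.
have pm i j : (i <= j)%N -> p i <= p j by move=> ij; rewrite ler_wpM2r// ler_nat.
have pN : p N.+1 = t by rewrite /p mulrC divfK.
pose S i x := th + \sum_(k < i) area_step l (w (p k) x) (w (p k.+1) x).
have mS i : Fm (p i) (S i).
  apply: measurable_funD; first exact: measurable_cst.
  apply: measurable_sum => k; apply: (Fm_mono filt (p0 k.+1)); first exact: pm.
  by apply: (Fm_sep filt bw (p0 k)); [exact: pm|exact: sep_area_step].
pose u i := E (fun x => cos (S i x) * g (w (p i) x)).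
have mc i : Fm (p i) (fun x => cos (S i x)).
  exact: (measurableT_comp (continuous_measurable_fun (@continuous_cos R)) (mS i)).
have c1 i x : `|cos (S i x)| <= 1 by rewrite ler_norml cos_geN1 cos_le1.
have bc i := bm_Fm filt (p0 i) (mc i) (c1 i).
have bg i : bm (fun x => g (w (p i) x)) by exact: (bm_path filt bw (p0 i) (smooth_continuous sg) cg).
have bd i : bm (fun x => area_gen l g (w (p i) x)).
  apply: (bm_path filt bw (p0 i)).
    apply: smooth_continuous; apply: smoothB; first exact: smooth_drift.
    apply: smoothZ; apply: smoothM => //; apply: smoothZ.
    by do 2!(apply: smooth_sum => ?); exact/smoothX/smooth_coord.
  have [M1 hM1] := compactly_supported_drift cg; have [M2 hM2] := cg.
  exists (Num.max M1 M2) => v; rewrite gt_max => /andP[v1 v2].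
  by rewrite /area_gen hM1// hM2// !mulr0 subrr.
have uB i : `|u i| <= B.
  apply: EE_bound; first exact: bmM.
  by move=> x; rewrite normrM; apply: (@le_trans _ _ `|g (w (p i) x)|) => //; rewrite ler_piMl.
have ue i : (i < N.+1)%N -> `|u i.+1 - expR (- (kap * h)) * u i| <= h * eps + (C + kap ^+ 2 * B) * (h * Num.sqrt h).
  move=> iN.
  have := step (p i) (p i.+1) (S i) (p0 i) (pm _ _ (leqnSn _)).
  have -> : p i.+1 - p i = h by rewrite pS addrC addKr.
  move=> /(_ h1 (mS i)).
  have -> : (fun x => cos (S i x + area_step l (w (p i) x) (w (p i.+1) x)) * G (vv (w (p i.+1) x))) =
      fun x => cos (S i.+1 x) * g (w (p i.+1) x).
    by apply/funext => x; rewrite /S big_ord_recr /= addrA.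
  rewrite -/(u i.+1).
  pose e x := area_gen l g (w (p i) x) + kap * g (w (p i) x).
  have be : bm e by apply: bmD => //; exact: bmZ.
  have -> : E (fun x => cos (S i x) * (G (vv (w (p i) x)) + h * area_gen l (fun v => G (vv v)) (w (p i) x))) =
      (1 - kap * h) * u i + h * E (fun x => cos (S i x) * e x).
    rewrite -(EEZ P _ (bmM (bc i) (bg i))) -(EEZ P _ (bmM (bc i) be)).
    rewrite -EED; [|exact/bmZ/bmM..].
    congr EE; apply/funext => x; rewrite /e -/(g _).
    by move: (area_gen _ _ _) (g _) (cos _) => a b c; ring.
  move=> q.
  have eE : `|E (fun x => cos (S i x) * e x)| <= eps.
    apply: le_trans (EE_norm P (bmM (bc i) be)) _.
    apply: le_trans (he _ (p0 i) _); last by rewrite -pN; apply: pm; exact: ltnW.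
    apply: EE_le; [exact/bm_norm/bmM|exact: bm_norm|].
    by move=> x; rewrite normrM ler_piMl.
  have kh0 : 0 <= kap * h by rewrite mulr_ge0.
  have ex : `|(1 - kap * h) - expR (- (kap * h))| <= (kap * h) ^+ 2.
    have a1 := expR_ge1Dx (- (kap * h)).
    have a2 : expR (- (kap * h)) <= (1 + kap * h)^-1.
      by rewrite expRN lef_pV2 ?posrE ?expR_gt0 ?ltr_pwDl//; exact: expR_ge1Dx.
    have a3 : (1 + kap * h)^-1 <= 1 - kap * h + (kap * h) ^+ 2.
      rewrite -(@ler_pM2l _ (1 + kap * h)) ?ltr_pwDl// divff ?gt_eqF ?ltr_pwDl//.
      have := exprn_ge0 3 kh0; set z := kap * h => z3.
      have -> : (1 + z) * (1 - z + z ^+ 2) = 1 + z ^+ 3 by ring.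
      by rewrite lerDl.
    rewrite ler_norml; apply/andP; split; last by have := sqr_ge0 (kap * h); lra.
    by move: (le_trans a2 a3); lra.
  have -> : u i.+1 - expR (- (kap * h)) * u i =
     (u i.+1 - ((1 - kap * h) * u i + h * E (fun x => cos (S i x) * e x))) +
     h * E (fun x => cos (S i x) * e x) + (1 - kap * h - expR (- (kap * h))) * u i.
    by move: (E _) (u _) (u _) => a b c; ring.
  have hs : h ^+ 2 <= h * Num.sqrt h.
    rewrite expr2 ler_wpM2l// -{1}(sqr_sqrtr h0) expr2 ler_piMl ?sqrtr_ge0//.
    by rewrite -sqrtr1 ler_wsqrtr.
  have alg (a b c c' f : R) : a + (b + c * c') * f = b * f + a + c * (c' * f) by ring.
  rewrite alg.
  apply: le_trans (ler_normD _ _) _; apply: lerD.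
    apply: le_trans (ler_normD _ _) _; apply: lerD => //.
    by rewrite normrM ger0_norm// ler_wpM2l.
  rewrite normrM; apply: (@le_trans _ _ ((kap * h) ^+ 2 * B)); first exact: ler_pM.
  rewrite exprMn -mulrA [h ^+ 2 * B]mulrC ler_wpM2l ?sqr_ge0// ler_wpM2l//.
have iter i : (i <= N.+1)%N -> `|u i - expR (- (kap * h)) ^+ i * u 0%N| <=
    i%:R * (h * eps + (C + kap ^+ 2 * B) * (h * Num.sqrt h)).
  elim: i => [_|i IH iN]; first by rewrite expr0 mul1r subrr normr0 mul0r.
  have q1 := IH (ltnW iN); have q2 := ue i iN.
  have -> : u i.+1 - expR (- (kap * h)) ^+ i.+1 * u 0%N =
     (u i.+1 - expR (- (kap * h)) * u i) + expR (- (kap * h)) * (u i - expR (- (kap * h)) ^+ i * u 0%N).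
    rewrite exprS; move: (expR _) (u _) (u _) (u _) => a b c e; ring.
  rewrite -natr1 mulrDl mul1r addrC; apply: le_trans (ler_normD _ _) _; apply: lerD => //.
  rewrite normrM; apply: le_trans q1; rewrite ler_piMl//.
  by rewrite ger0_norm ?expR_ge0// -expR0 ler_expR oppr_le0 mulr_ge0.
have := iter N.+1 (leqnn _).
have -> : expR (- (kap * h)) ^+ N.+1 = expR (- (kap * t)).
  by rewrite -expRM_natl -pN /p mulrN mulrCA.
have -> : u 0%N = cos th * G 1.
  rewrite -[RHS](EE_cst P); apply: EE_ae_eq.
  - exact: (bmM (bc 0%N) (bg 0%N)).1.
  - exact: measurable_cst.
  have [_ _ w0 _] := bw; apply: filterS w0 => x wx.
  rewrite /S big_ord0 addr0 /p mul0r wx /g; congr (_ * G _).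
  by rewrite /vv /sqnormH big1 ?addr0// => i _; rewrite big1// => j _; rewrite mxE expr0n.
have -> : u N.+1 = E (fun x => cos (th + \sum_(i < N.+1) area_step l (w (i%:R * h) x) (w (i.+1%:R * h) x)) * G (vv (w t x))).
  by rewrite /u pN.
move=> q; apply: le_trans q _; rewrite -/(p N.+1).
have -> (a b c : R) : N.+1%:R * (h * a + b * (h * c)) = p N.+1 * a + p N.+1 * b * c.
  by rewrite /p; ring.
by rewrite pN.
Qed.

Local Transparent EE.
Lemma expectation_bool (p : T -> bool) : measurable_fun setT p ->
  E (fun x => (p x)%:R) = fine (P [set x | p x]).
Proof.
move=> mp.
have mA : measurable [set x | p x] by rewrite -[X in measurable X]setTI; exact: mp.
have -> : (fun x => (p x)%:R) = \1_[set x | p x] :> (T -> R).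
  by apply/funext => x; rewrite indicE; congr (nat_of_bool _)%:R; apply/idP/idP; rewrite inE.
by rewrite /EE /Rintegral integral_indic// setIT.
Qed.

Local Opaque EE.

Lemma measurable_area_sum t (N : nat) (p : nat -> R) k : (forall i, 0 <= p i) ->
  (forall i, p i <= p i.+1) -> (forall i, (i <= N)%N -> p i <= t) ->
  measurable_fun setT (fun x => area_sum (w ^~ x) N p 0 k).
Proof.
move=> p0 pS pt.
have cl (k' : 'I_4) j q : continuous (fun v : V => lq k' v j q).
  apply: smooth_continuous.
  have -> : (fun w : V => lq k' w j q) = fun w => mxvec (lq k' w) 0 (mxvec_index j q).
    by apply/funext => v; rewrite mxvecE.
  exact: smooth_mxvec_lq.
have civ : continuous (@iv R n) by exact: smooth_continuous smooth_iv.
under eq_fun do rewrite area_sum_coord.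
apply: measurable_sum => i; apply: measurable_funM; first exact: measurable_cst.
apply: measurable_funM.
  apply: measurable_funM; first exact: measurable_cst.
  by apply: measurable_funD; exact: (w_measurable filt bw).
apply: measurable_sum => j; apply: measurable_sum => q.
apply: measurable_funM.
  by apply: (w_measurable filt bw (p0 _) (phi := fun v : V => v j q)); exact: smooth_continuous (smooth_coord j q).
exact: (w_measurable filt bw (p0 _) (phi := fun v : V => lq k v j q)).
Qed.

Lemma area_sum_cos l (th t eps B : R) (g : V -> R) : 0 <= t -> 0 < eps -> 
  continuous g -> (forall v, `|g v| <= B) ->
  exists N0 : nat, forall N : nat, (N0 <= N)%N ->
   `|E (fun x => cos (th + \sum_(i < N.+1) area_step l (w (i%:R * (t / N.+1%:R)) x)
        (w (i.+1%:R * (t / N.+1%:R)) x)) * g (w t x)) -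
     E (fun x => cos (th + ip3 l (area t x)) * g (w t x))|
   <= B * (`|l.1.1| + `|l.1.2| + `|l.2| + 2) * eps.
Proof.
move=> t0 eps0 cg gB; have B0 : 0 <= B by exact: le_trans (gB 0).
have [ma /(_ eps eps0) [delta d0 hd]] := sa t0.
exists (Num.truncn (t / delta)) => N hN.
set h := t / N.+1%:R.
have h0 : 0 <= h by rewrite divr_ge0.
have hd' : h < delta.
  rewrite /h ltr_pdivrMr// mulrC -ltr_pdivrMr//.
  by apply: lt_le_trans (truncnS_gt _) _; rewrite ler_nat.
pose p (i : nat) := i%:R * h.
have p0 i : 0 <= p i by rewrite mulr_ge0.
have pS i : p i.+1 = p i + h by rewrite /p -natr1 mulrDl mul1r.
have pm i j : (i <= j)%N -> p i <= p j by move=> ij; rewrite ler_wpM2r// ler_nat.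
have pN : p N.+1 = t by rewrite /p mulrC divfK.
have sub : subdivision t N.+1 p.
  by split=> // [|i _]; [rewrite /p mul0r|exact: pm].
have hP := hd N.+1 p sub (fun i _ => _).
have {}hP : (P [set x | (eps <= `|area_sum (w ^~ x) N.+1 p - imquat (area t x)|)%R] <= eps%:E)%E.
  by apply: hP => i; rewrite pS addrC addKr.
pose Z x := area_sum (w ^~ x) N.+1 p - imquat (area t x).
have m11 : measurable_fun setT (fun x => (area t x).1.1).
  exact: (measurableT_comp measurable_fst (measurableT_comp measurable_fst ma)).
have m12 : measurable_fun setT (fun x => (area t x).1.2).
  exact: (measurableT_comp measurable_snd (measurableT_comp measurable_fst ma)).
have m2 : measurable_fun setT (fun x => (area t x).2).
  exact: (measurableT_comp measurable_snd ma).
have mas k : measurable_fun setT (fun x => area_sum (w ^~ x) N.+1 p 0 k).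
  by apply: (@measurable_area_sum t) => // [i|i iN]; [exact: pm|rewrite -pN; exact: pm].
have mZ (i : 'I_1) (k : 'I_4) : measurable_fun setT (fun x => Z x i k).
  rewrite (ord1 i).
  have -> : (fun x => Z x 0 k) = fun x => area_sum (w ^~ x) N.+1 p 0 k - imquat (area t x) 0 k.
    by apply/funext => x; rewrite /Z !mxE.
  apply: measurable_funB => //; under eq_fun do rewrite mxE.
  by move: k; apply: ord4P => //=; exact: measurable_cst.
have mN : measurable_fun setT (fun x => `|Z x|).
  by apply: (measurable_continuous_mx (phi := fun z : 'rV[R]_4 => `|z|)) => // z; exact: norm_continuous.
have mp : measurable_fun setT (fun x => eps <= `|Z x|).
  by apply: measurable_fun_ler => //; exact: measurable_cst.
have hE : E (fun x => (eps <= `|Z x| :> R)%:R) <= eps.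
  rewrite expectation_bool// -lee_fin fineK//; apply: fin_num_measure.
  by rewrite -[X in measurable X]setTI; exact: mp.
set L := `|l.1.1| + `|l.1.2| + `|l.2|.
have L0 : 0 <= L by rewrite !addr_ge0.
pose S x := \sum_(i < N.+1) area_step l (w (p i) x) (w (p i.+1) x).
have SE x : S x = l.1.1 * area_sum (w ^~ x) N.+1 p 0 1 + l.1.2 * area_sum (w ^~ x) N.+1 p 0 2 + l.2 * area_sum (w ^~ x) N.+1 p 0 3.
  by rewrite area_sum_step.
have mS : measurable_fun setT S.
  rewrite (_ : S = fun x => l.1.1 * area_sum (w ^~ x) N.+1 p 0 1 +
    l.1.2 * area_sum (w ^~ x) N.+1 p 0 2 + l.2 * area_sum (w ^~ x) N.+1 p 0 3); last exact/funext.
  by do 2?apply: measurable_funD; apply: measurable_funM => //; exact: measurable_cst.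
have mi : measurable_fun setT (fun x => ip3 l (area t x)).
  by do 2?apply: measurable_funD; apply: measurable_funM => //; exact: measurable_cst.
have bcos (f : T -> R) : measurable_fun setT f -> bm (fun x => cos (th + f x)).
  move=> mf; split; last by exists 1 => x; rewrite ler_norml cos_geN1 cos_le1.
  apply: (measurableT_comp (continuous_measurable_fun (@continuous_cos R))).
  by apply: measurable_funD => //; exact: measurable_cst.
have bg := bm_continuous filt bw t0 cg gB.
have b1 := bmM (bcos _ mS) bg; have b2 := bmM (bcos _ mi) bg.
have bp : bm (fun x => (eps <= `|Z x| :> R)%:R : R).
  split; last by exists 1 => x; case: (eps <= `|Z x|); rewrite ?normr1 ?normr0.
  have -> : (fun x => (eps <= `|Z x| :> R)%:R) = (fun b : bool => b%:R : R) \o (fun x => eps <= `|Z x|) by [].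
  exact: measurableT_comp.
rewrite -(EEB P b1 b2); apply: le_trans (EE_norm P (bmB b1 b2)) _.
apply: (@le_trans _ _ (E (fun x => B * (L * eps + 2 * (eps <= `|Z x| :> R)%:R)))); last first.
  rewrite (EEZ P _ (bmD (bm_cst _) (bmZ 2 bp))) EED ?EE_cst ?(EEZ P _ bp); [|exact: bm_cst|exact: bmZ].
  by rewrite -mulrA ler_wpM2l// [leRHS]mulrDl lerD2l ler_wpM2l.
apply: EE_le; [exact/bm_norm/bmB|by apply/bmZ/bmD; [exact: bm_cst|exact: bmZ]|].
move=> x; rewrite -mulrBl normrM mulrC; apply: ler_pM => //.
have [h1|h1] := leP eps `|Z x|.
  rewrite mulr1; apply: (@le_trans _ _ 2); last by rewrite lerDr mulr_ge0// ltW.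
  apply: le_trans (ler_normB _ _) _.
  have c1 (y : R) : `|cos y| <= 1 by rewrite ler_norml cos_geN1 cos_le1.
  by have := lerD (c1 (th + S x)) (c1 (th + ip3 l (area t x))).
rewrite mulr0 addr0; apply: le_trans (cos_lipschitz _ _) _.
have -> : th + S x - (th + ip3 l (area t x)) = l.1.1 * Z x 0 1 + l.1.2 * Z x 0 2 + l.2 * Z x 0 3.
  have subk (X Y : 'rV[R]_4) k : (X - Y) 0 k = X 0 k - Y 0 k by rewrite !mxE.
  rewrite SE /Z /ip3; move: (area_sum _ _ _) => A.
  by rewrite !subk ![imquat _ 0 _]mxE /=; ring.
have cz k : `|Z x 0 k| <= eps.
  apply: le_trans (ltW h1); rewrite [leRHS]mx_normrE.
  exact: (le_bigmax _ (fun i : 'I_1 * 'I_4 => `|Z x i.1 i.2|) (0, k)).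
rewrite /L !mulrDl.
by apply: le_trans (ler_normD _ _) _; apply: lerD; [apply: le_trans (ler_normD _ _) _; apply: lerD|]; rewrite normrM ler_wpM2l.
Qed.

Lemma radial_expectation l (th t kap B : R) (H H1 H2 : R -> R) : 0 <= t -> 0 <= kap -> Dinf H ->
  (forall x : R, 0 < x -> is_derive x 1 H (H1 x)) ->
  (forall x : R, 0 < x -> is_derive x 1 H1 (H2 x)) ->
  (forall v : R, 1 <= v -> 2 * v ^+ 2 * (v - 1) * H2 v + 4 * n%:R * v * H1 v
     - 2^-1 * (sqnorm3 l * (v - 1) * H v) = - kap * H v) ->
  (forall v : R, 1 <= v -> `|H v| <= B) ->
  (forall eps : R, 0 < eps -> exists2 r : R, 1 <= r &
     forall v, r <= v -> `|H v| <= eps /\ `|v * H1 v| <= eps) ->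
  E (fun x => cos (th + ip3 l (area t x)) * H (vv (w t x))) = expR (- (kap * t)) * (cos th * H 1).
Proof.
move=> t0 k0 DH d1 d2 ode HB decay.
have [Ct Ct0 tail] := tail_bound filt bw t0.
have [p1 [p2 [K K0 [dp1 dp2 p0 pK]]]] := @plateau_derivatives R.
have ma : measurable_fun setT (area t) by have [] := sa t0.
have mi : measurable_fun setT (fun x => ip3 l (area t x)).
  have m11 : measurable_fun setT (fun x => (area t x).1.1).
    exact: (measurableT_comp measurable_fst (measurableT_comp measurable_fst ma)).
  have m12 : measurable_fun setT (fun x => (area t x).1.2).
    exact: (measurableT_comp measurable_snd (measurableT_comp measurable_fst ma)).
  have m2 : measurable_fun setT (fun x => (area t x).2).
    exact: (measurableT_comp measurable_snd ma).
  by do 2?apply: measurable_funD; apply: measurable_funM => //; exact: measurable_cst.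
have bc : bm (fun x => cos (th + ip3 l (area t x))).
  split; last by exists 1 => x; rewrite ler_norml cos_geN1 cos_le1.
  apply: (measurableT_comp (continuous_measurable_fun (@continuous_cos R))).
  by apply: measurable_funD => //; exact: measurable_cst.
have cH : continuous (fun v : V => H (vv v)) by exact: smooth_continuous (smooth_rad DH).
have bH := bm_continuous filt bw t0 cH (fun v => HB _ (vv_ge1 v)).
pose D : R := 1 + t * (K * (32 + 8 * n%:R) * Ct).
have D0 : 0 < D.
  by rewrite ltr_pwDl// mulr_ge0// mulr_ge0// mulr_ge0// addr_ge0// mulr_ge0.
suff approx (eps : R) : 0 < eps ->
    `|E (fun x => cos (th + ip3 l (area t x)) * H (vv (w t x))) - expR (- (kap * t)) * (cos th * H 1)| <= D * eps.
  apply/eqP; rewrite -subr_eq0 -normr_le0; apply/ler_addgt0Pr => e e0; rewrite add0r.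
  by apply: le_trans (approx _ (divr_gt0 e0 D0)) _; rewrite mulrC divfK// gt_eqF.
move=> eps0; have [r r1 hr] := decay _ eps0.
have r0 : 0 < r by exact: lt_le_trans ltr01 r1.
pose x0 (v : R) := plateau r v.
pose x1 (v : R) := r^-1 * p1 (r^-1 * v).
pose x2 (v : R) := r^-1 * (r^-1 * p2 (r^-1 * v)).
have rv (v : R) : 0 < v -> 0 < r^-1 * v by move=> v0; rewrite mulr_gt0 ?invr_gt0.
have dm (v : R) : is_derive v 1 (fun z : R => r^-1 * z) r^-1.
  by apply: is_derive_eq (is_deriveZ r^-1 (is_derive_id v 1)) _; rewrite /GRing.scale /= mulr1.
have dx0 (v : R) : 0 < v -> is_derive v 1 x0 (x1 v).
  move=> v0; rewrite /x0 plateau_scale.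
  by apply: is_derive_eq (is_derive_comp1 (dm v) (dp1 _ (rv v v0))) _; rewrite /x1 mulrC.
have dx1 (v : R) : 0 < v -> is_derive v 1 x1 (x2 v).
  move=> v0; apply: is_derive_eq (is_deriveZ r^-1 (is_derive_comp1 (dm v) (dp2 _ (rv v v0)))) _.
  by rewrite /x2 /GRing.scale /= [_ * r^-1]mulrC.
pose G (v : R) := H v * x0 v.
pose G1 (v : R) := H1 v * x0 v + H v * x1 v.
pose G2 (v : R) := H2 v * x0 v + 2 * (H1 v * x1 v) + H v * x2 v.
have DG : Dinf G by move=> k; apply: DkM; [exact: DH|exact: Dinf_plateau].
have dG1 (v : R) : 0 < v -> is_derive v 1 G (G1 v).
  move=> v0; apply: is_derive_eq (is_deriveM (d1 v v0) (dx0 v v0)) _.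
  by rewrite /G1 /GRing.scale /= addrC [x0 v * _]mulrC.
have dG2 (v : R) : 0 < v -> is_derive v 1 G1 (G2 v).
  move=> v0; apply: is_derive_eq (is_deriveD (is_deriveM (d2 v v0) (dx0 v v0)) (is_deriveM (d1 v v0) (dx1 v v0))) _.
  rewrite /G2 /GRing.scale /=.
  by move: (H _) (H1 _) (H2 _) (x0 _) (x1 _) (x2 _) => a b c a' b' c'; ring.
have r20 : 0 < 2 * r by rewrite mulr_gt0.
have r21 : 1 <= 2 * r by rewrite (le_trans r1)// ler_peMl ?ler1n// ltW.
have G0 v : 2 * r <= v -> G v = 0 by move=> h; rewrite /G /x0 plateau0// mulr0.
have GH v : 1 <= v -> `|G v - H v| <= eps.
  move=> v1; have [vr|vr] := leP v r; first by rewrite /G /x0 plateau1// mulr1 subrr normr0 ltW.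
  have [h _] := hr v (ltW vr).
  have -> : G v - H v = H v * (x0 v - 1) by rewrite /G mulrBr mulr1.
  rewrite normrM; apply: le_trans h.
  by rewrite ler_piMr// ler_norml; have := plateau_ge0 r v; have := plateau_le1 r v; rewrite -/(x0 v) => *; apply/andP; split; lra.
have GB v : 1 <= v -> `|G v| <= B.
  move=> v1; apply: le_trans (HB v v1); rewrite /G normrM ler_piMr// ger0_norm ?plateau_ge0//.
  exact: plateau_le1.
pose e v := 2 * v ^+ 2 * (v - 1) * (2 * (H1 v * x1 v) + H v * x2 v) + 4 * n%:R * v * (H v * x1 v).
have gen a : area_gen l (fun v : V => G (vv v)) a + kap * G (vv a) = e (vv a).
  rewrite /area_gen /drift (HPop_rad a DG dG1 dG2).
  have -> : sqnormH a = vv a - 1 by rewrite /vv addrC addKr.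
  have := ode _ (vv_ge1 a); move: (vv a) => v hv.
  have -> : e v = e v + x0 v * (2 * v ^+ 2 * (v - 1) * H2 v + 4 * n%:R * v * H1 v -
     2^-1 * (sqnorm3 l * (v - 1) * H v) - - kap * H v) by rewrite hv subrr mulr0 addr0.
  rewrite /e /G /G1 /G2; move: (H v) (H1 v) (H2 v) (x0 v) (x1 v) (x2 v) (sqnorm3 l) => *; by field.
have eb v : 1 <= v -> `|e v| <= (r * (K * (32 + 8 * n%:R)) * eps) * (r <= v :> R)%:R.
  move=> v1; have v0 : 0 < v by exact: lt_le_trans ltr01 v1.
  have zero : r^-1 * v < 1 \/ 2 < r^-1 * v -> e v = 0.
    move=> h; have [h1 h2] := p0 _ (rv _ v0) h.
    by rewrite /e /x1 /x2 h1 h2; ring.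
  have [rlev|vltr] := leP r v; last first.
    by rewrite mulr0 zero ?normr0//; left; rewrite mulrC ltr_pdivrMr// mul1r.
  have [vler|vgtr] := leP v (2 * r); last first.
    rewrite mulr1 zero ?normr0; last by right; rewrite mulrC ltr_pdivlMr.
    by rewrite mulr_ge0 ?mulr_ge0 ?addr_ge0 ?mulr_ge0// ltW.
  rewrite mulr1.
  have [k1 k2] := pK _ (rv _ v0).
  have [h1 h2] := hr v rlev.
  have ri : 0 <= r^-1 by rewrite invr_ge0 ltW.
  have y1 : r * `|x1 v| <= K.
    by rewrite /x1 normrM (ger0_norm ri) mulrA divff ?mul1r// gt_eqF.
  have y2 : r ^+ 2 * `|x2 v| <= K.
    by rewrite /x2 !normrM (ger0_norm ri) !mulrA expr2 mulfK ?gt_eqF// divff ?mul1r// gt_eqF.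
  have v10 : 0 <= v - 1 by rewrite subr_ge0.
  have vr1 : v - 1 <= 2 * r by rewrite (le_trans _ vler)// gerBl.
  have -> : e v = 4 * ((v * (v - 1)) * (v * H1 v * x1 v)) + 2 * (v * v * (v - 1)) * (H v * x2 v)
       + 4 * n%:R * (v * (H v * x1 v)).
    by rewrite /e; move: (H v) (H1 v) (x1 v) (x2 v) => *; ring.
  have e0 := ltW eps0; have v0' := ltW v0; have r0' := ltW r0.
  have i1 : `|4 * ((v * (v - 1)) * (v * H1 v * x1 v))| <= 16 * (r * K * eps).
    rewrite normrM ger0_norm//.
    have -> : 16 * (r * K * eps) = 4 * ((2 * r * (2 * r)) * (eps * (r^-1 * K))) by field; rewrite gt_eqF.
    rewrite ler_wpM2l// normrM; apply: ler_pM => //.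
      by rewrite ger0_norm ?mulr_ge0//; apply: ler_pM.
    by rewrite normrM; apply: ler_pM => //; rewrite ler_pdivlMl.
  have i2 : `|2 * (v * v * (v - 1)) * (H v * x2 v)| <= 16 * (r * K * eps).
    have -> : 16 * (r * K * eps) = 2 * ((2 * r) * (2 * r) * (2 * r)) * (eps * ((r ^+ 2)^-1 * K)).
      by field; rewrite gt_eqF.
    rewrite normrM; apply: ler_pM => //.
      rewrite ger0_norm ?mulr_ge0// ler_wpM2l//.
      by apply: ler_pM => //; [rewrite mulr_ge0|apply: ler_pM].
    by rewrite normrM; apply: ler_pM => //; rewrite ler_pdivlMl ?exprn_gt0.
  have i3 : `|4 * n%:R * (v * (H v * x1 v))| <= 8 * n%:R * (r * K * eps).
    have -> : 8 * n%:R * (r * K * eps) = 4 * n%:R * (2 * r * (eps * K)) by ring.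
    rewrite normrM ger0_norm ?mulr_ge0// ler_wpM2l ?mulr_ge0// !normrM.
    rewrite (ger0_norm v0'); apply: ler_pM; rewrite ?mulr_ge0//; apply: ler_pM => //.
    by rewrite -normrM -/(x1 v); apply: le_trans y1; rewrite ler_peMl.
  have -> : r * (K * (32 + 8 * n%:R)) * eps = 16 * (r * K * eps) + 16 * (r * K * eps) + 8 * n%:R * (r * K * eps) by ring.
  by apply: le_trans (ler_normD _ _) _; apply: lerD => //; apply: le_trans (ler_normD _ _) _; exact: lerD.
have DGdrift s : 0 <= s -> bm (fun x => e (vv (w s x))).
  move=> s0; have sG := smooth_rad DG (n := n).
  have cG : compactly_supported (fun v : V => G (vv v)) by exact: compactly_supported_rad G0.
  rewrite (_ : (fun x => e _) = fun x => drift (fun v : V => G (vv v)) (w s x) -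
     2^-1 * (sqnorm3 l * (sqnormH (w s x) * G (vv (w s x)))) + kap * G (vv (w s x))); last first.
    by apply/funext => x; rewrite -gen /area_gen mulrA.
  apply: bmD; last by apply: bmZ; exact: (bm_path filt bw s0 (smooth_continuous sG) cG).
  apply: bmB.
    by apply: (bm_path filt bw s0); [exact/smooth_continuous/smooth_drift|exact: compactly_supported_drift].
  do 2!apply: bmZ; apply: (bm_path filt bw s0 (k := fun v : V => sqnormH v * G (vv v))).
    apply: smooth_continuous; apply: smoothM => //.
    by do 2!(apply: smooth_sum => ?); exact/smoothX/smooth_coord.
  exact: compactly_supportedMr.
pose eps' := K * (32 + 8 * n%:R) * Ct * eps.
have eps'0 : 0 <= eps' by rewrite mulr_ge0 ?mulr_ge0 ?addr_ge0 ?mulr_ge0// ltW.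
have he s : 0 <= s -> s <= t ->
    E (fun x => `|area_gen l (fun v : V => G (vv v)) (w s x) + kap * G (vv (w s x))|) <= eps'.
  move=> s0 st.
  rewrite (_ : (fun x => `|_|) = fun x => `|e (vv (w s x))|); last by apply/funext => x; rewrite gen.
  have cvv : continuous (@vv R n) by exact: smooth_continuous smooth_vv.
  have bb : bm (fun x => (r <= vv (w s x) :> R)%:R : R).
    split; last by exists 1 => x; case: (r <= vv (w s x)); rewrite ?normr1 ?normr0.
    have -> : (fun x => (r <= vv (w s x) :> R)%:R) = (fun b : bool => b%:R : R) \o (fun x => r <= vv (w s x)) by [].
    apply: measurableT_comp => //; apply: measurable_fun_ler; first exact: measurable_cst.
    exact: (w_measurable filt bw s0 cvv).
  apply: le_trans (EE_le P (bm_norm (DGdrift s s0)) (bmZ _ bb) (fun x => eb _ (vv_ge1 _))) _.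
  rewrite (EEZ P _ bb); apply: le_trans (ler_wpM2l _ (tail r s r0 s0 st)) _.
    by rewrite mulr_ge0 ?mulr_ge0 ?addr_ge0 ?mulr_ge0// ltW.
  rewrite /eps' le_eqVlt; apply/orP; left; apply/eqP; field; by rewrite gt_eqF.
have [C C0 hC] := cos_sum_approx th t0 DG r21 G0 k0 eps'0 he.
have cG : continuous (fun v : V => G (vv v)) by exact: smooth_continuous (smooth_rad DG).
have bG := bm_continuous filt bw t0 cG (fun v => GB _ (vv_ge1 v)).
have main : `|E (fun x => cos (th + ip3 l (area t x)) * G (vv (w t x))) - expR (- (kap * t)) * (cos th * G 1)|
    <= t * eps'.
  apply/ler_addgt0Pr => de de0.
  set L := B * (`|l.1.1| + `|l.1.2| + `|l.2| + 2).
  have L0 : 0 <= L by rewrite mulr_ge0 ?addr_ge0//; exact: le_trans (HB 1 (lexx 1)).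
  pose e2 := de / 2 / (L + 1).
  have L1 : 0 < L + 1 by rewrite ltr_wpDl.
  have C1 : 0 < C + 1 by rewrite ltr_wpDl.
  have e20 : 0 < e2 by rewrite !divr_gt0.
  have [N0 hN0] := area_sum_cos l th t0 e20 cG (fun v => GB _ (vv_ge1 v)).
  pose y := Num.min 1 ((de / 2 / (C + 1)) ^+ 2).
  have y0 : 0 < y by rewrite lt_min ltr01 exprn_gt0// !divr_gt0.
  pose N := maxn N0 (Num.truncn (t / y)).
  have hN : t / N.+1%:R <= y.
    rewrite ler_pdivrMr// mulrC -ler_pdivrMr// ltW//.
    by apply: lt_le_trans (truncnS_gt _) _; rewrite ler_nat ltnS leq_maxr.
  have y1 : y <= 1 by rewrite ge_min lexx.
  have {}hC := hC N (le_trans hN y1).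
  have {}hN0 := hN0 N (leq_maxl _ _).
  have sq : C * Num.sqrt (t / N.+1%:R) <= de / 2.
    have i1 : Num.sqrt (t / N.+1%:R) <= de / 2 / (C + 1).
      rewrite -[leRHS]ger0_norm ?divr_ge0//; [|exact: ltW..].
      by rewrite -sqrtr_sqr ler_wsqrtr// (le_trans hN)// ge_min lexx orbT.
    apply: le_trans (ler_wpM2l C0 i1) _.
    by rewrite mulrCA ler_piMr ?divr_ge0//; [exact: ltW|rewrite ler_pdivrMr// mul1r lerDl].
  have lq : L * e2 <= de / 2.
    by rewrite /e2 mulrCA ler_piMr ?divr_ge0//; [exact: ltW|rewrite ler_pdivrMr// mul1r lerDl].
  move: hC hN0; rewrite -/L; set b := E _; set a := E _; set c := expR _ * _ => hC hN0.
  have alg (a' b' c' : R) : a' - c' = (b' - c') - (b' - a') by ring.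
  rewrite (alg a b c).
  have -> : t * eps' + de = (t * eps' + de / 2) + de / 2 by field.
  apply: le_trans (ler_normB _ _) _; apply: lerD; last exact: le_trans lq.
  by apply: le_trans hC _; rewrite lerD2l.
have -> : H 1 = G 1 by rewrite /G /x0 plateau1// mulr1.
set c := expR _ * _ in main *.
have alg (a b c' : R) : a - c' = b - c' - (b - a) by ring.
have -> : E (fun x => cos (th + ip3 l (area t x)) * H (vv (w t x))) - c =
   (E (fun x => cos (th + ip3 l (area t x)) * G (vv (w t x))) - c) -
   E (fun x => cos (th + ip3 l (area t x)) * (G (vv (w t x)) - H (vv (w t x)))).
  rewrite [X in _ = _ - E X](_ : _ = fun x => cos (th + ip3 l (area t x)) * G (vv (w t x)) -
     cos (th + ip3 l (area t x)) * H (vv (w t x))); last by apply/funext => x; rewrite mulrBr.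
  by rewrite EEB; [exact: alg|exact: bmM..].
have -> : D * eps = t * eps' + eps by rewrite /D /eps'; ring.
apply: le_trans (ler_normB _ _) _; apply: lerD => //.
apply: EE_bound; first by apply: bmM => //; exact: bmB.
move=> x; rewrite normrM; apply: (@le_trans _ _ `|G (vv (w t x)) - H (vv (w t x))|).
  by rewrite ler_piMl// ler_norml cos_geN1 cos_le1.
exact/GH/vv_ge1.
Qed.

End RadialMartingale.

Local Transparent derive.

Local Transparent EE.

(** * Gaussian integrals and the Bessel kernel *)

Section ProductMeasure. Variables (R : realType) (d1 d2 :measure_display) (T1 : measurableType d1) (T2 : measurableType d2).
Variable (m1 : {sigma_finite_measure set T1 -> \bar R}) (m2 : {sigma_finite_measure set T2 -> \bar R}).
Definition prodm : set (T1 * T2)%type -> \bar R := (m1 \x m2)%E.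
HB.instance Definition _ := Measure.on prodm.
Let prodm_sigma_finite : sigma_finite setT prodm.
Proof.
have /sigma_finiteP[F [TF ndF Foo]] := sigma_finiteT m1.
have /sigma_finiteP[G [TG ndG Goo]] := sigma_finiteT m2.
exists (fun k => F k `*` G k).
  rewrite -setXTT TF TG predeqE => -[x y]; split.
    move=> [/= [k _ Fkx] [l _ Gly]]; exists (maxn k l) => //; split.
    - by move: x Fkx; exact/subsetPset/ndF/leq_maxl.
    - by move: y Gly; exact/subsetPset/ndG/leq_maxr.
  by move=> [k _ []/= ? ?]; split; exists k.
move=> k; have [? ?] := Foo k; have [? ?] := Goo k.
split; first exact: measurableX.
by rewrite /prodm product_measure1E// lte_mul_pinfty// ge0_fin_numE.
Qed.
HB.instance Definition _ := Measure_isSigmaFinite.Build _ _ _ prodm prodm_sigma_finite.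
End ProductMeasure.
Section Lebesgue3.
Variable R : realType.
Notation leb := (@lebesgue_measure R).
Definition leb2 := prodm leb leb.
HB.instance Definition _ := SigmaFiniteMeasure.on leb2.
Definition leb3 := prodm leb2 leb.
HB.instance Definition _ := SigmaFiniteMeasure.on leb3.
End Lebesgue3.

Section FubiniR.
Context d1 d2 (T1 : measurableType d1) (T2 : measurableType d2) (R : realType).
Variable m1 : {sigma_finite_measure set T1 -> \bar R}.
Variable m2 : {sigma_finite_measure set T2 -> \bar R}.
Variable f : T1 * T2 -> R.
Hypothesis mf : measurable_fun setT f.

Lemma RintegralE (d : measure_display) (T : measurableType d) (m : {measure set T -> \bar R}) (D : set T) (g : T -> R) :
  measurable D -> m.-integrable D (EFin \o g) -> (\int[m]_(x in D) (g x)%:E)%E = (\int[m]_(x in D) g x)%:E.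
Proof. by move=> mD ig; rewrite /Rintegral fineK//; exact: integrable_fin_num ig. Qed.

Lemma integrable_le (d : measure_display) (T : measurableType d) (m : {measure set T -> \bar R}) (D : set T) (g h : T -> R) :
  measurable D -> measurable_fun D g -> (forall x, D x -> `|g x| <= h x) -> m.-integrable D (EFin \o h) ->
  m.-integrable D (EFin \o g).
Proof.
move=> mD mg gh; apply: le_integrable => //; first exact/measurable_EFinP.
move=> x Dx; rewrite /= lee_fin; apply: le_trans (gh x Dx) _; exact: ler_norm.
Qed.

Lemma integrable_prod : (exists2 G : T1 -> R, m1.-integrable setT (EFin \o G) &
    forall x, m2.-integrable setT (fun y => (f (x, y))%:E) /\ \int[m2]_y `|f (x, y)| <= G x) ->
  (prodm m1 m2).-integrable setT (EFin \o f).
Proof.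
move=> [G iG hG]; apply/integrable12ltyP; first exact/measurable_EFinP.
apply: (@le_lt_trans _ _ (\int[m1]_x (G x)%:E)%E); last first.
  by rewrite RintegralE// ltry.
apply: ge0_le_integral => //.
- by move=> x _; exact: integral_ge0.
- apply: (measurable_fun_fubini_tonelli_F (fun z => `|(f z)%:E|)%E) => //.
  by apply: measurableT_comp => //; exact/measurable_EFinP.
- by have /integrableP[] := iG.
move=> x _; have [ix hx] := hG x.
rewrite /= -[leLHS]fineK; last by apply: (@integrable_fin_num _ _ _ m2 setT _ (fun y => `|(f (x, y))%:E|%E)) => //; exact: integrable_abse.
by rewrite lee_fin.
Qed.

Hypothesis ifm : (prodm m1 m2).-integrable setT (EFin \o f).
Hypothesis i1 : forall x, m2.-integrable setT (fun y => (f (x, y))%:E).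
Hypothesis i2 : forall y, m1.-integrable setT (fun x => (f (x, y))%:E).

Lemma Rfubini1 : \int[m1]_x \int[m2]_y f (x, y) = \int[prodm m1 m2]_z f z.
Proof.
rewrite /Rintegral -(integral12_prod_meas1 ifm); congr fine; apply: eq_integral => x _.
exact/esym/(RintegralE measurableT (i1 x)).
Qed.

Lemma Rfubini2 : \int[m2]_y \int[m1]_x f (x, y) = \int[prodm m1 m2]_z f z.
Proof.
rewrite /Rintegral -(integral21_prod_meas1 ifm); congr fine; apply: eq_integral => x _.
exact/esym/(RintegralE measurableT (i2 x)).
Qed.

Lemma Rfubini : \int[m1]_x \int[m2]_y f (x, y) = \int[m2]_y \int[m1]_x f (x, y).
Proof. by rewrite Rfubini1 Rfubini2. Qed.

Lemma measurable_fun_Rint : measurable_fun setT (fun x => \int[m2]_y f (x, y)).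
Proof.
have := measurable_fubini_F ifm; move=> h.
have -> : (fun x => \int[m2]_y f (x, y)) = fine \o (fun x => \int[m2]_y (f (x, y))%:E)%E by [].
exact: measurableT_comp.
Qed.

End FubiniR.

Section Dominated.
Context {R : realType}.

Lemma integrable_dominated_prod d1 d2 (T1 : measurableType d1) (T2 : measurableType d2)
  (m1 : {sigma_finite_measure set T1 -> \bar R}) (m2 : {sigma_finite_measure set T2 -> \bar R})
  (f : T1 * T2 -> R) (g : T1 -> R) (h : T2 -> R) :
  measurable_fun setT f -> m1.-integrable setT (EFin \o g) -> m2.-integrable setT (EFin \o h) ->
  (forall x y, `|f (x, y)| <= g x * h y) ->
  [/\ (prodm m1 m2).-integrable setT (EFin \o f),
     forall x, m2.-integrable setT (fun y => (f (x, y))%:E) &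
     forall y, m1.-integrable setT (fun x => (f (x, y))%:E)].
Proof.
move=> mf ig ih fgh.
have s1 x : m2.-integrable setT (fun y => (f (x, y))%:E).
  apply: (@integrable_le _ _ _ m2 setT (fun y => f (x, y)) (fun y => g x * h y)) => //.
    exact: measurableT_comp.
  exact: (integrableZl _ (g x) ih).
have s2 y : m1.-integrable setT (fun x => (f (x, y))%:E).
  apply: (@integrable_le _ _ _ m1 setT (fun x => f (x, y)) (fun x => g x * h y)) => //.
    exact: measurableT_comp.
  exact: (integrableZr _ (h y) ig).
split=> //; apply: integrable_prod => //.
exists (fun x => g x * \int[m2]_y h y); first exact: (integrableZr _ _ ig).
move=> x; split=> //.
rewrite -RintegralZl//; apply: le_Rintegral => //.
- exact: (integrable_abse (s1 x)).
- exact: (integrableZl _ (g x) ih).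
Qed.

End Dominated.

Lemma Rintegral_dominated {R : realType} d (T : measurableType d) (m : {measure set T -> \bar R})
  (F : nat -> T -> R) (f h : T -> R) :
  (forall k, measurable_fun setT (F k)) -> measurable_fun setT f ->
  (forall k x, `|F k x| <= h x) -> m.-integrable setT (EFin \o h) ->
  (forall x, F k x @[k --> \oo] --> f x) ->
  m.-integrable setT (EFin \o f) /\
  \int[m]_x F k x @[k --> \oo] --> \int[m]_x f x.
Proof.
move=> mF mf Fh ih Ff.
have fin_h : (forall x, setT x -> (EFin \o h) x \is a fin_num) by [].
have [||i1 _ h3] := @dominated_convergence _ T R m setT measurableT (fun k x => (F k x)%:E) (EFin \o f) (EFin \o h)
   (fun k => proj2 (measurable_EFinP _ _) (mF k)) (proj2 (measurable_EFinP _ _) mf) _ ih.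
- by apply: aeW => x _; apply: cvg_EFin; [exact: nearW|exact: Ff].
- by apply: aeW => x k _; rewrite /= lee_fin.
split=> //; apply: fine_cvg; rewrite (fineK (integrable_fin_num measurableT i1)).
exact: h3.
Qed.

Section Gauss.
Context {R : realType}.
Notation leb := (@lebesgue_measure R).

Lemma is_derive_continuous (f g : R -> R) : (forall x : R, is_derive x 1 f (g x)) -> continuous f.
Proof.
move=> fg x; apply: differentiable_continuous; apply/derivable1_diffP.
by have [] := fg x.
Qed.

Lemma integralT_affine (c a : R) (G : R -> R) : 0 < c -> continuous G -> (forall x, 0 <= G x) ->
  (\int[leb]_x (G x)%:E = \int[leb]_x (G (c * x + a) * c)%:E)%E.
Proof.
move=> c0 cG G0; pose f (x : R) := c * x + a.
have df (x : R) : is_derive x 1 f c.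
  have := is_deriveD (is_deriveZ c (is_derive_id x 1)) (is_derive_cst a x 1).
  by move=> h; apply: is_derive_eq h _; rewrite addr0 /GRing.scale /= mulr1.
have f' : f^`()%classic = fun=> c by apply/funext => x; rewrite derive1E derive_val.
rewrite (@increasing_ge0_integration_by_substitutionT _ f G) ?f'//.
- by move=> x y xy; rewrite /f ltrD2r ltr_pM2l.
- by move=> x; exact: cvg_cst.
- exact: is_cvg_cst.
- exact: is_cvg_cst.
- apply/cvgrNyPle => A; have := nbhs_ninfty_le (num_real (c^-1 * (A - a))).
  by apply: filterS => x; rewrite /f -lerBrDr ler_pdivlMl.
- apply/cvgryPge => A; have := nbhs_pinfty_ge (num_real (c^-1 * (A - a))).
  by apply: filterS => x; rewrite /f -lerBlDr ler_pdivrMl.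
Qed.

Definition gauss (tau x : R) := expR (- (tau * x ^+ 2)).

Lemma is_derive_gauss tau (x : R) : is_derive x 1 (gauss tau) (- (2 * tau * x) * gauss tau x).
Proof.
have dX := @is_deriveX _ _ (fun x : R => x) 2 x 1 _ (is_derive_id _ _).
rewrite exprfctE in dX.
apply: is_derive_eq (@is_derive_comp1 _ _ (@expR R) x _ _ (is_deriveN (is_deriveZ tau dX)) (is_derive_expR _)) _.
rewrite /gauss /GRing.scale /=; move: (expR _) => e; ring.
Qed.

Lemma continuous_gauss tau : continuous (gauss tau).
Proof. exact: is_derive_continuous (is_derive_gauss tau). Qed.

Lemma gauss_ge0 tau x : 0 <= gauss tau x. Proof. exact: expR_ge0. Qed.

Lemma integral_gauss tau : 0 < tau ->
  (\int[leb]_x (gauss tau x)%:E = (Num.sqrt (pi / tau))%:E)%E.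
Proof.
move=> tau0.
have s0 : 0 < Num.sqrt tau by rewrite sqrtr_gt0.
have := @integralT_gauss R; rewrite (integralT_affine 0 s0 (@continuous_gauss_fun R) (@gauss_fun_ge0 R)).
have -> : (\int[leb]_x (gauss_fun (Num.sqrt tau * x + 0) * Num.sqrt tau)%:E =
   (Num.sqrt tau)%:E * \int[leb]_x (gauss tau x)%:E)%E.
  rewrite -ge0_integralZl//.
  - apply: eq_integral => x _.
    by rewrite -EFinM mulrC addr0 /gauss_fun /gauss exprMn sqr_sqrtr// ltW.
  - by apply/measurable_EFinP; apply: continuous_measurable_fun; exact: continuous_gauss.
  - by move=> x _; rewrite lee_fin gauss_ge0.
move=> h.
have -> : (\int[leb]_x (gauss tau x)%:E)%E = (((Num.sqrt tau)^-1)%:E * ((Num.sqrt tau)%:E * \int[leb]_x (gauss tau x)%:E))%E.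
  by rewrite muleA -EFinM mulVf ?gt_eqF// mul1e.
by rewrite h -EFinM sqrtrM ?pi_ge0// sqrtrV ?ltW// mulrC.
Qed.

Lemma integrable_gauss tau : 0 < tau -> leb.-integrable setT (EFin \o gauss tau).
Proof.
move=> tau0; apply/integrableP; split.
  by apply/measurable_EFinP; apply: continuous_measurable_fun; exact: continuous_gauss.
under eq_integral do rewrite /= ger0_norm ?gauss_ge0//.
by rewrite integral_gauss// ltry.
Qed.

Lemma Rintegral_gauss tau : 0 < tau -> \int[leb]_x gauss tau x = Num.sqrt (pi / tau).
Proof. by move=> tau0; rewrite /Rintegral integral_gauss. Qed.

Lemma integral_derivative (f g h : R -> R) : (forall x : R, is_derive x 1 f (g x)) ->
  continuous g -> (forall x, `|g x| <= h x) -> leb.-integrable setT (EFin \o h) ->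
  f k%:R @[k --> \oo] --> 0 -> f (- k%:R) @[k --> \oo] --> 0 ->
  \int[leb]_x g x = 0.
Proof.
move=> df cg gh ih f1 f2.
have cf := is_derive_continuous df.
have mg : measurable_fun setT g by exact: continuous_measurable_fun.
pose I (k : nat) : set R := `[- k.+1%:R, k.+1%:R]%classic.
have FTC k : (\int[leb]_(x in I k) (g x)%:E = (f k.+1%:R - f (- k.+1%:R))%:E)%E.
  rewrite EFinB; apply: continuous_FTC2.
  - by rewrite gtrN.
  - exact: continuous_subspaceT.
  - split.
    + by move=> x _; have [] := df x.
    + by apply: cvg_at_right_filter; exact: cf.
    + by apply: cvg_at_left_filter; exact: cf.
  - by move=> x _; rewrite derive1E derive_val.
pose gk k x := g x * \1_(I k) x.
have mI k : measurable (I k) by exact: measurable_itv.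
have mgk k : measurable_fun setT (gk k).
  by apply: measurable_funM => //; exact: measurable_indic.
have [_ lim1] : leb.-integrable setT (EFin \o g) /\ \int[leb]_x gk k x @[k --> \oo] --> \int[leb]_x g x.
  apply: (@Rintegral_dominated _ _ _ leb gk g h) => //.
  - move=> k x; rewrite /gk indicE; apply: le_trans (gh x).
    by case: (_ \in _); rewrite ?mulr1// mulr0 normr0.
  move=> x; apply: cvg_near_cst; near=> k; rewrite /gk indicE mem_set ?mulr1//.
  rewrite /I /= in_itv /= -ler_norml.
  near: k; exists (Num.truncn `|x|) => // k /= hk.
  by apply: ltW; apply: lt_le_trans (truncnS_gt _) _; rewrite ler_nat.
have lim2 : \int[leb]_x gk k x @[k --> \oo] --> 0.
  have -> : (fun k => \int[leb]_x gk k x) = fun k => f k.+1%:R - f (- k.+1%:R).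
    apply/funext => k; rewrite -[RHS]/(fine (_%:E)) -FTC [X in _ = fine X]integral_mkcond.
    congr fine; apply: eq_integral => x _.
    rewrite patchE /gk indicE; case: (x \in I k); by rewrite ?mulr1 ?mulr0.
  rewrite -(subr0 0); apply: cvgB.
    by have := f1; rewrite -(@cvg_shiftS _ (fun k => f k%:R)).
  by have := f2; rewrite -(@cvg_shiftS _ (fun k => f (- k%:R))).
exact: (cvg_unique _ lim1 lim2).
Unshelve. all: by end_near.
Qed.

Lemma normr_gauss (tau x : R) : 0 < tau -> `|x| * gauss tau x <= (1 + tau^-1) * gauss (tau / 2) x.
Proof.
move=> tau0.
have -> : gauss tau x = gauss (tau / 2) x * gauss (tau / 2) x.
  by rewrite /gauss -expRD; congr expR; field.
rewrite mulrA ler_wpM2r ?gauss_ge0// /gauss expRN ler_pdivrMr ?expR_gt0//.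
apply: (@le_trans _ _ ((1 + tau^-1) * (1 + tau / 2 * x ^+ 2))); last first.
  by rewrite ler_wpM2l ?expR_ge1Dx// addr_ge0// invr_ge0 ltW.
have t1 : tau^-1 * tau = 1 by rewrite mulVf// gt_eqF.
have -> : (1 + tau^-1) * (1 + tau / 2 * x ^+ 2) = 1 + tau^-1 + (tau + tau^-1 * tau) / 2 * x ^+ 2.
  by field; rewrite gt_eqF.
rewrite t1 -real_normK ?num_real//; have := normr_ge0 x; move: `|x| => y y0.
have ti : 0 <= tau^-1 by rewrite invr_ge0 ltW.
have := sqr_ge0 (y - 1); have := sqr_ge0 y; have := mulr_ge0 (ltW tau0) (sqr_ge0 y); nra.
Qed.

Lemma gauss_cvg0 tau (u : nat -> R) : 0 < tau -> (forall k, k%:R <= `|u k|) ->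
  gauss tau (u k) @[k --> \oo] --> 0.
Proof.
move=> tau0 hu; apply/cvgrPdist_le => e e0; near=> k.
rewrite sub0r normrN ger0_norm ?gauss_ge0// /gauss expRN -[leRHS]invrK lef_pV2 ?posrE ?expR_gt0 ?invr_gt0//.
apply: (@le_trans _ _ (1 + tau * u k ^+ 2)); last exact: expR_ge1Dx.
apply: (@le_trans _ _ (tau * k%:R)); last first.
  have k1 : k%:R <= u k ^+ 2.
    rewrite -real_normK ?num_real//; apply: (@le_trans _ _ (k%:R ^+ 2)).
      rewrite -natrX ler_nat; case: (k) => // m; by rewrite -mulnn leq_pmulr.
    by rewrite ler_sqr ?nnegrE.
  by apply: ler_wpDl => //; rewrite ler_wpM2l// ltW.
rewrite mulrC -ler_pdivrMr//; near: k; exists (Num.truncn (e^-1 / tau)).+1 => // k /= hk.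
by apply: ltW; apply: lt_le_trans (truncnS_gt _) _; rewrite ler_nat.
Unshelve. all: by end_near.
Qed.

Lemma contM (f g : R -> R) : continuous f -> continuous g -> continuous (fun x => f x * g x).
Proof. by move=> cf cg x; exact: continuousM (cf x) (cg x). Qed.

Lemma contD (f g : R -> R) : continuous f -> continuous g -> continuous (fun x => f x + g x).
Proof. by move=> cf cg x; exact: continuousD (cf x) (cg x). Qed.

Lemma contB (f g : R -> R) : continuous f -> continuous g -> continuous (fun x => f x - g x).
Proof. by move=> cf cg x; exact: continuousB (cf x) (cg x). Qed.

Lemma cont_id : continuous (fun x : R => x). Proof. by move=> x; exact: cvg_id. Qed.

Lemma cont_cst (c : R) : continuous (fun x : R => c). Proof. by move=> x; exact: cvg_cst. Qed.

Lemma cont_comp (f g : R -> R) : continuous f -> continuous g -> continuous (fun x => g (f x)).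
Proof. by move=> cf cg x; exact: continuous_comp (cf x) (cg (f x)). Qed.

Lemma integrable_leT (g h : R -> R) : continuous g -> (forall x, `|g x| <= h x) ->
  leb.-integrable setT (EFin \o h) -> leb.-integrable setT (EFin \o g).
Proof. by move=> cg gh; apply: integrable_le => //; exact: continuous_measurable_fun. Qed.

Lemma continuous_cosine (y th : R) : continuous (fun l : R => cos (l * y + th)).
Proof.
apply: cont_comp (@continuous_cos R).
apply: contD; last exact: cont_cst.
by apply: contM; [exact: cont_id|exact: cont_cst].
Qed.

Lemma integrable_cos_gauss tau (y th : R) : 0 < tau ->
  leb.-integrable setT (fun l => (cos (l * y + th) * gauss tau l)%:E).
Proof.
move=> tau0.
apply: (@integrable_leT (fun l => cos (l * y + th) * gauss tau l) _ _ _ (integrable_gauss tau0)).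
  by apply: contM; [exact: continuous_cosine|exact: continuous_gauss].
move=> l.
by rewrite normrM (ger0_norm (gauss_ge0 _ _)) ler_piMl ?gauss_ge0// ler_norml cos_geN1 cos_le1.
Qed.

Lemma gauss_fourier tau (y th : R) : 0 < tau ->
  \int[leb]_l (cos (l * y + th) * gauss tau l) =
  cos th * Num.sqrt (pi / tau) * expR (- (y ^+ 2 / (4 * tau))).
Proof.
move=> tau0.
pose k (y l : R) := cos (l * y + th) * gauss tau l.
pose F y := \int[leb]_l k y l.
have dk (l z : R) : is_derive z 1 (k ^~ l) (- (l * sin (l * z + th) * gauss tau l)).
  have d1 : is_derive z 1 (fun z : R => l * z + th) l.
    have := is_deriveD (is_deriveZ l (is_derive_id z 1)) (is_derive_cst th z 1).
    by move=> h; apply: is_derive_eq h _; rewrite addr0 /GRing.scale /= mulr1.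
  have d2 := is_derive_comp1 d1 (is_derive_cos _).
  have := is_deriveM d2 (is_derive_cst (gauss tau l) z 1).
  move=> h; apply: is_derive_eq h _; rewrite /GRing.scale /= mulr0 add0r.
  by move: (sin _) (gauss _ _) => a b; ring.
have dl (z l : R) : is_derive l 1 (fun l => sin (l * z + th) * gauss tau l)
    (z * (cos (l * z + th) * gauss tau l) - 2 * tau * (l * sin (l * z + th) * gauss tau l)).
  have d1 : is_derive l 1 (fun l : R => l * z + th) z.
    have := is_deriveD (is_deriveM (is_derive_id l 1) (is_derive_cst z l 1)) (is_derive_cst th l 1).
    by move=> h; apply: is_derive_eq h _; rewrite addr0 /GRing.scale /= mulr1 mulr0 add0r.
  have d2 := is_derive_comp1 d1 (is_derive_sin _).
  have := is_deriveM d2 (is_derive_gauss tau l).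
  move=> h; apply: is_derive_eq h _; rewrite /GRing.scale /=.
  by move: (sin _) (cos _) (gauss _ _) => a b c; ring.
have tau20 : 0 < tau / 2 by rewrite divr_gt0.
have ik z : leb.-integrable setT (EFin \o k z) by exact: integrable_cos_gauss.
have bnd l z : `|l * sin (l * z + th) * gauss tau l| <= (1 + tau^-1) * gauss (tau / 2) l.
  apply: le_trans (normr_gauss l tau0); rewrite !normrM (ger0_norm (gauss_ge0 _ _)).
  by rewrite ler_wpM2r ?gauss_ge0// ler_piMr// ler_norml sin_geN1 sin_le1.
have iG : leb.-integrable setT (fun l => ((1 + tau^-1) * gauss (tau / 2) l)%:E).
  exact: (integrableZl _ _ (integrable_gauss tau20)).
have G0 l : 0 <= (1 + tau^-1) * gauss (tau / 2) l.
  by rewrite mulr_ge0 ?gauss_ge0// addr_ge0// invr_ge0 ltW.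
have cs z : continuous (fun l : R => sin (l * z + th)).
  apply: cont_comp (@continuous_sin R).
  by apply: contD; [apply: contM; [exact: cont_id|exact: cont_cst]|exact: cont_cst].
have cls z : continuous (fun l : R => l * sin (l * z + th) * gauss tau l).
  apply: contM; last exact: continuous_gauss.
  by apply: contM; [exact: cont_id|exact: cs].
have ils z : leb.-integrable setT (fun l => (l * sin (l * z + th) * gauss tau l)%:E).
  exact: (@integrable_leT (fun l => l * sin (l * z + th) * gauss tau l) _ (cls z) (bnd ^~ z) iG).
have parts z : \int[leb]_l (l * sin (l * z + th) * gauss tau l) = z / (2 * tau) * F z.
  have c1 : continuous (fun l : R => z * (cos (l * z + th) * gauss tau l) - 2 * tau * (l * sin (l * z + th) * gauss tau l)).
    apply: contB; apply: contM; try exact: cont_cst; last exact: cls.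
    by apply: contM; [exact: continuous_cosine|exact: continuous_gauss].
  have : \int[leb]_l (z * (cos (l * z + th) * gauss tau l) - 2 * tau * (l * sin (l * z + th) * gauss tau l)) = 0.
    apply: (@integral_derivative _ _ (fun l => `|z| * gauss tau l + 2 * tau * ((1 + tau^-1) * gauss (tau / 2) l)) (dl z) c1).
    - move=> l; apply: le_trans (ler_normB _ _) _; apply: lerD.
        rewrite normrM ler_wpM2l// normrM (ger0_norm (gauss_ge0 _ _)) ler_piMl ?gauss_ge0//.
        by rewrite ler_norml cos_geN1 cos_le1.
      by rewrite normrM ger0_norm ?mulr_ge0 ?(ltW tau0)// ler_wpM2l ?mulr_ge0 ?(ltW tau0).
    - apply: (@integrableD _ _ _ leb setT measurableT (fun l => (`|z| * gauss tau l)%:E) (fun l => (2 * tau * ((1 + tau^-1) * gauss (tau / 2) l))%:E)).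
        exact: (integrableZl _ _ (integrable_gauss tau0)).
      exact: (integrableZl _ _ iG).
    - apply: (@squeeze_cvgr _ _ _ _ (fun k => - gauss tau k%:R) (fun k => gauss tau k%:R)).
      + apply: nearW => m; rewrite -ler_norml normrM (ger0_norm (gauss_ge0 _ _)) ler_piMl ?gauss_ge0//.
        by rewrite ler_norml sin_geN1 sin_le1.
      + rewrite -oppr0; apply: cvgN; apply: gauss_cvg0 => // m; exact: ler_norm.
      + by apply: gauss_cvg0 => // m; exact: ler_norm.
    - apply: (@squeeze_cvgr _ _ _ _ (fun k => - gauss tau (- k%:R)) (fun k => gauss tau (- k%:R))).
      + apply: nearW => m; rewrite -ler_norml normrM (ger0_norm (gauss_ge0 _ _)) ler_piMl ?gauss_ge0//.
        by rewrite ler_norml sin_geN1 sin_le1.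
      + by rewrite -oppr0; apply: cvgN; apply: gauss_cvg0 => // m; rewrite normrN ler_norm.
      + by apply: gauss_cvg0 => // m; rewrite normrN ler_norm.
  rewrite RintegralB//; last 2 first.
  - exact: (integrableZl _ _ (ik z)).
  - exact: (integrableZl _ _ (ils z)).
  rewrite RintegralZl//; last exact: (ik z).
  rewrite RintegralZl//; last exact: (ils z).
  move=> /eqP; rewrite subr_eq0 => /eqP h.
  have t2 : 2 * tau != 0 by rewrite mulf_neq0// gt_eqF.
  by apply: (mulfI t2); rewrite -h -/(F z) mulrA mulrCA divff// mulr1.
have dF (z : R) : is_derive z 1 F (- (z / (2 * tau) * F z)).
  have Iz : `]z - 1, z + 1[%classic z by rewrite /= in_itv /= gtrBl ltrDl ltr01.
  have p1 x l : partial1of2 k x l = - (l * sin (l * x + th) * gauss tau l).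
    by rewrite partial1of2E; have [_ ->] := dk l x.
  have Gub x l : `]z - 1, z + 1[%classic x -> setT l -> `|partial1of2 k x l| <= (1 + tau^-1) * gauss (tau / 2) l.
    by move=> _ _; rewrite p1 normrN.
  have dd x l : `]z - 1, z + 1[%classic x -> setT l -> derivable (k ^~ l) x 1.
    by move=> _ _; have [] := dk l x.
  have h1 := @derivable_under_integral _ _ _ leb k setT measurableT _ _ _ Iz (fun x _ => ik x) dd _ G0 iG Gub.
  have h2 := @differentiation_under_integral _ _ _ leb k setT measurableT _ _ _ Iz (fun x _ => ik x) dd _ G0 iG Gub.
  apply: DeriveDef => //; rewrite -derive1E h2 -(parts z).
  rewrite (@eq_Rintegral _ _ _ leb setT (fun l => (-1) * (l * sin (l * z + th) * gauss tau l))); last first.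
    by move=> l _; rewrite p1 mulN1r.
  by rewrite RintegralZl ?mulN1r//; exact: (ils z).
pose h (z : R) := F z * expR (z ^+ 2 / (4 * tau)).
have dh (z : R) : is_derive z 1 h 0.
  have dX := @is_deriveX _ _ (fun x : R => x) 2 z 1 _ (is_derive_id _ _).
  rewrite exprfctE in dX.
  have dE := @is_derive_comp1 _ _ (@expR R) z _ _ (is_deriveM dX (is_derive_cst (4 * tau)^-1 z 1)) (is_derive_expR _).
  apply: is_derive_eq (is_deriveM (dF z) dE) _.
  rewrite /GRing.scale /=; move: (F z) (expR _) => a b; field; by rewrite gt_eqF.
have ch : continuous h by exact: is_derive_continuous dh.
have hy : h y = h 0.
  have [y0|y0] := leP 0 y.
    have [c _ /eqP] := MVT_segment y0 (fun z _ => dh z) (continuous_subspaceT ch).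
    by rewrite mul0r subr_eq0 => /eqP.
  have [c _ /eqP] := MVT_segment (ltW y0) (fun z _ => dh z) (continuous_subspaceT ch).
  by rewrite mul0r subr_eq0 => /eqP.
have F0 : F 0 = cos th * Num.sqrt (pi / tau).
  rewrite /F /k (@eq_Rintegral _ _ _ leb setT (fun l => cos th * gauss tau l)); last first.
    by move=> l _; rewrite mulr0 add0r.
  by rewrite RintegralZl ?Rintegral_gauss//; exact: integrable_gauss.
rewrite -/(F y) -F0 expRN; apply: (@mulIf _ (expR (y ^+ 2 / (4 * tau)))).
  by rewrite gt_eqF ?expR_gt0.
rewrite -/(h y) hy /h expr0n /= mul0r expR0 mulr1 -mulrA mulVf ?mulr1//.
by rewrite gt_eqF ?expR_gt0.
Qed.

End Gauss.

Local Opaque derive.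

Local Opaque EE.

Section HalfLine.
Context {R : realType}.
Notation leb := (@lebesgue_measure R).

Lemma integralT_fold (f : R -> R) : (forall x, 0 <= f x) -> continuous f ->
  (\int[leb]_x (f x)%:E = \int[leb]_(x in `[0%R, +oo[) (f x + f (- x))%:E)%E.
Proof.
move=> f0 cf.
have mf : measurable_fun setT (EFin \o f) by apply/measurable_EFinP; exact: continuous_measurable_fun.
have cN : continuous (fun x => f (- x)).
  by move=> x; apply: continuous_comp; [exact: opp_continuous|exact: cf].
have mN : measurable_fun setT (fun x : R => (f (- x))%:E).
  by apply/measurable_EFinP; exact: continuous_measurable_fun.
have -> : (\int[leb]_(x in `[0%R, +oo[) (f x + f (- x))%:E = 
    \int[leb]_(x in `[0%R, +oo[) (f x)%:E + \int[leb]_(x in `[0%R, +oo[) (f (- x))%:E)%E.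
  rewrite -ge0_integralD//.
  - by move=> x _; rewrite lee_fin.
  - exact: measurable_funTS.
  - by move=> x _; rewrite lee_fin.
  - exact: measurable_funTS.
have <- := @ge0_integration_by_substitutionNy R f 0 (continuous_subspaceT cf) (fun x _ => f0 x).
have -> : [set: R] = `[0, +oo[%classic `|` `]-oo, 0[%classic.
  apply/seteqP; split=> x //= _; rewrite !in_itv /= andbT.
  by have [x0|x0] := leP 0 x; [left|right].
rewrite ge0_integral_setU//.
- by rewrite oppr0 integral_itv_bndo_bndc//; exact: measurable_funTS.
- by apply: measurable_funTS.
- by move=> x _; rewrite lee_fin.
- apply/disj_setPS => x [] /=; rewrite !in_itv /= andbT => x0 x1.
  by have := le_lt_trans x0 x1; rewrite ltxx.
Qed.

Definition asinh2 (x : R) := 2 * ln (x + Num.sqrt (1 + x ^+ 2)).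

Lemma sqrt1D_gt (x : R) : `|x| < Num.sqrt (1 + x ^+ 2).
Proof. by rewrite -sqrtr_sqr ltr_sqrt ?ltrDr// ltr_pwDl ?sqr_ge0. Qed.

Lemma asinh_arg_gt0 (x : R) : 0 < x + Num.sqrt (1 + x ^+ 2).
Proof. by have := sqrt1D_gt x; rewrite ltr_norml => /andP[]; set r := Num.sqrt _ => *; lra. Qed.

Lemma is_derive_asinh2 (x : R) : is_derive x 1 asinh2 (2 / Num.sqrt (1 + x ^+ 2)).
Proof.
have p : 0 < 1 + x ^+ 2 by rewrite ltr_pwDl ?sqr_ge0.
have dX := @is_deriveX _ _ (fun x : R => x) 2 x 1 _ (is_derive_id _ _).
rewrite exprfctE in dX.
have d1 := is_deriveD (is_derive_cst (1 : R) x 1) dX.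
have d2 : is_derive (1 + x ^+ 2) 1 (@Num.sqrt R) (2 * Num.sqrt (1 + x ^+ 2))^-1.
  exact: is_derive1_sqrt.
have d3 := is_deriveD (is_derive_id x 1) (is_derive_comp1 d1 d2).
have d4 := is_deriveZ 2 (is_derive_comp1 d3 (is_derive1_ln (asinh_arg_gt0 x))).
apply: is_derive_eq d4 _; rewrite /GRing.scale /= add0r mulr1.
have := asinh_arg_gt0 x; have : 0 < Num.sqrt (1 + x ^+ 2) by rewrite sqrtr_gt0.
move: (Num.sqrt _) => r r0 h; field; by rewrite !gt_eqF.
Qed.

Lemma contN (f : R -> R) : continuous f -> continuous (fun x => - f x).
Proof. by move=> cf x; exact: continuousN (cf x). Qed.

Lemma contV (f : R -> R) : (forall x, f x != 0) -> continuous f -> continuous (fun x => (f x)^-1).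
Proof. by move=> f0 cf x; exact: continuousV (f0 x) (cf x). Qed.

Lemma cont_scale (c : R) : continuous (fun x : R => c * x).
Proof. by apply: contM; [exact: cont_cst|exact: cont_id]. Qed.

Lemma continuous_cosh : continuous (@cosh R).
Proof.
apply: contM; last exact: cont_cst.
apply: contD; first exact: continuous_expR.
apply: cont_comp (@continuous_expR R); exact: opp_continuous.
Qed.

Lemma besselK_half (w : R) : 0 < w -> besselK 2^-1 w = Num.sqrt (pi / (2 * w)) * expR (- w).
Proof.
move=> w0; pose G u := expR (- (w * cosh u)) * cosh (2^-1 * u).
have w20 : 0 < 2 * w by rewrite mulr_gt0.
have ch0 u : 0 <= @cosh R u by rewrite /cosh divr_ge0 ?addr_ge0 ?expR_ge0.
have cG : continuous G.
  apply: contM.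
    apply: cont_comp (@continuous_expR R).
    by apply: contN; apply: contM; [exact: cont_cst|exact: continuous_cosh].
  apply: cont_comp continuous_cosh; by apply: contM; [exact: cont_cst|exact: cont_id].
have F' : asinh2^`()%classic = fun x : R => 2 / Num.sqrt (1 + x ^+ 2).
  by apply/funext => x; rewrite derive1E; have [_ ->] := is_derive_asinh2 x.
have r0 x : 0 < Num.sqrt (1 + x ^+ 2) :> R by rewrite sqrtr_gt0 ltr_pwDl ?sqr_ge0.
have cF := is_derive_continuous is_derive_asinh2.
have cF' : continuous (fun x : R => 2 / Num.sqrt (1 + x ^+ 2)).
  apply: contM; first exact: cont_cst.
  apply: contV; first by move=> x; rewrite gt_eqF.
  apply: (cont_comp (f := fun x : R => 1 + x ^+ 2) _ (@sqrt_continuous R)).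
  by apply: contD; [exact: cont_cst|exact: exprn_continuous].
have F0 : asinh2 (0 : R) = 0 by rewrite /asinh2 expr0n /= addr0 sqrtr1 add0r ln1 mulr0.
have lnge x : 0 < x -> ln x <= ln (x + Num.sqrt (1 + x ^+ 2)) :> R.
  by move=> x0; rewrite ler_ln ?posrE ?asinh_arg_gt0// lerDl ltW.
have key : (\int[leb]_(x in `[0%R, +oo[) (G x)%:E = \int[leb]_(x in `[0%R, +oo[) (2 * expR (- w) * gauss (2 * w) x)%:E)%E.
  rewrite -{1}F0 (@increasing_ge0_integration_by_substitutiony R asinh2 G 0).
  - apply: eq_integral => x _; rewrite F'; congr (_%:E).
    change (G (asinh2 x) * (2 / Num.sqrt (1 + x ^+ 2)) = 2 * expR (- w) * gauss (2 * w) x); rewrite /G.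
    pose r := Num.sqrt (1 + x ^+ 2); pose p := x + r.
    have p0 : 0 < p by exact: asinh_arg_gt0.
    have rr : r ^+ 2 = 1 + x ^+ 2 by rewrite sqr_sqrtr// ltW// ltr_pwDl ?sqr_ge0.
    have pV : p^-1 = r - x.
      apply: (mulfI (lt0r_neq0 p0)); rewrite divff ?gt_eqF// /p.
      have -> : (x + r) * (r - x) = r ^+ 2 - x ^+ 2 by ring.
      by rewrite rr addrK.
    have e1 : expR (2^-1 * asinh2 x) = p by rewrite /asinh2 mulrA mulVf// mul1r lnK// posrE.
    have e2 : expR (- (2^-1 * asinh2 x)) = r - x by rewrite expRN e1.
    have f2 : asinh2 x = 2^-1 * asinh2 x + 2^-1 * asinh2 x by rewrite -mulrDl; field.
    have -> : cosh (asinh2 x) = 1 + 2 * x ^+ 2.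
      rewrite /cosh f2 opprD !expRD e1 e2 /p.
      have -> : ((x + r) * (x + r) + (r - x) * (r - x)) / 2 = r ^+ 2 + x ^+ 2 by field.
      by rewrite rr; ring.
    have -> : cosh (2^-1 * asinh2 x) = r by rewrite /cosh e1 e2 /p; field.
    rewrite -/r -mulrA [r * _]mulrC divfK ?gt_eqF//; last exact: r0.
    rewrite mulrC -mulrA /gauss -expRD; congr (_ * expR _); ring.
  - move=> x y; rewrite !in_itv /= !andbT => x0 y0 xy; rewrite /asinh2 ltr_pM2l// ltr_ln ?posrE ?asinh_arg_gt0//.
    rewrite ltrD// ltr_sqrt; last by rewrite ltr_pwDl ?sqr_ge0.
    by rewrite ltrD2l ltrXn2r// ?nnegrE.
  - by rewrite F' => x _; exact: cF'.
  - rewrite F'; apply/cvg_ex; exists (2 / Num.sqrt (1 + 0 ^+ 2)).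
    by apply: cvg_at_right_filter; exact: cF'.
  - rewrite F'; apply/cvg_ex; exists 0; apply/cvgrPdist_le => e e0.
    have := nbhs_pinfty_ge (num_real (2 / e)); apply: filterS => x xe.
    rewrite sub0r normrN ger0_norm ?divr_ge0// ler_pdivrMr// mulrC -ler_pdivrMr//.
    apply: le_trans xe _; apply: le_trans (ler_norm _) _; exact: ltW (sqrt1D_gt x).
  - split; first by move=> x _; have [] := is_derive_asinh2 x.
    by apply: cvg_at_right_filter; exact: cF.
  - apply/cvgryPge => A; have := nbhs_pinfty_ge (num_real (expR (A / 2))).
    apply: filterS => x xe.
    have x0 : 0 < x by exact: lt_le_trans (expR_gt0 _) xe.
    rewrite /asinh2 mulrC -ler_pdivrMr//; apply: le_trans (lnge _ x0).
    by rewrite -[leLHS]expRK ler_ln ?posrE ?expR_gt0.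
  - exact: continuous_subspaceT.
  - by move=> x _; rewrite /G mulr_ge0 ?expR_ge0.
have half : (\int[leb]_(x in `[0%R, +oo[) (gauss (2 * w) x + gauss (2 * w) (- x))%:E = (Num.sqrt (pi / (2 * w)))%:E)%E.
  by rewrite -integralT_fold ?integral_gauss//; [exact: gauss_ge0|exact: continuous_gauss].
rewrite /besselK /Rintegral -/G key.
have -> : (\int[leb]_(x in `[0%R, +oo[) (2 * expR (- w) * gauss (2 * w) x)%:E =
   (expR (- w))%:E * \int[leb]_(x in `[0%R, +oo[) (gauss (2 * w) x + gauss (2 * w) (- x))%:E)%E.
  rewrite -ge0_integralZl//.
  - by apply: eq_integral => x _; rewrite -EFinM /gauss sqrrN; congr (_%:E); ring.
  - apply: measurable_funTS; apply/measurable_EFinP; apply: continuous_measurable_fun.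
    apply: contD; first exact: continuous_gauss.
    apply: cont_comp (@continuous_gauss R (2 * w)); exact: opp_continuous.
  - by move=> x _; rewrite lee_fin addr_ge0 ?gauss_ge0.
by rewrite half -EFinM /= mulrC.
Qed.

Lemma cosh_ge (v : R) : v ^+ 2 / 4 <= cosh v.
Proof.
wlog v0 : v / 0 <= v.
  move=> h; have [/h//|v0] := leP 0 v.
  have := h (- v); rewrite sqrrN oppr_ge0 /cosh opprK => /(_ (ltW v0)).
  by rewrite [expR (- v) + _]addrC.
have h := expR_ge1Dxn 1 v0; have h2 := expR_ge0 (- v).
have f2 : 2`!%:R = 2 :> R by [].
move: h; rewrite f2 /cosh expr2; lra.
Qed.

Lemma bessel_integrand_bound (al w v : R) : 0 < w -> `|al| <= 2 ->
  expR (- (al * v)) * expR (- (w * cosh v)) <= expR (8 / w) * gauss (w / 8) v.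
Proof.
move=> w0 al2; rewrite -!expRD ler_expR.
have h1 : - (al * v) <= 2 * `|v|.
  by apply: le_trans (ler_norm _) _; rewrite normrN normrM ler_wpM2r.
have h2 : w * (v ^+ 2 / 4) <= w * cosh v by rewrite ler_pM2l// cosh_ge.
have h3 : 2 * `|v| <= w / 8 * v ^+ 2 + 8 / w.
  rewrite -[v ^+ 2]real_normK ?num_real//; set y := `|v|.
  rewrite -subr_ge0; have -> : w / 8 * y ^+ 2 + 8 / w - 2 * y = 8 / w * (w / 8 * y - 1) ^+ 2.
    by field; rewrite gt_eqF.
  by rewrite mulr_ge0 ?sqr_ge0// divr_ge0// ltW.
move: h1 h2 h3; set y := `|v|; set z := w * cosh v; set q := v ^+ 2 => h1 h2 h3.
have e1 : w * (q / 4) = w / 8 * q + w / 8 * q by field.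
move: h2; rewrite e1; lra.
Qed.

Lemma besselK_integralT (al w : R) : 0 < w -> `|al| <= 2 ->
  leb.-integrable setT (fun v => (expR (- (al * v)) * expR (- (w * cosh v)))%:E) /\
  \int[leb]_v (expR (- (al * v)) * expR (- (w * cosh v))) = 2 * besselK al w.
Proof.
move=> w0 al2.
have cg : continuous (fun v : R => expR (- (al * v)) * expR (- (w * cosh v))).
  apply: contM; apply: cont_comp (@continuous_expR R).
    by apply: contN; exact: cont_scale.
  by apply: contN; apply: contM; [exact: cont_cst|exact: continuous_cosh].
have g0 v : 0 <= expR (- (al * v)) * expR (- (w * cosh v)) by rewrite mulr_ge0 ?expR_ge0.
have w8 : 0 < w / 8 by rewrite divr_gt0.
have ig : leb.-integrable setT (fun v => (expR (- (al * v)) * expR (- (w * cosh v)))%:E).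
  apply: (@integrable_leT _ (fun v => expR (- (al * v)) * expR (- (w * cosh v)))
    (fun v => expR (8 / w) * gauss (w / 8) v)) => //.
    by move=> v; rewrite ger0_norm ?g0// bessel_integrand_bound.
  exact: (integrableZl _ _ (integrable_gauss w8)).
split=> //.
have ev v : cosh (- v) = cosh v :> R by rewrite /cosh opprK addrC.
rewrite /Rintegral (integralT_fold g0 cg) /besselK /Rintegral.
pose m (x : R) := expR (- (w * cosh x)) * cosh (al * x).
have cm : continuous m.
  apply: contM; apply: cont_comp.
  - by apply: contN; apply: contM; [exact: cont_cst|exact: continuous_cosh].
  - exact: continuous_expR.
  - exact: cont_scale.
  - exact: continuous_cosh.
have mE x : expR (- (al * x)) * expR (- (w * cosh x)) + expR (- (al * - x)) * expR (- (w * cosh (- x))) = 2 * m x.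
  by rewrite ev mulrN opprK /m [in RHS]/cosh; move: (expR _) (expR _) (expR _) => a b c; field.
have im : leb.-integrable setT (EFin \o m).
  apply: (@integrable_leT _ m (fun v => expR (8 / w) * gauss (w / 8) v)) => //; last first.
    exact: (integrableZl _ _ (integrable_gauss w8)).
  move=> x; rewrite ger0_norm; last by rewrite mulr_ge0 ?expR_ge0// /cosh divr_ge0// addr_ge0 ?expR_ge0.
  rewrite -(@ler_pM2l _ 2)// -mE.
  have b1 := bessel_integrand_bound x w0 al2; have b2 := bessel_integrand_bound (- x) w0 al2.
  have -> : 2 * (expR (8 / w) * gauss (w / 8) x) = expR (8 / w) * gauss (w / 8) x + expR (8 / w) * gauss (w / 8) (- x).
    by rewrite /gauss sqrrN mulr_natl mulr2n.
  exact: lerD.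
have im' : leb.-integrable `[0, +oo[%classic (EFin \o m) by exact: integrableS im.
rewrite -RintegralZl//; congr fine; apply: eq_integral => x _; by rewrite mE.
Qed.

Lemma expcosh_integral (al b c : R) : 0 < b -> 0 < c -> `|al| <= 2 ->
  leb.-integrable setT (fun v => (expR (- (al * v)) * expR (- (c * expR v + b * expR (- v))))%:E) /\
  \int[leb]_v (expR (- (al * v)) * expR (- (c * expR v + b * expR (- v)))) =
  expR (- (al * ln (Num.sqrt b / Num.sqrt c))) * (2 * besselK al (2 * (Num.sqrt b * Num.sqrt c))).
Proof.
move=> b0 c0 al2; set a := ln _; set w := 2 * (Num.sqrt b * _).
have sb : 0 < Num.sqrt b by rewrite sqrtr_gt0.
have sc : 0 < Num.sqrt c by rewrite sqrtr_gt0.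
have w0 : 0 < w by rewrite !mulr_gt0.
have [ig Ig] := besselK_integralT w0 al2.
pose f v := expR (- (al * v)) * expR (- (c * expR v + b * expR (- v))).
have f0 v : 0 <= f v by rewrite mulr_ge0 ?expR_ge0.
have cf : continuous f.
  apply: contM; apply: cont_comp (@continuous_expR R); apply: contN; first exact: cont_scale.
  apply: contD; apply: contM; try exact: cont_cst; first exact: continuous_expR.
  by apply: cont_comp (@continuous_expR R); exact: opp_continuous.
have ea : expR a = Num.sqrt b / Num.sqrt c by rewrite lnK// posrE divr_gt0.
have fa (x : R) : f (1 * x + a) * 1 = expR (- (al * a)) * (expR (- (al * x)) * expR (- (w * cosh x))).
  rewrite /f mulr1 mul1r.
  have -> : - (al * (x + a)) = - (al * a) + - (al * x) by ring.
  rewrite [expR (- (al * a) + _)]expRD -mulrA; congr (_ * (_ * expR _)).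
  rewrite (opprD x a) !expRD /w /cosh !expRN ea.
  rewrite -{1}(sqr_sqrtr (ltW c0)) -{2}(sqr_sqrtr (ltW b0)).
  move: (Num.sqrt b) (Num.sqrt c) sb sc (expR x) (expR_gt0 x) => B C B0 C0 e e0.
  by field; rewrite !gt_eqF.
have I : (\int[leb]_v (f v)%:E = (expR (- (al * a)) * (2 * besselK al w))%:E)%E.
  rewrite (integralT_affine a ltr01 cf f0).
  under eq_integral do rewrite fa EFinM.
  rewrite ge0_integralZl//.
  - by rewrite (RintegralE measurableT ig) Ig.
  - by have /integrableP[] := ig.
split; last by rewrite /Rintegral I.
apply/integrableP; split; first by apply/measurable_EFinP; exact: continuous_measurable_fun.
under eq_integral do rewrite /= ger0_norm ?f0//.
by rewrite I ltry.
Qed.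

Lemma subordination (b c : R) : 0 < b -> 0 < c ->
  \int[leb]_v (expR (- (2^-1 * v)) * expR (- (c * expR v + b * expR (- v)))) =
  Num.sqrt (pi / b) * expR (- (2 * (Num.sqrt b * Num.sqrt c))).
Proof.
move=> b0 c0.
have h2 : `|2^-1 : R| <= 2 by rewrite ger0_norm//; lra.
have [_ ->] := expcosh_integral b0 c0 h2.
have sb : 0 < Num.sqrt b by rewrite sqrtr_gt0.
have sc : 0 < Num.sqrt c by rewrite sqrtr_gt0.
rewrite besselK_half ?mulr_gt0//.
have -> : 2 * (2 * (Num.sqrt b * Num.sqrt c)) = 4 * (Num.sqrt b * Num.sqrt c) by ring.
move: (expR (- (2 * (Num.sqrt b * _)))) => E.
have alg (e' S : R) : e' * (2 * (S * E)) = e' * 2 * S * E by ring.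
rewrite alg; congr (_ * _).
set q := Num.sqrt b / Num.sqrt c; set e := expR _.
have q0 : 0 < q by rewrite divr_gt0.
have e0 : 0 <= e by exact: expR_ge0.
have e2 : e ^+ 2 = q^-1.
  by rewrite /e -expRM_natl mulrN mulrA divff// mul1r expRN lnK// posrE.
apply/eqP; rewrite -(@eqrXn2 _ 2) ?mulr_ge0 ?sqrtr_ge0//; apply/eqP.
rewrite !exprMn e2 !sqr_sqrtr ?divr_ge0 ?pi_ge0 ?mulr_ge0 ?(ltW b0) ?(ltW sb) ?(ltW sc)//.
rewrite -[in RHS](sqr_sqrtr (ltW b0)) /q; move: (Num.sqrt b) (Num.sqrt c) sb sc => B C B0 C0.
by field; rewrite !gt_eqF.
Qed.

Lemma bessel2_integral (b c : R) : 0 < b -> 0 < c ->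
  \int[leb]_v (expR (- (2 * v)) * expR (- (c * expR v + b * expR (- v)))) =
  2 * (c / b) * besselK 2 (2 * (Num.sqrt b * Num.sqrt c)).
Proof.
move=> b0 c0.
have h2 : `|2 : R| <= 2 by rewrite ger0_norm.
have [_ ->] := expcosh_integral b0 c0 h2.
have sb : 0 < Num.sqrt b by rewrite sqrtr_gt0.
have sc : 0 < Num.sqrt c by rewrite sqrtr_gt0.
rewrite mulrA; congr (_ * _); rewrite mulrC; congr (_ * _).
rewrite expRN expRM_natl lnK ?posrE ?divr_gt0//.
by rewrite expr_div_n !sqr_sqrtr ?ltW// invf_div.
Qed.

End HalfLine.

Section Fourier3.
Context {R : realType}.
Notation leb := (@lebesgue_measure R).
Notation leb2 := (@leb2 R).
Notation leb3 := (@leb3 R).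
Implicit Types (y l : R * R * R).

Lemma integrable_le1 (g h : R -> R) : measurable_fun setT g -> (forall x, `|g x| <= h x) ->
  leb.-integrable setT (EFin \o h) -> leb.-integrable setT (EFin \o g).
Proof. by move=> mg gh; apply: (@integrable_le R _ (measurableTypeR R) leb setT g h). Qed.

Lemma integrable_le3 (g h : R * R * R -> R) : measurable_fun setT g -> (forall x, `|g x| <= h x) ->
  leb3.-integrable setT (EFin \o h) -> leb3.-integrable setT (EFin \o g).
Proof.
move=> mg gh.
by apply: (@integrable_le R _ (measurableTypeR R * measurableTypeR R * measurableTypeR R)%type leb3 setT g h).
Qed.

Lemma m3_11 : measurable_fun setT (fun l : R * R * R => l.1.1).
Proof. exact: (measurableT_comp measurable_fst measurable_fst). Qed.
Lemma m3_12 : measurable_fun setT (fun l : R * R * R => l.1.2).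
Proof. exact: (measurableT_comp measurable_snd measurable_fst). Qed.
Lemma m3_2 : measurable_fun setT (fun l : R * R * R => l.2).
Proof. exact: measurable_snd. Qed.

Lemma measurable_sqnorm3 : measurable_fun setT (@sqnorm3 R).
Proof.
have mX : measurable_fun setT (fun x : R => x ^+ 2) by apply: continuous_measurable_fun; exact: exprn_continuous.
rewrite /sqnorm3; apply: measurable_funD; first apply: measurable_funD.
- exact: (measurableT_comp mX m3_11).
- exact: (measurableT_comp mX m3_12).
- exact: (measurableT_comp mX m3_2).
Qed.

Lemma measurable_ip3 y : measurable_fun setT (fun l => ip3 l y).
Proof.
apply: measurable_funD; first apply: measurable_funD.
- by apply: measurable_funM; [exact: m3_11|exact: measurable_cst].
- by apply: measurable_funM; [exact: m3_12|exact: measurable_cst].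
- by apply: measurable_funM; [exact: m3_2|exact: measurable_cst].
Qed.

Lemma sqnorm3_ge0 l : 0 <= sqnorm3 l.
Proof. by rewrite !addr_ge0 ?sqr_ge0. Qed.

Definition gauss3 (tau : R) l := expR (- (tau * sqnorm3 l)).

Lemma gauss3E tau l : gauss3 tau l = gauss tau l.1.1 * gauss tau l.1.2 * gauss tau l.2.
Proof. by rewrite /gauss3 /gauss -!expRD /sqnorm3; congr expR; ring. Qed.

Lemma gauss3_ge0 tau l : 0 <= gauss3 tau l. Proof. exact: expR_ge0. Qed.

Lemma measurable_gauss3 tau : measurable_fun setT (gauss3 tau).
Proof.
have mE : measurable_fun setT (fun x : R => expR (- (tau * x))).
  apply: continuous_measurable_fun; apply: cont_comp (@continuous_expR R).
  by apply: contN; exact: cont_scale.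
exact: (measurableT_comp mE measurable_sqnorm3).
Qed.

Lemma measurable_cos_ip3 y th : measurable_fun setT (fun l => cos (ip3 l y + th)).
Proof.
have mC : measurable_fun setT (fun x : R => cos (x + th)).
  apply: continuous_measurable_fun; apply: cont_comp (@continuous_cos R).
  by apply: contD; [exact: cont_id|exact: cont_cst].
exact: (measurableT_comp mC (measurable_ip3 y)).
Qed.

Lemma integrable_dominated_prod2 (f : R * R -> R) (g h : R -> R) : measurable_fun setT f ->
  leb.-integrable setT (EFin \o g) -> leb.-integrable setT (EFin \o h) ->
  (forall a b, `|f (a, b)| <= g a * h b) ->
  [/\ leb2.-integrable setT (EFin \o f), forall a, leb.-integrable setT (fun b => (f (a, b))%:E) &
     forall b, leb.-integrable setT (fun a => (f (a, b))%:E)].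
Proof.
exact: (@integrable_dominated_prod R _ _ (measurableTypeR R) (measurableTypeR R) leb leb f g h).
Qed.

Lemma integrable_dominated_prod3 (f : R * R * R -> R) (g : R * R -> R) (h : R -> R) : measurable_fun setT f ->
  leb2.-integrable setT (EFin \o g) -> leb.-integrable setT (EFin \o h) ->
  (forall a b, `|f (a, b)| <= g a * h b) ->
  [/\ leb3.-integrable setT (EFin \o f), forall a, leb.-integrable setT (fun b => (f (a, b))%:E) &
     forall b, leb2.-integrable setT (fun a => (f (a, b))%:E)].
Proof.
exact: (@integrable_dominated_prod R _ _ (measurableTypeR R * measurableTypeR R)%type (measurableTypeR R) leb2 leb f g h).
Qed.

Lemma Rfubini_leb2 (f : R * R -> R) : leb2.-integrable setT (EFin \o f) ->
  (forall a, leb.-integrable setT (fun b => (f (a, b))%:E)) ->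
  \int[leb]_a \int[leb]_b f (a, b) = \int[leb2]_z f z.
Proof. exact: (@Rfubini1 _ _ (measurableTypeR R) (measurableTypeR R) R leb leb f). Qed.

Lemma Rfubini_leb3 (f : R * R * R -> R) : leb3.-integrable setT (EFin \o f) ->
  (forall a, leb.-integrable setT (fun b => (f (a, b))%:E)) ->
  \int[leb2]_a \int[leb]_b f (a, b) = \int[leb3]_z f z.
Proof. exact: (@Rfubini1 _ _ (measurableTypeR R * measurableTypeR R)%type (measurableTypeR R) R leb2 leb f). Qed.

Lemma gauss3_fourier tau y th : 0 < tau ->
  leb3.-integrable setT (fun l => (cos (ip3 l y + th) * gauss3 tau l)%:E) /\
  \int[leb3]_l (cos (ip3 l y + th) * gauss3 tau l) =
  cos th * Num.sqrt (pi / tau) ^+ 3 * expR (- (sqnorm3 y / (4 * tau))).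
Proof.
move=> tau0.
pose f2 (th : R) (l : R * R) := cos (l.1 * y.1.1 + (l.2 * y.1.2 + th)) * (gauss tau l.1 * gauss tau l.2).
pose f3 l := cos (ip3 l y + th) * gauss3 tau l.
have g1 := integrable_gauss tau0.
have cg : measurable_fun setT (gauss tau) by apply: continuous_measurable_fun; exact: continuous_gauss.
have mf2 t : measurable_fun setT (f2 t).
  apply: measurable_funM; last first.
    by apply: measurable_funM; [exact: (measurableT_comp cg measurable_fst)|exact: (measurableT_comp cg measurable_snd)].
  apply: (measurableT_comp (continuous_measurable_fun (@continuous_cos R))).
  apply: measurable_funD; first by apply: measurable_funM; [exact: measurable_fst|exact: measurable_cst].
  apply: measurable_funD; last exact: measurable_cst.
  by apply: measurable_funM; [exact: measurable_snd|exact: measurable_cst].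
have c1 (a : R) : `|cos a| <= 1 by rewrite ler_norml cos_geN1 cos_le1.
have b2 t (a b : R) : `|f2 t (a, b)| <= gauss tau a * gauss tau b.
  rewrite normrM [`|_ * gauss tau b|]ger0_norm ?mulr_ge0 ?gauss_ge0// ler_piMl ?mulr_ge0 ?gauss_ge0//.
have I2 t : \int[leb2]_l f2 t l = cos t * Num.sqrt (pi / tau) ^+ 2 * expR (- ((y.1.1 ^+ 2 + y.1.2 ^+ 2) / (4 * tau))).
  have [i2' s2t _] := integrable_dominated_prod2 (mf2 t) g1 g1 (b2 t).
  rewrite -(Rfubini_leb2 i2' s2t).
  have inner a : \int[leb]_b f2 t (a, b) = Num.sqrt (pi / tau) * expR (- (y.1.2 ^+ 2 / (4 * tau))) * (cos (a * y.1.1 + t) * gauss tau a).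
    rewrite (@eq_Rintegral _ _ _ leb setT (fun b : R => gauss tau a * (cos (b * y.1.2 + (a * y.1.1 + t)) * gauss tau b))); last first.
      move=> b _; rewrite /f2 /= addrCA; move: (gauss _ _) (gauss _ _) (cos _) => p q r; ring.
    rewrite RintegralZl//; last exact: integrable_cos_gauss.
    by rewrite gauss_fourier//; move: (gauss _ _) (Num.sqrt _) (cos _) (expR _) => p q r e; ring.
  rewrite (@eq_Rintegral _ _ _ leb setT (fun a : R => Num.sqrt (pi / tau) * expR (- (y.1.2 ^+ 2 / (4 * tau))) * (cos (a * y.1.1 + t) * gauss tau a))); last first.
    by move=> a _; rewrite inner.
  rewrite RintegralZl//; last exact: integrable_cos_gauss.
  rewrite gauss_fourier// [(_ + _) / (4 * tau)]mulrDl [in RHS]opprD [in RHS]expRD.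
  by move: (Num.sqrt _) (cos _) (expR _) (expR _) => q r e e'; ring.
have mf3 : measurable_fun setT f3 by apply: measurable_funM; [exact: measurable_cos_ip3|exact: measurable_gauss3].
have i2 t : leb2.-integrable setT (EFin \o f2 t) by have [] := integrable_dominated_prod2 (mf2 t) g1 g1 (b2 t).
pose g2 (x : R * R) := gauss tau x.1 * gauss tau x.2.
have ig2 : leb2.-integrable setT (EFin \o g2).
  have mg2 : measurable_fun setT g2.
    by apply: measurable_funM; [exact: (measurableT_comp cg measurable_fst)|exact: (measurableT_comp cg measurable_snd)].
  have bg (a b : R) : `|g2 (a, b)| <= gauss tau a * gauss tau b by rewrite ger0_norm ?mulr_ge0 ?gauss_ge0.
  by have [] := integrable_dominated_prod2 mg2 g1 g1 bg.
have b3 (x : R * R) (b : R) : `|f3 (x, b)| <= g2 x * gauss tau b.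
  rewrite /f3 normrM gauss3E /g2 /= [`|_ * _|]ger0_norm ?mulr_ge0 ?gauss_ge0//.
  by rewrite ler_piMl ?mulr_ge0 ?gauss_ge0.
have [i3 s3 _] := integrable_dominated_prod3 mf3 ig2 g1 b3.
split; first exact: i3.
rewrite -(Rfubini_leb3 i3 s3).
have inner (x : R * R) : \int[leb]_b f3 (x, b) = Num.sqrt (pi / tau) * expR (- (y.2 ^+ 2 / (4 * tau))) * f2 th x.
  rewrite (@eq_Rintegral _ _ _ leb setT (fun b : R => g2 x * (cos (b * y.2 + (x.1 * y.1.1 + (x.2 * y.1.2 + th))) * gauss tau b))); last first.
    move=> b _; rewrite /f3 gauss3E /g2 /ip3 /=.
    have -> : x.1 * y.1.1 + x.2 * y.1.2 + b * y.2 + th = b * y.2 + (x.1 * y.1.1 + (x.2 * y.1.2 + th)) by ring.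
    by move: (gauss _ _) (gauss _ _) (gauss _ _) (cos _) => p q r e; ring.
  rewrite RintegralZl//; last exact: integrable_cos_gauss.
  by rewrite gauss_fourier// /f2 /g2; move: (gauss _ _) (gauss _ _) (Num.sqrt _) (cos _) (expR _) => p q r e f; ring.
rewrite (@eq_Rintegral _ _ _ leb2 setT (fun x : R * R => Num.sqrt (pi / tau) * expR (- (y.2 ^+ 2 / (4 * tau))) * f2 th x)); last first.
  by move=> x _; rewrite inner.
rewrite RintegralZl//.
rewrite I2 /sqnorm3 [(_ + y.2 ^+ 2) / (4 * tau)]mulrDl [in RHS]opprD [in RHS]expRD.
by move: (Num.sqrt _) (cos _) (expR _) (expR _) => q r e e'; ring.
Qed.

Lemma area_kernelE y (s : R) : 0 < s -> area_kernel y s =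
  s * expR s * (besselK 2 (2 * Num.sqrt ((sqnorm3 y + s ^+ 2) / 4)) / (sqnorm3 y + s ^+ 2)).
Proof.
move=> s0; rewrite /area_kernel; set D := sqnorm3 y + _.
have D0 : 0 <= D by rewrite addr_ge0 ?sqnorm3_ge0 ?sqr_ge0.
have s4 : Num.sqrt 4 = 2 :> R.
  have e4 : (4 : R) = 2 ^+ 2 by ring.
  by rewrite e4 sqrtr_sqr ger0_norm.
have -> : Num.sqrt D = 2 * Num.sqrt (D / 4) by rewrite sqrtrM// sqrtrV// s4 mulrC divfK.
by [].
Qed.

Definition rho1 l : R := Num.sqrt (1 + sqnorm3 l).

Lemma rho1_ge1 l : 1 <= rho1 l.
Proof. by rewrite -sqrtr1 ler_wsqrtr// lerDl sqnorm3_ge0. Qed.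

Lemma measurable_rho1 : measurable_fun setT rho1.
Proof.
apply: (measurableT_comp (continuous_measurable_fun (@sqrt_continuous R))).
by apply: measurable_funD; [exact: measurable_cst|exact: measurable_sqnorm3].
Qed.

Lemma measurable_expR_rho1 s : measurable_fun setT (fun l => expR (- (s * rho1 l))).
Proof.
have mE : measurable_fun setT (fun x : R => expR (- (s * x))).
  apply: continuous_measurable_fun; apply: cont_comp (@continuous_expR R).
  by apply: contN; exact: cont_scale.
exact: (measurableT_comp mE measurable_rho1).
Qed.

(* The weight of the mixture of Gaussians [gauss3 (expR v)] that represents
   [exp (- s sqrt (1 + |l|^2))]. *)
Definition mixw (b v : R) := expR (- (2^-1 * v)) * expR (- (1 * expR v + b * expR (- v))).

Lemma mixture_integrand b (v : R) l : mixw b v * gauss3 (expR v) l =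
  expR (- (2^-1 * v)) * expR (- ((1 + sqnorm3 l) * expR v + b * expR (- v))).
Proof. by rewrite /mixw /gauss3 -mulrA -expRD; congr (_ * expR _); ring. Qed.

Lemma kernel_fourier (s : R) y th : 0 < s ->
  leb3.-integrable setT (fun l => (expR (- (s * rho1 l)))%:E) /\
  \int[leb3]_l (cos (ip3 l y + th) * expR (- (s * rho1 l))) =
  cos th * (4 * pi * (expR (- s) * area_kernel y s)).
Proof.
move=> s0; pose b := s ^+ 2 / 4.
have b0 : 0 < b by rewrite divr_gt0// exprn_gt0.
have sqb : Num.sqrt b = s / 2.
  have -> : b = (s / 2) ^+ 2 by rewrite /b; field.
  by rewrite sqrtr_sqr ger0_norm// divr_ge0// ltW.
have q0 l : 0 < 1 + sqnorm3 l by rewrite ltr_pwDl ?sqnorm3_ge0.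
have h2 : `|2^-1 : R| <= 2 by rewrite ger0_norm//; lra.
have w0 v : 0 <= mixw b v by rewrite mulr_ge0 ?expR_ge0.
have mw : measurable_fun setT (mixw b).
  apply: continuous_measurable_fun; apply: contM; apply: cont_comp (@continuous_expR R); apply: contN; first exact: cont_scale.
  apply: contD; apply: contM; try exact: cont_cst; first exact: continuous_expR.
  by apply: cont_comp (@continuous_expR R); exact: opp_continuous.
pose f th' (z : R * (R * R * R)) := cos (ip3 z.2 y + th') * (mixw b z.1 * gauss3 (expR z.1) z.2).
pose f1 (z : R * (R * R * R)) := mixw b z.1 * gauss3 (expR z.1) z.2.
have mg : measurable_fun setT (fun z : R * (R * R * R) => gauss3 (expR z.1) z.2).
  have mE : measurable_fun setT (fun x : R => expR (- x)).
    by apply: continuous_measurable_fun; apply: cont_comp (@continuous_expR R); exact: opp_continuous.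
  have m2 : measurable_fun setT (fun z : R * (R * R * R) => expR z.1 * sqnorm3 z.2).
    apply: measurable_funM.
      exact: (measurableT_comp (continuous_measurable_fun (@continuous_expR R)) measurable_fst).
    exact: (measurableT_comp measurable_sqnorm3 measurable_snd).
  exact: (measurableT_comp mE m2).
have mf1 : measurable_fun setT f1 by apply: measurable_funM; [exact: (measurableT_comp mw measurable_fst)|exact: mg].
have mf t : measurable_fun setT (f t).
  by apply: measurable_funM; [exact: (measurableT_comp (measurable_cos_ip3 y t) measurable_snd)|exact: mf1].
have c1 (a : R) : `|cos a| <= 1 by rewrite ler_norml cos_geN1 cos_le1.
have f10 z : 0 <= f1 z by rewrite mulr_ge0 ?gauss3_ge0.
have ff1 t z : `|f t z| <= f1 z by rewrite normrM [`|_ * gauss3 _ _|]ger0_norm ?f10// ler_piMl ?f10.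
have pe v : Num.sqrt (pi / expR v) ^+ 3 = Num.sqrt pi ^+ 3 * expR (- (3 / 2 * v)) :> R.
  rewrite sqrtrM ?pi_ge0// exprMn sqrtrV ?expR_ge0//; congr (_ * _).
  have -> : Num.sqrt (expR v) = expR (v / 2).
    have -> : expR v = expR (v / 2) ^+ 2 by rewrite -expRM_natl; congr expR; field.
    by rewrite sqrtr_sqr ger0_norm ?expR_ge0.
  by rewrite -expRN -expRM_natl; congr expR; field.
have rows v : leb3.-integrable setT (fun l => (f1 (v, l))%:E) /\ \int[leb3]_l f1 (v, l) =
    Num.sqrt pi ^+ 3 * (expR (- (2 * v)) * expR (- (1 * expR v + b * expR (- v)))).
  have [i e] := gauss3_fourier (0, 0, 0) 0 (expR_gt0 v).
  have cz l : cos (ip3 l (0, 0, 0) + 0) = 1 by rewrite /ip3 /= !mulr0 !addr0 cos0.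
  have ig : leb3.-integrable setT (fun l => (gauss3 (expR v) l)%:E).
    by apply: eq_integrable i => // l _; rewrite cz mul1r.
  split; first exact: (integrableZl _ (mixw b v) ig).
  rewrite /f1 /= RintegralZl//; move: e; under eq_Rintegral do rewrite cz mul1r.
  move=> ->; rewrite cos0 mul1r pe /sqnorm3 /= expr0n /= !addr0 mul0r oppr0 expR0 mulr1.
  rewrite /mixw; have -> : expR (- (2 * v)) = expR (- (2^-1 * v)) * expR (- (3 / 2 * v)).
    by rewrite -expRD; congr expR; field.
  by move: (expR (- (2^-1 * v))) (expR (- (3 / 2 * v))) (expR (- (1 * _ + _))) (Num.sqrt _) => p q r e'; ring.
have h22 : `|2 : R| <= 2 by rewrite ger0_norm.
have [i22 _] := expcosh_integral b0 ltr01 h22.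
have ifm1 : (prodm leb leb3).-integrable setT (EFin \o f1).
  apply: (@integrable_prod _ _ (measurableTypeR R) (measurableTypeR R * measurableTypeR R * measurableTypeR R)%type R leb leb3 f1 mf1).
  exists (fun v => Num.sqrt pi ^+ 3 * (expR (- (2 * v)) * expR (- (1 * expR v + b * expR (- v))))).
    exact: (integrableZl _ _ i22).
  move=> v; have [i e] := rows v; split=> //; rewrite -e.
  by under eq_Rintegral do rewrite ger0_norm ?f10//.
have cols l : leb.-integrable setT (fun v => (f1 (v, l))%:E) /\ \int[leb]_v f1 (v, l) =
    Num.sqrt (pi / b) * expR (- (s * rho1 l)).
  have [i _] := expcosh_integral b0 (q0 l) h2.
  have e1 v : f1 (v, l) = expR (- (2^-1 * v)) * expR (- ((1 + sqnorm3 l) * expR v + b * expR (- v))).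
    by rewrite -mixture_integrand.
  split; first by apply: eq_integrable i => // v _; rewrite e1.
  under eq_Rintegral do rewrite e1.
  rewrite subordination// sqb /rho1; congr (_ * expR _).
  by move: (Num.sqrt _) => r; field.
have ir : leb3.-integrable setT (fun l => (expR (- (s * rho1 l)))%:E).
  apply/integrableP; split; first by apply/measurable_EFinP; exact: measurable_expR_rho1.
  have p0 : 0 < Num.sqrt (pi / b) by rewrite sqrtr_gt0 divr_gt0// pi_gt0.
  under eq_integral do rewrite /= ger0_norm ?expR_ge0//.
  have -> : (\int[leb3]_l (expR (- (s * rho1 l)))%:E =
      ((Num.sqrt (pi / b))^-1)%:E * \int[leb3]_l \int[leb]_v (f1 (v, l))%:E)%E.
    rewrite -ge0_integralZl//.
    - apply: eq_integral => l _; have [i e] := cols l.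
      by rewrite (RintegralE measurableT i) e -EFinM mulKf// gt_eqF.
    - have := (@measurable_fun_fubini_tonelli_G _ _ (measurableTypeR R) (measurableTypeR R * measurableTypeR R * measurableTypeR R)%type R leb (EFin \o f1)).
      apply; first exact/measurable_EFinP.
      by move=> z; rewrite /= lee_fin f10.
    - by move=> l _; apply: integral_ge0 => v _; rewrite lee_fin f10.
  have /integrableP[_] := ifm1.
  under eq_integral do rewrite /= ger0_norm ?f10//.
  move=> hfin; apply: lte_mul_pinfty; rewrite ?lee_fin ?invr_ge0 ?ltW//.
  rewrite -(@fubini_tonelli2 _ _ (measurableTypeR R) (measurableTypeR R * measurableTypeR R * measurableTypeR R)%type R leb leb3 (EFin \o f1))//.
  exact/measurable_EFinP.
split; first exact: ir.
have ifm : (prodm leb leb3).-integrable setT (EFin \o f th).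
  exact: (@integrable_le R _ (measurableTypeR R * (measurableTypeR R * measurableTypeR R * measurableTypeR R))%type (prodm leb leb3) setT (f th) f1 measurableT (mf th) (fun z _ => ff1 th z) ifm1).
have i1 v : leb3.-integrable setT (fun l => (f th (v, l))%:E).
  have [i _] := rows v.
  exact: (integrable_le3 (measurableT_comp (mf th) (pair1_measurable v)) (fun l => ff1 th (v, l)) i).
have i2 l : leb.-integrable setT (fun v => (f th (v, l))%:E).
  have [i _] := cols l.
  exact: (integrable_le1 (measurableT_comp (mf th) (pair2_measurable l)) (fun v => ff1 th (v, l)) i).
have swap := @Rfubini _ _ (measurableTypeR R) (measurableTypeR R * measurableTypeR R * measurableTypeR R)%type R leb leb3 (f th) ifm i1 i2.
have p0 : 0 < Num.sqrt (pi / b) by rewrite sqrtr_gt0 divr_gt0// pi_gt0.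
have L l : \int[leb]_v f th (v, l) = Num.sqrt (pi / b) * (cos (ip3 l y + th) * expR (- (s * rho1 l))).
  have [i e] := cols l.
  by rewrite mulrCA -e -RintegralZl.
pose B := (sqnorm3 y + s ^+ 2) / 4.
have B0 : 0 < B by rewrite divr_gt0// ltr_wpDl ?sqnorm3_ge0// exprn_gt0.
have V v : \int[leb3]_l f th (v, l) = cos th * Num.sqrt pi ^+ 3 * (expR (- (2 * v)) * expR (- (1 * expR v + B * expR (- v)))).
  have [i e] := gauss3_fourier y th (expR_gt0 v).
  have fE l : f th (v, l) = mixw b v * (cos (ip3 l y + th) * gauss3 (expR v) l) by rewrite /f mulrCA.
  under eq_Rintegral do rewrite fE.
  rewrite RintegralZl// e pe /mixw.
  have -> : expR (- (2 * v)) = expR (- (2^-1 * v)) * expR (- (3 / 2 * v)).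
    by rewrite -expRD; congr expR; field.
  have -> : expR (- (1 * expR v + B * expR (- v))) =
      expR (- (1 * expR v + b * expR (- v))) * expR (- (sqnorm3 y / (4 * expR v))).
    rewrite -expRD; congr expR; rewrite /B /b expRN; field; by rewrite gt_eqF ?expR_gt0.
  by move: (expR (- (2^-1 * v))) (expR (- (3 / 2 * v))) (expR (- (1 * _ + _))) (expR (- (sqnorm3 y / _))) (Num.sqrt _) => p q r e' e''; ring.
move: swap; under eq_Rintegral do rewrite V.
have [ib _] := expcosh_integral B0 ltr01 h22.
rewrite RintegralZl//.
rewrite bessel2_integral// sqrtr1 mulr1.
under [RHS]eq_Rintegral do rewrite L.
have ic : leb3.-integrable setT (fun l => (cos (ip3 l y + th) * expR (- (s * rho1 l)))%:E).
  apply: (integrable_le3 (g := fun l => cos (ip3 l y + th) * expR (- (s * rho1 l))) _ _ ir).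
    by apply: measurable_funM; [exact: measurable_cos_ip3|exact: measurable_expR_rho1].
  by move=> l; rewrite normrM [`|expR _|]ger0_norm ?expR_ge0// ler_piMl ?expR_ge0.
rewrite RintegralZl// => h.
apply: (mulfI (lt0r_neq0 p0)); rewrite -h area_kernelE// -/B.
have -> : Num.sqrt (pi / b) = Num.sqrt pi * (2 / s).
  by rewrite sqrtrM ?pi_ge0// sqrtrV ?(ltW b0)// sqb invf_div.
set D := sqnorm3 y + s ^+ 2.
have D0 : D != 0 by rewrite gt_eqF// ltr_wpDl ?sqnorm3_ge0// exprn_gt0.
have -> : 1 / B = 4 / D by rewrite /B -/D invf_div mul1r.
have pp : pi = Num.sqrt pi ^+ 2 :> R by rewrite sqr_sqrtr// pi_ge0.
have ee : expR (- s) * expR s = 1 by rewrite -expRD addNr expR0.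
have alg (K : R) : expR (- s) * (s * expR s * (K / D)) = s * (K / D).
  by rewrite -[RHS]mul1r -ee; move: (expR _) (expR _) => p q; ring.
rewrite alg; move: (Num.sqrt pi) pp (besselK _ _) (cos th) => P -> K c.
by field; rewrite D0 gt_eqF.
Qed.

End Fourier3.

(** * Jacobi polynomials and the characteristic function of the area *)

Section Jacobi.
Context {R : realType}.
Variables (n : nat) (nu : R).
Hypothesis n0 : (0 < n)%N.
Hypothesis nu0 : 0 < nu.

Definition jacA : R := 2 * n%:R + 2 * nu + 1.

Lemma jacA_gt0 : 0 < jacA.
Proof. by rewrite ltr_wpDl// addr_ge0// mulr_ge0// ltW. Qed.

Lemma pochhammer0 (x : R) : pochhammer x 0 = 1.
Proof. by rewrite /pochhammer big_ord0. Qed.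

Lemma pochhammerS (x : R) m : pochhammer x m.+1 = pochhammer x m * (x + m%:R).
Proof. by rewrite /pochhammer big_ord_recr. Qed.

Lemma pochhammer_gt0 (x : R) m : 0 < x -> 0 < pochhammer x m.
Proof. by move=> x0; apply: prodr_gt0 => i _; rewrite ltr_pwDl. Qed.

Lemma twon_gt0 : 0 < 2 * n%:R :> R.
Proof. by rewrite mulr_gt0// ltr0n. Qed.

Definition jacobi_coef (j m : nat) : R :=
  (-1) ^+ m * 'C(j, m)%:R * pochhammer (j%:R + jacA) m / pochhammer (2 * n%:R) m.

Lemma jac0 j : jacobi_coef j 0 = 1.
Proof. by rewrite /jacobi_coef !pochhammer0 bin0 expr0 !mul1r invr1. Qed.

Lemma jacS j m : jacobi_coef j m.+1 * (m.+1%:R * (m%:R + 2 * n%:R)) =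
  jacobi_coef j m * ((m%:R - j%:R) * (m%:R + j%:R + jacA)).
Proof.
rewrite /jacobi_coef !pochhammerS exprS.
have p0 : pochhammer (2 * n%:R) m != 0 :> R by rewrite gt_eqF// pochhammer_gt0// twon_gt0.
have q0 : 2 * n%:R + m%:R != 0 :> R by rewrite gt_eqF// ltr_pwDl// twon_gt0.
have bE : 'C(j, m.+1)%:R * m.+1%:R = 'C(j, m)%:R * (j%:R - m%:R) :> R.
  have [jm|mj] := ltnP j m.
    by rewrite !bin_small// ?mul0r//; exact: leqW.
  by rewrite -natrB// -!natrM mulnC mul_bin_left mulnC.
move: ('C(j, m.+1)%:R) ('C(j, m)%:R) (m.+1%:R) bE => b b' m1 bE.
have -> : -1 * (-1) ^+ m * b * (pochhammer (j%:R + jacA) m * (j%:R + jacA + m%:R)) /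
    (pochhammer (2 * n%:R) m * (2 * n%:R + m%:R)) * (m1 * (m%:R + 2 * n%:R)) =
    - (-1) ^+ m * (b * m1) * (pochhammer (j%:R + jacA) m * (j%:R + jacA + m%:R)) / pochhammer (2 * n%:R) m.
  by field; rewrite p0 q0.
by rewrite bE; field.
Qed.

Definition jacP (j : nat) : {poly R} := \poly_(m < j.+1) jacobi_coef j m.

Lemma coef_jacP j m : (jacP j)`_m = jacobi_coef j m.
Proof.
rewrite coef_poly; case: ltnP => // jm.
by rewrite /jacobi_coef bin_small// mulr0 !mul0r.
Qed.

Lemma jacP_ode j : 'X * (1 - 'X) * (jacP j)^`()^`() +
  ((2 * n%:R)%:P - (jacA + 1)%:P * 'X) * (jacP j)^`() + (j%:R * (j%:R + jacA))%:P * jacP j = 0.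
Proof.
set q := jacP j.
have -> : 'X * (1 - 'X) * q^`()^`() + ((2 * n%:R)%:P - (jacA + 1)%:P * 'X) * q^`() + (j%:R * (j%:R + jacA))%:P * q =
   'X * q^`()^`() - 'X * ('X * q^`()^`()) + (2 * n%:R)%:P * q^`() - (jacA + 1)%:P * ('X * q^`()) + (j%:R * (j%:R + jacA))%:P * q.
  ring.
have c1 (i : nat) : ('X * q^`()^`())`_i = i%:R * (i.+1%:R * q`_i.+1).
  rewrite coefXM; case: i => [|i]; first by rewrite mul0r.
  by rewrite !coef_deriv /= !mulr_natl.
have c2 (i : nat) : ('X * ('X * q^`()^`()))`_i = i%:R * ((i%:R - 1) * q`_i).
  rewrite coefXM; case: i => [|i]; first by rewrite mul0r.
  by rewrite c1 /= mulrCA -[i.+1%:R - 1]/(i.+1%:R - 1%:R) -natrB// subSS subn0.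
have c3 (i : nat) : ('X * q^`())`_i = i%:R * q`_i.
  by rewrite coefXM; case: i => [|i]; [rewrite mul0r|rewrite coef_deriv mulr_natl].
apply/polyP => i.
rewrite coefD coefB coefD coefB !coefCM c1 c2 c3 coef_deriv coef0 -(mulr_natl q`_i.+1).
have := jacS j i; rewrite -!coef_jacP -/q -natr1.
move: (q`_i) (q`_i.+1) => a b h.
have -> : i%:R * ((i%:R + 1) * b) - i%:R * ((i%:R - 1) * a) + 2 * n%:R * ((i%:R + 1) * b) - (jacA + 1) * (i%:R * a) + j%:R * (j%:R + jacA) * a =
   b * ((i%:R + 1) * (i%:R + 2 * n%:R)) - a * ((i%:R - j%:R) * (i%:R + j%:R + jacA)) by ring.
by rewrite h subrr.
Qed.

Lemma Dk_horner k (q : {poly R}) (f : R -> R) : Dk k f -> Dk k (fun x => q.[f x]).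
Proof.
move=> Df; under eq_fun do rewrite horner_coef.
by apply: Dk_sum => i; apply: DkM; [exact: Dk_cst|exact: DkX].
Qed.

Lemma Dk_ln k : Dk k (@ln R).
Proof.
case: k => [|k]; first by split=> // x x0; have [] := is_derive1_ln x0.
apply: (@Dk_is_derive _ _ _ (fun x : R => x^-1) (fun x x0 => is_derive1_ln x0)).
by apply: DkV; [move=> x x0; rewrite gt_eqF|exact: Dk_id].
Qed.

Definition vpow (v : R) : R := expR (- nu * ln v).

Lemma Dk_vpow k : Dk k vpow.
Proof.
have Df : Dk k (fun v : R => - nu * ln v) by apply: DkM; [exact: Dk_cst|exact: Dk_ln].
exact: (Dk_comp (G := fun=> @expR R) (fun i x x0 => is_derive_expR _) Df 0%N).
Qed.

Lemma is_derive_vpow (v : R) : 0 < v -> is_derive v 1 vpow (- nu / v * vpow v).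
Proof.
move=> v0; have := is_derive_comp1 (is_deriveZ (- nu) (is_derive1_ln v0)) (is_derive_expR _).
by move=> h; apply: is_derive_eq h _; rewrite /GRing.scale /= mulrC.
Qed.

Lemma is_derive_hornerz (q : {poly R}) (v : R) : 0 < v ->
  is_derive v 1 (fun v => q.[1 - v^-1]) (q^`().[1 - v^-1] * v^-1 ^+ 2).
Proof.
move=> v0; have v0' : v != 0 by rewrite gt_eqF.
have d1 := is_deriveB (is_derive_cst (1 : R) v 1) (is_deriveV1 v0').
by apply: is_derive_eq (is_derive_comp1 d1 (is_derive_poly q _)) _; rewrite sub0r opprK.
Qed.

Definition jacH (q : {poly R}) (v : R) : R := vpow v * q.[1 - v^-1].

Definition jacH1 (q : {poly R}) (v : R) : R :=
  vpow v * (- nu * v^-1 * q.[1 - v^-1] + v^-1 ^+ 2 * q^`().[1 - v^-1]).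

Definition jacH2 (q : {poly R}) (v : R) : R :=
  vpow v * (nu * (nu + 1) * v^-1 ^+ 2 * q.[1 - v^-1] - (2 * nu + 2) * v^-1 ^+ 3 * q^`().[1 - v^-1]
    + v^-1 ^+ 4 * q^`()^`().[1 - v^-1]).

Lemma Dinf_jacH q : Dinf (jacH q).
Proof.
move=> k; apply: DkM; first exact: Dk_vpow.
apply: Dk_horner; apply: DkD; first exact: Dk_cst.
apply: (Dk_ext (f := fun x : R => -1 * x^-1)); first by move=> x _; rewrite mulN1r.
apply: DkM; first exact: Dk_cst.
by apply: DkV; [move=> x x0; rewrite gt_eqF|exact: Dk_id].
Qed.

Lemma is_derive_jacH q (v : R) : 0 < v -> is_derive v 1 (jacH q) (jacH1 q v).
Proof.
move=> v0; apply: is_derive_eq (is_deriveM (is_derive_vpow v0) (is_derive_hornerz q v0)) _.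
rewrite /jacH1 /GRing.scale /=.
by move: (vpow v) (q.[1 - v^-1]) (q^`().[1 - v^-1]) => a b c; ring.
Qed.

Lemma is_derive_jacH1 q (v : R) : 0 < v -> is_derive v 1 (jacH1 q) (jacH2 q v).
Proof.
move=> v0; have v0' : v != 0 by rewrite gt_eqF.
have dV := is_deriveV1 v0'.
have dV2 := @is_deriveX _ _ (fun x : R => x^-1) 2 v 1 _ dV.
rewrite exprfctE in dV2.
have h := is_deriveM (is_derive_vpow v0) (is_deriveD
  (is_deriveM (is_deriveZ (- nu) dV) (is_derive_hornerz q v0))
  (is_deriveM dV2 (is_derive_hornerz q^`() v0))).
apply: is_derive_eq h _.
change (vpow v * (- nu * v^-1 * (q^`().[1 - v^-1] * v^-1 ^+ 2) + q.[1 - v^-1] * (- nu * - v^-1 ^+ 2) +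
   (v^-1 ^+ 2 * (q^`()^`().[1 - v^-1] * v^-1 ^+ 2) + q^`().[1 - v^-1] * (2 * v^-1 ^+ 1 * - v^-1 ^+ 2))) +
  (- nu * v^-1 * q.[1 - v^-1] + v^-1 ^+ 2 * q^`().[1 - v^-1]) * (- nu / v * vpow v) = jacH2 q v).
rewrite /jacH2; move: (vpow v) (q.[1 - v^-1]) (q^`().[1 - v^-1]) (q^`()^`().[1 - v^-1]) => a b c d.
ring.
Qed.

Lemma jacH_ode j (v : R) : 1 <= v ->
  2 * v ^+ 2 * (v - 1) * jacH2 (jacP j) v + 4 * n%:R * v * jacH1 (jacP j) v
  - 2^-1 * (4 * nu * (nu + 1) * (v - 1) * jacH (jacP j) v) =
  - (4 * n%:R * nu + 2 * j%:R * (j%:R + jacA)) * jacH (jacP j) v.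
Proof.
move=> v1; have v0 : v != 0 by rewrite gt_eqF// (lt_le_trans ltr01).
have : (1 - v^-1) * (1 - (1 - v^-1)) * (jacP j)^`()^`().[1 - v^-1] +
   (2 * n%:R - (jacA + 1) * (1 - v^-1)) * (jacP j)^`().[1 - v^-1] +
   j%:R * (j%:R + jacA) * (jacP j).[1 - v^-1] = 0.
  have := congr1 (fun q => q.[1 - v^-1]) (jacP_ode j).
  by rewrite -[1 - 'X]/(1%:P - 'X) !(hornerD, hornerN, hornerM, hornerC, hornerX).
rewrite /jacH /jacH1 /jacH2 /jacA.
move: (vpow v) ((jacP j).[1 - v^-1]) ((jacP j)^`().[1 - v^-1]) ((jacP j)^`()^`().[1 - v^-1]) => e a b c h.
apply/eqP; rewrite -subr_eq0; apply/eqP; rewrite -[RHS](mulr0 (2 * e)) -h.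
by field.
Qed.

Lemma vpow_ge0 v : 0 <= vpow v. Proof. exact: expR_ge0. Qed.

Lemma vpow_le1 v : 1 <= v -> vpow v <= 1.
Proof.
move=> v1; rewrite -expR0 ler_expR mulNr oppr_le0 mulr_ge0 ?(ltW nu0)// ln_ge0//.
Qed.

Lemma vpow_small (eps : R) : 0 < eps -> exists2 r : R, 1 <= r & forall v, r <= v -> vpow v <= eps.
Proof.
move=> eps0; exists (Num.max 1 (expR (- ln eps / nu))); first by rewrite le_max lexx.
move=> v; rewrite ge_max => /andP[v1 ve].
have v0 : 0 < v by exact: lt_le_trans v1.
rewrite -[leRHS]lnK ?posrE// ler_expR mulNr lerNl mulrC -ler_pdivrMr//.
by rewrite -[leLHS]expRK ler_ln ?posrE ?expR_gt0.
Qed.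

Lemma horner_bound (q : {poly R}) : exists2 B : R, 0 <= B & forall v : R, 1 <= v -> `|q.[1 - v^-1]| <= B.
Proof.
exists (\sum_(i < size q) `|q`_i|); first exact: sumr_ge0.
move=> v v1; have v0 : 0 < v by exact: lt_le_trans v1.
rewrite horner_coef; apply: le_trans (ler_norm_sum _ _ _) _; apply: ler_sum => i _.
rewrite normrM ler_piMr// normrX exprn_ile1// ger0_norm ?subr_ge0 ?invf_le1//.
by rewrite gerBl invr_ge0 ltW.
Qed.

Lemma jacH_bound q : exists B : R, forall v, 1 <= v -> `|jacH q v| <= B.
Proof.
have [B B0 hB] := horner_bound q; exists B => v v1.
rewrite normrM (ger0_norm (vpow_ge0 _)); apply: le_trans (hB v v1).
by rewrite ler_piMl// vpow_le1.
Qed.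

Lemma jacH_decay q (eps : R) : 0 < eps -> exists2 r : R, 1 <= r &
  forall v, r <= v -> `|jacH q v| <= eps /\ `|v * jacH1 q v| <= eps.
Proof.
move=> eps0; have [B B0 hB] := horner_bound q; have [B' B'0 hB'] := horner_bound q^`().
pose M := (1 + nu) * B + B' + 1.
have M0 : 0 < M by rewrite ltr_wpDl// addr_ge0// mulr_ge0// addr_ge0// ltW.
have [r r1 hr] := vpow_small (divr_gt0 eps0 M0).
exists r => // v rv; have v1 := le_trans r1 rv; have v0 : 0 < v by exact: lt_le_trans v1.
have b := hB v v1; have b' := hB' v v1.
have key x : `|x| <= M -> `|vpow v * x| <= eps.
  move=> xM; rewrite normrM (ger0_norm (vpow_ge0 _)).
  have -> : eps = eps / M * M by rewrite divfK// gt_eqF.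
  by apply: ler_pM => //; [exact: vpow_ge0|exact: hr].
have nB : 0 <= nu * B by rewrite mulr_ge0// ltW.
split; first by apply: key; apply: le_trans b _; rewrite /M; lra.
rewrite /jacH1 mulrCA; apply: key.
have -> : v * (- nu * v^-1 * q.[1 - v^-1] + v^-1 ^+ 2 * q^`().[1 - v^-1]) =
   - nu * q.[1 - v^-1] + v^-1 * q^`().[1 - v^-1].
  by move: (q.[_]) (q^`().[_]) => a c; field; rewrite gt_eqF.
apply: le_trans (ler_normD _ _) _; rewrite !normrM normrN (gtr0_norm nu0).
have i1 : nu * `|q.[1 - v^-1]| <= nu * B by rewrite ler_pM2l.
have i2 : `|v^-1| * `|q^`().[1 - v^-1]| <= B'.
  apply: le_trans b'; rewrite ler_piMl// ger0_norm ?invf_le1// invr_ge0 ltW//.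
by rewrite /M; move: i1 i2; move: (nu * `|_|) (`|v^-1| * _) => p p' i1 i2; lra.
Qed.

End Jacobi.

Section Combinatorics.
Context {R : realType}.
Implicit Types (x a c : R).

Lemma pochhammer_cat x p q : pochhammer x (p + q) = pochhammer x p * pochhammer (x + p%:R) q.
Proof.
elim: q => [|q IH]; first by rewrite addn0 pochhammer0 mulr1.
by rewrite addnS !pochhammerS IH -mulrA natrD addrA.
Qed.

Lemma pochhammerSl x m : pochhammer x m.+1 = x * pochhammer (x + 1) m.
Proof. by rewrite -add1n pochhammer_cat pochhammerS pochhammer0 mul1r addr0. Qed.

Lemma pochhammer_nat (b i : nat) : pochhammer (b.+1%:R : R) i * b`!%:R = (b + i)`!%:R.
Proof.
elim: i => [|i IH]; first by rewrite pochhammer0 mul1r addn0.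
by rewrite pochhammerS mulrAC IH addnS factS natrM mulrC -natrD addSn.
Qed.

Lemma pochhammer_ge0 x m : 0 <= x -> 0 <= pochhammer x m.
Proof. by move=> x0; apply: prodr_ge0 => i _; rewrite addr_ge0. Qed.

Lemma pochhammer_le x y m : 0 <= x -> x <= y -> pochhammer x m <= pochhammer y m.
Proof.
move=> x0 xy; apply: ler_prod => i _; by rewrite addr_ge0//= lerD2r.
Qed.

Lemma alternating_sum a N : 0 < a ->
  \sum_(0 <= r < N.+1) (-1) ^+ r * 'C(N, r)%:R * (2 * r%:R + a) / pochhammer (r%:R + a) N.+1 = (N == 0%N)%:R.
Proof.
move=> a0; case: N => [|N].
  rewrite big_nat1 expr0 bin0 mulr0 !add0r !mul1r pochhammerS pochhammer0 mul1r addr0.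
  by rewrite divff// gt_eqF.
pose U (r : nat) := if r is s.+1 then (-1) ^+ s * 'C(N, s)%:R / pochhammer (s.+1%:R + a) N.+1 else 0.
rewrite (eq_big_nat _ _ (F2 := fun r => U r.+1 - U r)); last first.
  move=> r _; rewrite /U.
  case: r => [|s].
    rewrite !bin0 !expr0 mulr0 !add0r !mul1r subr0 pochhammerSl addrC.
    by rewrite invfM mulrA divff ?mul1r// gt_eqF.
  have ra (k : nat) : 0 < s.+1%:R + a + k%:R by rewrite ltr_wpDr// ltr_wpDl.
  have Q0 : 0 < pochhammer (s.+1%:R + a) N.+1.
    by have := ra 0%N; rewrite addr0 => h; rewrite pochhammer_gt0.
  have e2 : pochhammer (s.+2%:R + a) N.+1 = pochhammer (s.+1%:R + a) N.+1 * (s.+1%:R + a + N.+1%:R) / (s.+1%:R + a).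
    rewrite -pochhammerS (pochhammerSl _ N.+1) [_ * pochhammer _ _]mulrC mulfK; last first.
      by have := ra 0%N; rewrite addr0 => h; rewrite gt_eqF.
    by congr pochhammer; rewrite -[in LHS]natr1 addrAC.
  rewrite pochhammerS e2.
  have e3 : 'C(N.+1, s.+1)%:R * (2 * s.+1%:R + a) =
     'C(N, s.+1)%:R * (s.+1%:R + a) + 'C(N, s)%:R * (s.+1%:R + a + N.+1%:R) :> R.
    have d : N.+1%:R * 'C(N, s)%:R = s.+1%:R * 'C(N.+1, s.+1)%:R :> R.
      by rewrite -!natrM mul_bin_diag.
    have -> : 'C(N, s)%:R * (s.+1%:R + a + N.+1%:R) = 'C(N, s)%:R * (s.+1%:R + a) + N.+1%:R * 'C(N, s)%:R :> R by ring.
    rewrite d binS natrD; move: (s.+1%:R : R) => z; ring.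
  have := ra 0%N; have := ra N.+1; rewrite addr0 !exprS.
  rewrite -[(-1 * (-1) ^+ s) * _ * _]mulrA e3.
  set c1 : R := 'C(N, s.+1)%:R; set c2 : R := 'C(N, s)%:R.
  move: (pochhammer _ _) Q0 c1 c2 ((-1) ^+ s) => Q Q0 c1 c2 g.
  move: (s.+1%:R : R) (N.+1%:R : R) => z y h1 h2.
  by field; rewrite !gt_eqF.
by rewrite telescope_sumr// /U bin_small// mulr0 mul0r subr0.
Qed.

End Combinatorics.

Section Inversion.
Context {R : realType}.
Variables (n : nat) (nu : R).
Hypothesis n0 : (0 < n)%N.
Hypothesis nu0 : 0 < nu.
Notation A := (jacA n nu).
Notation jacobi := (jacobi_coef n nu).
Notation P := (jacP n nu).
Let A0 : 0 < A := jacA_gt0 n nu0.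

Definition jinv (m j : nat) : R :=
  (-1) ^+ j * 'C(m, j)%:R * pochhammer (2 * n%:R) m * (2 * j%:R + A) / pochhammer (j%:R + A) m.+1.

Lemma bin_trinomial (m r i : nat) : (r + i <= m)%N ->
  ('C(m, r + i) * 'C(r + i, i) = 'C(m, i) * 'C(m - i, r))%N.
Proof.
move=> rim.
have im : (i <= m)%N by exact: leq_trans (leq_addl _ _) rim.
have rmi : (r <= m - i)%N by rewrite leq_subRL// addnC.
have F (k : nat) : (0 < k`!)%N by exact: fact_gt0.
have e1 := bin_fact rim; have e2 := bin_fact (leq_addl r i); have e3 := bin_fact im.
have e4 := bin_fact rmi.
apply/eqP; rewrite -(eqn_pmul2r (F (m - (r + i))%N)) -(eqn_pmul2r (F r)) -(eqn_pmul2r (F i)); apply/eqP.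
rewrite addnK in e2.
have -> : ('C(m, r + i) * 'C(r + i, i) * (m - (r + i))`! * r`! * i`! =
   'C(m, r + i) * ('C(r + i, i) * (i`! * r`!) * (m - (r + i))`!))%N by lia.
rewrite e2 e1 -e3 -e4; have -> : (m - i - r = m - (r + i))%N by lia.
lia.
Qed.

Lemma jac_inversion (m i : nat) : \sum_(0 <= j < m.+1) jinv m j * jacobi j i = (m == i)%:R.
Proof.
have jac_small j : (j < i)%N -> jacobi j i = 0.
  by move=> ji; rewrite /jacobi_coef bin_small// mulr0 !mul0r.
have [mi|im] := ltnP m i.
  rewrite big_nat_cond big1; first by rewrite ltn_eqF.
  move=> j /andP[/andP[_ jm] _]; rewrite jac_small ?mulr0//.
  by rewrite (leq_trans jm).
rewrite (@big_cat_nat _ _ _ i)//=; last exact: leqW.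
rewrite big_nat_cond big1 ?add0r; last first.
  by move=> j /andP[/andP[_ ji] _]; rewrite jac_small ?mulr0.
rewrite -{1}[i]add0n big_addn subSn//.
pose K : R := pochhammer (2 * n%:R) m / pochhammer (2 * n%:R) i * 'C(m, i)%:R.
have a0 : 0 < 2 * i%:R + A by rewrite ltr_wpDl// mulr_ge0.
rewrite (eq_big_nat _ _ (F2 := fun r => K * ((-1) ^+ r * 'C(m - i, r)%:R * (2 * r%:R + (2 * i%:R + A)) /
    pochhammer (r%:R + (2 * i%:R + A)) (m - i).+1))); last first.
  move=> r /andP[_ rm]; rewrite ltnS in rm.
  have rim : (r + i <= m)%N by rewrite addnC -leq_subRL.
  have bt : 'C(m, r + i)%:R * 'C(r + i, i)%:R = 'C(m, i)%:R * 'C(m - i, r)%:R :> R.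
    by rewrite -!natrM bin_trinomial.
  have pA : pochhammer ((r + i)%:R + A) m.+1 = pochhammer ((r + i)%:R + A) i * pochhammer (r%:R + (2 * i%:R + A)) (m - i).+1.
    rewrite -{1}(subnKC im) -addnS pochhammer_cat; congr (_ * pochhammer _ _).
    by rewrite natrD; ring.
  have p1 : pochhammer ((r + i)%:R + A) i != 0 by rewrite gt_eqF// pochhammer_gt0// ltr_wpDl.
  have p2 : pochhammer (r%:R + (2 * i%:R + A)) (m - i).+1 != 0.
    by rewrite gt_eqF// pochhammer_gt0// ltr_wpDl.
  have p3 : pochhammer (2 * n%:R) i != 0 :> R by rewrite gt_eqF// pochhammer_gt0// twon_gt0.
  have sg : (-1) ^+ (r + i) * (-1) ^+ i = (-1) ^+ r :> R.
    by rewrite exprD -mulrA -exprD addnn -mul2n exprM sqrrN !expr1n mulr1.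
  rewrite /jinv /jacobi_coef /K pA.
  have -> : 2 * (r + i)%:R + A = 2 * r%:R + (2 * i%:R + A) by rewrite natrD; ring.
  have -> : (-1) ^+ r = (-1) ^+ (r + i) * (-1) ^+ i :> R by [].
  move: (pochhammer (2 * n%:R) i) p3 (pochhammer _ i) p1 (pochhammer (r%:R + _) _) p2 (pochhammer (2 * n%:R) m) => p3 q3 p1 q1 p2 q2 p4.
  move: bt; move: ('C(m, r + i)%:R) ('C(r + i, i)%:R) ('C(m, i)%:R) ('C(m - i, r)%:R) => b1 b2 b3 b4 bt.
  have -> : p4 / p3 * b3 * ((-1) ^+ (r + i) * (-1) ^+ i * b4 * (2 * r%:R + (2 * i%:R + A)) / p2) =
     p4 / p3 * (b3 * b4) * ((-1) ^+ (r + i) * (-1) ^+ i * (2 * r%:R + (2 * i%:R + A)) / p2) by ring.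
  by rewrite -bt; move: ((-1) ^+ (r + i)) ((-1) ^+ i) => s1 s2; field; rewrite q1 q2 q3.
rewrite -mulr_sumr alternating_sum// subn_eq0.
have [e|ne] := eqVneq m i.
  rewrite e leqnn mulr1 /K e binn mulr1 divff// gt_eqF// pochhammer_gt0// twon_gt0//.
by rewrite leqNgt ltn_neqAle eq_sym ne im mulr0.
Qed.

Lemma jacX m : 'X^m = \sum_(0 <= j < m.+1) jinv m j *: P j :> {poly R}.
Proof.
apply/polyP => i; rewrite coefXn coef_sum eq_sym -jac_inversion.
by apply: eq_bigr => j _; rewrite coefZ coef_jacP.
Qed.

End Inversion.

Section Sequences.
Context {R : realType}.

Lemma ratio_cvg0 (u : nat -> R) (q : R) (N : nat) : (forall k, 0 <= u k) -> 0 <= q -> q < 1 ->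
  (forall k, (N <= k)%N -> u k.+1 <= q * u k) -> u k @[k --> \oo] --> 0.
Proof.
move=> u0 q0 q1 h.
have b k : u (k + N)%N <= q ^+ k * u N.
  elim: k => [|k IH]; first by rewrite add0n expr0 mul1r.
  rewrite addSn; apply: le_trans (h _ (leq_addl _ _)) _.
  by rewrite exprS -mulrA ler_wpM2l.
rewrite -(cvg_shiftn N); apply: (@squeeze_cvgr _ _ _ _ (fun=> 0) (fun k => q ^+ k * u N)).
- by apply: nearW => k; rewrite u0 b.
- exact: cvg_cst.
- rewrite -(mul0r (u N)); apply: cvgM; last exact: cvg_cst.
  by apply: cvg_expr; rewrite ger0_norm.
Qed.

Lemma tannery (f : nat -> nat -> R) (c B : nat -> R) :
  (forall M j, `|f M j| <= B j) -> (forall j, f M j @[M --> \oo] --> c j) ->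
  cvgn (series B) ->
  cvgn (series c) /\ \sum_(0 <= j < M) f M j @[M --> \oo] --> limn (series c).
Proof.
move=> fB fc cB.
have B0 j : 0 <= B j by apply: le_trans (fB 0%N j).
have cBj j : `|c j| <= B j.
  have h : `|f M j| @[M --> \oo] --> `|c j| by apply: cvg_norm; exact: fc.
  rewrite -(cvg_lim (@Rhausdorff R) h); apply: limr_le; first by apply/cvg_ex; exists `|c j|.
  exact: nearW.
have cc : cvgn (series c).
  apply: normed_cvg; exact: (series_le_cvg (fun j => normr_ge0 (c j)) B0 cBj cB).
split=> //.
have ndB M J : (J <= M)%N -> \sum_(J <= j < M) B j = series B M - series B J.
  by move=> JM; rewrite /series /= (@big_cat_nat _ _ _ J 0 M)//= addrAC subrr add0r.
have lB J : series B J <= limn (series B).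
  apply: nondecreasing_cvgn_le => //; apply/nondecreasing_seqP => k.
  by rewrite /series /= big_nat_recr//= lerDl.
have d0 : (\sum_(0 <= j < M) f M j - series c M) @[M --> \oo] --> 0.
  apply/cvgrPdist_le => e e0.
  have e4 : 0 < e / 4 by rewrite divr_gt0.
  have /cvgrPdist_le/(_ _ e4)[J _ hJ] := cB.
  have := hJ J (leqnn J); rewrite /= => {}hJ.
  have fin : (\sum_(0 <= j < J) `|f M j - c j|) @[M --> \oo] --> 0.
    have h j : `|f M j - c j| @[M --> \oo] --> 0.
      rewrite -(normr0 R) -(subrr (c j)); apply: cvg_norm.
      by apply: cvgB; [exact: fc|exact: cvg_cst].
    elim: {hJ} J => [|J IH].
      by under eq_cvg do rewrite big_nil; exact: cvg_cst.
    rewrite (_ : (fun M => \sum_(0 <= j < J.+1) `|f M j - c j|) =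
      (fun M => \sum_(0 <= j < J) `|f M j - c j|) \+ (fun M => `|f M J - c J|)); last first.
      by apply/funext => M; rewrite big_nat_recr.
    have hJ := cvgD IH (h J); rewrite addr0 in hJ; exact: hJ.
  have e2 : 0 < e / 2 by rewrite divr_gt0.
  have /cvgrPdist_le/(_ _ e2) fin' := fin.
  near=> M; rewrite sub0r normrN /series /= -sumrB.
  have JM : (J <= M)%N by near: M; exact: nbhs_infty_ge.
  rewrite (@big_cat_nat _ _ _ J 0 M)//=; apply: le_trans (ler_normD _ _) _.
  have -> : e = e / 2 + e / 2 by field.
  apply: lerD.
    apply: le_trans (ler_norm_sum _ _ _) _.
    have : `|0 - \sum_(0 <= j < J) `|f M j - c j| | <= e / 2 by near: M.
    by rewrite sub0r normrN ger0_norm// sumr_ge0.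
  apply: le_trans (ler_norm_sum _ _ _) _.
  apply: (@le_trans _ _ (\sum_(J <= j < M) (2 * B j))).
    apply: ler_sum => j _; apply: le_trans (ler_normB _ _) _.
    by rewrite mulr_natl mulr2n lerD.
  rewrite -mulr_sumr ndB//.
  have := lB M; have := ler_norm (limn (series B) - series B J); move: hJ; lra.
have h := cvgD d0 cc; rewrite add0r in h.
rewrite (_ : (fun M => _) = (fun M => \sum_(0 <= j < M) f M j - series c M) + series c); first exact: h.
by apply/funext => M; rewrite fctE subrK.
Unshelve. all: by end_near.
Qed.

End Sequences.

Section Gauss.
Context {R : realType}.
Implicit Types (a c : R).

Definition gterm a c (b i : nat) : R :=
  pochhammer a i * pochhammer b%:R i / (pochhammer c i * i`!%:R).

Let V a c (b i : nat) : R :=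
  if i is k.+1 then (c + k%:R) * (pochhammer a k.+1 / pochhammer c k.+1) * (pochhammer b.+1%:R k / k`!%:R) else 0.

Let gterm_step a c (b i : nat) : 0 < a -> 0 < c ->
  (c - a - b%:R - 1) * gterm a c b.+1 i - (c - b%:R - 1) * gterm a c b i = V a c b i - V a c b i.+1.
Proof.
move=> a0 c0.
have cp k : 0 < c + k%:R by rewrite ltr_wpDr.
have pc k : 0 < pochhammer c k by exact: pochhammer_gt0.
case: i => [|k].
  rewrite /gterm /V !pochhammer0 fact0 !pochhammerS !pochhammer0 !addr0 !mul1r !invr1 !mulr1 sub0r.
  by field; rewrite gt_eqF.
have b1 : pochhammer b.+1%:R k.+1 = pochhammer b.+1%:R k * (b.+1%:R + k%:R) :> R by rewrite pochhammerS.
have b2 : pochhammer b%:R k.+1 = b%:R * pochhammer b.+1%:R k :> R by rewrite pochhammerSl natr1.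
rewrite /gterm /V b1 b2 (pochhammerS a k.+1) (pochhammerS c k.+1) factS natrM.
have f0 : 0 < k`!%:R :> R by rewrite ltr0n fact_gt0.
have c1 := pc k.+1; have k1 : 0 < k.+1%:R :> R by rewrite ltr0n.
move: (cp k) (cp k.+1); rewrite -[k.+1%:R]natr1 -[b.+1%:R]natr1 in k1 *.
move: (pochhammer a k.+1) (pochhammer c k.+1) c1 (pochhammer _ k) (k`!%:R) f0 => p q q0 s f f0.
by move=> h1 h2; field; rewrite !gt_eqF.
Qed.

Let V_cvg0 a c (b : nat) : 0 < a -> a + b%:R + 3 <= c -> V a c b M @[M --> \oo] --> 0.
Proof.
move=> a0 hc.
have ab0 : 0 < a + b%:R + 3 by rewrite ltr_wpDl// addr_ge0// ltW.
have c0 : 0 < c by exact: lt_le_trans hc.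
pose K := pochhammer a (b + 3) / b`!%:R * (c + 1).
have p0 (x : R) m : 0 < x -> 0 < pochhammer x m by exact: pochhammer_gt0.
have f0 m : 0 < m`!%:R :> R by rewrite ltr0n fact_gt0.
rewrite -(@cvg_shiftS _ (V a c b)).
apply: (@squeeze_cvgr _ _ _ _ (fun=> 0) (fun k => K * harmonic k)); last 2 first.
- exact: cvg_cst.
- by rewrite -(mulr0 K); apply: cvgM; [exact: cvg_cst|exact: cvg_harmonic].
apply: nearW => k.
have -> : [sequence V a c b n.+1]_n k = (c + k%:R) * (pochhammer a k.+1 / pochhammer c k.+1) * (pochhammer b.+1%:R k / k`!%:R) by [].
have cp : 0 < c + k%:R by rewrite ltr_wpDr.
have b10 : 0 < b.+1%:R :> R by rewrite ltr0n.
have k10 : 0 < k.+1%:R :> R by rewrite ltr0n.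
have nn (x : R) m : 0 < x -> 0 <= pochhammer x m by move=> x0; exact/ltW/p0.
apply/andP; split.
  by apply: mulr_ge0; [apply: mulr_ge0; [exact: ltW|]|]; apply: divr_ge0 => //; exact: nn.
have e1 : pochhammer b.+1%:R k / k`!%:R = pochhammer k.+1%:R b / b`!%:R :> R.
  apply/eqP; rewrite eqr_div ?lt0r_neq0//; apply/eqP.
  by rewrite !pochhammer_nat addnC.
have ak : 0 < a + k.+1%:R by rewrite addr_gt0.
have e2 : pochhammer a k.+1 / pochhammer (a + b%:R + 3) k.+1 = pochhammer a (b + 3) / pochhammer (a + k.+1%:R) (b + 3).
  apply/eqP; rewrite eqr_div ?lt0r_neq0 ?p0//; apply/eqP.
  have -> : a + b%:R + 3 = a + (b + 3)%:R by rewrite natrD; ring.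
  by rewrite -!pochhammer_cat addnC.
have i1 : pochhammer a k.+1 / pochhammer c k.+1 <= pochhammer a (b + 3) / pochhammer (a + k.+1%:R) (b + 3).
  rewrite -e2 ler_pM2l ?p0// lef_pV2 ?posrE ?p0//.
  by apply: pochhammer_le => //; exact: ltW.
have i2 : pochhammer k.+1%:R b * k.+1%:R ^+ 3 <= pochhammer (a + k.+1%:R) (b + 3).
  rewrite pochhammer_cat; apply: ler_pM.
  - exact: ltW (p0 _ _ _).
  - by rewrite exprn_ge0// ltW.
  - by apply: pochhammer_le; [exact: ltW|rewrite lerDr ltW].
  have h0 : k.+1%:R <= a + k.+1%:R + b%:R by rewrite addrAC lerDr addr_ge0// ltW.
  rewrite 3!pochhammerS pochhammer0 mul1r addr0 !exprS expr0 mulr1 mulrA.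
  have h (m : nat) : k.+1%:R <= a + k.+1%:R + b%:R + m%:R by rewrite (le_trans h0)// lerDl.
  by rewrite !ler_pM// ?mulr_ge0// ltW.
rewrite e1.
have -> : K * harmonic k = (c + 1) * k.+1%:R * (pochhammer a (b + 3) / (pochhammer k.+1%:R b * k.+1%:R ^+ 3)) * (pochhammer k.+1%:R b / b`!%:R) * k.+1%:R.
  rewrite /K /harmonic /=; have := p0 k.+1%:R b k10; have := f0 b.
  move: (pochhammer k.+1%:R b) (pochhammer a _) (b`!%:R); move: (k.+1%:R : R) k10 => w w0 x y z z0 x0.
  by field; rewrite !gt_eqF.
have q0 : 0 <= pochhammer k.+1%:R b / b`!%:R :> R by rewrite divr_ge0// ltW// p0.
have step : (c + k%:R) * (pochhammer a k.+1 / pochhammer c k.+1) <=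
   (c + 1) * k.+1%:R * (pochhammer a (b + 3) / (pochhammer k.+1%:R b * k.+1%:R ^+ 3)).
  apply: ler_pM.
  - exact: ltW.
  - by rewrite divr_ge0// ltW// p0.
  - rewrite -natr1 mulrDr mulr1 mulrDl mul1r; have : 0 <= c * k%:R by rewrite mulr_ge0// ltW.
    by move: (k%:R : R) (c * _) => x y; lra.
  apply: le_trans i1 _; rewrite ler_pM2l ?p0// lef_pV2 ?posrE ?p0//.
  by rewrite mulr_gt0 ?p0// exprn_gt0.
apply: le_trans (ler_wpM2r q0 step) _.
rewrite ler_peMr ?ler1n// mulr_ge0// mulr_ge0 ?mulr_ge0 ?divr_ge0 ?addr_ge0//.
- exact: ltW.
- exact: ltW (p0 _ _ _).
- by rewrite invr_ge0 mulr_ge0 ?exprn_ge0// ltW// p0.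
Qed.

(* Gauss's summation of 2F1(a, b; c; 1) for a natural number b, by contiguity in b. *)
Lemma gauss_sum a c (b : nat) : 0 < a -> a + b%:R + 2 <= c ->
  series (gterm a c b) @ \oo --> pochhammer (c - b%:R) b / pochhammer (c - a - b%:R) b.
Proof.
move=> a0; elim: b => [|b IH] hc.
  rewrite !pochhammer0 divr1 -(@cvg_shiftS _ (series _)).
  apply: cvg_near_cst; apply: nearW => k; rewrite /series /= big_nat_recl//.
  rewrite big1 ?addr0 => [|i _]; last by rewrite /gterm (pochhammerSl 0) mul0r mulr0 mul0r.
  by rewrite /gterm !pochhammer0 fact0 !mul1r invr1.
have hc' : a + b%:R + 3 <= c by move: hc; rewrite -natr1; move: (b%:R : R) => x; lra.
have c0 : 0 < c by apply: lt_le_trans hc'; rewrite ltr_wpDl// addr_ge0// ltW.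
have d0 : 0 < c - a - b%:R - 1 by move: hc'; move: (b%:R : R) => x; lra.
have hb : a + b%:R + 2 <= c by move: hc'; move: (b%:R : R) => x; lra.
have -> : pochhammer (c - b.+1%:R) b.+1 / pochhammer (c - a - b.+1%:R) b.+1 =
    (c - a - b%:R - 1)^-1 * ((c - b%:R - 1) * (pochhammer (c - b%:R) b / pochhammer (c - a - b%:R) b) - 0).
  rewrite !pochhammerSl -natr1 subr0 !opprD !addrA !subrK invfM.
  by move: (c - a - b%:R - 1)^-1 (pochhammer _ _)^-1 (pochhammer _ _) => x y z; ring.
have -> : series (gterm a c b.+1) = fun M => (c - a - b%:R - 1)^-1 * ((c - b%:R - 1) * series (gterm a c b) M - V a c b M).
  apply/funext => M; apply: (mulfI (lt0r_neq0 d0)); rewrite mulrA divff ?mul1r ?gt_eqF//.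
  have : (c - a - b%:R - 1) * series (gterm a c b.+1) M - (c - b%:R - 1) * series (gterm a c b) M = - V a c b M.
    rewrite /series /= !mulr_sumr -sumrB.
    rewrite (eq_bigr (fun i => - (V a c b i.+1 - V a c b i))); last first.
      by move=> i _; rewrite opprB -gterm_step// opprB.
    by rewrite sumrN telescope_sumr// (_ : V a c b 0 = 0)// subr0.
  by move=> h; rewrite -[LHS](subrK ((c - b%:R - 1) * series (gterm a c b) M)) h addrC.
apply: cvgM; first exact: cvg_cst.
apply: cvgB; last exact: V_cvg0.
by apply: cvgM; [exact: cvg_cst|exact: IH].
Qed.

End Gauss.

Lemma gauss_decay {R : realType} (D t : R) : 0 <= D -> 0 < t ->
  cvgn (series (fun j => D ^+ j * expR (- (2 * j%:R ^+ 2 * t)))).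
Proof.
move=> D0 t0; pose u j := (2 * D) ^+ j * expR (- (2 * j%:R ^+ 2 * t)).
have D2 : 0 <= 2 * D by rewrite mulr_ge0.
have u0 j : 0 <= u j by rewrite mulr_ge0 ?expR_ge0// exprn_ge0.
have u_cvg : u j @[j --> \oo] --> 0.
  apply: (@ratio_cvg0 _ u 2^-1 (Num.truncn (4 * D / (4 * t))).+1) => //.
  - by rewrite invf_lt1// ltr1n.
  move=> k hk; have k0 : 0 < k%:R :> R by rewrite ltr0n; case: k hk.
  rewrite /u exprS.
  have -> : expR (- (2 * k.+1%:R ^+ 2 * t)) = expR (- (2 * k%:R ^+ 2 * t)) * expR (- ((4 * k%:R + 2) * t)).
    by rewrite -expRD; congr expR; rewrite -natr1; ring.
  have -> : 2 * D * (2 * D) ^+ k * (expR (- (2 * k%:R ^+ 2 * t)) * expR (- ((4 * k%:R + 2) * t))) =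
    (2 * D * expR (- ((4 * k%:R + 2) * t))) * ((2 * D) ^+ k * expR (- (2 * k%:R ^+ 2 * t))) by ring.
  apply: ler_wpM2r; first by rewrite mulr_ge0 ?expR_ge0// exprn_ge0.
  have h : 4 * D <= 4 * t * k%:R.
    rewrite [leRHS]mulrC -ler_pdivrMr; last by rewrite mulr_gt0.
    apply: le_trans (ltW (truncnS_gt _)) _.
    by rewrite ler_nat.
  have e0 : 0 < 4 * t * k%:R by rewrite !mulr_gt0.
  rewrite expRN -ler_pdivlMr; last by rewrite invr_gt0 expR_gt0.
  rewrite invrK; have := expR_ge1Dx ((4 * k%:R + 2) * t).
  have : 0 < 2 * t by rewrite mulr_gt0.
  move: (expR _) => x; move: h.
  by rewrite (_ : (4 * k%:R + 2) * t = 4 * t * k%:R + 2 * t); [lra|ring].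
have [M hM] : exists M, forall j, u j <= M.
  have /cvg_seq_bounded/bounded_fun_has_ubound[M hM] : cvgn u by apply/cvg_ex; exists 0.
  by exists M => j; apply: hM; exists j.
have M0 : 0 <= M by exact: le_trans (u0 0%N) (hM 0%N).
apply: (@series_le_cvg _ _ (geometric M 2^-1)).
- by move=> j; rewrite mulr_ge0 ?expR_ge0// exprn_ge0.
- by move=> j; rewrite /geometric /= mulr_ge0// exprn_ge0.
- move=> j; rewrite /geometric /= exprVn ler_pdivlMr ?exprn_gt0//.
  by apply: le_trans (hM j); rewrite /u exprMn mulrC mulrA.
- by apply: is_cvg_geometric_series; rewrite ger0_norm// invf_lt1// ltr1n.
Qed.

Section Coefficients.
Context {R : realType}.
Variables (n : nat) (nu : R).
Hypothesis n0 : (0 < n)%N.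
Hypothesis nu0 : 0 < nu.
Notation A := (jacA n nu).

Definition binom_coef (m : nat) : R := pochhammer nu m / m`!%:R.

Definition binom_poly (M : nat) : {poly R} := \sum_(0 <= m < M) binom_coef m *: 'X^m.

Lemma binom_coef_ge0 m : 0 <= binom_coef m.
Proof. by rewrite divr_ge0// pochhammer_ge0// ltW. Qed.

Lemma binom_coefS m : m.+1%:R * binom_coef m.+1 = (nu + m%:R) * binom_coef m.
Proof.
rewrite /binom_coef pochhammerS factS natrM invfM.
move: (pochhammer nu m) (m`!%:R^-1) => x y.
have : m.+1%:R != 0 :> R by rewrite pnatr_eq0.
by move: (m.+1%:R : R) => z z0; field.
Qed.

Lemma binom_poly_ode M : (1 - 'X) * (binom_poly M.+1)^`() - nu *: binom_poly M.+1 =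
  - (M.+1%:R * binom_coef M.+1) *: 'X^M.
Proof.
elim: M => [|M IH].
  rewrite /binom_poly big_nat1 expr0 derivZ derivC scaler0 mulr0 sub0r binom_coefS addr0 scaleNr.
  by rewrite scalerA.
rewrite /binom_poly big_nat_recr//= -/(binom_poly _) derivD scalerDr mulrDr opprD addrACA IH.
rewrite derivZ derivXn /= (binom_coefS M.+1) exprS.
move: ('X^M : {poly R}) => c; rewrite -(scaler_nat M.+1 c).
move: (binom_coef M.+1) (M.+1%:R : R) => a e.
by rewrite -!mul_polyC !(polyCM, polyCN, polyCD); ring.
Qed.

Lemma binom_poly_horner_le (M : nat) (v : R) : 1 <= v ->
  0 <= 1 - jacH nu (binom_poly M.+1) v <= (v - 1) * (M.+1%:R * binom_coef M.+1 * (1 - v^-1) ^+ M).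
Proof.
move=> v1; have v0 : 0 < v by exact: lt_le_trans v1.
set q := binom_poly M.+1.
have c0 : 0 <= M.+1%:R * binom_coef M.+1 by rewrite mulr_ge0// binom_coef_ge0.
have dE x : 0 < x -> jacH1 nu q x = - (vpow nu x * x^-1 * (M.+1%:R * binom_coef M.+1 * (1 - x^-1) ^+ M)).
  move=> x0; have := congr1 (fun p => p.[1 - x^-1]) (binom_poly_ode M); rewrite -/q.
  rewrite -[1 - 'X]/(1%:P - 'X) !(hornerD, hornerN, hornerM, hornerC, hornerX, hornerZ, hornerXn).
  rewrite mulNr => h; rewrite /jacH1.
  rewrite -mulrN -h; move: (vpow nu x) (q.[_]) (q^`().[_]) => a b c; ring.
have e1 : jacH nu q 1 = 1.
  rewrite /jacH /vpow ln1 mulr0 expR0 mul1r invr1 subrr horner_coef0 /q /binom_poly.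
  rewrite big_nat_recl// coefD coef_sum big1 ?addr0; last first.
    by move=> i _; rewrite coefZ coefXn mulr0.
  by rewrite expr0 coefZ coef1 mulr1 /binom_coef pochhammer0 fact0 invr1 mulr1.
have der (x : R) : 0 < x -> is_derive x 1 (jacH nu q) (jacH1 nu q x) by exact: is_derive_jacH.
have [|c] := @MVT_segment _ (jacH nu q) (jacH1 nu q) 1 v v1
  (fun x h => der x (lt_trans ltr01 (proj1 (andP h)))).
  apply: continuous_in_subspaceT => x; rewrite inE /= in_itv /= => /andP[x1 _].
  apply/differentiable_continuous/derivable1_diffP.
  by have [] := der x (lt_le_trans ltr01 x1).
rewrite in_itv /= e1 => /andP[c1 cv]; have cp : 0 < c by exact: lt_le_trans c1.
rewrite dE// mulNr => /eqP; rewrite -eqr_opp opprB opprK => /eqP ->.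
have z0 : 0 <= 1 - c^-1 by rewrite subr_ge0 invf_le1.
have zv : 1 - c^-1 <= 1 - v^-1 by rewrite lerD2l lerN2 lef_pV2 ?posrE.
have v10 : 0 <= v - 1 by rewrite subr_ge0.
have s0 : 0 <= vpow nu c * c^-1 <= 1.
  have ci : 0 <= c^-1 by rewrite invr_ge0 ltW.
  by rewrite mulr_ge0 ?vpow_ge0//= mulr_ile1 ?vpow_ge0 ?vpow_le1 ?invf_le1.
case/andP: s0 => s0 s1.
apply/andP; split; first by rewrite mulr_ge0// mulr_ge0// mulr_ge0// exprn_ge0.
rewrite [leLHS]mulrC; apply: ler_wpM2l => //.
rewrite -[leRHS]mul1r; apply: ler_pM => //; first by rewrite mulr_ge0// exprn_ge0.
by apply: ler_wpM2l => //; rewrite lerXn2r// nnegrE//; exact: le_trans zv.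
Qed.

Lemma binom_poly_ge0 M (v : R) : 1 <= v -> 0 <= jacH nu (binom_poly M) v.
Proof.
move=> v1; have v0 : 0 < v by exact: lt_le_trans v1.
rewrite mulr_ge0 ?vpow_ge0// horner_sum; apply: sumr_ge0 => i _.
by rewrite hornerZ hornerXn mulr_ge0 ?binom_coef_ge0// exprn_ge0// subr_ge0 invf_le1.
Qed.

Lemma binom_poly_norm_le1 M (v : R) : 1 <= v -> `|jacH nu (binom_poly M.+1) v| <= 1.
Proof.
move=> v1; have /andP[h _] := binom_poly_horner_le M v1.
by rewrite ger0_norm ?binom_poly_ge0// -subr_ge0.
Qed.

Lemma binom_poly_cvg1 (v : R) : 1 <= v -> jacH nu (binom_poly M.+1) v @[M --> \oo] --> (1 : R).
Proof.
move=> v1; have v0 : 0 < v by exact: lt_le_trans v1.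
set z := 1 - v^-1.
have z0 : 0 <= z by rewrite subr_ge0 invf_le1.
have z1 : z < 1 by rewrite gtrBl invr_gt0.
pose q := (1 + z) / 2.
have zq : z < q by rewrite /q; lra.
have q1 : q < 1 by rewrite /q; lra.
have q0 : 0 < q by exact: le_lt_trans zq.
pose u M := M.+1%:R * binom_coef M.+1 * z ^+ M.
have u0 M : 0 <= u M by rewrite mulr_ge0 ?exprn_ge0// mulr_ge0 ?binom_coef_ge0.
have cu : u M @[M --> \oo] --> 0.
  apply: (@ratio_cvg0 _ u q (Num.truncn (nu * z / (q - z))).+1) => //; first exact: ltW.
  move=> k hk; rewrite /u binom_coefS exprS.
  have k0 : 0 < k.+1%:R :> R by rewrite ltr0n.
  have h : (nu + k.+1%:R) * z <= q * k.+1%:R.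
    have : nu * z <= (q - z) * k.+1%:R.
      rewrite mulrC [z * _]mulrC [leRHS]mulrC -ler_pdivrMr ?subr_gt0//.
      apply: le_trans (ltW (truncnS_gt _)) _.
      by rewrite ler_nat leqW.
    rewrite -subr_ge0 => h0; rewrite -subr_ge0.
    by rewrite (_ : _ - _ = (q - z) * k.+1%:R - nu * z)//; ring.
  have -> : (nu + k.+1%:R) * binom_coef k.+1 * (z * z ^+ k) = ((nu + k.+1%:R) * z) * (binom_coef k.+1 * z ^+ k) by ring.
  rewrite [leRHS](_ : _ = q * k.+1%:R * (binom_coef k.+1 * z ^+ k)); last by ring.
  apply: ler_wpM2r => //.
  by rewrite mulr_ge0 ?binom_coef_ge0// exprn_ge0.
have : (v - 1) * u M @[M --> \oo] --> 0.
  by rewrite -(mulr0 (v - 1)); apply: cvgM; [exact: cvg_cst|exact: cu].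
move=> h; have h1 : 1 - (1 - jacH nu (binom_poly M.+1) v) @[M --> \oo] --> (1 - 0 : R).
  apply: cvgB; first exact: cvg_cst.
  apply: (@squeeze_cvgr _ _ _ _ (fun=> 0) (fun M => (v - 1) * u M)) => //; last exact: cvg_cst.
  by apply: nearW => M; exact: binom_poly_horner_le.
rewrite subr0 in h1; rewrite (_ : (fun M => _) = (fun M => 1 - (1 - jacH nu (binom_poly M.+1) v)))//.
by apply/funext => M; rewrite subKr.
Qed.

Definition rr (j : nat) : R :=
  (2 * j%:R + A) * (nu * (nu + 1)) * pochhammer (j%:R + 2 * nu + 2) (2 * n).-1 / pochhammer (j%:R + nu) (2 * n).+2.

Lemma n2E : (2 * n)%N = (2 * n).-1.+1.
Proof. by rewrite prednK// muln_gt0. Qed.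

Lemma rr_ge0 j : 0 <= rr j.
Proof.
have j0 : 0 <= j%:R :> R by [].
have nu0' := ltW nu0; have A0 := ltW (jacA_gt0 n nu0).
rewrite /rr divr_ge0// ?mulr_ge0 ?addr_ge0 ?mulr_ge0// pochhammer_ge0// ?addr_ge0// mulr_ge0//.
Qed.

Lemma pochhammer_double_le (x y : R) m : 0 <= x -> x <= 2 * y -> pochhammer x m <= 2 ^+ m * pochhammer y m.
Proof.
move=> x0 xy; elim: m => [|m IH]; first by rewrite !pochhammer0 mulr1.
rewrite !pochhammerS exprS.
have -> : 2 * 2 ^+ m * (pochhammer y m * (y + m%:R)) = (2 ^+ m * pochhammer y m) * (2 * (y + m%:R)) by ring.
apply: ler_pM => //; [exact: pochhammer_ge0|exact: addr_ge0|].
have : 0 <= m%:R :> R by [].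
by move: (m%:R : R) => z z0; lra.
Qed.

Lemma rr_le j : rr j <= 2 ^+ (2 * n).
Proof.
have j0 : 0 <= j%:R :> R by [].
have nu0' := ltW nu0; have A0 := ltW (jacA_gt0 n nu0).
have jn : 0 < j%:R + nu by rewrite ltr_wpDl.
rewrite /rr ler_pdivrMr ?pochhammer_gt0//.
have -> : pochhammer (j%:R + nu) (2 * n).+2 =
    ((j%:R + nu) * (j%:R + nu + 1)) * pochhammer (j%:R + nu + 2) (2 * n).-1 * (j%:R + nu + (2 * n).+1%:R).
  rewrite {1}n2E -[X in pochhammer _ X]addn3 -[(_ + 3)%N]/(_ + (0 + 3))%N addnC -[((0 + 3) + _)%N]/(2 + (1 + _))%N.
  rewrite [(1 + _)%N]addnC !pochhammer_cat.
  rewrite !pochhammerS !pochhammer0 !mul1r !addr0 mulrA; congr (_ * _ * _).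
  by rewrite -addrA -(natrD _ 2); congr (_ + _%:R); lia.
have e : 2 ^+ (2 * n) = 2 * 2 ^+ (2 * n).-1 :> R by rewrite {1}n2E exprS.
rewrite e.
have i1 : nu * (nu + 1) <= (j%:R + nu) * (j%:R + nu + 1).
  by apply: ler_pM; rewrite ?addr_ge0// -?addrA ?lerDr// addrA.
have i2 : pochhammer (j%:R + 2 * nu + 2) (2 * n).-1 <= 2 ^+ (2 * n).-1 * pochhammer (j%:R + nu + 2) (2 * n).-1.
  apply: pochhammer_double_le; first by rewrite !addr_ge0// mulr_ge0.
  by move: (j%:R : R) j0 => z z0; lra.
have i3 : 2 * j%:R + A <= 2 * (j%:R + nu + (2 * n).+1%:R).
  rewrite /jacA -[(2 * n).+1%:R]natr1 natrM; have : 0 <= n%:R :> R by [].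
  by move: (j%:R : R) (n%:R : R) => z y y0; lra.
have p0 : 0 <= pochhammer (j%:R + 2 * nu + 2) (2 * n).-1.
  by rewrite pochhammer_ge0// !addr_ge0// mulr_ge0.
have t0 : 0 <= 2 * j%:R + A by rewrite addr_ge0// mulr_ge0.
have s0 : 0 <= nu * (nu + 1) by rewrite mulr_ge0// addr_ge0.
move: p0 t0 s0 i1 i2 i3; move: (2 * j%:R + A) (nu * (nu + 1)) (pochhammer (j%:R + 2 * nu + 2) _) (pochhammer (j%:R + nu + 2) _).
move: ((j%:R + nu) * _) (2 ^+ _) (j%:R + nu + (2 * n).+1%:R) => a b c x y z u z0 x0 y0 i1 i2 i3.
have -> : 2 * b * (a * u * c) = (2 * c * a) * (b * u) by ring.
by apply: ler_pM => //; [exact: mulr_ge0|exact: ler_pM].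
Qed.

Definition jcoef (j : nat) : R := (-1) ^+ j * (pochhammer (2 * n%:R) j / j`!%:R) * rr j.

Let W (j : nat) : R := (2 * j%:R + A) * pochhammer nu j * pochhammer (2 * n%:R) j /
  (j`!%:R * pochhammer (j%:R + A) j.+1).

Lemma binom_jinv (i j : nat) : binom_coef (i + j) * jinv n nu (i + j) j =
  (-1) ^+ j * W j * gterm (nu + j%:R) (2 * j%:R + A + 1) (2 * n + j) i.
Proof.
have A0 := jacA_gt0 n nu0.
have f0 k : k`!%:R != 0 :> R by rewrite pnatr_eq0 -lt0n fact_gt0.
have p1 : pochhammer (j%:R + A) j.+1 != 0 by rewrite gt_eqF// pochhammer_gt0// ltr_wpDl.
have p2 : pochhammer (2 * j%:R + A + 1) i != 0.
  by rewrite gt_eqF// pochhammer_gt0// addr_gt0// ltr_wpDl// mulr_ge0.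
have bE : 'C(i + j, j)%:R = (i + j)`!%:R / (j`!%:R * i`!%:R) :> R.
  apply: (canRL (mulfK _)); first by rewrite mulf_neq0.
  by rewrite -!natrM -(bin_fact (leq_addl i j)) addnK.
rewrite /binom_coef /jinv /gterm /W bE.
rewrite [in pochhammer nu _]addnC pochhammer_cat [in pochhammer (2 * n%:R) _]addnC pochhammer_cat.
have -> : pochhammer (j%:R + A) (i + j).+1 = pochhammer (j%:R + A) j.+1 * pochhammer (2 * j%:R + A + 1) i.
  rewrite -addnS addnC pochhammer_cat; congr (_ * pochhammer _ _).
  by rewrite -natr1; ring.
have -> : (2 * n + j)%:R = 2 * n%:R + j%:R :> R by rewrite natrD natrM.
move: (f0 i) (f0 j) (f0 (i + j)%N) p1 p2.
move: (i`!%:R) (j`!%:R) ((i + j)`!%:R) (pochhammer (j%:R + A) _) (pochhammer (2 * j%:R + A + 1) _).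
move: (pochhammer nu _) (pochhammer (nu + _) _) (pochhammer (2 * n%:R) _) (pochhammer (2 * n%:R + _) _) ((-1) ^+ j) (2 * j%:R + A).
by move=> a b c e s k g h p q r g0 h0 p0 q0 r0; field; rewrite g0 h0 p0 q0 r0.
Qed.

Lemma jcoefE j : jcoef j = (-1) ^+ j * W j *
  (pochhammer (2 * j%:R + A + 1 - (2 * n + j)%:R) (2 * n + j) /
   pochhammer (2 * j%:R + A + 1 - (nu + j%:R) - (2 * n + j)%:R) (2 * n + j)).
Proof.
have A0 := jacA_gt0 n nu0.
have p1 : pochhammer (j%:R + A) j.+1 != 0 by rewrite gt_eqF// pochhammer_gt0// ltr_wpDl.
have f0 : j`!%:R != 0 :> R by rewrite pnatr_eq0 -lt0n fact_gt0.
have p2 : pochhammer (nu + 2) (2 * n + j) != 0 by rewrite gt_eqF// pochhammer_gt0// addr_gt0.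
have p3 : pochhammer (j%:R + nu) (2 * n).+2 != 0 by rewrite gt_eqF// pochhammer_gt0// ltr_wpDl.
have -> : 2 * j%:R + A + 1 - (nu + j%:R) - (2 * n + j)%:R = nu + 2 by rewrite /jacA natrD natrM; ring.
have -> : 2 * j%:R + A + 1 - (2 * n + j)%:R = j%:R + 2 * nu + 2 by rewrite /jacA natrD natrM; ring.
have e1 : pochhammer (j%:R + 2 * nu + 2) (2 * n + j) = pochhammer (j%:R + 2 * nu + 2) (2 * n).-1 * pochhammer (j%:R + A) j.+1.
  rewrite {1}n2E addSnnS pochhammer_cat; congr (_ * pochhammer _ _).
  have : (2 * n).-1.+1%:R = 2 * n%:R :> R by rewrite -n2E natrM.
  by rewrite /jacA -natr1; move: ((2 * n).-1%:R : R) => z h; rewrite -h; ring.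
have e2 : nu * (nu + 1) * pochhammer (nu + 2) (2 * n + j) = pochhammer nu j * pochhammer (j%:R + nu) (2 * n).+2.
  rewrite [j%:R + nu]addrC -pochhammer_cat (_ : (j + (2 * n).+2)%N = (2 + (2 * n + j))%N); last by lia.
  rewrite (pochhammer_cat nu 2).
  by rewrite !pochhammerS pochhammer0 mul1r addr0.
rewrite e1 /jcoef /rr /W.
move: e2 p1 f0 p2 p3.
move: (j`!%:R) (pochhammer (j%:R + A) _) (pochhammer nu _) (pochhammer (nu + 2) _) (pochhammer (j%:R + nu) _).
move: (pochhammer (j%:R + 2 * nu + 2) _) (pochhammer (2 * n%:R) _) ((-1) ^+ j) (2 * j%:R + A) (nu * (nu + 1)).
move=> a b c e s g h p q r e2 h0 g0 q0 r0.
have -> : s = p * r / q by rewrite -e2 mulfK.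
by field; rewrite g0 h0 q0 r0.
Qed.

Lemma jinv_small m j : (m < j)%N -> jinv n nu m j = 0.
Proof. by move=> mj; rewrite /jinv bin_small// mulr0 !mul0r. Qed.

Lemma binom_jinv_sign m j : 0 <= (-1) ^+ j * (binom_coef m * jinv n nu m j).
Proof.
have A0 := jacA_gt0 n nu0.
rewrite /jinv; have -> (a b c e f s : R) : s * (a * (s * b * c * e / f)) = (s * s) * (a * b * c * e / f) by ring.
rewrite -expr2 sqrr_sign mul1r divr_ge0 ?pochhammer_ge0//; last by rewrite addr_ge0// ltW.
by rewrite !mulr_ge0 ?binom_coef_ge0 ?pochhammer_ge0 ?addr_ge0 ?mulr_ge0// ltW.
Qed.

Lemma binom_jinv_cvg j : series (fun m => binom_coef m * jinv n nu m j) @ \oo --> jcoef j.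
Proof.
have nu0' := ltW nu0.
rewrite -(cvg_shiftn j).
have -> : [sequence series (fun m => binom_coef m * jinv n nu m j) (k + j)%N]_k =
    fun k => (-1) ^+ j * W j * series (gterm (nu + j%:R) (2 * j%:R + A + 1) (2 * n + j)) k.
  apply/funext => k; rewrite /series /= (@big_cat_nat _ _ _ j)//=; last exact: leq_addl.
  rewrite big_nat_cond big1 ?add0r => [|i /andP[/andP[_ ij] _]]; last by rewrite jinv_small// mulr0.
  rewrite -{1}[j]add0n big_addn addnK mulr_sumr; apply: eq_bigr => i _.
  exact: binom_jinv.
rewrite jcoefE; apply: cvgM; first exact: cvg_cst.
apply: gauss_sum; first by rewrite ltr_wpDr.
rewrite /jacA natrD natrM; move: (n%:R : R) (j%:R : R) => x y; lra.
Qed.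

Lemma binom_jinv_bound M j : `|series (fun m => binom_coef m * jinv n nu m j) M| <= `|jcoef j|.
Proof.
pose u := series (fun m => (-1) ^+ j * (binom_coef m * jinv n nu m j)).
have uE k : u k = (-1) ^+ j * series (fun m => binom_coef m * jinv n nu m j) k.
  by rewrite /u /series /= mulr_sumr.
have cu : u @ \oo --> (-1) ^+ j * jcoef j.
  rewrite (_ : u = fun k => (-1) ^+ j * series (fun m => binom_coef m * jinv n nu m j) k); last exact/funext.
  by apply: cvgM; [exact: cvg_cst|exact: binom_jinv_cvg].
have nu_ : nondecreasing_seq u.
  apply/nondecreasing_seqP => k; rewrite /u /series /= big_nat_recr//= lerDl.
  exact: binom_jinv_sign.
have n1 (x : R) : `|x| = `|(-1) ^+ j * x| by rewrite normrM normrX normrN1 expr1n mul1r.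
rewrite [leLHS]n1 -uE [leRHS]n1 ger0_norm; last by rewrite /u; apply: sumr_ge0 => i _; exact: binom_jinv_sign.
apply: le_trans (ler_norm _).
rewrite -(cvg_lim (@Rhausdorff R) cu); apply: nondecreasing_cvgn_le => //.
by apply/cvg_ex; eexists; exact: cu.
Qed.

End Coefficients.

Section CharacteristicFunction.
Context {R : realType} {d : measure_display} {T : measurableType d}.
Context (P : probability T R) {n : nat} (F : R -> set (set T)).
Context (w : R -> T -> 'M[R]_(n, 4)) (area : R -> T -> R * R * R).
Hypothesis n0 : (0 < n)%N.
Hypothesis filt : filtration F.
Hypothesis bw : HPbrownian P F w.
Hypothesis sa : stochastic_area P w area.
Notation E := (EE P).

Lemma pochhammer_twon_le (j : nat) : pochhammer (2 * n%:R) j / j`!%:R <= (2 * n%:R) ^+ j :> R.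
Proof.
rewrite ler_pdivrMr ?ltr0n ?fact_gt0//; elim: j => [|j IH].
  by rewrite pochhammer0 expr0 mul1r fact0.
rewrite pochhammerS exprS factS natrM.
have n1 : 1 <= n%:R :> R by rewrite ler1n.
have -> : 2 * n%:R * (2 * n%:R) ^+ j * (j.+1%:R * j`!%:R) = ((2 * n%:R) ^+ j * j`!%:R) * (2 * n%:R * j.+1%:R) :> R by ring.
apply: ler_pM => //; first by rewrite pochhammer_ge0// mulr_ge0.
rewrite -[j.+1%:R]natr1 mulrDr mulr1 addrC lerD2r.
have : 0 <= j%:R :> R by [].
move: (j%:R : R) => z z0; rewrite -[leLHS]mul1r; apply: ler_pM => //; lra.
Qed.

Lemma jcoef_summable (nu t : R) : 0 < nu -> 0 < t ->
  cvgn (series (fun j => `|jcoef n nu j| * expR (- ((4 * n%:R * nu + 2 * j%:R * (j%:R + jacA n nu)) * t)))).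
Proof.
move=> nu0 t0; have A0 := ltW (jacA_gt0 n nu0).
apply: (@series_le_cvg _ _ (fun j => 2 ^+ (2 * n) * ((2 * n%:R) ^+ j * expR (- (2 * j%:R ^+ 2 * t))))).
- by move=> j; rewrite mulr_ge0 ?expR_ge0.
- by move=> j; rewrite !mulr_ge0 ?expR_ge0 ?exprn_ge0// mulr_ge0.
- move=> j.
  have c0 : 0 <= pochhammer (2 * n%:R) j / j`!%:R :> R by rewrite divr_ge0// pochhammer_ge0// mulr_ge0.
  rewrite /jcoef -mulrA normrM normrX normrN1 expr1n mul1r (ger0_norm (mulr_ge0 c0 (rr_ge0 n nu0 j))).
  rewrite mulrA [X in _ <= X * _]mulrC; apply: ler_pM; [exact: (mulr_ge0 c0 (rr_ge0 n nu0 j))|exact: expR_ge0| |].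
    by apply: ler_pM => //; [exact: rr_ge0|exact: pochhammer_twon_le|exact: rr_le].
  rewrite ler_expR lerN2 ler_wpM2r ?(ltW t0)//.
  have -> : 4 * n%:R * nu + 2 * j%:R * (j%:R + jacA n nu) = 2 * j%:R ^+ 2 + (4 * n%:R * nu + 2 * (j%:R * jacA n nu)) by ring.
  by rewrite lerDl; apply: addr_ge0; rewrite !mulr_ge0// ltW.
- under [X in cvgn X]funext => k do rewrite /series /= -mulr_sumr.
  apply: is_cvgMr; apply: gauss_decay => //; by rewrite mulr_ge0.
Qed.

Lemma area_cos (l : R * R * R) (th t nu : R) : 0 < t -> 0 < nu -> sqnorm3 l = 4 * nu * (nu + 1) ->
  let c j := jcoef n nu j * expR (- ((4 * n%:R * nu + 2 * j%:R * (j%:R + jacA n nu)) * t)) in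
  cvgn (series c) /\ E (fun x => cos (th + ip3 l (area t x))) = cos th * limn (series c).
Proof.
move=> t0 nu0 lE c.
have A0 := ltW (jacA_gt0 n nu0).
pose e j := expR (- ((4 * n%:R * nu + 2 * j%:R * (j%:R + jacA n nu)) * t)).
pose f M j := series (fun m => binom_coef nu m * jinv n nu m j) M * e j.
have [cc tan] : cvgn (series c) /\ \sum_(0 <= j < M) f M j @[M --> \oo] --> limn (series c).
  apply: (@tannery _ f c (fun j => `|jcoef n nu j| * e j)).
  - by move=> M j; rewrite /f normrM (ger0_norm (expR_ge0 _)) ler_wpM2r ?expR_ge0// binom_jinv_bound.
  - move=> j; apply: cvgM; [exact: binom_jinv_cvg|exact: cvg_cst].
  - exact: jcoef_summable.
split=> //.
have ma : measurable_fun setT (area t) by have [] := sa (ltW t0).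
have mi : measurable_fun setT (fun x => ip3 l (area t x)).
  rewrite (_ : (fun x => _) = fun x => ip3 (area t x) l).
    exact: measurableT_comp (measurable_ip3 l) ma.
  by apply/funext => x; rewrite /ip3 ![l.1.1 * _]mulrC ![l.1.2 * _]mulrC ![l.2 * _]mulrC.
have mc : measurable_fun setT (fun x => cos (th + ip3 l (area t x))).
  apply: (measurableT_comp (continuous_measurable_fun (@continuous_cos R))).
  by apply: measurable_funD => //; exact: measurable_cst.
have bc : bm (fun x => cos (th + ip3 l (area t x))).
  by split=> //; exists 1 => x; rewrite ler_norml cos_geN1 cos_le1.
pose G (q : {poly R}) := E (fun x => cos (th + ip3 l (area t x)) * jacH nu q (vv (w t x))).
have bH q : bm (fun x => jacH nu q (vv (w t x))).
  have [B hB] := jacH_bound nu0 q.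
  have cH : continuous (fun v : 'M[R]_(n, 4) => jacH nu q (vv v)).
    exact: smooth_continuous (smooth_rad (Dinf_jacH nu q)).
  exact: (bm_continuous filt bw (ltW t0) cH (fun v => hB _ (vv_ge1 v))).
have bG q : bm (fun x => cos (th + ip3 l (area t x)) * jacH nu q (vv (w t x))) by exact: bmM.
have Gsum (I : Type) (r : seq I) (a : I -> R) (q : I -> {poly R}) :
    G (\sum_(i <- r) a i *: q i) = \sum_(i <- r) a i * G (q i).
  transitivity (\sum_(i <- r) E (fun x => a i * (cos (th + ip3 l (area t x)) * jacH nu (q i) (vv (w t x))))); last first.
    by apply: eq_bigr => i _; exact: EEZ.
  rewrite -EE_sum; last by move=> i; exact: bmZ.
  rewrite /G; congr EE; apply/funext => x; rewrite /jacH horner_sum !mulr_sumr; apply: eq_bigr => i _.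
  by rewrite hornerZ; ring.
have GP j : G (jacP n nu j) = e j * cos th.
  have [B hB] := jacH_bound nu0 (jacP n nu j).
  have k0 : 0 <= 4 * n%:R * nu + 2 * j%:R * (j%:R + jacA n nu).
    by rewrite addr_ge0// mulr_ge0// ?addr_ge0// ?mulr_ge0// ltW.
  have ode (v : R) : 1 <= v -> 2 * v ^+ 2 * (v - 1) * jacH2 nu (jacP n nu j) v + 4 * n%:R * v * jacH1 nu (jacP n nu j) v
      - 2^-1 * (sqnorm3 l * (v - 1) * jacH nu (jacP n nu j) v) =
      - (4 * n%:R * nu + 2 * j%:R * (j%:R + jacA n nu)) * jacH nu (jacP n nu j) v.
    by move=> v1; rewrite lE; exact: jacH_ode.
  have der (x : R) (x0 : 0 < x) := @is_derive_jacH R nu (jacP n nu j) x x0.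
  have der1 (x : R) (x0 : 0 < x) := @is_derive_jacH1 R nu (jacP n nu j) x x0.
  rewrite /G (radial_expectation filt bw sa th (ltW t0) k0 (Dinf_jacH nu _) der der1 ode hB (fun eps => @jacH_decay R nu nu0 _ eps)).
  congr (_ * _); rewrite -[RHS]mulr1; congr (_ * _).
  rewrite /jacH /vpow ln1 mulr0 expR0 mul1r invr1 subrr horner_coef0 coef_jacP jac0//.
have Xw m M : (m < M)%N -> 'X^m = \sum_(0 <= j < M) jinv n nu m j *: jacP n nu j.
  move=> mM; rewrite (@big_cat_nat _ _ _ m.+1)//= -jacX// big_nat_cond big1 ?addr0//.
  by move=> j /andP[/andP[mj _] _]; rewrite jinv_small// scale0r.
have GS M : G (binom_poly nu M) = cos th * \sum_(0 <= j < M) f M j.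
  rewrite /binom_poly Gsum.
  rewrite (eq_big_nat _ _ (F2 := fun m => \sum_(0 <= j < M) binom_coef nu m * (jinv n nu m j * (e j * cos th)))); last first.
    move=> m /andP[_ mM]; rewrite (Xw _ _ mM) Gsum mulr_sumr.
    by apply: eq_bigr => j _; rewrite GP.
  rewrite exchange_big /= mulr_sumr; apply: eq_bigr => j _.
  rewrite /f /series /= !mulr_suml mulr_sumr; apply: eq_bigr => m _; ring.
have l1 : G (binom_poly nu M.+1) @[M --> \oo] --> E (fun x => cos (th + ip3 l (area t x))).
  have h (M : nat) : measurable_fun setT (fun x => cos (th + ip3 l (area t x)) * jacH nu (binom_poly nu M.+1) (vv (w t x))).
    by have [] := bG (binom_poly nu M.+1).
  apply: (EE_dominated h mc (M := 1)).
    move=> M x; rewrite normrM mulr_ile1//; first by rewrite ler_norml cos_geN1 cos_le1.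
    by apply: binom_poly_norm_le1 => //; exact: vv_ge1.
  apply: aeW => x; rewrite -[X in _ --> X]mulr1; apply: cvgM; first exact: cvg_cst.
  by apply: binom_poly_cvg1 => //; exact: vv_ge1.
have l2 : G (binom_poly nu M.+1) @[M --> \oo] --> cos th * limn (series c).
  rewrite (_ : (fun M => G _) = [sequence cos th * \sum_(0 <= j < M.+1) f M.+1 j]_M); last first.
    by apply/funext => M; rewrite GS.
  rewrite (@cvg_shiftS _ (fun M => cos th * \sum_(0 <= j < M) f M j)).
  by apply: cvgM; [exact: cvg_cst|exact: tan].
exact: (cvg_unique _ l1 l2).
Qed.

End CharacteristicFunction.

(** * The Gamma function and the partial fractions *)

Section GammaFunction.
Context {R : realType}.
Notation leb := (@lebesgue_measure R).

Definition gamma_integrand (s x : R) : R := x `^ (s - 1) * expR (- x).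
Notation g := gamma_integrand.

Lemma gamma_integrand_ge0 s x : 0 <= g s x.
Proof. by rewrite mulr_ge0 ?powR_ge0 ?expR_ge0. Qed.

Lemma measurable_gamma_integrand s : measurable_fun setT (g s).
Proof.
apply: measurable_funM; first exact: measurable_powR.
apply: continuous_measurable_fun => x.
by apply: continuous_comp; [exact: cvgN|exact: continuous_expR].
Qed.

Let continuous_powR s (x : R) : 0 < x -> {for x, continuous (fun y : R => y `^ s)}.
Proof.
move=> x0; apply/differentiable_continuous/derivable1_diffP.
by have [] := is_derive1_powR s x0.
Qed.

Let continuous_expN (x : R) : {for x, continuous (fun y : R => expR (- y))}.
Proof. by apply: continuous_comp; [exact: cvgN|exact: continuous_expR]. Qed.

Let LRcont (f : R -> R) (a b : R) : a < b -> (forall x, a <= x -> derivable f x 1) ->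
  derivable_oo_LRcontinuous f a b.
Proof.
move=> ab df.
have cf x : a <= x -> {for x, continuous f}.
  by move=> ax; apply/differentiable_continuous/derivable1_diffP/df.
split.
- by move=> x; rewrite in_itv /= => /andP[ax _]; exact/df/ltW.
- by apply: cvg_at_right_filter; apply: cf.
- by apply: cvg_at_left_filter; apply: cf; exact: ltW.
Qed.

Let gamma_continuous s (a b : R) : 0 < a -> {within `[a, b], continuous (g s)}.
Proof.
move=> a0; apply: continuous_in_subspaceT => x; rewrite inE /= in_itv /= => /andP[ax _].
apply: cvgM; last exact: continuous_expN.
by apply: continuous_powR; exact: lt_le_trans ax.
Qed.

Lemma gamma_step (s a b : R) : 0 < s -> 0 < a -> a < b ->
  \int[leb]_(x in `[a, b]) g (s + 1) x =
  s * \int[leb]_(x in `[a, b]) g s x + (a `^ s * expR (- a) - b `^ s * expR (- b)).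
Proof.
move=> s0 a0 ab.
have ib (h : R -> R) : {within `[a, b], continuous h} -> leb.-integrable `[a, b] (EFin \o h).
  by apply: continuous_compact_integrable; exact: segment_compact.
have pos (x : R) : x \in `]a, b[ -> 0 < x by rewrite in_itv /= => /andP[ax _]; exact: lt_trans ax.
have dG (x : R) : is_derive x 1 (fun y : R => - expR (- y)) (expR (- x)).
  have h := is_deriveN (is_derive_comp1 (is_deriveN (is_derive_id x (1 : R))) (is_derive_expR _)).
  by apply: is_derive_eq h _; rewrite mulrN1 opprK.
have c1 : {within `[a, b], continuous (fun x => s * x `^ (s - 1))}.
  apply: continuous_in_subspaceT => x; rewrite inE /= in_itv /= => /andP[ax _].
  by apply: cvgM; [exact: cvg_cst|apply: continuous_powR; exact: lt_le_trans ax].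
have c2 : {within `[a, b], continuous (fun x => expR (- x))}.
  by apply: continuous_in_subspaceT => x _; exact: continuous_expN.
have d1 x : a <= x -> derivable (fun y : R => y `^ s) x 1.
  by move=> ax; have [] := is_derive1_powR s (lt_le_trans a0 ax).
have d2 x : a <= x -> derivable (fun y : R => - expR (- y)) x 1 by move=> _; have [] := dG x.
have := @Rintegration_by_parts R (fun x => x `^ s) (fun x => - expR (- x)) (fun x => s * x `^ (s - 1))
  (fun x => expR (- x)) a b ab c1 (LRcont ab d1) _ c2 (LRcont ab d2) _.
have -> : \int[leb]_(x in `[a, b]) g (s + 1) x = \int[leb]_(x in `[a, b]) (x `^ s * expR (- x)).
  by apply: eq_Rintegral => x _; rewrite /g addrK.
move=> ->.
- have -> : \int[leb]_(x in `[a, b]) (s * x `^ (s - 1) * - expR (- x)) = - s * \int[leb]_(x in `[a, b]) g s x.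
    rewrite -RintegralZl//; last exact/ib/gamma_continuous.
    by apply: eq_Rintegral => x _; rewrite /g; ring.
  by ring.
- by move=> x /pos x0; rewrite derive1E; have [_ ->] := is_derive1_powR s x0.
- by move=> x _; rewrite derive1E; have [_ ->] := dG x.
Qed.

Let G (s : R) : \bar R := (\int[leb]_(x in `]0%R, +oo[) (g s x)%:E)%E.

Let I (k : nat) : set R := `[k.+1%:R^-1, k.+2%:R]%classic.

Let G_lim s : (\int[leb]_(x in I k) g s x)%:E @[k --> \oo] --> G s.
Proof.
have -> : (fun k => (\int[leb]_(x in I k) g s x)%:E) = fun k => (\int[leb]_(x in I k) (g s x)%:E)%E.
  apply/funext => k; apply/esym/RintegralE; first exact: measurable_itv.
  by apply: continuous_compact_integrable; [exact: segment_compact|exact: gamma_continuous].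
rewrite /G; have -> : `]0, +oo[%classic = \bigcup_k I k.
  apply/seteqP; split => x /=; rewrite in_itv /= ?andbT.
    move=> x0; exists (maxn (Num.truncn x) (Num.truncn x^-1)) => //=.
    rewrite /I /= in_itv /=; apply/andP; split.
      rewrite invf_ple ?posrE//; apply: ltW; apply: lt_le_trans (truncnS_gt _) _.
      by rewrite ler_nat ltnS leq_maxr.
    apply: ltW; apply: lt_le_trans (truncnS_gt _) _.
    by rewrite ler_nat leqW// ltnS leq_maxl.
  move=> [k _]; rewrite /I /= in_itv /= => /andP[h _].
  by apply: lt_le_trans h; rewrite invr_gt0.
apply: ge0_nondecreasing_set_cvg_integral.
- move=> m k mk; apply/subsetPset => x; rewrite /I /= !in_itv /= => /andP[h1 h2]; apply/andP; split.
    by apply: le_trans h1; rewrite lef_pV2 ?posrE// ler_nat.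
  by apply: (le_trans h2); rewrite ler_nat.
- by move=> k; exact: measurable_itv.
- move=> k; apply/measurable_EFinP; apply: measurable_funS (measurable_gamma_integrand s) => //.
- by move=> k x _; rewrite lee_fin gamma_integrand_ge0.
Qed.

Let boundary0 (s : R) : 0 < s ->
  k.+1%:R^-1 `^ s * expR (- k.+1%:R^-1) - k.+2%:R `^ s * expR (- k.+2%:R) @[k --> \oo] --> (0 : R).
Proof.
move=> s0.
have small (u : nat -> R) : (forall k, 0 < u k) -> u @ \oo --> 0 -> u k `^ s @[k --> \oo] --> 0.
  by move=> u0 cu; have /cvg_at_rightP := powR_cvg0 s0; apply.
have h1 : k.+1%:R^-1 `^ s @[k --> \oo] --> (0 : R).
  by apply: small => [k|]; [rewrite invr_gt0|exact: cvg_harmonic].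
have c1 : k.+1%:R^-1 `^ s * expR (- k.+1%:R^-1) @[k --> \oo] --> (0 : R).
  apply: (@squeeze_cvgr _ _ _ _ (fun=> 0) (fun k => k.+1%:R^-1 `^ s)) h1; last exact: cvg_cst.
  apply: nearW => k; rewrite mulr_ge0 ?powR_ge0 ?expR_ge0//=.
  by rewrite ler_piMr ?powR_ge0// -expR0 ler_expR oppr_le0 invr_ge0.
pose v k := k.+2%:R * expR (- (k.+2%:R / s)) : R.
have v0 k : 0 < v k by rewrite mulr_gt0// expR_gt0.
have cv : v k @[k --> \oo] --> 0.
  apply: (@squeeze_cvgr _ _ _ _ (fun=> 0) (fun k => 4 * s ^+ 2 * harmonic k)); last 2 first.
  - exact: cvg_cst.
  - by rewrite -(mulr0 (4 * s ^+ 2)); apply: cvgM; [exact: cvg_cst|exact: cvg_harmonic].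
  apply: nearW => k; rewrite (ltW (v0 k))/= /v /harmonic /=.
  have b0 : 0 < k.+2%:R :> R by [].
  apply: (@le_trans _ _ (4 * s ^+ 2 * k.+2%:R^-1)); last first.
    by rewrite ler_pM2l ?lef_pV2 ?posrE// ?ler_nat// mulr_gt0// exprn_gt0.
  have : (k.+2%:R / s / 2) ^+ 2 <= expR (k.+2%:R / s).
    have -> : expR (k.+2%:R / s) = expR (k.+2%:R / s / 2) ^+ 2.
      by rewrite -expRM_natl; congr expR; field; rewrite gt_eqF.
    have h : 0 <= k.+2%:R / s / 2 by rewrite !divr_ge0// ltW.
    rewrite lerXn2r ?nnegrE// ?expR_ge0//.
    by apply: le_trans (expR_ge1Dx _); rewrite lerDr.
  move: (k.+2%:R : R) b0 => b b0 h.
  rewrite expRN ler_pdivrMr ?expR_gt0//.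
  apply: (@le_trans _ _ (4 * s ^+ 2 * b^-1 * (b / s / 2) ^+ 2)).
    by rewrite le_eqVlt; apply/orP; left; apply/eqP; field; rewrite !gt_eqF.
  by apply: ler_wpM2l => //; rewrite mulr_ge0 ?invr_ge0 ?mulr_ge0 ?exprn_ge0// ltW.
have c2 : k.+2%:R `^ s * expR (- k.+2%:R) @[k --> \oo] --> (0 : R).
  have := small v v0 cv; apply: cvg_trans; apply: near_eq_cvg; apply: nearW => k.
  rewrite /v powRM ?expR_ge0//; congr (_ * _).
  by rewrite /powR gt_eqF ?expR_gt0// expRK; congr expR; field; rewrite gt_eqF.
by rewrite -(subr0 0); apply: cvgB.
Qed.

Let GS s : 0 < s -> G (s + 1) = (s%:E * G s)%E.
Proof.
move=> s0; apply/esym.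
have h1 : (s%:E * (\int[leb]_(x in I k) g s x)%:E)%E @[k --> \oo] --> (s%:E * G s)%E.
  by apply: cvgeZl; [by []|exact: G_lim].
have h2 : (k.+1%:R^-1 `^ s * expR (- k.+1%:R^-1) - k.+2%:R `^ s * expR (- k.+2%:R))%:E @[k --> \oo] --> (0 : R)%:E.
  by apply: cvg_EFin; [exact: nearW|exact: boundary0].
have h3 : (s%:E * (\int[leb]_(x in I k) g s x)%:E + (k.+1%:R^-1 `^ s * expR (- k.+1%:R^-1) - k.+2%:R `^ s * expR (- k.+2%:R))%:E)%E
    @[k --> \oo] --> (s%:E * G s + 0%:E)%E.
  by apply: cvgeD; [exact: fin_num_adde_defl|exact: h1|exact: h2].
rewrite adde0 in h3.
have h4 : (\int[leb]_(x in I k) g (s + 1) x)%:E @[k --> \oo] --> G (s + 1) by exact: G_lim.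
have e : (fun k => (\int[leb]_(x in I k) g (s + 1) x)%:E) =
   (fun k => (s%:E * (\int[leb]_(x in I k) g s x)%:E + (k.+1%:R^-1 `^ s * expR (- k.+1%:R^-1) - k.+2%:R `^ s * expR (- k.+2%:R))%:E)%E).
  apply/funext => k; rewrite -EFinM -EFinD; congr _%:E; apply: gamma_step => //.
  by apply: (@le_lt_trans _ _ 1); rewrite ?invf_le1 ?ler1n ?ltr1n.
rewrite e in h4; exact: (cvg_unique _ h3 h4).
Qed.

Let G1 : G 1 = 1%E.
Proof.
have c : {within `[0, +oo[, continuous (fun x : R => expR (- x))}.
  by apply: continuous_subspaceT => x; exact: continuous_expN.
have d (x : R) : is_derive x 1 (fun y : R => - expR (- y)) (expR (- x)).
  have h := is_deriveN (is_derive_comp1 (is_deriveN (is_derive_id x (1 : R))) (is_derive_expR _)).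
  by apply: is_derive_eq h _; rewrite mulrN1 opprK.
have -> : G 1 = (\int[leb]_(x in `]0%R, +oo[) (expR (- x))%:E)%E.
  by apply: eq_integral => x _; rewrite /g subrr powRr0 mul1r.
rewrite integral_itv_obnd_cbnd; last first.
  by apply/measurable_EFinP; apply: measurable_funTS; apply: continuous_measurable_fun => x; exact: continuous_expN.
rewrite (@ge0_continuous_FTC2y _ _ (fun x => - expR (- x)) 0 0) ?oppr0 ?expR0 //.
- by rewrite EFinN oppeK add0e.
- by rewrite -oppr0; apply: cvgN; exact: cvgr_expR.
- have h : - expR (- x) @[x --> 0^'+] --> - expR (- (0 : R)).
    by apply: cvg_at_right_filter; apply: cvgN; exact: continuous_expN.
  by rewrite oppr0 expR0 in h.
- by move=> x _; rewrite derive1E; have [_ ->] := d x.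
Qed.

Let G_ge0 s : (0 <= G s)%E.
Proof. by apply: integral_ge0 => x _; rewrite lee_fin gamma_integrand_ge0. Qed.

Let G_nat m : (G m.+1%:R < +oo)%E.
Proof.
elim: m => [|m IH]; first by rewrite G1 ltry.
rewrite -natr1 GS//; apply: lte_mul_pinfty => //.
Qed.

Let mg s (D : set R) : measurable_fun D (fun x => (g s x)%:E).
Proof. by apply/measurable_EFinP; apply: measurable_funTS; exact: measurable_gamma_integrand. Qed.

Let G_fin s : 0 < s -> (G s < +oo)%E.
Proof.
have big (r : R) : 1 <= r -> (G r < +oo)%E.
  move=> r1; pose m := Num.truncn r.
  have rm : r <= m.+1%:R by exact/ltW/truncnS_gt.
  apply: (@le_lt_trans _ _ (G 1 + G m.+1%:R)%E); last by rewrite lte_add_pinfty ?G1 ?ltry//; exact: G_nat.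
  rewrite /G -ge0_integralD//; last 4 first.
  - by move=> x _; rewrite lee_fin gamma_integrand_ge0.
  - exact: mg.
  - by move=> x _; rewrite lee_fin gamma_integrand_ge0.
  - exact: mg.
  apply: ge0_le_integral => //.
  - by move=> x _; rewrite lee_fin gamma_integrand_ge0.
  - exact: mg.
  - by apply: emeasurable_funD; exact: mg.
  move=> x; rewrite /= in_itv /= andbT => x0.
  rewrite -EFinD lee_fin /g subrr powRr0 mul1r -[X in _ <= X + _]mul1r -mulrDl ler_wpM2r ?expR_ge0//.
  have [x1|x1] := leP x 1.
    have h : x `^ (r - 1) <= 1 `^ (r - 1).
      by apply: ge0_ler_powR; rewrite ?nnegrE ?subr_ge0// ltW.
    by apply: le_trans h _; rewrite powR1 lerDl powR_ge0.
  rewrite ler_wpDl//; apply: ler_powR; first exact: ltW.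
  by move: rm; move: (m.+1%:R : R) => z; lra.
move=> s0; have h : (s%:E * G s < +oo)%E by rewrite -GS//; apply: big; rewrite lerDr ltW.
by move: h; case: (G s) => [r|/=|//]; rewrite ?ltry// gt0_muley ?lte_fin.
Qed.

Let G_gt0 s : (0 < G s)%E.
Proof.
pose m := expR (- `|s - 1|) * expR (- 2) : R.
have m0 : 0 < m by rewrite mulr_gt0 ?expR_gt0.
apply: (@lt_le_trans _ _ (\int[leb]_(x in `[1%R, 2%R]) m%:E)%E).
  by rewrite integral_cst//= lebesgue_measure_itv /= lte_fin ltr1n -EFinD -EFinM lte_fin mulr_gt0// subr_gt0 ltr1n.
apply: (@le_trans _ _ (\int[leb]_(x in `[1%R, 2%R]) (g s x)%:E)%E).
  apply: ge0_le_integral => //; [by move=> x _; rewrite lee_fin ltW|exact: mg|].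
  move=> x; rewrite /= in_itv /= => /andP[x1 x2]; have x0 : 0 < x by exact: lt_le_trans x1.
  rewrite lee_fin /g /m /powR gt_eqF//; apply: ler_pM; rewrite ?expR_ge0// ler_expR ?lerN2//.
  have l0 : 0 <= ln x by exact: ln_ge0.
  have l1 : ln x <= 1.
    have h : -1 < (x : R) - 1 by rewrite ltrDr.
    have := le_ln1Dx h; rewrite addrCA subrr addr0 => h'; apply: (le_trans h').
    by rewrite lerBlDl.
  apply: (@le_trans _ _ (- `|(s - 1) * ln x|)); last by rewrite lerNl -normrN ler_norm.
  by rewrite lerN2 normrM (ger0_norm l0) ler_piMr.
apply: ge0_subset_integral; [exact: measurable_itv|exact: measurable_itv|exact: mg| |].
  by move=> x _; rewrite lee_fin gamma_integrand_ge0.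
by move=> x; rewrite /= !in_itv /= andbT => /andP[x1 _]; exact: lt_le_trans x1.
Qed.

Lemma GammaS (s : R) : 0 < s -> Gamma (s + 1) = s * Gamma s.
Proof.
move=> s0; have e r : Gamma r = fine (G r) by [].
by rewrite !e GS// fineM// ge0_fin_numE// G_fin.
Qed.

Lemma Gamma_gt0 (s : R) : 0 < s -> 0 < Gamma s.
Proof.
move=> s0; have e r : Gamma r = fine (G r) by [].
by rewrite e fine_gt0// G_gt0 G_fin.
Qed.

Lemma Gamma_pochhammer (s : R) m : 0 < s -> Gamma (s + m%:R) = pochhammer s m * Gamma s.
Proof.
move=> s0; elim: m => [|m IH]; first by rewrite pochhammer0 addr0 mul1r.
rewrite -natr1 addrA GammaS; last by rewrite ltr_wpDr.
by rewrite IH pochhammerS; ring.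
Qed.

End GammaFunction.

Local Transparent derive.

Local Transparent EE.

Section PartialFractions.
Context {K : fieldType}.
Implicit Types (x : nat -> K) (p : {poly K}).

Lemma horner_prod_XsubC x m (u : K) :
  (\prod_(0 <= i < m) ('X - (x i)%:P)).[u] = \prod_(0 <= i < m) (u - x i).
Proof. by rewrite horner_prod; apply: eq_bigr => i _; rewrite hornerXsubC. Qed.

Lemma size_prod_nat_XsubC x m : size (\prod_(0 <= i < m) ('X - (x i)%:P)) = m.+1.
Proof.
by rewrite size_prod_XsubC size_iota subn0.
Qed.

Lemma partial_fractions x m p : (forall i k, (i < k < m)%N -> x k != x i) -> (size p <= m)%N ->
  exists a : nat -> K, forall u, (forall i, (i < m)%N -> u != x i) ->
    p.[u] / \prod_(0 <= i < m) (u - x i) = \sum_(0 <= i < m) a i / (u - x i).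
Proof.
elim: m p => [|m IH] p inj sp.
  exists (fun=> 0) => u _; rewrite !big_geq// divr1.
  by move: sp; rewrite leqn0 size_poly_eq0 => /eqP ->; rewrite horner0.
have D0 : \prod_(0 <= i < m) (x m - x i) != 0.
  by rewrite prodf_seq_neq0; apply/allP => i; rewrite mem_index_iota => /andP[_ im] /=; rewrite subr_eq0 inj ?im /=.
set D := \prod_(0 <= i < m) (x m - x i) in D0.
pose c := p.[x m] / D.
pose q := p - c *: \prod_(0 <= i < m) ('X - (x i)%:P).
have : root q (x m).
  by rewrite /root /q hornerD hornerN hornerZ horner_prod_XsubC -/D /c divfK// subrr.
move=> /factor_theorem[q' qE].
have sq' : (size q' <= m)%N.
  have [->|q'0] := eqVneq q' 0; first by rewrite size_poly0.
  have : (size q <= m.+1)%N.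
    rewrite /q; apply: (leq_trans (size_polyD _ _)); rewrite geq_max sp size_polyN.
    by apply: (leq_trans (size_scale_leq _ _)); rewrite size_prod_nat_XsubC.
  by rewrite qE size_Mmonic ?monicXsubC// size_XsubC addn2.
have [|a ha] := IH q' _ sq'.
  by move=> i k /andP[ik km]; apply: inj; rewrite ik ltnW.
exists (fun i => if i == m then c else a i) => u hu.
have um : u - x m != 0 by rewrite subr_eq0 hu.
have P0 : \prod_(0 <= i < m) (u - x i) != 0.
  rewrite prodf_seq_neq0; apply/allP => i; rewrite mem_index_iota => /andP[_ im] /=.
  by rewrite subr_eq0 hu// ltnW.
rewrite !big_nat_recr//= eqxx.
rewrite [in RHS](eq_big_nat _ _ (F2 := fun i => a i / (u - x i))); last first.
  by move=> i /andP[_ im]; rewrite /= ltn_eqF.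
rewrite -ha; last by move=> i im; rewrite hu// ltnW.
have pE : p.[u] = q'.[u] * (u - x m) + c * \prod_(0 <= i < m) (u - x i).
  have -> : p = q + c *: \prod_(0 <= i < m) ('X - (x i)%:P) by rewrite /q subrK.
  by rewrite hornerD hornerZ horner_prod_XsubC qE hornerM hornerXsubC.
by rewrite pE; move: (q'.[u]) (\prod_(_ <= _ < _) _) P0 => y z z0; field; rewrite um z0.
Qed.

Lemma partial_fractions_monic x m p : (forall i k, (i < k < m)%N -> x k != x i) ->
  p \is monic -> size p = m.+1 ->
  exists a : nat -> K, forall u, (forall i, (i < m)%N -> u != x i) ->
    p.[u] / \prod_(0 <= i < m) (u - x i) = 1 + \sum_(0 <= i < m) a i / (u - x i).
Proof.
move=> inj mp sp.
set z := \prod_(0 <= i < m) ('X - (x i)%:P).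
have sz : size z = m.+1 by exact: size_prod_nat_XsubC.
have mz : z \is monic by apply: monic_prod => i _; exact: monicXsubC.
have [|a ha] := @partial_fractions x m (p - z) inj.
  apply/leq_sizeP => i; rewrite leq_eqVlt => /predU1P[<-|im].
    move: mp mz; rewrite !monicE /lead_coef sp sz /= coefB => /eqP -> /eqP ->.
    by rewrite subrr.
  by rewrite coefB !nth_default ?sp ?sz// subrr.
exists a => u hu; rewrite -ha// hornerD hornerN horner_prod_XsubC mulrBl divff; first by rewrite subrKC.
rewrite prodf_seq_neq0; apply/allP => i; rewrite mem_index_iota => /andP[_ im] /=.
by rewrite subr_eq0 hu.
Qed.

End PartialFractions.

Section AreaCoefficients.
Context {R : realType}.
Variable n : nat.
Hypothesis n0 : (0 < n)%N.

Definition numer_root (j i : nat) : R :=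
  nth (- (j%:R + (i.-1)%:R)) [:: - (2 * j%:R + 2 * n%:R + 1); 0; - 2] i.

Definition numer (j : nat) : {poly R} := \prod_(0 <= i < (2 * n).+2) ('X - (numer_root j i)%:P).

Definition pole (j i : nat) : R := - (2 * j%:R + 2 * i%:R).

Lemma poleB j (mu : R) i : mu - pole j i = mu + 2 * j%:R + 2 * i%:R.
Proof. by rewrite /pole opprK addrA. Qed.

Lemma pole_inj j i k : i != k -> pole j i != pole j k.
Proof.
apply: contraNneq => /oppr_inj/addrI/(mulfI _) => /(_ _)/eqP; rewrite eqr_nat => -> //.
Qed.

Lemma numer_horner j (mu : R) : (numer j).[mu] =
  (2 * j%:R + 2 * n%:R + mu + 1) * (mu * (mu + 2)) * \prod_(2 <= i < (2 * n).+1) (j%:R + mu + i%:R).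
Proof.
rewrite /numer horner_prod_XsubC big_ltn// big_ltn// big_ltn; last first.
  by rewrite !ltnS muln_gt0.
rewrite big_add1 /= !mulrA; congr (_ * _).
  by rewrite /numer_root /=; ring.
apply: eq_big_nat => -[|[|i]] // _; rewrite /numer_root /=.
by rewrite nth_nil opprK addrA [mu + _]addrC.
Qed.

Lemma denominatorE j (mu : R) N : \prod_(0 <= i < N) (j%:R + mu / 2 + i%:R) =
  2 ^- N * \prod_(0 <= i < N) (mu + 2 * j%:R + 2 * i%:R).
Proof.
elim: N => [|N IH]; first by rewrite !big_geq// expr0 invr1 mulr1.
rewrite !big_nat_recr//= IH exprS invfM; move: (2 ^- N) (\prod_(_ <= _ < _) _) => x y.
by field.
Qed.

Lemma fractionE j (mu : R) :
  (2 * j%:R + 2 * n%:R + mu + 1) * (mu * (mu + 2)) * \prod_(2 <= i < (2 * n).+1) (j%:R + mu + i%:R)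
    / (4 * \prod_(0 <= i < (2 * n + 1).+1) (j%:R + mu / 2 + i%:R)) =
  2 ^+ (2 * n) * ((numer j).[mu] / \prod_(0 <= i < (2 * n).+2) (mu - pole j i)).
Proof.
rewrite -numer_horner addn1 denominatorE.
under [in RHS]eq_bigr do rewrite poleB.
have -> : 2 ^- (2 * n).+2 = (4 * 2 ^+ (2 * n))^-1 :> R by rewrite !exprS; congr _^-1; ring.
rewrite !invfM !invrK; move: (2 ^+ (2 * n)) ((\prod_(0 <= i < (2 * n).+2) _)^-1) => x y.
by field.
Qed.

Lemma numer_monic j : numer j \is monic.
Proof. by apply: monic_prod => i _; exact: monicXsubC. Qed.

Lemma size_numer j : size (numer j) = (2 * n).+3.
Proof. exact: size_prod_nat_XsubC. Qed.

Lemma Gamma_quotient (mu : R) : - 2 < mu ->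
  Gamma (mu / 2 + 2) * Gamma (2 * n%:R + mu + 2) / (Gamma (mu / 2 + 2 * n%:R + 2) * Gamma (mu + 2)) =
  pochhammer (mu + 2) (2 * n) / pochhammer (mu / 2 + 2) (2 * n).
Proof.
move=> hmu.
have s1 : 0 < mu / 2 + 2 by lra.
have s2 : 0 < mu + 2 by lra.
have -> : 2 * n%:R + mu + 2 = mu + 2 + (2 * n)%:R by rewrite natrM; ring.
have -> : mu / 2 + 2 * n%:R + 2 = mu / 2 + 2 + (2 * n)%:R by rewrite natrM; ring.
rewrite (Gamma_pochhammer _ s1) (Gamma_pochhammer _ s2).
have := Gamma_gt0 s1; have := Gamma_gt0 s2; have := pochhammer_gt0 (2 * n) s1.
move: (Gamma (mu / 2 + 2)) (Gamma (mu + 2)) (pochhammer (mu / 2 + 2) _) (pochhammer (mu + 2) _) => a b c e c0 b0 a0.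
by field; rewrite !gt_eqF.
Qed.

Theorem area_coefficients_exist : exists a : nat -> nat -> R, area_coefficients n a.
Proof.
have inj j i k : (i < k < (2 * n).+2)%N -> pole j k != pole j i.
  by move=> /andP[ik _]; rewrite pole_inj// gtn_eqF.
have pf j := partial_fractions_monic (inj j) (numer_monic j) (size_numer j).
pose x0 i : R := - (4 + 2 * i%:R).
have [|||c hc] := @partial_fractions_monic _ x0 (2 * n) (\prod_(0 <= i < 2 * n) ('X - (- (2 + i%:R))%:P)).
- move=> i k /andP[ik _]; rewrite /x0 eqr_opp; apply/negP => /eqP/addrI/(mulfI _).
  by move=> /(_ _)/eqP; rewrite eqr_nat gtn_eqF// pnatr_eq0 => /(_ isT).
- by apply: monic_prod => i _; exact: monicXsubC.
- exact: size_prod_nat_XsubC.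
have [b hb] := choice pf.
exists (fun k j => if j is j'.+1 then 2 ^+ (2 * n) * b j k else if (k < 2)%N then 0 else 2 ^+ (2 * n) * c k.-2).
split=> //.
- case=> // j mu _ h; rewrite fractionE hb; last first.
    move=> i; rewrite ltnS => hi; rewrite -subr_eq0 poleB; apply: h; rewrite addn1//.
  rewrite mulrDr mulr1 addn1 mulr_sumr; congr (_ + _).
  by apply: eq_bigr => i _; rewrite poleB mulrA.
- move=> mu hmu; rewrite Gamma_quotient//.
  have hm (i : nat) : mu - x0 i = mu + 2 * i.+2%:R by rewrite /x0 -[i.+2]addn2 natrD; ring.
  have m0 (i : nat) : 0 < mu + 2 * i.+2%:R.
    by rewrite -[i.+2]addn2 natrD; have : 0 <= i%:R :> R by []; move: (i%:R : R) => z; lra.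
  have -> : pochhammer (mu + 2) (2 * n) / pochhammer (mu / 2 + 2) (2 * n) =
     2 ^+ (2 * n) * ((\prod_(0 <= i < 2 * n) ('X - (- (2 + i%:R))%:P)).[mu] / \prod_(0 <= i < 2 * n) (mu - x0 i)).
    rewrite horner_prod_XsubC /pochhammer !big_mkord.
    have -> : \prod_(i < 2 * n) (mu - x0 i) = 2 ^+ (2 * n) * \prod_(i < 2 * n) (mu / 2 + 2 + i%:R).
      rewrite -[X in 2 ^+ X]card_ord -prodr_const -big_split /=; apply: eq_bigr => i _.
      by rewrite /x0; field.
    have cancel (x p q : R) : x != 0 -> x * (p / (x * q)) = p / q.
      by move=> x_neq0; rewrite invfM mulrCA [x * _]mulrA divff// mul1r.
    rewrite cancel ?expf_neq0//.
    have -> // : \prod_(i < 2 * n) (mu - - (2 + i%:R)) = \prod_(i < 2 * n) (mu + 2 + i%:R).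
    by apply: eq_bigr => i _; rewrite opprK addrA.
  rewrite hc; last by move=> i _; rewrite -subr_eq0 hm gt_eqF.
  rewrite mulrDr mulr1 [in RHS]big_ltn; last by rewrite addn1.
  rewrite /= mul0r add0r addn1 mulr_sumr; congr (_ + _).
  rewrite [in RHS]big_add1 [in RHS]big_add1 /=.
  by apply: eq_bigr => i _; rewrite hm mulrA.
Qed.

Variable a : nat -> nat -> R.
Hypothesis ha : area_coefficients n a.

Definition gcoef (j : nat) (mu : R) : R :=
  2 ^+ (2 * n) + \sum_(0 <= k < (2 * n + 1).+1) a k j / (mu + 2 * j%:R + 2 * k%:R).

Lemma gcoefE (j : nat) (mu : R) : (0 < j)%N -> 0 <= mu -> gcoef j mu =
  (2 * j%:R + 2 * n%:R + mu + 1) * (mu * (mu + 2)) * \prod_(2 <= i < (2 * n).+1) (j%:R + mu + i%:R)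
    / (4 * \prod_(0 <= i < (2 * n + 1).+1) (j%:R + mu / 2 + i%:R)).
Proof.
move=> j0 mu0; have [h _ _] := ha; rewrite h// => k _.
by rewrite gt_eqF// ltr_wpDr// ltr_wpDl// mulr_gt0// ltr0n.
Qed.

Lemma gcoef0E (mu : R) : 0 <= mu ->
  gcoef 0 mu = pochhammer (mu + 2) (2 * n) / pochhammer (mu / 2 + 2) (2 * n).
Proof.
move=> mu0; have hmu : - 2 < mu by lra.
have [_ h a00] := ha; rewrite -Gamma_quotient// h// /gcoef; congr (_ + _).
rewrite big_ltn// a00 mul0r add0r; apply: eq_bigr => i _.
by rewrite mulr0 addr0.
Qed.

Lemma gcoef_at0 j : gcoef j 0 = (j == 0%N)%:R.
Proof.
case: j => [|j]; last by rewrite gcoefE// mul0r mulr0 !mul0r.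
by rewrite gcoef0E// mul0r add0r divff// gt_eqF// pochhammer_gt0.
Qed.

Lemma gcoef_rr j (nu : R) : 0 < nu -> gcoef j (2 * nu) = rr n nu j.
Proof.
move=> nu0; have mu0 : 0 <= 2 * nu by rewrite mulr_ge0// ltW.
have e : \prod_(2 <= i < (2 * n).+1) (j%:R + 2 * nu + i%:R) = pochhammer (j%:R + 2 * nu + 2) (2 * n).-1.
  rewrite /pochhammer big_add1 big_add1 /= big_mkord; apply: eq_bigr => i _.
  by rewrite -[i.+2]addn2 natrD; ring.
have h2 : 2 * nu / 2 = nu by field.
case: j e => [|j] e.
  rewrite gcoef0E// h2 /rr !add0r mulr0 add0r !pochhammerSl.
  have e2 : pochhammer (2 * nu + 2) (2 * n) = pochhammer (2 * nu + 2) (2 * n).-1 * (jacA n nu).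
    rewrite {1}(n2E n0) pochhammerS; congr (_ * _).
    have : (2 * n).-1.+1%:R = 2 * n%:R :> R by rewrite -(n2E n0) natrM.
    by rewrite /jacA -natr1; move: ((2 * n).-1%:R : R) => z h; rewrite -h; ring.
  have -> : nu + 1 + 1 = nu + 2 by ring.
  rewrite e2; have : pochhammer (nu + 2) (2 * n) != 0 by rewrite gt_eqF// pochhammer_gt0// addr_gt0.
  have : nu != 0 by rewrite gt_eqF.
  have : nu + 1 != 0 by rewrite gt_eqF// addr_gt0.
  move: (jacA n nu) (pochhammer _ _) (pochhammer _ _) => x y z h1 h3 h4; field.
  by rewrite h1 h3 h4.
rewrite gcoefE// e h2 /rr.
have -> : \prod_(0 <= i < (2 * n + 1).+1) (j.+1%:R + nu + i%:R) = pochhammer (j.+1%:R + nu) (2 * n).+2.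
  by rewrite /pochhammer addn1 big_mkord.
have -> : 2 * j.+1%:R + 2 * n%:R + 2 * nu + 1 = 2 * j.+1%:R + jacA n nu by rewrite /jacA !addrA.
rewrite invfM; move: (_ + jacA n nu) (pochhammer _ _) ((pochhammer _ _)^-1) => x y z.
by field.
Qed.

End AreaCoefficients.

Local Opaque derive.

Local Opaque EE.

(** * Fourier inversion and the density *)

Section Smoothing.
Context {R : realType}.
Notation leb := (@lebesgue_measure R).
Notation leb2 := (@leb2 R).
Notation leb3 := (@leb3 R).

(* The normal density of variance 1/(2c). *)
Definition normal_kernel (c u : R) : R := Num.sqrt (c / pi) * gauss c u.

Lemma normal_kernel_ge0 c u : 0 <= normal_kernel c u.
Proof. by rewrite mulr_ge0 ?sqrtr_ge0 ?gauss_ge0. Qed.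

Lemma continuous_normal_kernel c x : continuous (fun y => normal_kernel c (x - y)).
Proof.
apply: contM; first exact: cont_cst.
apply: (cont_comp (g := gauss c)); last exact: continuous_gauss.
by apply: contD; [exact: cont_cst|exact: contN cont_id].
Qed.

Lemma integral_normal_kernel c x : 0 < c ->
  leb.-integrable setT (fun y => (normal_kernel c (x - y))%:E) /\ \int[leb]_y normal_kernel c (x - y) = 1.
Proof.
move=> c0.
have h : (\int[leb]_y (normal_kernel c (x - y))%:E = 1)%E.
  have -> : (\int[leb]_y (normal_kernel c (x - y))%:E =
      \int[leb]_y ((Num.sqrt (c / pi))%:E * (gauss c (y - x))%:E))%E.
    by apply: eq_integral => y _; rewrite -EFinM /normal_kernel /gauss -[y - x]opprB sqrrN.
  have m : measurable_fun setT (fun y : R => (gauss c (y - x))%:E).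
    apply/measurable_EFinP; apply: continuous_measurable_fun.
    apply: (cont_comp (g := gauss c)); last exact: continuous_gauss.
    by apply: contD; [exact: cont_id|exact: cont_cst].
  rewrite ge0_integralZl//; last by move=> y _; rewrite lee_fin gauss_ge0.
  have := @integralT_affine R 1 (- x) (gauss c) ltr01 (@continuous_gauss R c) (@gauss_ge0 R c).
  rewrite integral_gauss// => e.
  have -> : (\int[leb]_y (gauss c (y - x))%:E = \int[leb]_y (gauss c (1 * y + - x) * 1)%:E)%E.
    by apply: eq_integral => y _; rewrite mul1r mulr1.
  rewrite -e -EFinM -sqrtrM ?divr_ge0 ?pi_ge0 ?ltW//.
  have -> : c / pi * (pi / c) = 1.
    by have := lt0r_neq0 (pi_gt0 R); move: (pi : R) => q q0; field; rewrite q0 lt0r_neq0.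
  by rewrite sqrtr1.
split; last by rewrite /Rintegral h.
apply/integrableP; split.
  by apply/measurable_EFinP; apply: continuous_measurable_fun; exact: continuous_normal_kernel.
under eq_integral do rewrite /= ger0_norm ?normal_kernel_ge0//.
by rewrite h ltry.
Qed.

Definition smooth_itv (c a b x : R) : R := \int[leb]_y ((a < y < b)%R%:R * normal_kernel c (x - y)).

Lemma measurable_itvR (a b : R) : measurable_fun setT (fun y : R => ((a < y < b)%R%:R : R)).
Proof.
have -> : (fun y : R => ((a < y < b)%R%:R : R)) = \1_`]a, b[%classic.
  by apply/funext => y; rewrite indicE; congr (nat_of_bool _)%:R; apply/idP/idP; rewrite inE /= in_itv.
by apply: measurable_indic; exact: measurable_itv.
Qed.

Lemma integrable_itv_kernel c a b x : 0 < c ->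
  leb.-integrable setT (fun y => ((a < y < b)%R%:R * normal_kernel c (x - y))%:E).
Proof.
move=> c0; have [i _] := integral_normal_kernel x c0.
apply: (integrable_le1 (h := fun y => normal_kernel c (x - y))) => //.
  apply: measurable_funM; first exact: measurable_itvR.
  by apply: continuous_measurable_fun; exact: continuous_normal_kernel.
move=> y; case: (a < y < b); rewrite ?mul1r ?mul0r ?normr0 ?normal_kernel_ge0//.
by rewrite ger0_norm ?normal_kernel_ge0.
Qed.

Lemma smooth_itv_ge0 c a b x : 0 <= smooth_itv c a b x.
Proof. by apply: Rintegral_ge0 => // y _; rewrite mulr_ge0 ?normal_kernel_ge0. Qed.

Lemma smooth_itv_le1 c a b x : 0 < c -> smooth_itv c a b x <= 1.
Proof.
move=> c0; have [i <-] := integral_normal_kernel x c0.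
apply: le_Rintegral => //; first exact: integrable_itv_kernel.
by move=> y _; rewrite ler_piMl ?normal_kernel_ge0// lern1 leq_b1.
Qed.

Lemma kernel_tail c del (p : R -> bool) x : 0 < c -> 0 < del -> measurable_fun setT (fun y => (p y)%:R : R) ->
  (forall y, p y -> del <= `|x - y|) ->
  \int[leb]_y ((p y)%:R * normal_kernel c (x - y)) <= Num.sqrt 2 * expR (- (del ^+ 2 / 2 * c)).
Proof.
move=> c0 d0 mp hp.
have c2 : 0 < c / 2 by rewrite divr_gt0.
have [i _] := integral_normal_kernel x c0.
have [i2 e2] := integral_normal_kernel x c2.
have bound y : (p y)%:R * normal_kernel c (x - y) <=
   Num.sqrt 2 * expR (- (del ^+ 2 / 2 * c)) * normal_kernel (c / 2) (x - y).
  case py : (p y); last by rewrite mul0r !mulr_ge0 ?sqrtr_ge0 ?expR_ge0 ?gauss_ge0.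
  rewrite mul1r /normal_kernel.
  have -> : Num.sqrt (c / pi) = Num.sqrt 2 * Num.sqrt (c / 2 / pi).
    by rewrite -sqrtrM//; congr Num.sqrt; have := lt0r_neq0 (pi_gt0 R); move: (pi : R) => q q0; field.
  rewrite mulrACA ler_wpM2l ?mulr_ge0 ?sqrtr_ge0//.
  rewrite /gauss -expRD ler_expR -opprD lerN2.
  have : del ^+ 2 <= (x - y) ^+ 2.
    by rewrite -[X in _ <= X]real_normK ?num_real// lerXn2r ?nnegrE ?(ltW d0)// hp.
  have key (u v : R) : u <= v -> u / 2 * c + c / 2 * v <= c * v.
    move=> uv; have : 0 <= c / 2 * (v - u) by rewrite mulr_ge0 ?subr_ge0 ?(ltW c2).
    by rewrite mulrBr; lra.
  exact: key.
have i3 : leb.-integrable setT (fun y => ((p y)%:R * normal_kernel c (x - y))%:E).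
  apply: (integrable_le1 (h := fun y => normal_kernel c (x - y))) => //.
    by apply: measurable_funM => //; apply: continuous_measurable_fun; exact: continuous_normal_kernel.
  move=> y; case: (p y); rewrite ?mul1r ?mul0r ?normr0 ?normal_kernel_ge0//.
  by rewrite ger0_norm ?normal_kernel_ge0.
have -> : Num.sqrt 2 * expR (- (del ^+ 2 / 2 * c)) =
    \int[leb]_y (Num.sqrt 2 * expR (- (del ^+ 2 / 2 * c)) * normal_kernel (c / 2) (x - y)).
  by rewrite RintegralZl// e2 mulr1.
apply: le_Rintegral => //.
exact: (integrableZl measurableT (Num.sqrt 2 * expR (- (del ^+ 2 / 2 * c))) i2).
Qed.

Lemma exp_square_cvg0 (K : R) : 0 < K -> Num.sqrt 2 * expR (- (K * k.+1%:R)) @[k --> \oo] --> (0 : R).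
Proof.
move=> K0; rewrite -(mulr0 (Num.sqrt 2)); apply: cvgM; first exact: cvg_cst.
apply: (@squeeze_cvgr _ _ _ _ (fun=> 0) (fun k => K^-1 * harmonic k)); last 2 first.
- exact: cvg_cst.
- by rewrite -(mulr0 K^-1); apply: cvgM; [exact: cvg_cst|exact: cvg_harmonic].
apply: nearW => k; rewrite expR_ge0/= /harmonic /= -invfM expRN lef_pV2 ?posrE ?expR_gt0 ?mulr_gt0//.
by apply: le_trans (expR_ge1Dx _); rewrite lerDr.
Qed.

Lemma smooth_itv_cvg1 a b x : a < x < b -> smooth_itv k.+1%:R a b x @[k --> \oo] --> (1 : R).
Proof.
move=> /andP[ax xb]; pose del := Num.min (x - a) (b - x).
have d0 : 0 < del by rewrite lt_min !subr_gt0 ax.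
have mN : measurable_fun setT (fun y : R => (~~ (a < y < b))%R%:R : R).
  rewrite (_ : (fun y : R => _) = fun y : R => 1 - (a < y < b)%R%:R); last first.
    by apply/funext => y; case: (a < y < b); rewrite ?subrr ?subr0.
  by apply: measurable_funB; [exact: measurable_cst|exact: measurable_itvR].
apply: (@squeeze_cvgr _ _ _ _ (fun k => 1 - Num.sqrt 2 * expR (- (del ^+ 2 / 2 * k.+1%:R))) (fun=> 1)); last 2 first.
- rewrite -[X in _ --> X]subr0; apply: cvgB; first exact: cvg_cst.
  by apply: exp_square_cvg0; rewrite divr_gt0// exprn_gt0.
- exact: cvg_cst.
apply: nearW => k; rewrite smooth_itv_le1// andbT lerBlDr -lerBlDl.
have [i e] := @integral_normal_kernel k.+1%:R x (ltr0Sn R k).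
rewrite -[X in X - _]e /smooth_itv -RintegralB//; last exact: integrable_itv_kernel.
apply: le_trans (_ : \int[leb]_y ((~~ (a < y < b))%R%:R * normal_kernel k.+1%:R (x - y)) <= _).
  rewrite le_eqVlt; apply/orP; left; apply/eqP; apply: eq_Rintegral => y _.
  by case: (a < y < b); rewrite ?mul1r ?mul0r ?subrr ?subr0.
apply: kernel_tail => // y; rewrite negb_and -!leNgt /del ge_min => /orP[ya|by_].
  by apply/orP; left; rewrite ger0_norm ?lerD2l ?lerN2// subr_ge0 (le_trans ya) ?ltW.
by apply/orP; right; rewrite distrC ger0_norm ?lerD2r// subr_ge0 (le_trans _ by_) ?ltW.
Qed.

Lemma smooth_itv_cvg0 a b x : ~~ (a <= x <= b) -> smooth_itv k.+1%:R a b x @[k --> \oo] --> (0 : R).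
Proof.
move=> hx.
have [del d0 hd] : exists2 del, 0 < del & forall y, a < y < b -> del <= `|x - y|.
  move: hx; rewrite negb_and -!ltNge => /orP[xa|bx].
    exists (a - x); first by rewrite subr_gt0.
    move=> y /andP[ay _]; rewrite distrC ger0_norm ?lerD2r ?ltW// subr_gt0; exact: lt_trans ay.
  exists (x - b); first by rewrite subr_gt0.
  by move=> y /andP[_ yb]; rewrite ger0_norm ?lerD2l ?lerN2 ?ltW// subr_gt0; exact: lt_trans bx.
apply: (@squeeze_cvgr _ _ _ _ (fun=> 0) (fun k => Num.sqrt 2 * expR (- (del ^+ 2 / 2 * k.+1%:R)))); last 2 first.
- exact: cvg_cst.
- by apply: exp_square_cvg0; rewrite divr_gt0// exprn_gt0.
apply: nearW => k; rewrite smooth_itv_ge0/=.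
by apply: kernel_tail => //; exact: measurable_itvR.
Qed.

Lemma integral_tensor3 (g1 g2 g3 : R -> R) : leb.-integrable setT (EFin \o g1) ->
  leb.-integrable setT (EFin \o g2) -> leb.-integrable setT (EFin \o g3) ->
  leb3.-integrable setT (EFin \o (fun y : R * R * R => g1 y.1.1 * g2 y.1.2 * g3 y.2)) /\
  \int[leb3]_y (fun y : R * R * R => g1 y.1.1 * g2 y.1.2 * g3 y.2) y = (\int[leb]_y g1 y) * (\int[leb]_y g2 y) * (\int[leb]_y g3 y).
Proof.
move=> i1 i2 i3.
have mE g : leb.-integrable setT (EFin \o g) -> measurable_fun setT g.
  by move=> i; apply/measurable_EFinP; exact: measurable_int i.
have ni g : leb.-integrable setT (EFin \o g) -> leb.-integrable setT (EFin \o (fun y => `|g y|)).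
  by move=> i; have := integrable_abse i; apply: eq_integrable.
have m1 := mE _ i1; have m2 := mE _ i2; have m3 := mE _ i3.
pose h (y : R * R) := g1 y.1 * g2 y.2.
have mh : measurable_fun setT h.
  by apply: measurable_funM; [exact: measurableT_comp m1 measurable_fst|exact: measurableT_comp m2 measurable_snd].
have bh (a b : R) : `|h (a, b)| <= `|g1 a| * `|g2 b| by rewrite normrM.
have [ih sh _] := integrable_dominated_prod2 mh (ni _ i1) (ni _ i2) bh.
have nih : leb2.-integrable setT (EFin \o (fun y => `|h y|)).
  by have := integrable_abse ih; apply: eq_integrable.
pose f (y : R * R * R) := g1 y.1.1 * g2 y.1.2 * g3 y.2.
have mf : measurable_fun setT f.
  apply: measurable_funM; first exact: (measurableT_comp mh measurable_fst).
  exact: (measurableT_comp m3 measurable_snd).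
have bf (a : R * R) (b : R) : `|f (a, b)| <= `|h a| * `|g3 b| by rewrite -normrM.
have [if_ sf _] := integrable_dominated_prod3 mf nih (ni _ i3) bf.
split; first exact: if_.
rewrite -(Rfubini_leb3 if_ sf).
rewrite (@eq_Rintegral _ _ _ leb2 setT (fun a : R * R => (\int[leb]_y g3 y) * h a)); last first.
  by move=> a _; rewrite mulrC -RintegralZl.
rewrite RintegralZl// -(Rfubini_leb2 ih sh) mulrC; congr (_ * _).
rewrite (@eq_Rintegral _ _ _ leb setT (fun a : R => (\int[leb]_y g2 y) * g1 a)); last first.
  by move=> a _; rewrite mulrC -RintegralZl.
by rewrite RintegralZl// mulrC.
Qed.

End Smoothing.

Local Transparent EE.

Section Inversion.
Context {R : realType} {d : measure_display} {T : measurableType d}.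
Context (P : probability T R) (X : T -> R * R * R) (Phi : R * R * R -> R).
Notation leb := (@lebesgue_measure R).
Notation leb3 := (@leb3 R).
Notation R3 := (measurableTypeR R * measurableTypeR R * measurableTypeR R)%type.
Hypothesis mX : measurable_fun setT X.
Hypothesis iPhi : leb3.-integrable setT (EFin \o Phi).
Hypothesis charf : forall (l : R * R * R) th, EE P (fun x : T => cos (th + ip3 l (X x))) = cos th * Phi l.
Implicit Types (x y l a b : R * R * R).

Definition sub3 x y : R * R * R := (x.1.1 - y.1.1, x.1.2 - y.1.2, x.2 - y.2).

Definition kernel3 (c : R) x y : R :=
  normal_kernel c (x.1.1 - y.1.1) * normal_kernel c (x.1.2 - y.1.2) * normal_kernel c (x.2 - y.2).

Lemma kernel3_ge0 c x y : 0 <= kernel3 c x y.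
Proof. by apply: mulr_ge0; [apply: mulr_ge0|]; exact: normal_kernel_ge0. Qed.

Lemma normal_kernel_le (c u : R) : 0 < c -> normal_kernel c u <= Num.sqrt (c / pi).
Proof.
move=> c0; rewrite ler_piMr ?sqrtr_ge0// -expR0 ler_expR oppr_le0 mulr_ge0 ?sqr_ge0// ltW//.
Qed.

Lemma kernel3_le (c : R) x y : 0 < c -> kernel3 c x y <= Num.sqrt (c / pi) ^+ 3.
Proof.
move=> c0; rewrite /kernel3 !exprS expr0 mulr1 mulrA.
have p := normal_kernel_ge0 c; have h u := normal_kernel_le u c0.
by apply: ler_pM; [exact: mulr_ge0|exact: p|exact: ler_pM|exact: h].
Qed.

Lemma kernel3_fourier (c : R) x y : 0 < c -> kernel3 c x y =
  (2 * pi) ^- 3 * \int[leb3]_l (cos (ip3 l (sub3 x y) + 0) * gauss3 (4 * c)^-1 l).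
Proof.
move=> c0; have t0 : 0 < (4 * c)^-1 by rewrite invr_gt0 mulr_gt0.
have p0 : 0 < pi :> R by exact: pi_gt0.
have [_ ->] := gauss3_fourier (sub3 x y) 0 t0.
rewrite cos0 mul1r.
have -> : Num.sqrt (pi / (4 * c)^-1) = 2 * pi * Num.sqrt (c / pi).
  have -> : pi / (4 * c)^-1 = (2 * pi) ^+ 2 * (c / pi).
    by move: (pi : R) p0 => q q0; field; rewrite !gt_eqF.
  by rewrite sqrtrM ?sqr_ge0// sqrtr_sqr ger0_norm// mulr_ge0 ?ltW.
have -> : expR (- (sqnorm3 (sub3 x y) / (4 * (4 * c)^-1))) = gauss3 c (sub3 x y).
  rewrite /gauss3; congr (expR (- _)); move: (sqnorm3 _) => s; field; rewrite gt_eqF//.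
rewrite gauss3E /kernel3 /normal_kernel /sub3 /=.
move: (gauss _ _) (gauss _ _) (gauss _ _) (Num.sqrt _) => e f g s.
by move: (pi : R) p0 => q q0; field; rewrite gt_eqF.
Qed.

Definition invfourier y : R := (2 * pi) ^- 3 * \int[leb3]_l (cos (ip3 l y) * Phi l).

Definition fsmooth (c : R) y : R :=
  (2 * pi) ^- 3 * \int[leb3]_l (cos (ip3 l y) * (Phi l * gauss3 (4 * c)^-1 l)).

Let mPhi : measurable_fun setT Phi.
Proof. by apply/measurable_EFinP; exact: measurable_int iPhi. Qed.

Let iabs : leb3.-integrable setT (EFin \o (fun l => `|Phi l|)).
Proof. by have := integrable_abse iPhi; apply: eq_integrable. Qed.

Let gauss3_le1 (tau : R) l : 0 < tau -> gauss3 tau l <= 1.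
Proof.
by move=> t0; rewrite -expR0 ler_expR oppr_le0 mulr_ge0 ?sqnorm3_ge0// ltW.
Qed.

Let mcos y : measurable_fun setT (fun l => cos (ip3 l y)).
Proof.
rewrite (_ : (fun l => _) = fun l => cos (ip3 l y + 0)); last by apply/funext => l; rewrite addr0.
exact: measurable_cos_ip3.
Qed.

Lemma fsmooth_cvg y : fsmooth k.+1%:R y @[k --> \oo] --> invfourier y.
Proof.
apply: cvgM; first exact: cvg_cst.
have t0 (k : nat) : 0 < (4 * k.+1%:R)^-1 :> R by rewrite invr_gt0 mulr_gt0.
have [] // := @Rintegral_dominated R _ R3 leb3
  (fun k l => cos (ip3 l y) * (Phi l * gauss3 (4 * k.+1%:R)^-1 l)) (fun l => cos (ip3 l y) * Phi l)
  (fun l => `|Phi l|).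
- move=> k; exact: (measurable_funM (mcos y) (measurable_funM mPhi (measurable_gauss3 _))).
- exact: (measurable_funM (mcos y) mPhi).
- move=> k l; rewrite !normrM [`|gauss3 _ _|]ger0_norm ?gauss3_ge0//.
  have c1 : `|cos (ip3 l y)| <= 1 by rewrite ler_norml cos_geN1 cos_le1.
  apply: le_trans (ler_piMl _ c1) _; first by rewrite mulr_ge0 ?gauss3_ge0.
  by rewrite ler_piMr// gauss3_le1.
- move=> l; apply: cvgM; first exact: cvg_cst.
  rewrite -[X in _ --> X]mulr1; apply: cvgM; first exact: cvg_cst.
  have h : (4 * k.+1%:R)^-1 * sqnorm3 l @[k --> \oo] --> (0 : R).
    rewrite (_ : (fun k : nat => _) = (fun k => (4^-1 * sqnorm3 l) * harmonic k)); last first.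
      by apply/funext => k; rewrite /harmonic /= invfM mulrAC.
    by rewrite -(mulr0 (4^-1 * sqnorm3 l)); apply: cvgM; [exact: cvg_cst|exact: cvg_harmonic].
  have hN : - ((4 * k.+1%:R)^-1 * sqnorm3 l) @[k --> \oo] --> (0 : R) by rewrite -oppr0; exact: cvgN.
  have hE : expR (- ((4 * k.+1%:R)^-1 * sqnorm3 l)) @[k --> \oo] --> expR (0 : R).
    by apply: (cvg_comp _ _ hN); exact: continuous_expR.
  by rewrite expR0 in hE.
Qed.

Lemma fsmoothE (c : R) y : 0 < c -> fsmooth c y = EE P (fun x : T => kernel3 c (X x) y).
Proof.
move=> c0; have t0 : 0 < (4 * c)^-1 by rewrite invr_gt0 mulr_gt0.
have -> : EE P (fun x : T => kernel3 c (X x) y) =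
   EE P (fun x : T => (2 * pi) ^- 3 * \int[leb3]_l (cos (ip3 l (sub3 (X x) y) + 0) * gauss3 (4 * c)^-1 l)).
  by congr EE; apply/funext => x; exact: kernel3_fourier.
pose F (z : T * R3) : R := cos (ip3 z.2 (X z.1) - ip3 z.2 y) * gauss3 (4 * c)^-1 z.2.
have mip : measurable_fun setT (fun z : T * R3 => ip3 z.2 (X z.1)).
  have mX1 := measurableT_comp mX (@measurable_fst _ _ T R3).
  have m2 := @measurable_snd _ _ T R3.
  apply: measurable_funD; first apply: measurable_funD.
  - by apply: measurable_funM; [exact: (measurableT_comp m3_11 m2)|exact: (measurableT_comp m3_11 mX1)].
  - by apply: measurable_funM; [exact: (measurableT_comp m3_12 m2)|exact: (measurableT_comp m3_12 mX1)].
  - by apply: measurable_funM; [exact: (measurableT_comp m3_2 m2)|exact: (measurableT_comp m3_2 mX1)].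
have mF : measurable_fun setT F.
  apply: measurable_funM; last exact: (measurableT_comp (measurable_gauss3 _) measurable_snd).
  apply: (measurableT_comp (continuous_measurable_fun (@continuous_cos R))).
  apply: measurable_funB => //.
  exact: (measurableT_comp (measurable_ip3 y) measurable_snd).
have ig : leb3.-integrable setT (EFin \o gauss3 (4 * c)^-1).
  have [h _] := gauss3_fourier (0, 0, 0) 0 t0; move: h; apply: eq_integrable => // l _ /=.
  by rewrite /ip3 /= !mulr0 !addr0 cos0 mul1r.
have i1 : P.-integrable setT (EFin \o (fun _ : T => 1 : R)) by apply: bm_integrable; exact: bm_cst.
have bF (x : T) l : `|F (x, l)| <= 1 * gauss3 (4 * c)^-1 l.
  rewrite mul1r normrM [`|gauss3 _ _|]ger0_norm ?gauss3_ge0// ler_piMl ?gauss3_ge0//.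
  by rewrite ler_norml cos_geN1 cos_le1.
have [iF s1 s2] := @integrable_dominated_prod R _ _ T R3 P leb3 F (fun=> 1) (gauss3 (4 * c)^-1) mF i1 ig bF.
have ipB (x : R3) l : ip3 l (sub3 x y) + 0 = ip3 l x - ip3 l y by rewrite addr0 /ip3 /sub3 /=; ring.
have -> : EE P (fun x : T => (2 * pi) ^- 3 * \int[leb3]_l (cos (ip3 l (sub3 (X x) y) + 0) * gauss3 (4 * c)^-1 l)) =
   \int[P]_x ((2 * pi) ^- 3 * \int[leb3]_l F (x, l)).
  rewrite /EE; apply: eq_Rintegral => x _; congr (_ * _); apply: eq_Rintegral => l _.
  by rewrite ipB.
have i2 : P.-integrable setT (EFin \o (fun x : T => \int[leb3]_l F (x, l))).
  have kE (x : T) : \int[leb3]_l F (x, l) = (2 * pi) ^+ 3 * kernel3 c (X x) y.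
    rewrite kernel3_fourier// mulVKf; last by rewrite expf_neq0// mulf_neq0// lt0r_neq0// pi_gt0.
    by apply: eq_Rintegral => l _; rewrite /F ipB.
  apply: bm_integrable; split; first exact: (measurable_fun_Rint iF).
  exists ((2 * pi) ^+ 3 * Num.sqrt (c / pi) ^+ 3) => x.
  have p3 : 0 <= (2 * pi) ^+ 3 :> R by rewrite exprn_ge0// mulr_ge0// pi_ge0.
  rewrite kE ger0_norm; last exact: mulr_ge0 p3 (kernel3_ge0 _ _ _).
  by apply: ler_wpM2l => //; exact: kernel3_le.
rewrite RintegralZl// (Rfubini iF s1 s2) /fsmooth; congr (_ * _).
apply: eq_Rintegral => l _.
have -> : \int[P]_x F (x, l) = EE P (fun x : T => gauss3 (4 * c)^-1 l * cos (- ip3 l y + ip3 l (X x))).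
  by rewrite /EE; apply: eq_Rintegral => x _; rewrite /F /= mulrC [- _ + _]addrC.
rewrite EEZ; first by rewrite charf cosN; ring.
split; last by exists 1 => x; rewrite ler_norml cos_geN1 cos_le1.
apply: (measurableT_comp (continuous_measurable_fun (@continuous_cos R))).
apply: measurable_funD; first exact: measurable_cst.
exact: (measurableT_comp mip (pair2_measurable l)).
Qed.

Definition inbox a b y : bool :=
  [&& a.1.1 < y.1.1 < b.1.1, a.1.2 < y.1.2 < b.1.2 & a.2 < y.2 < b.2].

Definition incbox a b y : bool :=
  [&& a.1.1 <= y.1.1 <= b.1.1, a.1.2 <= y.1.2 <= b.1.2 & a.2 <= y.2 <= b.2].

Definition smooth_box (c : R) a b x : R :=
  smooth_itv c a.1.1 b.1.1 x.1.1 * smooth_itv c a.1.2 b.1.2 x.1.2 * smooth_itv c a.2 b.2 x.2.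

Lemma inboxE a b y : (inbox a b y)%:R =
  (a.1.1 < y.1.1 < b.1.1)%R%:R * (a.1.2 < y.1.2 < b.1.2)%R%:R * (a.2 < y.2 < b.2)%R%:R :> R.
Proof. by rewrite /inbox -!natrM !mulnb andbA. Qed.

Lemma integrable_itvR (a b : R) : leb.-integrable setT (EFin \o (fun y : R => (a < y < b)%R%:R)).
Proof.
apply: (@integrable_le1 R _ (fun y : R => expR (a ^+ 2 + b ^+ 2) * gauss 1 y)).
- exact: measurable_itvR.
- move=> y; case: (boolP (a < y < b)) => [/andP[ay yb]|_]; last by rewrite normr0 mulr_ge0 ?expR_ge0.
  rewrite normr1 /gauss mul1r -expRD -[X in X <= _]expR0 ler_expR subr_ge0.
  have [y0|y0] := leP 0 y.
    have : y ^+ 2 <= b ^+ 2 by rewrite lerXn2r ?nnegrE// ltW// (le_lt_trans y0).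
    by have := sqr_ge0 a; lra.
  have : (- y) ^+ 2 <= (- a) ^+ 2 by rewrite lerXn2r ?nnegrE ?oppr_ge0 ?lerN2 ?ltW// (lt_trans ay).
  by rewrite !sqrrN; have := sqr_ge0 b; lra.
- exact: (integrableZl measurableT _ (integrable_gauss ltr01)).
Qed.

Lemma integrable_inbox a b : leb3.-integrable setT (EFin \o (fun y => (inbox a b y)%:R)).
Proof.
have [h _] := integral_tensor3 (integrable_itvR a.1.1 b.1.1) (integrable_itvR a.1.2 b.1.2) (integrable_itvR a.2 b.2).
by move: h; apply: eq_integrable => // y _ /=; rewrite inboxE.
Qed.

Lemma measurable_inbox a b : measurable_fun setT (fun y => (inbox a b y)%:R : R).
Proof. by apply/measurable_EFinP; exact: measurable_int (integrable_inbox a b). Qed.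

Lemma smooth_boxE (c : R) a b x : 0 < c ->
  \int[leb3]_y ((inbox a b y)%:R * kernel3 c x y) = smooth_box c a b x.
Proof.
move=> c0.
have [_ h] := integral_tensor3 (integrable_itv_kernel a.1.1 b.1.1 x.1.1 c0)
  (integrable_itv_kernel a.1.2 b.1.2 x.1.2 c0) (integrable_itv_kernel a.2 b.2 x.2 c0).
rewrite /smooth_box /smooth_itv -h; apply: eq_Rintegral => y _.
by rewrite inboxE /kernel3; ring.
Qed.

Lemma measurable_kernel3 (c : R) : measurable_fun setT (fun z : R3 * T => kernel3 c (X z.2) z.1).
Proof.
have mk : measurable_fun setT (normal_kernel c).
  by apply: continuous_measurable_fun; apply: contM; [exact: cont_cst|exact: continuous_gauss].
have mX2 := measurableT_comp mX (@measurable_snd _ _ R3 T).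
have m1 := @measurable_fst _ _ R3 T.
apply: measurable_funM; first apply: measurable_funM.
- by apply: (measurableT_comp mk); apply: measurable_funB; [exact: (measurableT_comp m3_11 mX2)|exact: (measurableT_comp m3_11 m1)].
- by apply: (measurableT_comp mk); apply: measurable_funB; [exact: (measurableT_comp m3_12 mX2)|exact: (measurableT_comp m3_12 m1)].
- by apply: (measurableT_comp mk); apply: measurable_funB; [exact: (measurableT_comp m3_2 mX2)|exact: (measurableT_comp m3_2 m1)].
Qed.

Lemma fsmooth_box (c : R) a b : 0 < c ->
  measurable_fun setT (fun y => (inbox a b y)%:R * fsmooth c y) /\
  \int[leb3]_y ((inbox a b y)%:R * fsmooth c y) = EE P (fun x : T => smooth_box c a b (X x)).
Proof.
move=> c0; pose F (z : R3 * T) : R := (inbox a b z.1)%:R * kernel3 c (X z.2) z.1.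
have mF : measurable_fun setT F.
  by apply: measurable_funM; [exact: (measurableT_comp (measurable_inbox a b) measurable_fst)|exact: measurable_kernel3].
have i1 : P.-integrable setT (EFin \o (fun _ : T => Num.sqrt (c / pi) ^+ 3)) by apply: bm_integrable; exact: bm_cst.
have bF (y : R3) (x : T) : `|F (y, x)| <= (inbox a b y)%:R * Num.sqrt (c / pi) ^+ 3.
  by rewrite normrM normr_nat ler_wpM2l// ger0_norm ?kernel3_ge0// kernel3_le.
have [iF s1 s2] := @integrable_dominated_prod R _ _ R3 T leb3 P F _ _ mF (integrable_inbox a b) i1 bF.
have bk (y : R3) : bm (fun x : T => kernel3 c (X x) y).
  split; first exact: (measurableT_comp (measurable_kernel3 c) (pair1_measurable y)).
  by exists (Num.sqrt (c / pi) ^+ 3) => x; rewrite ger0_norm ?kernel3_ge0// kernel3_le.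
have e : (fun y => (inbox a b y)%:R * fsmooth c y) = fun y => \int[P]_x F (y, x).
  by apply/funext => y; rewrite fsmoothE// -EEZ.
rewrite e; split; first exact: (measurable_fun_Rint iF).
rewrite (Rfubini iF s1 s2) /EE; apply: eq_Rintegral => x _.
by rewrite -(smooth_boxE a b (X x) c0).
Qed.

Lemma invfourier_bound y : `|invfourier y| <= (2 * pi) ^- 3 * \int[leb3]_l `|Phi l|.
Proof.
have p3 : 0 <= (2 * pi) ^- 3 :> R by rewrite invr_ge0 exprn_ge0// mulr_ge0// pi_ge0.
have i : leb3.-integrable setT (EFin \o (fun l => cos (ip3 l y) * Phi l)).
  apply: (integrable_le3 _ _ iabs); first exact: (measurable_funM (mcos y) mPhi).
  by move=> l; rewrite normrM ler_piMl// ler_norml cos_geN1 cos_le1.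
rewrite normrM ger0_norm// ler_wpM2l//.
apply: le_trans (le_normr_Rintegral measurableT i) _.
apply: (@le_Rintegral _ _ R leb3 setT) => //; first exact: (integrable_abse i).
by move=> l _ /=; rewrite normrM ler_piMl// ler_norml cos_geN1 cos_le1.
Qed.

Lemma fsmooth_bound (c : R) y : 0 < c -> `|fsmooth c y| <= (2 * pi) ^- 3 * \int[leb3]_l `|Phi l|.
Proof.
move=> c0; have t0 : 0 < (4 * c)^-1 by rewrite invr_gt0 mulr_gt0.
have p3 : 0 <= (2 * pi) ^- 3 :> R by rewrite invr_ge0 exprn_ge0// mulr_ge0// pi_ge0.
have b l : `|cos (ip3 l y) * (Phi l * gauss3 (4 * c)^-1 l)| <= `|Phi l|.
  rewrite !normrM [`|gauss3 _ _|]ger0_norm ?gauss3_ge0//.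
  have c1 : `|cos (ip3 l y)| <= 1 by rewrite ler_norml cos_geN1 cos_le1.
  apply: le_trans (ler_piMl _ c1) _; first by rewrite mulr_ge0 ?gauss3_ge0.
  by rewrite ler_piMr// gauss3_le1.
have i : leb3.-integrable setT (EFin \o (fun l => cos (ip3 l y) * (Phi l * gauss3 (4 * c)^-1 l))).
  apply: (integrable_le3 _ b iabs).
  exact: (measurable_funM (mcos y) (measurable_funM mPhi (measurable_gauss3 _))).
rewrite normrM ger0_norm// ler_wpM2l//.
apply: le_trans (le_normr_Rintegral measurableT i) _.
by apply: (@le_Rintegral _ _ R leb3 setT) => //; first exact: (integrable_abse i).
Qed.

Lemma invfourier_ge0 y : 0 <= invfourier y.
Proof.
have h : fsmooth k.+1%:R y @[k --> \oo] --> invfourier y by exact: fsmooth_cvg.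
rewrite -(cvg_lim (@Rhausdorff R) h).
apply: limr_ge; first by apply/cvg_ex; exists (invfourier y).
apply: nearW => k; rewrite fsmoothE//; apply: EE_ge0 => x; exact: kernel3_ge0.
Qed.

Lemma measurable_inbox_invfourier a b : measurable_fun setT (fun y => (inbox a b y)%:R * invfourier y).
Proof.
apply: (@measurable_fun_cvg _ R3 R setT (fun k y => (inbox a b y)%:R * fsmooth k.+1%:R y)).
- by move=> k; have [] := @fsmooth_box k.+1%:R a b (ltr0Sn R k).
- by move=> y _; apply: cvgM; [exact: cvg_cst|exact: fsmooth_cvg].
Qed.

Let cube (k : nat) : R * R * R := (k%:R, k%:R, k%:R).
Let ncube (k : nat) : R * R * R := (- k%:R, - k%:R, - k%:R).

Lemma inbox_cube y : \forall k \near \oo, inbox (ncube k) (cube k) y.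
Proof.
have h (u : R) : \forall k \near \oo, - k%:R < u < k%:R.
  near=> k; rewrite -ltr_norml; near: k; exists (Num.truncn `|u|).+1 => // k /= hk.
  by apply: lt_le_trans (truncnS_gt _) _; rewrite ler_nat.
near=> k; apply/and3P; split; near: k; exact: h.
Unshelve. all: by end_near.
Qed.

Lemma measurable_invfourier : measurable_fun setT invfourier.
Proof.
apply: (@measurable_fun_cvg _ R3 R setT (fun k y => (inbox (ncube k) (cube k) y)%:R * invfourier y)).
- by move=> k; exact: measurable_inbox_invfourier.
- move=> y _; apply: cvg_near_cst; have := inbox_cube y; apply: filterS => k ->.
  by rewrite mul1r.
Qed.

Lemma integrable_inbox_invfourier a b : leb3.-integrable setT (EFin \o (fun y => (inbox a b y)%:R * invfourier y)).
Proof.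
apply: (@integrable_le3 R _ (fun y => ((2 * pi) ^- 3 * \int[leb3]_l `|Phi l|) * (inbox a b y)%:R)).
- exact: measurable_inbox_invfourier.
- by move=> y; rewrite normrM normr_nat mulrC ler_wpM2r// invfourier_bound.
- exact: (integrableZl measurableT _ (integrable_inbox a b)).
Qed.

Lemma fsmooth_box_cvg a b : EE P (fun x : T => smooth_box k.+1%:R a b (X x)) @[k --> \oo] -->
  \int[leb3]_y ((inbox a b y)%:R * invfourier y).
Proof.
rewrite (_ : (fun k => _) = fun k => \int[leb3]_y ((inbox a b y)%:R * fsmooth k.+1%:R y)); last first.
  by apply/funext => k; have [_ ->] := @fsmooth_box k.+1%:R a b (ltr0Sn R k).
have [] // := @Rintegral_dominated R _ R3 leb3
  (fun k y => (inbox a b y)%:R * fsmooth k.+1%:R y) (fun y => (inbox a b y)%:R * invfourier y)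
  (fun y => ((2 * pi) ^- 3 * \int[leb3]_l `|Phi l|) * (inbox a b y)%:R).
- by move=> k; have [] := @fsmooth_box k.+1%:R a b (ltr0Sn R k).
- exact: measurable_inbox_invfourier.
- by move=> k y; rewrite normrM normr_nat mulrC ler_wpM2r// fsmooth_bound.
- exact: (integrableZl measurableT _ (integrable_inbox a b)).
- by move=> y; apply: cvgM; [exact: cvg_cst|exact: fsmooth_cvg].
Qed.

Lemma smooth_box_ge0 (c : R) a b x : 0 <= smooth_box c a b x.
Proof. by apply: mulr_ge0; [apply: mulr_ge0|]; exact: smooth_itv_ge0. Qed.

Lemma smooth_box_le1 (c : R) a b x : 0 < c -> smooth_box c a b x <= 1.
Proof.
move=> c0; apply: mulr_ile1; rewrite ?smooth_itv_ge0 ?smooth_itv_le1//.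
  by apply: mulr_ge0; exact: smooth_itv_ge0.
by apply: mulr_ile1; rewrite ?smooth_itv_ge0 ?smooth_itv_le1.
Qed.

End Inversion.

Local Opaque EE.

Section DensityMeasure.
Context {d : measure_display} {T : measurableType d} {R : realType}.
Variables (m : {measure set T -> \bar R}) (f : T -> R).
Hypothesis mf : measurable_fun setT f.
Hypothesis f0 : forall x, 0 <= f x.

Definition density_measure of measurable_fun setT f & (forall x, 0 <= f x) : set T -> \bar R :=
  fun A => (\int[m]_(x in A) (f x)%:E)%E.
Notation nu := (density_measure mf f0).

Let nu0 : nu set0 = 0%E. Proof. by rewrite /density_measure integral_set0. Qed.

Let nu_ge0 A : (0 <= nu A)%E.
Proof. by apply: integral_ge0 => x _; rewrite lee_fin. Qed.

Let nu_sigma_additive : semi_sigma_additive nu.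
Proof.
move=> /= F mF tF mUF; rewrite /density_measure; apply: cvg_toP.
  apply: ereal_nondecreasing_is_cvgn => k l kl.
  by apply: lee_sum_nneg_natr => // i _ _; exact: nu_ge0.
rewrite ge0_integral_bigcup//=.
- by apply: measurable_funTS; exact/measurable_EFinP.
- by move=> x _; rewrite lee_fin.
Qed.

HB.instance Definition _ := isMeasure.Build _ _ _ nu nu0 nu_ge0 nu_sigma_additive.
End DensityMeasure.

Section Density.
Context {R : realType} {d : measure_display} {T : measurableType d}.
Context (P : probability T R) (X : T -> R * R * R) (Phi : R * R * R -> R).
Notation leb := (@lebesgue_measure R).
Notation leb3 := (@leb3 R).
Notation R3 := (measurableTypeR R * measurableTypeR R * measurableTypeR R)%type.
Hypothesis mX : measurable_fun setT X.
Hypothesis iPhi : leb3.-integrable setT (EFin \o Phi).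
Hypothesis charf : forall (l : R * R * R) th, EE P (fun x : T => cos (th + ip3 l (X x))) = cos th * Phi l.
Implicit Types (a b y : R * R * R).
Notation f := (invfourier Phi).

Let mbox a b : measurable_fun setT (fun x : T => (inbox a b (X x))%:R : R).
Proof. exact: (measurableT_comp (measurable_inbox a b) mX). Qed.

Let mcbox a b : measurable_fun setT (fun x : T => (incbox a b (X x))%:R : R).
Proof.
have mi (u v : R) : measurable_fun setT (fun y : R => ((u <= y <= v)%R%:R : R)).
  have -> : (fun y : R => ((u <= y <= v)%R%:R : R)) = \1_`[u, v]%classic.
    by apply/funext => y; rewrite indicE; congr (nat_of_bool _)%:R; apply/idP/idP; rewrite inE /= in_itv.
  by apply: measurable_indic; exact: measurable_itv.
rewrite (_ : (fun x => _) = fun x => (a.1.1 <= (X x).1.1 <= b.1.1)%R%:R *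
   (a.1.2 <= (X x).1.2 <= b.1.2)%R%:R * (a.2 <= (X x).2 <= b.2)%R%:R); last first.
  by apply/funext => x; rewrite /incbox -!natrM !mulnb andbA.
apply: measurable_funM; first apply: measurable_funM.
- exact: (measurableT_comp (mi _ _) (measurableT_comp m3_11 mX)).
- exact: (measurableT_comp (mi _ _) (measurableT_comp m3_12 mX)).
- exact: (measurableT_comp (mi _ _) (measurableT_comp m3_2 mX)).
Qed.

Let msmooth (k : nat) a b : measurable_fun setT (fun x : T => smooth_box k.+1%:R a b (X x)).
Proof.
have c0 : 0 < k.+1%:R :> R by [].
pose F (z : T * R3) : R := (inbox a b z.2)%:R * kernel3 k.+1%:R (X z.1) z.2.
have mF : measurable_fun setT F.
  apply: measurable_funM; first exact: (measurableT_comp (measurable_inbox a b) measurable_snd).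
  exact: (measurableT_comp (measurable_kernel3 mX _) (measurable_fun_pair measurable_snd measurable_fst)).
have i1 : P.-integrable setT (EFin \o (fun _ : T => Num.sqrt (k.+1%:R / pi) ^+ 3 : R)) by apply: bm_integrable; exact: bm_cst.
have bF (x : T) (y : R3) : `|F (x, y)| <= Num.sqrt (k.+1%:R / pi) ^+ 3 * (inbox a b y)%:R.
  by rewrite normrM normr_nat mulrC ler_wpM2r// ger0_norm ?kernel3_ge0// kernel3_le.
have [iF s1 s2] := @integrable_dominated_prod R _ _ T R3 P leb3 F _ _ mF i1 (integrable_inbox a b) bF.
rewrite (_ : (fun x => _) = fun x => \int[leb3]_y F (x, y)); first exact: (measurable_fun_Rint iF).
by apply/funext => x; rewrite -(smooth_boxE a b (X x) c0).
Qed.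

Let bmbool (p : T -> bool) : measurable_fun setT (fun x => (p x)%:R : R) -> bm (fun x => (p x)%:R : R).
Proof. by move=> mp; split=> //; exists 1 => x; rewrite normr_nat lern1 leq_b1. Qed.

Let bmsmooth (k : nat) a b : bm (fun x : T => smooth_box k.+1%:R a b (X x)).
Proof. by split=> //; exists 1 => x; rewrite ger0_norm ?smooth_box_ge0 ?smooth_box_le1. Qed.

Let smooth_in a b y : inbox a b y -> smooth_box k.+1%:R a b y @[k --> \oo] --> (1 : R).
Proof.
move=> /and3P[h1 h2 h3].
have := cvgM (cvgM (smooth_itv_cvg1 h1) (smooth_itv_cvg1 h2)) (smooth_itv_cvg1 h3).
by rewrite !mulr1; apply.
Qed.

Let smooth_out a b y : ~~ incbox a b y -> smooth_box k.+1%:R a b y @[k --> \oo] --> (0 : R).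
Proof.
have le (c u v : R) : 0 <= u <= 1 -> 0 <= v <= 1 -> 0 <= c -> c * u * v <= c.
  by move=> /andP[u0 u1] /andP[v0 v1] c0; rewrite -mulrA ler_piMr// mulr_ile1.
have q01 (k : nat) (u v z : R) : 0 <= smooth_itv k.+1%:R u v z <= 1.
  by rewrite smooth_itv_ge0 smooth_itv_le1.
have q0 (k : nat) (u v z : R) : 0 <= smooth_itv k.+1%:R u v z by exact: smooth_itv_ge0.
have sq (g : nat -> R) : (forall k, smooth_box k.+1%:R a b y <= g k) -> g k @[k --> \oo] --> (0 : R) ->
    smooth_box k.+1%:R a b y @[k --> \oo] --> (0 : R).
  move=> hg g0; apply: (@squeeze_cvgr _ _ _ _ (fun=> 0) g) => //; last exact: cvg_cst.
  by apply: nearW => k; rewrite smooth_box_ge0 hg.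
rewrite /incbox !negb_and => /or3P[h|h|h]; rewrite -negb_and in h.
- apply: (sq (fun k => smooth_itv k.+1%:R a.1.1 b.1.1 y.1.1)); last exact: smooth_itv_cvg0.
  by move=> k; exact: le.
- apply: (sq (fun k => smooth_itv k.+1%:R a.1.2 b.1.2 y.1.2)); last exact: smooth_itv_cvg0.
  by move=> k; rewrite /smooth_box [X in X * _]mulrC; exact: le.
- apply: (sq (fun k => smooth_itv k.+1%:R a.2 b.2 y.2)); last exact: smooth_itv_cvg0.
  by move=> k; rewrite /smooth_box mulrC mulrA; exact: le.
Qed.

Lemma prob_inbox_le a b : EE P (fun x : T => (inbox a b (X x))%:R) <= \int[leb3]_y ((inbox a b y)%:R * f y).
Proof.
have l1 : EE P (fun x : T => (inbox a b (X x))%:R * smooth_box k.+1%:R a b (X x)) @[k --> \oo] -->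
    EE P (fun x : T => (inbox a b (X x))%:R).
  apply: (EE_dominated _ _ (M := 1)) => //.
  - by move=> k; apply: measurable_funM.
  - move=> k x; rewrite normrM normr_nat ger0_norm ?smooth_box_ge0// mulr_ile1 ?smooth_box_ge0 ?smooth_box_le1//.
    by rewrite lern1 leq_b1.
  apply: aeW => x; case: (boolP (inbox a b (X x))) => h.
    rewrite -[X in _ --> X]mulr1; apply: cvgM; first exact: cvg_cst.
    exact: smooth_in.
  under eq_cvg do rewrite mul0r; exact: cvg_cst.
have l2 : EE P (fun x : T => smooth_box k.+1%:R a b (X x)) @[k --> \oo] --> \int[leb3]_y ((inbox a b y)%:R * f y).
  exact: (fsmooth_box_cvg mX iPhi charf).
apply: (ler_cvg_to l1 l2).
apply: nearW => k; apply: EE_le => //; first by apply: bmM => //; exact: bmbool.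
by move=> x; rewrite ler_piMl ?smooth_box_ge0// lern1 leq_b1.
Qed.

Lemma prob_incbox_ge a b : \int[leb3]_y ((inbox a b y)%:R * f y) <= EE P (fun x : T => (incbox a b (X x))%:R).
Proof.
have mN : measurable_fun setT (fun x : T => (~~ incbox a b (X x))%:R : R).
  rewrite (_ : (fun x => _) = fun x => 1 - (incbox a b (X x))%:R); last first.
    by apply/funext => x; case: (incbox _ _ _); rewrite ?subrr ?subr0.
  by apply: measurable_funB => //; exact: measurable_cst.
have l1 : EE P (fun x : T => (~~ incbox a b (X x))%:R * smooth_box k.+1%:R a b (X x)) @[k --> \oo] --> (0 : R).
  rewrite -(EE_cst P 0); apply: (EE_dominated _ _ (M := 1)) => //.
  - by move=> k; apply: measurable_funM.
  - move=> k x; rewrite normrM normr_nat ger0_norm ?smooth_box_ge0// mulr_ile1 ?smooth_box_ge0 ?smooth_box_le1//.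
    by rewrite lern1 leq_b1.
  apply: aeW => x; case: (boolP (incbox a b (X x))) => h /=.
    under eq_cvg do rewrite mul0r; exact: cvg_cst.
  under eq_cvg do rewrite mul1r; exact: smooth_out.
have l2 : EE P (fun x : T => (incbox a b (X x))%:R) +
   EE P (fun x : T => (~~ incbox a b (X x))%:R * smooth_box k.+1%:R a b (X x)) @[k --> \oo] -->
   EE P (fun x : T => (incbox a b (X x))%:R) + 0.
  by apply: cvgD; [exact: cvg_cst|exact: l1].
rewrite addr0 in l2.
have l3 : EE P (fun x : T => smooth_box k.+1%:R a b (X x)) @[k --> \oo] --> \int[leb3]_y ((inbox a b y)%:R * f y).
  exact: (fsmooth_box_cvg mX iPhi charf).
apply: (ler_cvg_to l3 l2).
have bN k : bm (fun x : T => (~~ incbox a b (X x))%:R * smooth_box k.+1%:R a b (X x)).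
  by apply: bmM => //; exact: bmbool.
apply: nearW => k; rewrite -EED//; last exact: bmbool.
apply: EE_le => //; first by apply: bmD => //; exact: bmbool.
move=> x; case: (incbox a b (X x)); last by rewrite add0r mul1r.
by rewrite mul0r addr0 smooth_box_le1.
Qed.

Definition shrink (k : nat) a : R * R * R := (a.1.1 + k.+1%:R^-1, a.1.2 + k.+1%:R^-1, a.2 + k.+1%:R^-1).
Definition shrinkr (k : nat) b : R * R * R := (b.1.1 - k.+1%:R^-1, b.1.2 - k.+1%:R^-1, b.2 - k.+1%:R^-1).

Lemma prob_inboxE a b : EE P (fun x : T => (inbox a b (X x))%:R) = \int[leb3]_y ((inbox a b y)%:R * f y).
Proof.
apply/eqP; rewrite eq_le prob_inbox_le/=.
have sub k y : incbox (shrink k a) (shrinkr k b) y -> inbox a b y.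
  have k0 : 0 < k.+1%:R^-1 :> R by rewrite invr_gt0.
  have h (u v z : R) : u + k.+1%:R^-1 <= z <= v - k.+1%:R^-1 -> u < z < v.
    by move=> /andP[h1 h2]; apply/andP; split;
      [apply: lt_le_trans h1; rewrite ltrDl|apply: le_lt_trans h2 _; rewrite gtrBl].
  by move=> /and3P[/h h1 /h h2 /h h3]; apply/and3P.
have l1 : \int[leb3]_y ((inbox (shrink k a) (shrinkr k b) y)%:R * f y) @[k --> \oo] -->
   \int[leb3]_y ((inbox a b y)%:R * f y).
  have f0 y : 0 <= f y by exact: (invfourier_ge0 mX iPhi charf).
  have [] // := @Rintegral_dominated R _ R3 leb3
    (fun k y => (inbox (shrink k a) (shrinkr k b) y)%:R * f y) (fun y => (inbox a b y)%:R * f y)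
    (fun y => (inbox a b y)%:R * f y).
  - by move=> k; exact: (measurable_inbox_invfourier mX iPhi charf).
  - exact: (measurable_inbox_invfourier mX iPhi charf).
  - move=> k y; rewrite normrM normr_nat ger0_norm// ler_wpM2r// ler_nat.
    case: (boolP (inbox (shrink k a) (shrinkr k b) y)) => // h; rewrite (sub k y)//.
    by move: h => /and3P[/andP[h1 h2] /andP[h3 h4] /andP[h5 h6]]; apply/and3P; split; rewrite !ltW.
  - exact: (integrable_inbox_invfourier mX iPhi charf).
  move=> y; apply: cvgM; last exact: cvg_cst.
  apply: cvg_near_cst.
  have near1 (u v z : R) : \forall k \near \oo, (u + k.+1%:R^-1 < z < v - k.+1%:R^-1) = (u < z < v).
    case: (boolP (u < z < v)) => [/andP[uz zv]|h].
      have e0 : 0 < Num.min (z - u) (v - z) by rewrite lt_min !subr_gt0 uz.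
      have /cvgrPdist_lt/(_ _ e0) := @cvg_harmonic R.
      apply: filterS => k; rewrite /harmonic /= sub0r normrN ger0_norm ?invr_ge0// lt_min => /andP[h1 h2].
      by rewrite -ltrBrDl h1 ltrBrDr -ltrBrDl h2.
    apply: nearW => k; apply/negbTE; apply: contra h => /andP[h1 h2].
    have k0 : 0 < k.+1%:R^-1 :> R by rewrite invr_gt0.
    by apply/andP; split; [apply: lt_trans h1; rewrite ltrDl|apply: lt_trans h2 _; rewrite gtrBl].
  near=> k; congr (nat_of_bool _)%:R; rewrite /inbox /=; congr [&& _, _ & _]; near: k; exact: near1.
have l2 : EE P (fun x : T => (inbox a b (X x))%:R) @[_ --> \oo] --> EE P (fun x : T => (inbox a b (X x))%:R).
  exact: cvg_cst.
apply: (ler_cvg_to l1 l2).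
apply: nearW => k; apply: le_trans (prob_incbox_ge _ _) _.
apply: EE_le; [exact: bmbool|exact: bmbool|].
move=> x; rewrite ler_nat; case: (boolP (incbox _ _ _)) => // h; by rewrite (sub k).
Unshelve. all: by end_near.
Qed.

Lemma measurable_inbox_set a b : measurable [set y : R3 | inbox a b y].
Proof.
have := measurable_inbox a b measurableT (measurable_set1 (1 : R)).
rewrite setTI; congr measurable; apply/seteqP; split => y /=.
  by case: (inbox a b y) => // /esym/eqP; rewrite oner_eq0.
by move=> ->.
Qed.

Lemma prob_inbox_ereal a b : P (X @^-1` [set y | inbox a b y]) =
  (\int[leb3]_(y in [set y | inbox a b y]) (f y)%:E)%E.
Proof.
have mP : measurable (X @^-1` [set y | inbox a b y]).
  by rewrite -[X in measurable X]setTI; apply: mX => //; exact: measurable_inbox_set.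
have mbl : measurable_fun setT (fun x => inbox a b (X x)).
  apply: (measurable_fun_bool true); rewrite setTI.
  by move: mP; congr measurable; apply/seteqP; split => x /= ->.
have e1 := expectation_bool P mbl.
have e2 : (\int[leb3]_(y in [set y | inbox a b y]) (f y)%:E = \int[leb3]_y ((inbox a b y)%:R * f y)%:E)%E.
  rewrite integral_mkcond; apply: eq_integral => y _.
  rewrite patchE; case: (boolP (inbox a b y)) => h.
    by rewrite mem_set// mul1r.
  by rewrite memNset ?mul0r//; exact/negP.
rewrite e2 (RintegralE measurableT (integrable_inbox_invfourier mX iPhi charf a b)) -prob_inboxE e1.
by rewrite fineK// fin_num_measure.
Qed.

Let G : set (set R3) := [set B | exists a b, B = [set y | inbox a b y]].

Let GE : @measurable _ R3 = <<s G >>.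
Proof.
apply/seteqP; split; last first.
  apply: smallest_sub; first exact: sigma_algebra_measurable.
  by move=> _ [a [b ->]]; exact: measurable_inbox_set.
pose T' := g_sigma_algebraType G.
have mcoord (p : R3 -> R) (lo hi : R -> nat -> R3) :
    (forall u v, p @^-1` `]u, v[%classic = \bigcup_k [set y | inbox (lo u k) (hi v k) y]) ->
    measurable_fun setT (p : T' -> R).
  move=> hp; apply: (measurability _ (RGenOpens.measurableE R)).
  move=> _ [_ [u [v ->]] <-]; rewrite setTI hp; apply: bigcupT_measurable => k.
  by apply: sub_sigma_algebra; exists (lo u k), (hi v k).
have m : measurable_fun setT ((fun y => y) : T' -> R3).
  have m1 : measurable_fun setT ((fun y => y.1.1) : T' -> R).
    apply: (mcoord _ (fun u k => (u, - k%:R, - k%:R)) (fun v k => (v, k%:R, k%:R))) => u v.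
    apply/seteqP; split => y /=; rewrite in_itv /=.
      move=> h; have [k _ hk] := inbox_cube y; exists k => //=.
      by have /and3P[_ h2 h3] := hk k (leqnn k); apply/and3P.
    by move=> [k _ /and3P[]].
  have m2 : measurable_fun setT ((fun y => y.1.2) : T' -> R).
    apply: (mcoord _ (fun u k => (- k%:R, u, - k%:R)) (fun v k => (k%:R, v, k%:R))) => u v.
    apply/seteqP; split => y /=; rewrite in_itv /=.
      move=> h; have [k _ hk] := inbox_cube y; exists k => //=.
      by have /and3P[h1 _ h3] := hk k (leqnn k); apply/and3P.
    by move=> [k _ /and3P[]].
  have m3 : measurable_fun setT ((fun y => y.2) : T' -> R).
    apply: (mcoord _ (fun u k => (- k%:R, - k%:R, u)) (fun v k => (k%:R, k%:R, v))) => u v.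
    apply/seteqP; split => y /=; rewrite in_itv /=.
      move=> h; have [k _ hk] := inbox_cube y; exists k => //=.
      by have /and3P[h1 h2 _] := hk k (leqnn k); apply/and3P.
    by move=> [k _ /and3P[]].
  rewrite (_ : (fun y => y) = fun y : T' => (y.1.1, y.1.2, y.2)); last by apply/funext => -[[]].
  exact: (measurable_fun_pair (measurable_fun_pair m1 m2) m3).
by move=> A mA; have := m measurableT A mA; rewrite setTI.
Qed.

Lemma inboxI a b a' b' : exists a'' b'', [set y | inbox a b y] `&` [set y | inbox a' b' y] = [set y | inbox a'' b'' y].
Proof.
exists (Num.max a.1.1 a'.1.1, Num.max a.1.2 a'.1.2, Num.max a.2 a'.2).
exists (Num.min b.1.1 b'.1.1, Num.min b.1.2 b'.1.2, Num.min b.2 b'.2).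
apply/seteqP; split => y; rewrite /inbox /= !gt_max !lt_min.
  move=> [/and3P[/andP[-> ->] /andP[-> ->] /andP[-> ->]]].
  by move=> /and3P[/andP[-> ->] /andP[-> ->] /andP[-> ->]].
move=> /and3P[/andP[/andP[-> ->] /andP[-> ->]] /andP[/andP[-> ->] /andP[-> ->]]].
by move=> /andP[/andP[-> ->] /andP[-> ->]].
Qed.

Theorem density_of_characteristic_function : has_density3 P X f.
Proof.
have f0 y : 0 <= f y by exact: (invfourier_ge0 mX iPhi charf).
have mf : measurable_fun setT f by exact: (measurable_invfourier mX iPhi charf).
split=> // A mA.
have mX' : @measurable_fun _ _ T R3 setT X by exact: mX.
pose X' : {mfun T >-> R3} := @mfun_Sub _ _ T R3 X (mem_set mX').
pose m1 : {measure set R3 -> \bar R} := distribution P X'.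
pose m2 : {measure set R3 -> \bar R} := density_measure leb3 mf f0.
have cover : \bigcup_k [set y | inbox (- k%:R, - k%:R, - k%:R) (k%:R, k%:R, k%:R) y] = [set: R3].
  apply/seteqP; split => // y _; have [k _ hk] := inbox_cube y; exists k => //.
  exact: hk k (leqnn k).
have setIG : setI_closed G.
  by move=> _ _ [a [b ->]] [a' [b' ->]]; have [a'' [b'' ->]] := inboxI a b a' b'; exists a'', b''.
have -> : P (X @^-1` A) = m1 A by [].
(* [lebesgue3] integrates over the default measurable structure of [R * R * R], [leb3] over that of
   Lebesgue measure; they have the same measurable sets but are not convertible. *)
have -> : (\int[lebesgue3]_(x in A) (f x)%:E)%E = m2 A.
  have mid : @measurable_fun _ _ R3 (R * R * R)%type setT (fun x => x) by move=> _ B mB; rewrite setTI.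
  have mfE : measurable_fun A (EFin \o f) by apply/measurable_EFinP; exact: measurable_funTS.
  exact: (@ge0_integral_pushforward _ _ R3 (R * R * R)%type R (fun x => x) mid leb3 A (EFin \o f) mA mfE (fun x _ => f0 x)).
apply: (@measure_unique _ R R3 G (fun k : nat => [set y | inbox (- k%:R, - k%:R, - k%:R) (k%:R, k%:R, k%:R) y]) GE setIG _ cover m1 m2 _ _ A mA).
- by move=> k; eexists; eexists.
- by move=> _ [a [b ->]]; exact: prob_inbox_ereal.
- move=> k; apply: (@le_lt_trans _ _ 1%E); last exact: ltry.
  exact: (@probability_le1 _ R3 R (distribution P X') _ (measurable_inbox_set _ _)).
Qed.

End Density.

Section AreaTerms.
Context {R : realType}.
Notation leb := (@lebesgue_measure R).
Notation leb3 := (@leb3 R).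
Notation R3 := (measurableTypeR R * measurableTypeR R * measurableTypeR R)%type.
Implicit Types (y l : R * R * R) (g h : R * R * R -> R).

Definition halfexp (p u : R) : R := (0 <= u)%R%:R * expR (- (p * u)).

Lemma halfexpE p : halfexp p = (fun u => expR (- (p * u))) \_ `[0, +oo[.
Proof.
apply/funext => u; rewrite patchE /halfexp mem_setE in_itv /= andbT.
by case: (0 <= u); rewrite ?mul1r ?mul0r.
Qed.

Lemma integral_halfexp (p : R) : 0 < p ->
  leb.-integrable setT (EFin \o halfexp p) /\ \int[leb]_u halfexp p u = p^-1.
Proof.
move=> p0.
have ce : continuous (fun u : R => expR (- (p * u))).
  by apply: cont_comp (@continuous_expR R); apply: contN; exact: cont_scale.
have de (u : R) : is_derive u 1 (fun u : R => - p^-1 * expR (- (p * u))) (expR (- (p * u))).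
  have h := is_deriveZ (- p^-1) (is_derive_comp1 (is_deriveN (is_deriveZ p (is_derive_id u (1 : R)))) (is_derive_expR _)).
  apply: is_derive_eq h _; rewrite /GRing.scale /=; move: (expR _) => e; field; exact: lt0r_neq0.
have I : (\int[leb]_(u in `[0%R, +oo[) (expR (- (p * u)))%:E = (p^-1)%:E)%E.
  rewrite (@ge0_continuous_FTC2y _ _ (fun u => - p^-1 * expR (- (p * u))) 0 0).
  - by rewrite mulr0 oppr0 expR0 mulr1 EFinN oppeK add0e.
  - by move=> x _; exact: expR_ge0.
  - exact: continuous_subspaceT.
  - rewrite -(mulr0 (- p^-1)); apply: cvgM; first exact: cvg_cst.
    apply: (cvg_comp (fun u : R => p * u) (fun v => expR (- v))); last exact: cvgr_expR.
    by apply: gt0_cvgMry => //; exact: cvg_id.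
  - by move=> x _; have [] := de x.
  - by apply: cvg_at_right_filter; exact: (is_derive_continuous de).
  - by move=> x _; rewrite derive1E; have [_ ->] := de x.
have m : measurable_fun setT (fun u : R => expR (- (p * u))) by exact: continuous_measurable_fun.
have I' : (\int[leb]_u (halfexp p u)%:E = (p^-1)%:E)%E.
  rewrite -I [RHS]integral_mkcond halfexpE; apply: eq_integral => u _.
  by rewrite restrict_EFin.
have mh : measurable_fun setT (halfexp p).
  rewrite halfexpE; apply/(measurable_restrictT _ (measurable_itv _)); exact: measurable_funTS.
split; last by rewrite /Rintegral I'.
apply/integrableP; split; first exact/measurable_EFinP.
under eq_integral do rewrite /= ger0_norm ?mulr_ge0 ?expR_ge0//.
by rewrite I' ltry.
Qed.

Definition muf l : R := rho1 l - 1.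

Lemma muf_ge0 l : 0 <= muf l. Proof. by rewrite subr_ge0 rho1_ge1. Qed.

Lemma measurable_muf : measurable_fun setT muf.
Proof. by apply: measurable_funB; [exact: measurable_rho1|exact: measurable_cst]. Qed.

Definition cos_transform y g (c : R) : Prop :=
  leb3.-integrable setT (EFin \o (fun l => cos (ip3 l y) * g l)) /\
  \int[leb3]_l (cos (ip3 l y) * g l) = 4 * pi * c.

Lemma cos_transformZ y g c k : cos_transform y g c -> cos_transform y (fun l => k * g l) (k * c).
Proof.
move=> [i e]; have E : (fun l => cos (ip3 l y) * (k * g l)) = fun l => k * (cos (ip3 l y) * g l).
  by apply/funext => l; rewrite mulrCA.
split; first by rewrite E; exact: (integrableZl measurableT k i).
rewrite [LHS](_ : _ = \int[leb3]_l (k * (cos (ip3 l y) * g l))); last first.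
  by apply: eq_Rintegral => l _; rewrite mulrCA.
by rewrite RintegralZl// e; ring.
Qed.

Lemma cos_transformD y g h c c' : cos_transform y g c -> cos_transform y h c' ->
  cos_transform y (fun l => g l + h l) (c + c').
Proof.
move=> [i e] [i' e'].
have E : (fun l => cos (ip3 l y) * (g l + h l)) = fun l => cos (ip3 l y) * g l + cos (ip3 l y) * h l.
  by apply/funext => l; rewrite mulrDr.
split; first by rewrite E; exact: (integrableD measurableT i i').
rewrite [LHS](_ : _ = \int[leb3]_l (cos (ip3 l y) * g l + cos (ip3 l y) * h l)); last first.
  by apply: eq_Rintegral => l _; rewrite mulrDr.
by rewrite RintegralD// e e' -mulrDr.
Qed.

Lemma cos_transform_sum y (g : nat -> R * R * R -> R) (c : nat -> R) N :
  (forall k, cos_transform y (g k) (c k)) ->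
  cos_transform y (fun l => \sum_(0 <= k < N) g k l) (\sum_(0 <= k < N) c k).
Proof.
move=> h; elim: N => [|N IH].
  rewrite big_geq//; have := cos_transformZ 0 (h 0%N); rewrite mul0r.
  by rewrite (_ : (fun l => 0 * g 0%N l) = fun l => \sum_(0 <= k < 0) g k l)//; apply/funext => l; rewrite big_geq// mul0r.
rewrite big_nat_recr//=.
rewrite (_ : (fun l => _) = fun l => \sum_(0 <= k < N) g k l + g N l); first exact: cos_transformD.
by apply/funext => l; rewrite big_nat_recr.
Qed.

Lemma kernel_transform y (s : R) : 0 < s ->
  leb3.-integrable setT (EFin \o (fun l => expR (- (s * muf l)))) /\
  cos_transform y (fun l => expR (- (s * muf l))) (area_kernel y s).
Proof.
move=> s0; have [i e] := kernel_fourier y 0 s0.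
have E l : expR (- (s * muf l)) = expR s * expR (- (s * rho1 l)).
  by rewrite -expRD /muf; congr expR; ring.
have i' : leb3.-integrable setT (EFin \o (fun l => expR (- (s * muf l)))).
  have := integrableZl measurableT (expR s) i; apply: eq_integrable => // l _ /=.
  by rewrite E.
have c1 (x : R) : `|cos x| <= 1 by rewrite ler_norml cos_geN1 cos_le1.
have ic : leb3.-integrable setT (EFin \o (fun l => cos (ip3 l y + 0) * expR (- (s * rho1 l)))).
  apply: (integrable_le3 (h := fun l => expR (- (s * rho1 l)))) => //.
    exact: (measurable_funM (measurable_cos_ip3 y 0) (measurable_expR_rho1 s)).
  by move=> l; rewrite normrM [`|expR _|]ger0_norm ?expR_ge0// ler_piMl ?expR_ge0.
split=> //; split.
  have := integrableZl measurableT (expR s) ic; apply: eq_integrable => // l _ /=.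
  by rewrite E addr0 -EFinM; congr _%:E; ring.
rewrite [LHS](_ : _ = \int[leb3]_l (expR s * (cos (ip3 l y + 0) * expR (- (s * rho1 l))))); last first.
  by apply: eq_Rintegral => l _; rewrite E addr0 mulrCA.
rewrite RintegralZl// e cos0 mul1r expRN.
by have := expR_gt0 s; move: (expR s) (area_kernel y s) (pi : R) => x z q x0; field; exact: lt0r_neq0.
Qed.

Lemma resolvent_transform y (s p : R) : 0 < s -> 0 < p ->
  cos_transform y (fun l => expR (- (s * muf l)) / (muf l + p))
    (\int[leb]_(u in `[0, +oo[) (expR (- (p * u)) * area_kernel y (u + s))).
Proof.
move=> s0 p0; have [ih _] := integral_halfexp p0; have [ie _] := kernel_transform y s0.
pose F (z : R3 * measurableTypeR R) : R :=
  cos (ip3 z.1 y + 0) * (expR (- (s * muf z.1)) * halfexp (p + muf z.1) z.2).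
have m1 := @measurable_fst _ _ R3 (measurableTypeR R).
have m2 := @measurable_snd _ _ R3 (measurableTypeR R).
have mE : measurable_fun setT (fun x : R => expR (- x)).
  by apply: continuous_measurable_fun; apply: cont_comp (@continuous_expR R); exact: contN cont_id.
have mmu := measurableT_comp measurable_muf m1.
have mpos : measurable_fun setT (fun u : R => (0 <= u)%R%:R : R).
  rewrite (_ : (fun u : R => _) = \1_`[0, +oo[%classic); first exact: measurable_indic.
  by apply/funext => u; rewrite indicE mem_setE in_itv /= andbT.
have mF : measurable_fun setT F.
  apply: measurable_funM; first exact: (measurableT_comp (measurable_cos_ip3 y 0) m1).
  apply: measurable_funM.
    apply: (measurableT_comp mE); apply: measurable_funM; [exact: measurable_cst|exact: mmu].
  apply: measurable_funM; first exact: (measurableT_comp mpos m2).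
  apply: (measurableT_comp mE); apply: measurable_funM; last exact: m2.
  by apply: measurable_funD; [exact: measurable_cst|exact: mmu].
have bF (l : R3) (u : measurableTypeR R) : `|F (l, u)| <= expR (- (s * muf l)) * halfexp p u.
  have c1 : `|cos (ip3 l y + 0)| <= 1 by rewrite ler_norml cos_geN1 cos_le1.
  have q0 (a : R) : 0 <= halfexp a u by rewrite mulr_ge0 ?expR_ge0.
  rewrite normrM [X in _ * X]ger0_norm ?mulr_ge0 ?expR_ge0//.
  apply: le_trans (ler_piMl _ c1) _; first by rewrite mulr_ge0 ?expR_ge0.
  rewrite ler_wpM2l ?expR_ge0// /halfexp; case: (leP 0 u) => u0; last by rewrite !mul0r.
  by rewrite !mul1r ler_expR lerN2 ler_wpM2r// lerDl muf_ge0.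
have [iF s1 s2] := @integrable_dominated_prod R _ _ R3 (measurableTypeR R) leb3 leb F _ _ mF ie ih bF.
have inner l : \int[leb]_u F (l, u) = cos (ip3 l y) * (expR (- (s * muf l)) / (muf l + p)).
  have pm : 0 < p + muf l by rewrite ltr_wpDr ?muf_ge0.
  have [ihl e] := integral_halfexp pm.
  rewrite [LHS](_ : _ = \int[leb]_u (cos (ip3 l y) * expR (- (s * muf l)) * halfexp (p + muf l) u)); last first.
    by apply: eq_Rintegral => u _; rewrite /F /= addr0 mulrA.
  by rewrite RintegralZl// e [muf l + p]addrC mulrA.
split.
  have h := measurable_fun_Rint iF.
  apply: (@integrable_le3 R _ (fun l => p^-1 * expR (- (s * muf l)))).
  - by move: h; congr measurable_fun; apply/funext => l; exact: inner.
  - move=> l; have c1 : `|cos (ip3 l y)| <= 1 by rewrite ler_norml cos_geN1 cos_le1.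
    have pm : 0 < muf l + p by rewrite ltr_wpDl ?muf_ge0.
    have q0 : 0 <= expR (- (s * muf l)) / (muf l + p).
      by apply: divr_ge0; [exact: expR_ge0|exact: ltW].
    rewrite normrM [X in _ * X]ger0_norm//.
    apply: le_trans (ler_piMl q0 c1) _.
    by rewrite mulrC ler_wpM2r ?expR_ge0// lef_pV2 ?posrE// lerDr muf_ge0.
  - exact: (integrableZl measurableT p^-1 ie).
rewrite [LHS](_ : _ = \int[leb3]_l \int[leb]_u F (l, u)); last first.
  by apply: eq_Rintegral => l _; rewrite inner.
rewrite (Rfubini iF s1 s2).
pose K := (fun u => expR (- (p * u)) * area_kernel y (u + s)) \_ `[0, +oo[.
have KE : forall u : R, \int[leb3]_l F (l, u) = 4 * pi * K u.
  move=> u; rewrite /K patchE mem_setE in_itv /= andbT.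
  case: (leP 0 u) => u0; last first.
    transitivity (\int[leb3]_l (0 * expR (- (s * muf l)))).
      by apply: eq_Rintegral => l _; rewrite /F /halfexp /= leNgt u0 !mul0r !mulr0.
    by rewrite RintegralZl// mul0r; exact/esym/(mulr0 (4 * pi)).
  have us : 0 < u + s by rewrite ltr_wpDl.
  have [_ [ik ek]] := kernel_transform y us.
  rewrite [LHS](_ : _ = \int[leb3]_l (expR (- (p * u)) * (cos (ip3 l y) * expR (- ((u + s) * muf l))))); last first.
    apply: eq_Rintegral => l _; rewrite /F /halfexp /= u0 mul1r addr0 [RHS]mulrCA -!expRD.
    by congr (_ * expR _); ring.
  by rewrite RintegralZl// ek; ring.
have pi4 : 0 < 4 * pi :> R by rewrite mulr_gt0 ?pi_gt0.
pose F' (z : measurableTypeR R * R3) : R := F (z.2, z.1).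
have mF' : measurable_fun setT F' by exact: (measurableT_comp mF (measurable_fun_pair measurable_snd measurable_fst)).
have bF' (u : measurableTypeR R) (l : R3) : `|F' (u, l)| <= halfexp p u * expR (- (s * muf l)) by rewrite mulrC; exact: bF.
have [iF' _ _] := @integrable_dominated_prod R _ _ (measurableTypeR R) R3 leb leb3 F' _ _ mF' ih ie bF'.
have iG : leb.-integrable setT (EFin \o (fun u => \int[leb3]_l F (l, u))).
  apply: (@integrable_le1 R _ (fun u => (\int[leb3]_l expR (- (s * muf l))) * halfexp p u)).
  - exact: (measurable_fun_Rint iF').
  - move=> u; apply: le_trans (le_normr_Rintegral measurableT (s2 u)) _.
    have ieu := integrableZl measurableT (halfexp p u) ie.
    rewrite mulrC -RintegralZl//.
    apply: (@le_Rintegral _ _ R leb3 setT) => //; first exact: (integrable_abse (s2 u)).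
    by move=> l _; rewrite mulrC; exact: bF.
  - exact: (integrableZl measurableT _ ih).
have iK : leb.-integrable setT (EFin \o K).
  have := integrableZl measurableT (4 * pi)^-1 iG; apply: eq_integrable => // u _ /=.
  by rewrite KE -EFinM mulKf// lt0r_neq0.
rewrite [LHS](_ : _ = \int[leb]_u (4 * pi * K u)); last by apply: eq_Rintegral => u _; exact: KE.
have -> : \int[leb]_(u in `[0, +oo[) (expR (- (p * u)) * area_kernel y (u + s)) = \int[leb]_u K u.
  exact: Rintegral_mkcond.
by rewrite RintegralZl.
Qed.

End AreaTerms.

Section AreaSeries.
Context {R : realType}.
Notation leb := (@lebesgue_measure R).
Notation leb3 := (@leb3 R).
Notation R3 := (measurableTypeR R * measurableTypeR R * measurableTypeR R)%type.
Variables (n : nat) (a : nat -> nat -> R) (t : R).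
Hypothesis n0 : (0 < n)%N.
Hypothesis ha : area_coefficients n a.
Hypothesis t0 : 0 < t.
Implicit Types (y l : R * R * R).

Let D (j : nat) : R := (-1) ^+ j * (pochhammer (2 * n%:R) j / j`!%:R)
  * expR (- (2 * j%:R * (j%:R + 2 * n%:R + 1) * t)).
Let s (j : nat) : R := (2 * j%:R + 2 * n%:R) * t.

Definition area_transform (j : nat) l : R := D j * (gcoef n a j (muf l) * expR (- (s j * muf l))).
Notation F := area_transform.

Let s_gt0 j : 0 < s j.
Proof. by rewrite mulr_gt0// ltr_wpDl ?mulr_ge0// mulr_gt0// ltr0n. Qed.

Lemma cos_transform_area_term y j : cos_transform y (F j) (area_term n a t y j).
Proof.
have [_ h0] := kernel_transform y (s_gt0 j).
have hk k : cos_transform y (fun l => a k j * (expR (- (s j * muf l)) / (muf l + 2 * (j%:R + k%:R))))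
  (a k j * \int[leb]_(u in `[0, +oo[) (expR (- (2 * (j%:R + k%:R) * u)) * area_kernel y (u + s j))).
  have [/andP[/eqP -> /eqP ->]|jk] := boolP ((j == 0%N) && (k == 0%N)).
    have [_ _ a0] := ha; rewrite a0 mul0r.
    rewrite (_ : (fun l => _) = fun l => 0 * expR (- (s j * muf l))); last first.
      by apply/funext => l; rewrite !mul0r.
    by have := cos_transformZ 0 h0; rewrite mul0r.
  apply: cos_transformZ; apply: resolvent_transform => //.
  rewrite -natrD mulr_gt0// ltr0n lt0n addn_eq0//.
have := cos_transformZ (D j) (cos_transformD (cos_transformZ (2 ^+ (2 * n)) h0)
  (cos_transform_sum (2 * n + 1).+1 hk)).
rewrite (_ : (fun l => _) = F j)//.
apply/funext => l; rewrite /F /gcoef; congr (_ * _).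
rewrite mulrDl mulr_suml; congr (_ + _); apply: eq_bigr => k _.
by rewrite mulrA mulrAC; congr (_ / _ * _); ring.
Qed.

Lemma muf_cases l : muf l = 0 \/ 0 < muf l.
Proof. by have := muf_ge0 l; rewrite le_eqVlt => /predU1P[<-|]; [left|right]. Qed.

Lemma gcoef_muf j l : 0 <= gcoef n a j (muf l) <= 2 ^+ (2 * n).
Proof.
have [->|mu0] := muf_cases l.
  by rewrite (gcoef_at0 ha); case: (j == 0%N); rewrite ?ler01 ?lexx ?exprn_ge0 ?exprn_ege1 ?ler1n.
have nu0 : 0 < muf l / 2 by rewrite divr_gt0.
have -> : muf l = 2 * (muf l / 2) by field.
by rewrite (gcoef_rr n0 ha j nu0) rr_ge0// rr_le.
Qed.

Let B (j : nat) : R := 2 ^+ (2 * n) * ((2 * n%:R) ^+ j * expR (- (2 * j%:R ^+ 2 * t))).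

Let cB : cvgn (series B).
Proof.
under [X in cvgn X]funext => k do rewrite /series /B /= -mulr_sumr.
by apply: is_cvgMr; apply: gauss_decay => //; rewrite mulr_ge0.
Qed.

Let B_ge0 j : 0 <= B j.
Proof. by rewrite !mulr_ge0 ?expR_ge0 ?exprn_ge0// mulr_ge0. Qed.

Let h (l : R * R * R) : R := expR (- (2 * n%:R * t * muf l)).

Let ih : leb3.-integrable setT (EFin \o h).
Proof. by have [] := @kernel_transform R (0, 0, 0) (2 * n%:R * t) _; rewrite // mulr_gt0// mulr_gt0// ltr0n. Qed.

Lemma area_transform_bound j l : `|F j l| <= B j * h l.
Proof.
have /andP[g0 g1] := gcoef_muf j l.
have c0 : 0 <= pochhammer (2 * n%:R) j / j`!%:R :> R by rewrite divr_ge0// pochhammer_ge0// mulr_ge0.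
have Dj : `|D j| <= (2 * n%:R) ^+ j * expR (- (2 * j%:R ^+ 2 * t)).
  rewrite /D !normrM normrX normrN1 expr1n mul1r -normrM (ger0_norm c0) ger0_norm ?expR_ge0//.
  apply: ler_pM; rewrite ?expR_ge0//; first exact: pochhammer_twon_le.
  rewrite ler_expR lerN2 ler_wpM2r ?(ltW t0)//.
  have -> : 2 * j%:R * (j%:R + 2 * n%:R + 1) = 2 * j%:R ^+ 2 + 2 * j%:R * (2 * n%:R + 1) :> R by ring.
  by rewrite lerDl !mulr_ge0// addr_ge0// mulr_ge0.
have Ej : expR (- (s j * muf l)) <= h l.
  rewrite ler_expR lerN2 ler_wpM2r ?muf_ge0// /s ler_wpM2r ?(ltW t0)// lerDr mulr_ge0//.
have -> : `|F j l| = `|D j| * gcoef n a j (muf l) * expR (- (s j * muf l)).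
  by rewrite /F normrM [X in _ * X]ger0_norm ?mulr_ge0 ?expR_ge0// mulrA.
rewrite /B [2 ^+ (2 * n) * _]mulrC.
exact: (ler_pM (mulr_ge0 (normr_ge0 _) g0) (expR_ge0 _) (ler_pM (normr_ge0 _) g0 Dj g1) Ej).
Qed.

Let sum_bound N l : `|\sum_(0 <= j < N) F j l| <= limn (series B) * h l.
Proof.
apply: le_trans (ler_norm_sum _ _ _) _.
apply: (@le_trans _ _ (series B N * h l)).
  by rewrite /series /= mulr_suml; apply: ler_sum => j _; exact: area_transform_bound.
apply: ler_wpM2r; first exact: expR_ge0.
apply: nondecreasing_cvgn_le => //; apply/nondecreasing_seqP => k.
by rewrite /series /= big_nat_recr//= lerDl.
Qed.

Definition area_charfun l : R := limn (series (fun j => F j l)).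

Lemma area_charfun_cvg l : series (fun j => F j l) @ \oo --> area_charfun l.
Proof.
suff : cvgn (series (fun j => F j l)) by [].
apply: normed_cvg; apply: (@series_le_cvg _ _ (fun j => B j * h l)) => //.
- by move=> j; exact: normr_ge0.
- by move=> j; rewrite /= mulr_ge0 ?expR_ge0.
- by move=> j; exact: area_transform_bound.
under [X in cvgn X]funext => k do rewrite /series /= -mulr_suml.
exact: is_cvgMl.
Qed.

Lemma area_charfun_transform y : leb3.-integrable setT (EFin \o area_charfun) /\
  4 * pi * series (area_term n a t y) N @[N --> \oo] --> \int[leb3]_l (cos (ip3 l y) * area_charfun l).
Proof.
have mF z N : measurable_fun setT (fun l => cos (ip3 l z) * \sum_(0 <= j < N) F j l).
  have [i _] := cos_transform_sum N (cos_transform_area_term z).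
  by apply/measurable_EFinP; exact: measurable_int i.
have cvF z l : cos (ip3 l z) * \sum_(0 <= j < N) F j l @[N --> \oo] --> cos (ip3 l z) * area_charfun l.
  by apply: cvgM; [exact: cvg_cst|exact: area_charfun_cvg].
have c1 (x : R) : `|cos x| <= 1 by rewrite ler_norml cos_geN1 cos_le1.
have dom z := @Rintegral_dominated R _ R3 leb3 (fun N l => cos (ip3 l z) * \sum_(0 <= j < N) F j l)
  (fun l => cos (ip3 l z) * area_charfun l) (fun l => limn (series B) * h l) (mF z)
  (@measurable_fun_cvg _ R3 R setT (fun N l => cos (ip3 l z) * \sum_(0 <= j < N) F j l) _ (mF z) (fun l _ => cvF z l)).
have bnd z N l : `|cos (ip3 l z) * \sum_(0 <= j < N) F j l| <= limn (series B) * h l.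
  by rewrite normrM; apply: le_trans (sum_bound N l); rewrite ler_piMl.
have ihB := integrableZl measurableT (limn (series B)) ih.
split.
  have [i _] := dom (0, 0, 0) (bnd _) ihB (cvF _).
  by move: i; apply: eq_integrable => // l _ /=; rewrite /ip3 /= !mulr0 !addr0 cos0 mul1r.
have [_ lim] := dom y (bnd _) ihB (cvF _).
rewrite (_ : (fun N => _) = fun N => \int[leb3]_l (cos (ip3 l y) * \sum_(0 <= j < N) F j l)); first exact: lim.
by apply/funext => N; have [_ ->] := cos_transform_sum N (cos_transform_area_term y).
Qed.

Lemma normed_area_series_cvg y : cvgn [normed series (area_term n a t y)].
Proof.
have pi4 : 0 < 4 * pi :> R by rewrite mulr_gt0 ?pi_gt0.
have hI : 0 <= \int[leb3]_l h l by apply: Rintegral_ge0 => // l _; exact: expR_ge0.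
apply: (@series_le_cvg _ _ (fun j => B j * ((4 * pi)^-1 * \int[leb3]_l h l))) => //.
- by move=> j; exact: normr_ge0.
- by move=> j; rewrite /= !mulr_ge0 ?invr_ge0 ?(ltW pi4).
- move=> j; have [i e] := cos_transform_area_term y j.
  rewrite -[leLHS]/(`|area_term n a t y j|).
  have -> : area_term n a t y j = (4 * pi)^-1 * \int[leb3]_l (cos (ip3 l y) * F j l).
    by rewrite e mulKf// lt0r_neq0.
  rewrite normrM ger0_norm ?invr_ge0 ?(ltW pi4)// mulrCA ler_wpM2l ?invr_ge0 ?(ltW pi4)//.
  apply: le_trans (le_normr_Rintegral measurableT i) _; rewrite -RintegralZl//.
  apply: (@le_Rintegral _ _ R leb3 setT) => //.
  + exact: (integrable_abse i).
  + exact: (integrableZl measurableT (B j) ih).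
  move=> l _; rewrite normrM; apply: le_trans (area_transform_bound j l).
  by rewrite ler_piMl// ler_norml cos_geN1 cos_le1.
- under [X in cvgn X]funext => k do rewrite /series /= -mulr_suml.
  exact: is_cvgMl.
Qed.

Lemma area_densityE y : invfourier area_charfun y = (2 * pi ^+ 2)^-1 * limn (series (area_term n a t y)).
Proof.
have [_ lim] := area_charfun_transform y.
have cs : series (area_term n a t y) @ \oo --> limn (series (area_term n a t y)).
  suff : cvgn (series (area_term n a t y)) by [].
  by apply: normed_cvg; exact: normed_area_series_cvg.
have lim2 : 4 * pi * series (area_term n a t y) N @[N --> \oo] --> 4 * pi * limn (series (area_term n a t y)).
  by apply: cvgM; [exact: cvg_cst|exact: cs].
rewrite /invfourier (cvg_unique _ lim lim2)//.
have := lt0r_neq0 (pi_gt0 R); move: (pi : R) (limn _) => p x p0.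
by field.
Qed.

Lemma area_charfun_at0 l : muf l = 0 -> area_charfun l = 1.
Proof.
move=> ml; have e j : F j l = (j == 0%N)%:R.
  rewrite /F ml (gcoef_at0 ha) mulr0 oppr0 expR0 mulr1; case: j => [|j]; last by rewrite mulr0.
  by rewrite /D pochhammer0 fact0 expr0 divr1 !(mulr0, mul0r) oppr0 expR0 !mulr1.
have S k : series (fun j => F j l) k.+1 = 1.
  rewrite /series /= (eq_bigr (fun j => (j == 0%N)%:R)) => [|i _]; last exact: e.
  by rewrite big_nat_recl// big1 ?addr0.
have c : series (fun j => F j l) @ \oo --> (1 : R).
  by rewrite -(@cvg_shiftS _ (series _)); apply: cvg_near_cst; exact: nearW.
have c' : series (fun j => F j l) @ \oo --> area_charfun l by exact: area_charfun_cvg.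
exact: (cvg_unique _ c' c).
Qed.

Lemma area_charfun_jacobi l (nu : R) : 0 < nu -> muf l = 2 * nu ->
  area_charfun l = limn (series (fun j => jcoef n nu j *
    expR (- ((4 * n%:R * nu + 2 * j%:R * (j%:R + jacA n nu)) * t)))).
Proof.
move=> nu0 ml; rewrite /area_charfun; congr (limn (series _)); apply/funext => j.
rewrite /F ml (gcoef_rr n0 ha j nu0) /D /jcoef /s.
rewrite [_ * (_ * expR _)]mulrCA -!mulrA -expRD [RHS]mulrA [RHS]mulrA.
rewrite mulrCA !mulrA; congr (_ * expR _); first by ring.
by rewrite /jacA; ring.
Qed.

End AreaSeries.

Section MainTheorem.
Context {R : realType} {d : measure_display} {T : measurableType d}.
Context (P : probability T R) {n : nat} (F : R -> set (set T)).
Context (w : R -> T -> 'M[R]_(n, 4)) (area : R -> T -> R * R * R).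
Hypothesis n0 : (0 < n)%N.
Hypothesis filt : filtration F.
Hypothesis bw : HPbrownian P F w.
Hypothesis sa : stochastic_area P w area.

Lemma area_characteristic_function (a : nat -> nat -> R) (t : R) (l : R * R * R) (th : R) :
  area_coefficients n a -> 0 < t ->
  EE P (fun x : T => cos (th + ip3 l (area t x))) = cos th * area_charfun n a t l.
Proof.
move=> ha t0; have q0 := sqnorm3_ge0 l.
have r2 : rho1 l ^+ 2 = 1 + sqnorm3 l by rewrite sqr_sqrtr// addr_ge0.
have [ml|mu0] := muf_cases l.
  rewrite (area_charfun_at0 n0 ha t0 ml) mulr1.
  have : sqnorm3 l = 0.
    have : rho1 l = 1 by move: ml; rewrite /muf => /eqP; rewrite subr_eq0 => /eqP.
    by move=> e; move: r2; rewrite e expr1n => /eqP; rewrite -subr_eq0 opprD addrA subrr sub0r oppr_eq0 => /eqP.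
  rewrite /sqnorm3 => /eqP; rewrite paddr_eq0 ?addr_ge0 ?sqr_ge0// paddr_eq0 ?sqr_ge0// !sqrf_eq0.
  move=> /andP[/andP[/eqP e1 /eqP e2] /eqP e3].
  rewrite -[RHS](EE_cst P); congr EE; apply/funext => x.
  by rewrite /ip3 e1 e2 e3 !mul0r !addr0.
have nu0 : 0 < muf l / 2 by rewrite divr_gt0.
have lE : sqnorm3 l = 4 * (muf l / 2) * (muf l / 2 + 1).
  have -> : sqnorm3 l = rho1 l ^+ 2 - 1 by rewrite r2 addrC addKr.
  by rewrite /muf; field.
have [_ ->] := area_cos n0 filt bw sa th t0 nu0 lE.
congr (_ * _); apply/esym; apply: area_charfun_jacobi => //; by field.
Qed.

End MainTheorem.

Theorem theorem4p11 (R : realType) (d : measure_display) (T : measurableType d)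
    (P : probability T R) (n : nat) (F : R -> set (set T))
    (w : R -> T -> 'M[R]_(n, 4)) (area : R -> T -> R * R * R) :
  (1 <= n)%N -> filtration F -> HPbrownian P F w -> stochastic_area P w area ->
  (exists a : nat -> nat -> R, area_coefficients n a) /\
  (forall a : nat -> nat -> R, area_coefficients n a ->
   forall t : R, 0 < t ->
     (forall x : R * R * R, cvgn [normed series (area_term n a t x)]) /\
     has_density3 P (area t)
       (fun x => (2 * pi ^+ 2)^-1 * limn (series (area_term n a t x)))).
Proof.
move=> n0 filt bw sa; split; first exact: area_coefficients_exist.
move=> a ha t t0; split; first exact: normed_area_series_cvg.
have [mA _] := sa t (ltW t0).
have [iPhi _] := area_charfun_transform n0 ha t0 (0, 0, 0).
have := density_of_characteristic_function mA iPhi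
  (fun l th => area_characteristic_function n0 filt bw sa l th ha t0).
rewrite (_ : invfourier (area_charfun n a t) = (fun x => (2 * pi ^+ 2)^-1 * limn (series (area_term n a t x))))//.
by apply/funext => y; exact: area_densityE.
Qed.
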